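(* Let $n\in\mathbb Z_{>0}$, $R_0\in\mathbb R$, and let $(\hat M,\hat\omega)$ be a compact connected Kähler manifold of complex dimension $N>n$. Let $\mathcal K(n,R_0,\hat M,\hat\omega)$ be the class of $4$-tuples $(M,\omega,p,\phi)$ where $(M,\omega)$ is a smooth complete connected Kähler manifold of complex dimension $n$ with scalar curvature $R(\omega)\ge R_0$, $p\in M$ is a point, and $\phi:(M,\omega)\to(\hat M,\hat\omega)$ is a holomorphic isometry. Then every sequence $\{(M_i,\omega_i,p_i,\phi_i)\}\subset\mathcal K(n,R_0,\hat M,\hat\omega)$ has a subsequence which converges in the pointed Gromov-Hausdorff sense to a tuple $(M_\infty,\omega_\infty,p_\infty,\phi_\infty)\in\mathcal K(n,R_0,\hat M,\hat\omega)$.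
   Context: A holomorphic isometry $\phi:(M,\omega)\to(\hat M,\hat\omega)$ between Kähler manifolds is a holomorphic map with $\phi^*\hat\omega=\omega$ (a holomorphic isometric immersion, not assumed injective). Scalar curvature is the Riemannian scalar curvature of the Kähler metric. A connected Kähler manifold is regarded as a metric space with its Riemannian distance. Notation in a metric space: $B(S,\varepsilon)$ is the open $\varepsilon$-neighbourhood of a set $S$, and $\bar B(p,r)=\{x: d(x,p)\le r\}$. All metric spaces are boundedly compact (closed bounded subsets are compact). Pointed Gromov-Hausdorff convergence of spaces: $(X_i,p_i)\to(X,p)$ if there are maps $\Phi_i:X\to X_i$ with $\Phi_i(p)=p_i$ such that (a) for any $r>0$ and $\varepsilon>0$, when $i$ is sufficiently large, $B(\Phi_i(\bar B(p,r)),\varepsilon)\supset\bar B(p_i,r-\varepsilon)$ and $|d(\Phi_i(x_1),\Phi_i(x_2))-d(x_1,x_2)|<\varepsilon$ for all $x_1,x_2\in\bar B(p,r)$. Convergence of maps: if $(X_i,p_i)\to(X,p)$ and $f_i:X_i\to Y$ are $1$-Lipschitz maps into a fixed metric space $Y$, then $f_i$ converges to $f:X\to Y$ in the pointed Gromov-Hausdorff sense if there are maps $\Phi_i:X\to X_i$ with $\Phi_i(p)=p_i$ satisfying (a) such that for every $r>0$ and $\varepsilon>0$, when $i$ is sufficiently large, $d(f_i(\Phi_i(x)),f(x))<\varepsilon$ for all $x\in\bar B(p,r)$. A sequence of tuples (space, metric, point, map) converges if both the sequence of pointed spaces and the sequence of maps converge. *)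

(* Defs.v *)
From HB Require Import structures.
From mathcomp Require Import all_boot all_order all_algebra.
From mathcomp Require Import all_classical all_reals all_analysis.

Set Implicit Arguments.
Unset Strict Implicit.
Unset Printing Implicit Defensive.

Import Order.TTheory GRing.Theory Num.Theory.
Import numFieldNormedType.Exports.

Local Open Scope classical_set_scope.
Local Open Scope ring_scope.

(* C^n is represented by 'rV[R]_(n + n): the row vector (x, y) stands for
   x + iy, and [Jmx] is multiplication by i, i.e. (x, y) |-> (- y, x), acting on
   the right.  All bilinear forms are given by their Gram matrices in the
   standard real basis. *)

Definition Jmx {R : realType} {n : nat} : 'M[R]_(n + n) :=
  block_mx 0 1%:M (- 1%:M) 0.

Definition bilin {R : realType} {m : nat} (A : 'M[R]_m) (u v : 'rV[R]_m) : R :=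
  (u *m A *m v^T) 0 0.

(* Complex differentiability: the real differential is C-linear. *)
Definition holomorphic_on {R : realType} {m n : nat} (U : set 'rV[R]_(m + m))
    (f : 'rV[R]_(m + m) -> 'rV[R]_(n + n)) : Prop :=
  forall z, U z -> differentiable f z /\
    forall v, 'd f z (v *m Jmx) = 'd f z v *m Jmx.

Fixpoint Ck_on {R : realType} {m : nat} (k : nat) (U : set 'rV[R]_m)
    (f : 'rV[R]_m -> R) : Prop :=
  (forall z, U z -> {for z, continuous f}) /\
  if k is k'.+1 then
    forall v, (forall z, U z -> derivable f z v) /\ Ck_on k' U ('D_v f)
  else True.

Definition smooth_on {R : realType} {m : nat} (U : set 'rV[R]_m)
    (f : 'rV[R]_m -> R) : Prop := forall k, Ck_on k U f.

Section LocalCurvature.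
Context {R : realType} {m : nat}.
Variable G : 'rV[R]_m -> 'M[R]_m.

Definition partial (a : 'I_m) (f : 'rV[R]_m -> R) : 'rV[R]_m -> R :=
  'D_(delta_mx 0 a) f.

(* \Gamma^d_{ab} *)
Definition christoffel (d a b : 'I_m) (z : 'rV[R]_m) : R :=
  2^-1 * \sum_(e < m) invmx (G z) d e *
    (partial a (fun y => G y b e) z + partial b (fun y => G y a e) z
     - partial e (fun y => G y a b) z).

(* R(\partial_a, \partial_b) \partial_c = \sum_d R^d_{cab} \partial_d with
   R(X, Y) = [\nabla_X, \nabla_Y] - \nabla_{[X, Y]} *)
Definition riemann (d c a b : 'I_m) (z : 'rV[R]_m) : R :=
  partial a (christoffel d b c) z - partial b (christoffel d a c) z
  + \sum_(e < m) (christoffel d a e z * christoffel e b c z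
                  - christoffel d b e z * christoffel e a c z).

Definition ricci (b c : 'I_m) (z : 'rV[R]_m) : R :=
  \sum_(a < m) riemann a c a b z.

Definition local_scalar_curvature (z : 'rV[R]_m) : R :=
  \sum_(b < m) \sum_(c < m) invmx (G z) b c * ricci b c z.

End LocalCurvature.

(* The values of [cmap] outside [dom], and of [cinv] outside [cmap @` dom],
   are irrelevant. *)
Record chart (R : realType) (T : topologicalType) (m : nat) := Chart {
  dom : set T;
  cmap : T -> 'rV[R]_m;
  cinv : 'rV[R]_m -> T;
  dom_open : open dom;
  codom_open : open (cmap @` dom);
  cmapK : forall x, dom x -> cinv (cmap x) = x;
  cmap_continuous : forall x, dom x -> {for x, continuous cmap};
  cinv_continuous : forall z, (cmap @` dom) z -> {for z, continuous cinv}
}.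

Record complexManifold (R : realType) (n : nat) := ComplexManifold {
  carrier :> topologicalType;
  carrier_hausdorff : hausdorff_space carrier;
  carrier_second_countable : @second_countable carrier;
  atlas : set (chart R carrier (n + n));
  atlas_cover : forall x, exists2 c, atlas c & dom c x;
  atlas_holomorphic : forall c c', atlas c -> atlas c' ->
    holomorphic_on (cmap c @` (dom c `&` dom c')) (cmap c' \o cinv c)
}.

(* [kform c x] is the matrix, in the coordinates of the chart c, of the Kaehler
   form at the point x; it is meaningful for c in the atlas and x in [dom c]. *)
Record kahlerManifold (R : realType) (n : nat) := KahlerManifold {
  cmanifold :> complexManifold R n;
  kform : chart R cmanifold (n + n) -> cmanifold -> 'M[R]_(n + n);
  kform_transition : forall c c' x u v, atlas c -> atlas c' ->
    dom c x -> dom c' x ->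
    let D := 'd (cmap c' \o cinv c) (cmap c x) in
    bilin (kform c' x) (D u) (D v) = bilin (kform c x) u v;
  kform_smooth : forall c a b, atlas c ->
    smooth_on (cmap c @` dom c) (fun z => kform c (cinv c z) a b);
  kform_alternating : forall c x u v, atlas c -> dom c x ->
    bilin (kform c x) v u = - bilin (kform c x) u v;
  kform_11 : forall c x u v, atlas c -> dom c x ->
    bilin (kform c x) (u *m Jmx) (v *m Jmx) = bilin (kform c x) u v;
  kform_positive : forall c x u, atlas c -> dom c x -> u != 0 ->
    0 < bilin (kform c x) u (u *m Jmx);
  kform_closed : forall c z u v w, atlas c -> (cmap c @` dom c) z ->
    let omega v w y := bilin (kform c (cinv c y)) v w in
    'D_u (omega v w) z + 'D_v (omega w u) z + 'D_w (omega u v) z = 0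
}.

Section KahlerGeometry.
Context {R : realType} {n : nat} (M : kahlerManifold R n).
Implicit Types (x y : M) (c : chart R M (n + n)).

Definition chart_at x : chart R M (n + n) := s2val (cid2 (atlas_cover x)).

(* The Riemannian metric g(u, v) = omega(u, Jv). *)
Definition metric c x : 'M[R]_(n + n) := kform c x *m Jmx^T.

(* Does not depend on the chart around x. *)
Definition scalar_curvature x : R :=
  let c := chart_at x in
  local_scalar_curvature (fun z => metric c (cinv c z)) (cmap c x).

Definition velocity c (gamma : R -> M) : R -> 'rV[R]_(n + n) :=
  derive1 (cmap c \o gamma).

Definition C1_curve (gamma : R -> M) : Prop :=
  forall t, t \in `[0, 1] -> {for t, continuous gamma} /\
    forall c, atlas c -> dom c (gamma t) ->
      (\forall s \near t, derivable (cmap c \o gamma) s 1) /\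
      {for t, continuous (velocity c gamma)}.

Definition speed (gamma : R -> M) (t : R) : R :=
  let c := chart_at (gamma t) in
  let v := velocity c gamma t in
  Num.sqrt (bilin (metric c (gamma t)) v v).

Definition curve_length (gamma : R -> M) : R :=
  \int[lebesgue_measure]_(t in `[0, 1]) speed gamma t.

(* There is a piecewise C^1 curve from x to y of length l. *)
Inductive joined_by_length : M -> M -> R -> Prop :=
| Joined_refl x : joined_by_length x x 0
| Joined_cons (gamma : R -> M) y l : C1_curve gamma ->
    joined_by_length (gamma 1) y l ->
    joined_by_length (gamma 0) y (curve_length gamma + l).

(* Only meaningful when x and y lie in the same connected component. *)
Definition rdist x y : R := inf [set l | joined_by_length x y l].

Definition complete_kahler : Prop := forall u : nat -> M,
  (forall e, 0 < e -> exists k : nat, forall i j : nat,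
     (k <= i)%N -> (k <= j)%N -> rdist (u i) (u j) < e) ->
  exists x, rdist (u i) x @[i --> \oo] --> (0 : R).

End KahlerGeometry.

Section Isometry.
Context {R : realType} {m n : nat}.
Context (M : kahlerManifold R m) (M' : kahlerManifold R n).

Definition holomorphic_map (phi : M -> M') : Prop :=
  continuous phi /\
  forall c c', atlas c -> atlas c' ->
    holomorphic_on (cmap c @` (dom c `&` phi @^-1` dom c'))
                   (cmap c' \o phi \o cinv c).

Definition preserves_kform (phi : M -> M') : Prop :=
  forall c c' x u v, atlas c -> atlas c' -> dom c x -> dom c' (phi x) ->
    let D := 'd (cmap c' \o phi \o cinv c) (cmap c x) in
    bilin (kform c' (phi x)) (D u) (D v) = bilin (kform c x) u v.

Definition holomorphic_isometry (phi : M -> M') : Prop :=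
  holomorphic_map phi /\ preserves_kform phi.

End Isometry.

(* Metric spaces are given by a type and a distance function. *)

Definition nbhd_of {R : realType} {X : Type} (d : X -> X -> R) (S : set X)
    (e : R) : set X := [set y | exists2 x, S x & d x y < e].

Definition cball {R : realType} {X : Type} (d : X -> X -> R) (p : X) (r : R) :
  set X := [set x | d p x <= r].

Section PointedGromovHausdorff.
Context {R : realType}.
Variables (Xs : nat -> Type) (ds : forall i, Xs i -> Xs i -> R).
Variable ps : forall i, Xs i.
Variables (X : Type) (d : X -> X -> R) (p : X).

Definition pgh_approximation (Phi : forall i, X -> Xs i) : Prop :=
  (forall i, Phi i p = ps i) /\
  forall r e : R, 0 < r -> 0 < e -> \forall i \near \oo,
    cball (@ds i) (ps i) (r - e) `<=` nbhd_of (@ds i) (Phi i @` cball d p r) e /\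
    forall x1 x2, cball d p r x1 -> cball d p r x2 ->
      `|ds (Phi i x1) (Phi i x2) - d x1 x2| < e.

Definition pgh_spaces_converge : Prop := exists Phi, pgh_approximation Phi.

Variables (Y : Type) (dY : Y -> Y -> R).
Variables (fs : forall i, Xs i -> Y) (f : X -> Y).

Definition pgh_maps_converge : Prop :=
  exists2 Phi : forall i, X -> Xs i, pgh_approximation Phi &
    forall r e : R, 0 < r -> 0 < e -> \forall i \near \oo,
      forall x, cball d p r x -> dY (fs (Phi i x)) (f x) < e.

End PointedGromovHausdorff.

Section Tuples.
Context {R : realType} (n : nat) (R0 : R) {N : nat} (Mhat : kahlerManifold R N).

Record kahler_tuple := KahlerTuple {
  tspace : kahlerManifold R n;
  tpoint : tspace;
  tmap : tspace -> Mhat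
}.

Definition class_K (T : kahler_tuple) : Prop :=
  [/\ connected [set: tspace T],
      complete_kahler (tspace T),
      forall x : tspace T, R0 <= scalar_curvature x &
      holomorphic_isometry (@tmap T)].

Definition tuples_converge (Ts : nat -> kahler_tuple) (T : kahler_tuple) :
  Prop :=
  pgh_spaces_converge (fun i => @rdist R n (tspace (Ts i)))
    (fun i => tpoint (Ts i)) (@rdist R n (tspace T)) (tpoint T) /\
  pgh_maps_converge (fun i => @rdist R n (tspace (Ts i)))
    (fun i => tpoint (Ts i)) (@rdist R n (tspace T)) (tpoint T)
    (@rdist R N Mhat) (fun i => @tmap (Ts i)) (@tmap T).

End Tuples.

(* Main.v *)
(* By the Gauss equation the scalar curvature of a complex submanifold is a trace
   of the ambient curvature minus the squared norm of the second fundamental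
   form; the mean curvature term vanishes by holomorphy. Since [Mhat] is compact,
   [R0 <= R] therefore bounds the second fundamental forms of all [phi_i]
   uniformly, so that near the image of every point [phi_i] is a holomorphic graph
   over a ball of uniform radius, and completeness prevents the graph from
   stopping early. The parametrisations [F] of these graphs have uniform C^1
   bounds, and the pulled back metrics are uniformly Lipschitz.

   The limit is the metric ultraproduct [X] of the pointed spaces along a
   nonprincipal ultrafilter. By Cauchy's estimates the [F]'s converge with
   their 2-jets, so they give holomorphic charts of [X] in which the limit map
   is a holomorphic immersion; the Kaehler form of [X] is the pull-back of the
   one of [Mhat], and the bound on the scalar curvature, a function of the 2-jet
   of [F], persists. The Riemannian distance of [X] is the ultralimit distance,
   because both admit almost midpoints and both are locally (1 + e)-Lipschitz
   equivalent to the Euclidean distance of the charts, with uniform radii. Balls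
   of [X] have finite nets, so for every scale ultrafilter-many [M_i] are close
   to [X] at that scale, and a diagonal choice yields the subsequence. *)

Require Import Defs.
From HB Require Import structures.
From mathcomp Require Import all_boot all_order all_algebra.
From mathcomp Require Import all_classical all_reals all_analysis.
From mathcomp Require Import ring lra.

Set Implicit Arguments.
Unset Strict Implicit.
Unset Printing Implicit Defensive.

Import Order.TTheory GRing.Theory Num.Theory.
Import numFieldNormedType.Exports.

Local Open Scope classical_set_scope.
Local Open Scope ring_scope.

(** * Complex differentiable maps *)

(** The notions only ask a holomorphic map to be complex differentiable, with no continuity of the
    derivative. In place of Goursat's theorem, [hol] also asks for a locally bounded derivative,
    which is automatic for maps preserving Kähler metrics ([isometric_hol]). With this bound
    Cauchy's estimate follows from means over circles and yields the higher regularity. The charts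
    that pass to the limit are inverses of a linear projection [P], the ambient orthogonal
    projection to a tangent space. Second derivatives of a section of [P] are killed by [P], so
    their tangential part is determined by the normal part and the ambient connection: a bound for
    the second fundamental form bounds the whole 2-jet. The given atlases have no uniform size,
    hence lengths and distances are studied in all charts compatible with them. The scalar curvature
    of a pulled back metric formally contains third derivatives of the map; the Gauss equation
    removes them, so limits of 2-jets suffice. One ultrafilter makes all limits exist at once. *)

Section Norm.
Context {R : realType}.

Lemma coord_le_norm {m} (v : 'rV[R]_m) i j : `|v i j| <= `|v|.
Proof.
rewrite [leRHS]/Num.Def.normr/= mx_normrE.
exact: (le_bigmax _ (fun ij : 'I_1 * 'I_m => `|v ij.1 ij.2|) (i, j)).
Qed.

Lemma norm_rV_le {m} (v : 'rV[R]_m) e :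
  0 <= e -> (forall j, `|v 0 j| <= e) -> `|v| <= e.
Proof.
move=> e0 H; rewrite [leLHS]/Num.Def.normr/= mx_normrE bigmax_le// => -[i j] _/=.
by rewrite ord1.
Qed.

Lemma mulmx_norm_le {m k} (v : 'rV[R]_m) (A : 'M[R]_(m, k)) e : 0 <= e ->
  (forall i j, `|A i j| <= e) -> `|v *m A| <= m%:R * e * `|v|.
Proof.
move=> e0 H; apply: norm_rV_le; first by rewrite !mulr_ge0.
move=> j; rewrite mxE (le_trans (ler_norm_sum _ _ _))//.
rewrite -mulrA mulr_natl -[X in _ *+ X]card_ord -sumr_const.
by apply: ler_sum => i _; rewrite normrM mulrC ler_pM// coord_le_norm.
Qed.

Lemma mulmx_bounded {m k} (A : 'M[R]_(m, k)) :
  exists2 C, 0 < C & forall v : 'rV[R]_m, `|v *m A| <= C * `|v|.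
Proof.
exists (m%:R * (\sum_i \sum_j `|A i j|) + 1).
  by rewrite ltr_wpDl// mulr_ge0// sumr_ge0// => i _; rewrite sumr_ge0.
move=> v; apply: le_trans (mulmx_norm_le v (e := \sum_i \sum_j `|A i j|) _ _) _.
- by rewrite sumr_ge0// => i _; rewrite sumr_ge0.
- move=> i j; rewrite (bigD1 i)//= (bigD1 j)//= -addrA lerDl addr_ge0//.
    by rewrite sumr_ge0.
  by rewrite sumr_ge0// => ? _; rewrite sumr_ge0.
- by rewrite ler_wpM2r// lerDl.
Qed.

End Norm.

Section Diff.
Context {R : realType} {V W : normedModType R}.

Lemma diff_intro (f : V -> W) (x : V) (L : {linear V -> W}) C :
  (forall v, `|L v| <= C * `|v|) ->
  (forall e, 0 < e -> \forall h \near (0 : V), `|f (x + h) - f x - L h| <= e * `|h|) ->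
  differentiable f x /\ ('d f x = L :> (V -> W)).
Proof.
move=> LC H.
have Lc : continuous L.
  apply/linear_bounded_continuous/linear_boundedP; exists C; split; first exact: num_real.
  by move=> r /ltW Cr v; apply: le_trans (LC v) _; exact: ler_wpM2r.
have HL : f \o shift x = cst (f x) + L +o_ 0 id.
  apply/eqaddoP => e /= e0; near=> h.
  rewrite /= -[(_ - _) h]/(f (h + x) - (f x + L h)) opprD addrA (addrC h x).
  by near: h; exact: H.
have dL := diff_unique Lc HL.
split=> //; apply/diff_locallyP; rewrite dL; split => //.
Unshelve. all: by end_near. Qed.

Lemma diff_approx (f : V -> W) (x : V) : differentiable f x ->
  forall e, 0 < e -> \forall h \near (0 : V),
    `|f (x + h) - f x - 'd f x h| <= e * `|h|.
Proof.
move=> df e e0; have [_ /eqaddoP /(_ e e0)] := (diff_locallyP _ _).1 df.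
apply: filterS => h.
by rewrite /= -[(_ - _) h]/(f (h + x) - (f x + 'd f x h)) opprD addrA (addrC h x).
Qed.

Lemma near_eq_diff (f g : V -> W) (x : V) : {near x, f =1 g} ->
  differentiable f x -> differentiable g x /\ 'd g x = 'd f x :> (V -> W).
Proof.
move=> fg df.
have /linear_boundedP [r [_ H]] : bounded_near ('d f x) (nbhs (0:V)).
  by apply/linear_bounded_continuous; exact: diff_continuous.
apply: (@diff_intro g x ('d f x) (`|r| + 1)).
  by apply: H; rewrite (le_lt_trans (ler_norm _))// ltrDl.
move=> e e0; have fg0 := nbhs_singleton fg.
have fgx : \forall h \near (0 : V), f (x + h) = g (x + h).
  have : (x + h) @[h --> (0 : V)] --> x.
    by rewrite -[X in _ --> X]addr0; apply: cvgD; [exact: cvg_cst|exact: cvg_id].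
  by move/(_ _ fg).
near=> h; rewrite -fg0 -(near fgx h)//.
by near: h; exact: diff_approx.
Unshelve. all: by end_near. Qed.

End Diff.

Section MeanValue.
Context {R : realType} {V : normedModType R}.

Lemma derive_line (f : V -> R) (x v : V) (t : R) : differentiable f (x + t *: v) ->
  is_derive t 1 (fun s : R => f (x + s *: v)) ('d f (x + t *: v) v).
Proof.
move=> df; have dg : is_diff t (fun s : R => x + s *: v) (fun s => s *: v).
  have -> : (fun s : R => s *: v) = cst 0 + (fun s : R => s *: v) by rewrite add0r.
  exact: is_diffD.
have dfg : differentiable (f \o (fun s : R => x + s *: v)) t.
  by apply: differentiable_comp => //.
apply: DeriveDef; first exact: diff_derivable.
by rewrite deriveE// diff_comp//= diff_val scale1r.
Qed.

Lemma mean_value (f : V -> R) (x y : V) :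
  (forall t, 0 <= t <= 1 -> differentiable f (x + t *: (y - x))) ->
  exists2 t, 0 <= t <= 1 & f y - f x = 'd f (x + t *: (y - x)) (y - x).
Proof.
move=> df; have [||t t01] := @MVT_segment R (fun s => f (x + s *: (y - x)))
    (fun s => 'd f (x + s *: (y - x)) (y - x)) 0 1 ler01.
- move=> t; rewrite in_itv/= => /andP[t0 t1].
  by apply: derive_line; apply: df; rewrite !ltW.
- apply: derivable_within_continuous => t; rewrite in_itv/= => t01.
  by have [] := derive_line (df _ t01).
- rewrite scale1r scale0r addr0 (addrC x) subrK subr0 mulr1 => ->.
  by exists t => //; rewrite in_itv/= in t01.
Qed.

Lemma diff_coord k (f : V -> 'rV[R]_k) (z : V) j : differentiable f z ->
  differentiable (fun z => f z 0 j) z /\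
  'd (fun z => f z 0 j) z = (fun v => 'd f z v 0 j) :> (V -> R).
Proof.
move=> dfz; have L : is_diff (f z) (fun M : 'rV[R]_k => M 0 j) (fun M => M 0 j).
  apply: DiffDef; first exact: differentiable_coord.
  have @L : {linear 'rV[R]_k -> R}.
    by exists (fun N : 'rV[R]_k => N 0 j); do ![eexists]; do ?[constructor];
       rewrite ?mxE// => ? *; rewrite ?mxE//; move=> ?; rewrite !mxE.
  by rewrite -[(fun M => _)]/(L : _ -> _) diff_lin//; exact: coord_continuous.
split; first exact: (differentiable_comp dfz (ex_diff)).
by rewrite (@diff_comp _ _ _ _ f (fun M : 'rV[R]_k => M 0 j) z)// diff_val.
Qed.

(** In the sup norm it suffices to bound each coordinate, so the scalar mean value theorem applies,
    with an intermediate point that depends on the coordinate. *)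
Lemma mean_value_rV k (f : V -> 'rV[R]_k) (x y : V) C : 0 <= C ->
  (forall t, 0 <= t <= 1 -> differentiable f (x + t *: (y - x)) /\
     `|'d f (x + t *: (y - x)) (y - x)| <= C) ->
  `|f y - f x| <= C.
Proof.
move=> C0 df; apply: norm_rV_le => // j.
have [t t01 E] : exists2 t : R, 0 <= t <= 1 &
    f y 0 j - f x 0 j = 'd f (x + t *: (y - x)) (y - x) 0 j.
  have [|t t01 E] := @mean_value (fun z => f z 0 j) x y.
    by move=> t t01; have [/(diff_coord j)[]] := df t t01.
  by exists t => //; rewrite E; have [/(diff_coord j)[_ ->]] := df _ t01.
by rewrite !mxE E (le_trans (coord_le_norm _ _ _))//; have [] := df _ t01.
Qed.

End MeanValue.

Section IsD.
Context {R : realType}.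

(** Differentiability is kept together with a formula for the differential as a plain function, so
    that rules compose without exhibiting linear maps and [isd_ext] adjusts the formula at the
    end. *)
Record isd {V W : normedModType R} (f : V -> W) (z : V) (df : V -> W) : Prop := IsDiff {
  isd_differentiable : differentiable f z;
  isd_val : forall v, 'd f z v = df v
}.

Section Abstract.
Context {U V W : normedModType R}.

Lemma isd_ext (f : V -> W) z df df' : (forall v, df v = df' v) -> isd f z df -> isd f z df'.
Proof. by move=> e [d H]; split => // v; rewrite H. Qed.

Lemma isd_near (f g : V -> W) z df : {near z, f =1 g} -> isd f z df -> isd g z df.
Proof. by move=> fg [d H]; have [dg e] := near_eq_diff fg d; split => // v; rewrite e. Qed.

Lemma isd_comp (f : U -> V) (g : V -> W) z df dg : isd f z df -> isd g (f z) dg ->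
  isd (fun x => g (f x)) z (fun v => dg (df v)).
Proof.
move=> [d1 e1] [d2 e2]; split; first exact: (differentiable_comp d1 d2).
by move=> v; rewrite (diff_comp d1 d2) /= e1 e2.
Qed.

Lemma isdD (f g : V -> W) z df dg : isd f z df -> isd g z dg ->
  isd (fun x => f x + g x) z (fun v => df v + dg v).
Proof.
move=> [d1 e1] [d2 e2]; split; first exact: (differentiableD d1 d2).
by move=> v; rewrite (diffD d1 d2) -e1 -e2.
Qed.

Lemma isdB (f g : V -> W) z df dg : isd f z df -> isd g z dg ->
  isd (fun x => f x - g x) z (fun v => df v - dg v).
Proof.
move=> [d1 e1] [d2 e2]; split; first exact: (differentiableB d1 d2).
by move=> v; rewrite (diffB d1 d2) -e1 -e2.
Qed.

Lemma isdZ c (f : V -> W) z df : isd f z df -> isd (fun x => c *: f x) z (fun v => c *: df v).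
Proof.
move=> [d1 e1]; split; first exact: (differentiableZ c d1).
by move=> v; rewrite (diffZ c d1) -e1.
Qed.

Lemma isd_cst (w : W) (z : V) : isd (fun=> w) z (fun=> 0).
Proof. by split; [exact: (differentiable_cst w z)|move=> v; rewrite (diff_cst w z)]. Qed.

Lemma isd_lin (L : {linear V -> W}) (z : V) : continuous L -> isd L z L.
Proof. by move=> cL; split; [exact: linear_differentiable|move=> v; rewrite diff_lin]. Qed.

Lemma isd_id (z : V) : isd (fun x : V => x) z (fun v => v).
Proof. by split; [exact: ex_diff|move=> v; rewrite (@diff_val _ _ _ _ _ id id)]. Qed.

Lemma isd_derive (f : V -> W) z df v : isd f z df -> is_derive z v f (df v).
Proof. by move=> [d <-]; split; [exact: diff_derivable|rewrite deriveE]. Qed.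

Lemma isd_continuous (f : V -> W) z df : isd f z df -> {for z, continuous f}.
Proof. by move=> [d _]; exact: differentiable_continuous. Qed.

End Abstract.

Lemma isd_shift {V W : normedModType R} (f : V -> W) z h df :
  isd f (z + h) df -> isd (fun x => f (x + h)) z df.
Proof.
move=> df_; apply: isd_ext (isd_comp (isdD (isd_id z) (isd_cst h z)) df_).
by move=> v; rewrite addr0.
Qed.

Definition isD {m k} (f : 'rV[R]_m -> 'rV[R]_k) (z : 'rV[R]_m) (A : 'M[R]_(m, k)) :=
  isd f z (fun v => v *m A).

(** Vectors are rows and matrices act on the right, so in the chain rule the derivative of the inner
    map comes first. *)
Definition jac {m k} (f : 'rV[R]_m -> 'rV[R]_k) (z : 'rV[R]_m) : 'M[R]_(m, k) :=
  locked (lin1_mx ('d f z)).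

Section Jac.
Context {m k : nat}.
Implicit Types (f g : 'rV[R]_m -> 'rV[R]_k) (z : 'rV[R]_m).

Lemma jacE f z v : 'd f z v = v *m jac f z.
Proof. by rewrite /jac -lock mul_rV_lin1. Qed.

Lemma isD_jac f z : differentiable f z -> isD f z (jac f z).
Proof. by move=> d; split => // v; rewrite jacE. Qed.

Lemma mulmxrI (A B : 'M[R]_(m, k)) : (forall v : 'rV[R]_m, v *m A = v *m B) -> A = B.
Proof. by move=> H; apply/row_matrixP => i; rewrite !rowE. Qed.

Lemma jac_isD f z A : isD f z A -> jac f z = A.
Proof. by move=> [d H]; apply: mulmxrI => v; rewrite -jacE. Qed.

Lemma isD_intro f z A :
  (forall e, 0 < e -> \forall h \near (0 : 'rV[R]_m), `|f (z + h) - f z - h *m A| <= e * `|h|) ->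
  isD f z A.
Proof.
move=> H; have [C C0 HC] := mulmx_bounded A.
have [d e] := @diff_intro _ _ _ f z (mulmxr A) C HC H.
by split => // v; rewrite e.
Qed.

Lemma isD_approx f z A : isD f z A ->
  forall e, 0 < e -> \forall h \near (0 : 'rV[R]_m), `|f (z + h) - f z - h *m A| <= e * `|h|.
Proof. by move=> [d H] e e0; apply: filterS (diff_approx d e0) => h; rewrite H. Qed.

End Jac.

Lemma continuous_mulmxr {m k} (A : 'M[R]_(m, k)) : continuous (fun v : 'rV[R]_m => v *m A).
Proof.
have [C C0 HC] := mulmx_bounded A.
apply/(@linear_bounded_continuous _ _ _ (mulmxr A))/linear_boundedP.
exists C; split; first exact: num_real.
by move=> r /ltW Cr v; rewrite /= (le_trans (HC v))// ler_wpM2r.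
Qed.

Lemma isD_mulmxr {m k} (A : 'M[R]_(m, k)) z : isD (fun v => v *m A) z A.
Proof. exact: (isd_lin (L := mulmxr A) z (@continuous_mulmxr _ _ A)). Qed.

Lemma isD_comp {m k l} (f : 'rV[R]_m -> 'rV[R]_k) (g : 'rV[R]_k -> 'rV[R]_l) z A B :
  isD f z A -> isD g (f z) B -> isD (fun x => g (f x)) z (A *m B).
Proof.
by move=> fA gB; apply: isd_ext (isd_comp fA gB) => v; rewrite mulmxA.
Qed.

Lemma isD_sub {m k} (f g : 'rV[R]_m -> 'rV[R]_k) z A B :
  isD f z A -> isD g z B -> isD (fun x => f x - g x) z (A - B).
Proof.
by move=> fA gB; apply: isd_ext (isdB fA gB) => v; rewrite mulmxBr.
Qed.

Lemma isD_scale {m k} c (f : 'rV[R]_m -> 'rV[R]_k) z A :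
  isD f z A -> isD (fun x => c *: f x) z (c *: A).
Proof. by move=> fA; apply: isd_ext (isdZ c fA) => v; rewrite scalemxAr. Qed.

Lemma isd_coord {V : normedModType R} {k} (f : V -> 'rV[R]_k) z df j :
  isd f z df -> isd (fun x => f x 0 j) z (fun v => df v 0 j).
Proof.
by move=> [d H]; have [dj e] := diff_coord j d; split => // v; rewrite e H.
Qed.

Lemma isd_curve {V : normedModType R} (g : R -> V) (s : R) g' :
  is_derive s 1 g g' <-> isd g s (fun t => t *: g').
Proof.
split=> [[d e]|[d H]].
  have d' : differentiable g s by exact/derivable1_diffP.
  by split => // t; rewrite -[t in LHS]mulr1 -[t * 1]/(t *: (1 : R^o)) linearZ /= -deriveE// e.
by split; [exact/derivable1_diffP|rewrite deriveE// H scale1r].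
Qed.

Lemma is_derive_isd {V W : normedModType R} (f : V -> W) (g : R -> V) (s : R) g' df :
  is_derive s 1 g g' -> isd f (g s) df -> is_derive s 1 (fun t => f (g t)) (df g').
Proof.
move=> /isd_curve dg dff; have [d H] := isd_comp dg dff.
by split; [exact/derivable1_diffP|rewrite deriveE// H scale1r].
Qed.

End IsD.

(** * Integrals of continuous functions over segments *)

Section Integral.
Context {R : realType}.
Notation mu := (@lebesgue_measure R).
Implicit Types (a b : R) (f : R -> R).

Lemma within_continuousW a b f : (forall t, a <= t <= b -> {for t, continuous f}) ->
  {within `[a, b], continuous f}.
Proof.
move=> fc; apply: continuous_in_subspaceT => t; rewrite inE/= in_itv/=; exact: fc.
Qed.

Lemma cont_integrable a b f : (forall t, a <= t <= b -> {for t, continuous f}) ->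
  mu.-integrable `[a, b] (EFin \o f).
Proof.
move=> fc; apply: continuous_compact_integrable; first exact: segment_compact.
exact: within_continuousW.
Qed.

Lemma Rintegral_derive a b f F : a < b ->
  (forall t, a <= t <= b -> {for t, continuous f}) ->
  (forall t, a <= t <= b -> {for t, continuous F}) ->
  (forall t, a < t < b -> is_derive t 1 F (f t)) ->
  \int[mu]_(t in `[a, b]) f t = F b - F a.
Proof.
move=> ab fc Fc dF; rewrite /Rintegral (@continuous_FTC2 _ f F a b)//.
- exact: within_continuousW.
- split.
  + by move=> t /[!in_itv]/= /dF[].
  + by apply: cvg_at_right_filter; apply: Fc; rewrite lexx ltW.
  + by apply: cvg_at_left_filter; apply: Fc; rewrite lexx ltW.
- by move=> t /[!in_itv]/= /dF dFt; rewrite derive1E derive_val.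
Qed.

Lemma primitive_exists a b f : (forall t, a <= t <= b -> {for t, continuous f}) ->
  forall t, a < t < b ->
  is_derive t 1 (fun x => \int[mu]_(s in `[a, x]) f s) (f t).
Proof.
move=> fc t /andP[at_ tb].
have ct : {for t, continuous f} by apply: fc; rewrite !ltW.
have [dP P'] := @continuous_FTC1_closed R f a t b tb (cont_integrable fc) at_ ct.
by apply: DeriveDef; rewrite -?derive1E.
Qed.

Lemma Rintegral_bound a b f M : a <= b ->
  (forall t, a <= t <= b -> {for t, continuous f}) ->
  (forall t, a <= t <= b -> `|f t| <= M) ->
  `|\int[mu]_(t in `[a, b]) f t| <= M * (b - a).
Proof.
move=> ab fc fM; have If := cont_integrable fc.
have Ic : mu.-integrable `[a, b] (EFin \o cst M).
  by apply: cont_integrable => t _; exact: cvg_cst.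
apply: le_trans (le_normr_Rintegral _ If) _ => //.
have -> : M * (b - a) = \int[mu]_(t in `[a, b]) cst M t.
  rewrite Rintegral_cst//= lebesgue_measure_itv/= lte_fin.
  by case: ltgtP ab => // -> _; rewrite ?subrr ?mulr0.
apply: le_Rintegral => //.
  by apply: cont_integrable => t tab; apply: continuous_comp; [exact: fc|exact: norm_continuous].
Qed.

Lemma derive_cont f (t d : R) : is_derive t 1 f d -> {for t, continuous f}.
Proof.
by move=> [df _]; apply: differentiable_continuous; exact/derivable1_diffP.
Qed.

Lemma continuous_shift f h : continuous f -> continuous (fun t => f (t + h)).
Proof.
move=> fc t; apply: continuous_comp; last exact: fc.
by apply: continuousD; [exact: cvg_id|exact: cvg_cst].
Qed.

Lemma continuous_sub f g : continuous f -> continuous g -> continuous (fun t => f t - g t).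
Proof. by move=> fc gc t; apply: continuousB; [exact: fc|exact: gc]. Qed.

Lemma is_derive_addl (c t : R) : is_derive t 1 (fun s : R => c + s) 1.
Proof.
by have := @is_deriveD _ _ _ (cst c) (@id R) t 1 _ _ (is_derive_cst _ _ _) (is_derive_id _ _); rewrite add0r.
Qed.

(** In terms of a primitive [P] the shifted integral is [P (T + h) - P h], whose derivative in [h]
    vanishes by periodicity. The primitive starts at -2 so that all shifts of size at most 1 stay in
    the interior of its domain. *)
Lemma Rintegral_shift_periodic (T : R) f h : 0 < T -> continuous f ->
  (forall t, f (t + T) = f t) -> `|h| < 1 ->
  \int[mu]_(t in `[0, T]) f (t + h) = \int[mu]_(t in `[0, T]) f t.
Proof.
move=> T0 fc fT; pose P x := \int[mu]_(s in `[- 2, x]) f s.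
have dP (t : R) : - 2 < t < T + 2 -> is_derive t 1 P (f t).
  by apply: primitive_exists => s _; exact: fc.
have dPs (k t : R) : `|k| <= 1 -> 0 <= t <= T ->
    is_derive t 1 (fun s => P (s + k)) (f (t + k)).
  move=> k1 tT; have Dt : is_derive (t + k) 1 P (f (t + k)).
    by apply: dP; move: k1; rewrite ler_norml; lra.
  have Ds : is_derive t 1 (fun s : R => s + k) 1.
    by apply: is_derive_eq; rewrite addr0.
  by have := @is_derive1_comp _ P (fun s => s + k) t _ _ Dt Ds; rewrite mulr1.
have E (k : R) : `|k| <= 1 -> \int[mu]_(t in `[0, T]) f (t + k) = P (T + k) - P k.
  move=> k1; have := @Rintegral_derive 0 T (fun t => f (t + k)) (fun s => P (s + k)) T0.
  rewrite add0r; apply.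
  - by move=> t _; apply: continuous_comp; [apply: continuousD; [exact: cvg_id|exact: cvg_cst]|exact: fc].
  - by move=> t tT; exact: derive_cont (dPs k t k1 tT).
  - by move=> t /andP[t0 tT]; apply: dPs => //; rewrite !ltW.
move=> h1.
have EQ (k : R) : `|k| <= 1 -> P (T + k) - P k = P T - P 0.
  move=> k1; have D (t : R) : `|t| <= 1 -> is_derive t 1 (fun s => P (T + s) - P s) 0.
    move=> t1; rewrite -[X in is_derive _ _ _ X](subrr (f t)).
    have D1 : is_derive t 1 (fun s => P (T + s)) (f t).
      have Dt : is_derive (T + t) 1 P (f t).
        by rewrite -(fT t) addrC; apply: dP; move: t1; rewrite ler_norml; lra.
      have Ds := is_derive_addl T t.
      by have := @is_derive1_comp _ P (fun s => T + s) t _ _ Dt Ds; rewrite mulr1.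
    have D2 : is_derive t 1 P (f t).
      by apply: dP; move: t1; rewrite ler_norml; lra.
    exact: is_deriveB.
  have W (a b : R) : `|a| <= 1 -> `|b| <= 1 -> a <= b ->
      P (T + b) - P b = P (T + a) - P a.
    move=> a1 b1 ab; have [|||c _ Ec] := @MVT_segment R (fun s => P (T + s) - P s) (fun=> 0) a b.
    - by [].
    - move=> x; rewrite in_itv/= => /andP[ax xb]; apply: D.
      by rewrite ler_norml; move: a1 b1; rewrite !ler_norml; lra.
    - apply: within_continuousW => t /andP[at_ tb]; apply: (derive_cont (D t _)).
      by rewrite ler_norml; move: a1 b1; rewrite !ler_norml; lra.
    by apply/eqP; rewrite -subr_eq0 Ec mul0r.
  have z1 : `|0 : R| <= 1 by rewrite normr0.
  by rewrite -[T in RHS]addr0; have [k0|/ltW k0] := leP 0 k; [exact: W|exact/esym/W].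
rewrite E ?ltW// EQ ?ltW//.
have := E 0; rewrite normr0 ler01 => /(_ isT); rewrite EQ ?normr0// => <-.
by apply: eq_Rintegral => t _; rewrite addr0.
Qed.

End Integral.

(** * Means over circles in polar coordinates *)

Section Circle.
Context {R : realType}.
Notation mu := (@lebesgue_measure R).
Let T : R := pi *+ 2.
Let T0 : 0 < T. Proof. by rewrite /T pmulrn_lgt0// pi_gt0. Qed.

(* [p + i q] is a holomorphic function in polar coordinates and [a] the real
   part of its derivative at the center. *)
Lemma polar_cauchy (p q pr qr : R -> R -> R) (a rho L M : R) :
  (forall r t, 0 < r < rho ->
     [/\ is_derive r 1 (p ^~ t) (pr r t), is_derive r 1 (q ^~ t) (qr r t),
         is_derive t 1 (p r) (- (r * qr r t)) & is_derive t 1 (q r) (r * pr r t)]) ->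
  (forall r t, 0 < r < rho ->
     [/\ `|pr r t| <= L, `|qr r t| <= L, `|p r t| <= M & `|q r t| <= M]) ->
  (forall r t, p r (t + T) = p r t /\ q r (t + T) = q r t) ->
  (forall e, 0 < e -> exists2 d, 0 < d & forall r t, 0 < r < d ->
     `|p r t * cos t + q r t * sin t - r * a| <= e * r) ->
  forall r, 0 < r < rho -> `|a| * r <= 2 * M.
Proof.
move=> Dpq Bpq per appr.
(* [A] and [B] are the real and imaginary parts of exp(-it)(p + iq). *)
pose A r t := p r t * cos t + q r t * sin t.
pose B r t := q r t * cos t - p r t * sin t.
have cs1 (t : R) : `|cos t| <= 1 /\ `|sin t| <= 1.
  by rewrite !ler_norml cos_geN1 cos_le1 sin_geN1 sin_le1.
have bnd (x y X Y t : R) : `|x| <= X -> `|y| <= Y ->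
    `|x * cos t + y * sin t| <= X + Y /\ `|x * cos t - y * sin t| <= X + Y.
  move=> xX yY; have [c1 s1] := cs1 t.
  have h1 : `|x * cos t| <= X by rewrite normrM -[X]mulr1 ler_pM.
  have h2 : `|y * sin t| <= Y by rewrite normrM -[Y]mulr1 ler_pM.
  by rewrite (le_trans (ler_normD _ _)) ?(le_trans (ler_normB _ _)) ?lerD.
have DA (r t : R) : 0 < r < rho -> is_derive r 1 (A ^~ t) (pr r t * cos t + qr r t * sin t).
  move=> /(Dpq r t)[D1 D2 _ _]; apply: is_derive_eq.
  by rewrite /= !scaler0 !add0r /= mulrC; congr (_ + _); rewrite mulrC.
have DAt (r t : R) : 0 < r < rho ->
   is_derive t 1 (A r) (- (r * qr r t) * cos t - p r t * sin t + (r * pr r t * sin t + q r t * cos t)).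
  move=> /(Dpq r t)[_ _ D1 D2]; apply: is_derive_eq.
  by rewrite /=  /GRing.scale/=; ring.
have DBt (r t : R) : 0 < r < rho ->
   is_derive t 1 (B r) (r * (pr r t * cos t + qr r t * sin t) - A r t).
  move=> /(Dpq r t)[_ _ D1 D2]; apply: is_derive_eq.
  by rewrite /= /A /GRing.scale/=; ring.
have cA (r : R) : 0 < r < rho -> continuous (A r).
  by move=> rr t; exact: derive_cont (DAt r t rr).
have cB (r : R) : 0 < r < rho -> continuous (B r).
  by move=> rr t; exact: derive_cont (DBt r t rr).
pose J r := \int[mu]_(t in `[0, T]) A r t.
pose K r := \int[mu]_(t in `[0, T]) B r t.
have DJ (r : R) : 0 < r < rho -> is_derive r 1 J (J r / r).
  move=> rr; have /andP[r0 rrho] := rr.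
  have r_neq0 : r != 0 by rewrite gt_eqF.
  pose dl := Num.min (2^-1) ((rho - r) / r).
  have dl0 : 0 < dl by rewrite lt_min invr_gt0 ltr0n/= divr_gt0// subr_gt0.
  have inr (h : R) : h \in `](- dl), dl[ -> 0 < r * (1 + h) < rho /\ `|h| < 1.
    rewrite in_itv/= /dl => /andP[]; rewrite ltrNl !lt_min => /andP[h1 h2] /andP[h3 h4].
    rewrite ltr_norml.
    have h5 : h * r < rho - r by rewrite -ltr_pdivlMr.
    split; last by lra.
    by rewrite mulr_gt0//=; [rewrite mulrDr mulr1 mulrC; lra|lra].
  (* The radial derivative of [A] is bounded but not known to be continuous in [t]. Subtracting a
     rotated copy of [B], whose integral over a period does not depend on [h], turns the derivative
     in [h] at 0 into the continuous function [A r], by the Cauchy-Riemann equations. This gives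
     [J' = J / r]. *)
  pose f h t := A (r * (1 + h)) t - B r (t + h).
  have Df (h t : R) : h \in `](- dl), dl[ -> is_derive h 1 (f ^~ t)
     (r * (pr (r * (1 + h)) t * cos t + qr (r * (1 + h)) t * sin t) -
      (r * (pr r (t + h) * cos (t + h) + qr r (t + h) * sin (t + h)) - A r (t + h))).
    move=> /inr[h1 _].
    have D1 : is_derive h 1 (fun h : R => r * (1 + h)) r.
      by apply: is_derive_eq; rewrite /= /GRing.scale/= add0r mulr1.
    have D2 := is_derive_addl t h.
    have D3 := @is_derive1_comp _ (A ^~ t) (fun h => r * (1 + h)) h _ _ (DA _ t h1) D1.
    have D4 := @is_derive1_comp _ (B r) (fun h => t + h) h _ _ (DBt r (t + h) rr) D2.
    rewrite mulr1 in D4; rewrite mulrC in D3.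
    exact: is_deriveB.
  have i0 : (0 : R) \in `](- dl), dl[ by rewrite in_itv/= oppr_lt0 dl0.
  have H := @cvg_differentiation_under_integral R _ _ mu f `[0, T] (measurable_itv _) 0 (- dl) dl i0.
  have fint (h : R) : h \in `](- dl), dl[ -> mu.-integrable `[0, T] (EFin \o f h).
    move=> hh; have [h1 _] := inr h hh; apply: cont_integrable => t _.
    exact: (continuous_sub (cA _ h1) (@continuous_shift R (B r) h (cB r rr))).
  have {}H := H fint.
  have der1 (h t : R) : h \in `](- dl), dl[ -> t \in `[0, T] -> derivable (f ^~ t) h 1.
    by move=> hh _; have [] := Df h t hh.
  have L0 : 0 <= L by have [/(le_trans (normr_ge0 _))] := Bpq r 0 rr.
  have M0 : 0 <= M by have [_ _ /(le_trans (normr_ge0 _))] := Bpq r 0 rr.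
  pose G := fun _ : R => r * (L + L) + (r * (L + L) + (M + M)).
  have {}H := H der1 G.
  have G0 : 0 <= r * (L + L) + (r * (L + L) + (M + M)).
    by rewrite !addr_ge0// mulr_ge0// ?addr_ge0// ltW.
  have iG : mu.-integrable `[0, T] (EFin \o G) by apply: cont_integrable => t _; exact: cvg_cst.
  have {}H := H (fun=> G0) iG.
  have {}H : h^-1 *: ((\int[mu]_(t in `[0, T]) f (h + 0) t) - \int[mu]_(t in `[0, T]) f 0 t)
     @[h --> 0^'] --> J r.
    rewrite [X in _ --> X](_ : J r = \int[mu]_(t in `[0, T]) (partial1of2 f) 0 t).
      apply: H => h t hh _; rewrite partial1of2E (@derive_val _ _ _ _ _ _ _ (Df h t hh)).
      have [h1 _] := inr h hh.
      have [b1 b2 _ _] := Bpq _ t h1; have [b3 b4 b5 b6] := Bpq r (t + h) rr.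
      rewrite (le_trans (ler_normB _ _))// lerD//.
        rewrite normrM gtr0_norm// ler_pM2l//; exact: (bnd _ _ _ _ _ _ _).1.
      rewrite (le_trans (ler_normB _ _))// lerD//.
        rewrite normrM gtr0_norm// ler_pM2l//; exact: (bnd _ _ _ _ _ _ _).1.
      exact: (bnd _ _ _ _ _ _ _).1.
    apply: eq_Rintegral => t _; rewrite partial1of2E (@derive_val _ _ _ _ _ _ _ (Df 0 t i0)).
    by rewrite !addr0 mulr1 opprB addrC subrK.
  have FJ (h : R) : h \in `](- dl), dl[ -> \int[mu]_(t in `[0, T]) f h t = J (r * (1 + h)) - K r.
    move=> hh; have [h1 h2] := inr h hh; rewrite /f RintegralB//.
    - congr (_ - _); apply: Rintegral_shift_periodic => //; first exact: cB.
      by move=> t; rewrite /B /T sinD2pi cosD2pi; have [-> ->] := per r t.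
    - by apply: cont_integrable => t _; exact: cA.
    - by apply: cont_integrable => t _; exact: (@continuous_shift R (B r) h (cB r rr)).
  have D0 : is_derive (0 : R) 1 (fun h : R => J (r * (1 + h))) (J r).
    have E : {near (0 : R)^', (fun h => h^-1 *: ((\int[mu]_(t in `[0, T]) f (h + 0) t) - \int[mu]_(t in `[0, T]) f 0 t))
       =1 (fun h => h^-1 *: (((fun h => J (r * (1 + h))) \o shift 0) (h *: 1) - J (r * (1 + 0))))}.
      apply: cvg_within; have : \forall h \near (0 : R), h \in `](- dl), dl[.
        exact: near_in_itvoo.
      apply: filterS => h hh; rewrite addr0 !FJ//= addr0 [h *: 1]mulr1; congr (_ *: _).
      by rewrite [h + 0]addr0 opprB addrA subrK.
    have {}H := cvg_trans (near_eq_cvg E) H.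
    have {}H := H (dnbhs_filter _).
    by apply: DeriveDef; [apply/cvg_ex; exists (J r); exact: H|apply: cvg_lim => //; exact: H].
  have -> : J = (fun h => J (r * (1 + h))) \o (fun s => s / r - 1).
    by apply/funext => s /=; congr J; field.
  have D1 : is_derive r 1 (fun s : R => s / r - 1) r^-1.
    by apply: is_derive_eq; rewrite /GRing.scale/=; ring.
  have E0 : r / r - 1 = 0 by rewrite divff// subrr.
  have D0' : is_derive (r / r - 1) 1 (fun h : R => J (r * (1 + h))) (J r) by rewrite E0.
  have := @is_derive1_comp _ (fun h => J (r * (1 + h))) (fun s => s / r - 1) r _ _ D0' D1.
  rewrite /= E0 addr0 mulr1; congr is_derive; rewrite addrCA subrr addr0 mulrC divff// mulr1 ?mulrC//.
have cst_ (r s : R) : 0 < r -> r <= s -> s < rho -> J r / r = J s / s.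
  move=> r0 rs srho.
  have D (x : R) : r <= x <= s -> is_derive x 1 (fun x : R => J x * x^-1) 0.
    move=> /andP[rx xs]; have x0 : 0 < x by lra.
    have x_neq0 : x != 0 by rewrite gt_eqF.
    have xx : 0 < x < rho by rewrite x0; lra.
    have DJx := DJ x xx.
    have DV : is_derive x 1 (fun x : R => x^-1) (- x ^- 2).
      by apply: DeriveDef; [apply: derivableV|rewrite deriveV// derive_id [LHS]mulr1].
    apply: (is_derive_eq (is_deriveM DJx DV)); rewrite /GRing.scale/=.
    by field.
  have [|||c _ Ec] := @MVT_segment R (fun x => J x * x^-1) (fun=> 0) r s.
  - by [].
  - by move=> x; rewrite in_itv/= => /andP[rx xs]; apply: D; rewrite !ltW.
  - by apply: within_continuousW => t tt; exact: derive_cont (D t tt).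
  by apply/eqP; rewrite eq_sym -subr_eq0 Ec mul0r.
have JT (r : R) : 0 < r < rho -> `|J r| <= (M + M) * T.
  move=> rr; rewrite -[X in _ * X](subr0 T); apply: Rintegral_bound.
  - exact: ltW.
  - by move=> t _; exact: cA.
  - move=> t _; have [_ _ b1 b2] := Bpq r t rr; exact: (bnd _ _ _ _ _ _ _).1.
move=> r rr; have /andP[r0 rrho] := rr.
(* The quotient [J r / r] is constant, and near the centre [A s t] is close to [s * a]; letting the
   radius tend to 0 identifies the constant. *)
have E : J r / r = T * a.
  apply/eqP; rewrite -subr_eq0 -normr_le0; apply/ler_addgt0Pr => e e0; rewrite add0r.
  have [d d0 H] := appr (e / T) (divr_gt0 e0 T0).
  pose s := Num.min (d / 2) r.
  have s0 : 0 < s by rewrite lt_min divr_gt0//= r0.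
  have sd : 0 < s < d by rewrite s0 gt_min; apply/orP; left; rewrite ltr_pdivrMr//; lra.
  have sr : s <= r by rewrite ge_min lexx orbT.
  have ss : 0 < s < rho by rewrite s0 (le_lt_trans sr).
  rewrite -(cst_ s r)//.
  have -> : J s / s - T * a = (\int[mu]_(t in `[0, T]) (A s t - s * a)) / s.
    rewrite RintegralB//; last 2 first.
    - by apply: cont_integrable => t _; exact: cA.
    - by apply: cont_integrable => t _; exact: cst_continuous.
    have -> : \int[mu]_(_ in `[0, T]) (s * a) = s * a * T.
      by rewrite Rintegral_cst//= lebesgue_measure_itv/= lte_fin T0/= subr0.
    by rewrite mulrBl; congr (_ - _); field; rewrite gt_eqF.
  rewrite normrM normfV (gtr0_norm s0) ler_pdivrMr//.
  have -> : e * s = (e / T * s) * (T - 0) by rewrite subr0 mulrAC divfK// gt_eqF.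
  apply: Rintegral_bound; first exact: ltW.
  - move=> t _; exact: (@continuous_sub R (A s) (cst (s * a)) (cA _ ss) (@cst_continuous _ _ _)).
  - by move=> t _; exact: H.
have := JT r rr.
have -> : J r = T * a * r by rewrite -E divfK// gt_eqF.
by rewrite !normrM (gtr0_norm T0) (gtr0_norm r0) -mulrA mulrC ler_pM2r// mulr_natl mulr2n.
Qed.

End Circle.

(** * Limits along an ultrafilter *)

Lemma cvg_norm_le {R : realType} {V : normedModType R} {T : Type} (F : set_system T)
    {FF : ProperFilter F} (a : T -> V) (l : V) C :
  a i @[i --> F] --> l -> (\forall i \near F, `|a i| <= C) -> `|l| <= C.
Proof.
move=> /cvgrPdist_le al aC; apply/ler_addgt0Pr => e /al ae.
have [i [ali aCi]] := filter_ex (filterI ae aC).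
have := ler_normD (l - a i) (a i); rewrite subrK => /le_trans; apply.
by rewrite addrC lerD.
Qed.

Section Ultra.
Context {R : realType} {T : Type} (U : set_system T) {UU : UltraFilter U}.

Lemma ultra_fmap (S : Type) (a : T -> S) : UltraFilter (a i @[i --> U]).
Proof.
split; first exact: fmap_proper_filter.
move=> G GF sUG; rewrite eqEsubset; split => // A GA.
have [//|UnA] := in_ultra_setVsetC (a @^-1` A) UU.
have /sUG GnA : (a i @[i --> U]) (~` A) by [].
by have /filter_ex[x []] : G (A `&` ~` A) by exact: filterI.
Qed.

(** Closed balls are compact, and an ultrafilter on a compact set converges; boundedness along [U]
    is all that is required. *)
Lemma ultra_cvg k (a : T -> 'rV[R]_k) C : (\forall i \near U, `|a i| <= C) ->
  cvg (a i @[i --> U]).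
Proof.
move=> aC; have K : compact [set v : 'rV[R]_k | `|v| <= C].
  apply: bounded_closed_compact.
    by exists C; split; [exact: num_real|move=> x Cx v /= vC; rewrite (le_trans vC)// ltW].
  rewrite [X in closed X](_ : _ = (fun v => `|v|) @^-1` [set x | x <= C])//.
  by apply: closed_comp; [move=> v _; exact: norm_continuous|exact: closed_le].
rewrite compact_ultra in K; have [|l [_ al]] := K (a i @[i --> U]) _ aC.
  exact: ultra_fmap.
by apply/cvg_ex; exists l.
Qed.

Lemma ultra_cvgR (a : T -> R) C : (\forall i \near U, `|a i| <= C) ->
  cvg (a i @[i --> U]).
Proof.
move=> aC; have K : compact `[- C, C] by exact: segment_compact.
rewrite compact_ultra in K; have [||l [_ al]] := K (a i @[i --> U]).
- exact: ultra_fmap.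
- by apply: filterS aC => i; rewrite /= in_itv/= ler_norml.
by apply/cvg_ex; exists l.
Qed.

Lemma ultra_mx m n (A : T -> 'M[R]_(m, n)) C :
  (\forall i \near U, forall j k, `|A i j k| <= C) ->
  exists B : 'M[R]_(m, n), forall e, 0 < e ->
    \forall i \near U, forall j k, `|A i j k - B j k| <= e.
Proof.
move=> AC; pose B := \matrix_(j, k) lim (A i j k @[i --> U]).
exists B => e e0; apply: filter_forall => j; apply: filter_forall => k.
have cA : cvg (A i j k @[i --> U]).
  by apply: (@ultra_cvgR _ C); apply: filterS AC.
rewrite /B; under eq_near do rewrite mxE distrC.
by move/cvgrPdist_le : cA; exact.
Qed.

End Ultra.

(** * Holomorphic maps and Cauchy's estimate *)

Section Hol.
Context {R : realType}.

Lemma JmxE m (x y : 'rV[R]_m) : row_mx x y *m Jmx = row_mx (- y) x.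
Proof. by rewrite mul_row_block !mulmx0 mulmx1 mulmxN mulmx1 add0r addr0. Qed.

Lemma JmxK m (v : 'rV[R]_(m + m)) : v *m Jmx *m Jmx = - v.
Proof. by rewrite -[v]hsubmxK !JmxE opp_row_mx. Qed.

Lemma Jmx_lshift m (v : 'rV[R]_(m + m)) j : (v *m Jmx) 0 (lshift m j) = - v 0 (rshift m j).
Proof. by rewrite -[v]hsubmxK JmxE !row_mxEl !row_mxEr mxE. Qed.

Lemma Jmx_rshift m (v : 'rV[R]_(m + m)) j : (v *m Jmx) 0 (rshift m j) = v 0 (lshift m j).
Proof. by rewrite -[v]hsubmxK JmxE !row_mxEl !row_mxEr. Qed.

Lemma norm_Jmx m (v : 'rV[R]_(m + m)) : `|v *m Jmx| <= `|v|.
Proof.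
apply: norm_rV_le => // j; rewrite -(splitK j); case: (fintype.split j) => k /=.
  by rewrite Jmx_lshift normrN coord_le_norm.
by rewrite Jmx_rshift coord_le_norm.
Qed.

Record cdiff {m n} (f : 'rV[R]_(m + m) -> 'rV[R]_(n + n)) (z : 'rV[R]_(m + m)) : Prop := CDiff {
  cdiff_differentiable : differentiable f z;
  cdiff_J : Jmx *m jac f z = jac f z *m Jmx
}.

Definition hol_ball {m n} (f : 'rV[R]_(m + m) -> 'rV[R]_(n + n)) (z : 'rV[R]_(m + m))
    (rho L : R) :=
  forall y, `|y - z| < rho ->
    cdiff f y /\ forall v : 'rV[R]_(m + m), `|v *m jac f y| <= L * `|v|.

(** Complex differentiability near [z] with a bounded derivative. The bound lets the mean over
    circles be differentiated under the integral sign, where continuity of the derivative is not yet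
    available. *)
Definition hol {m n} (f : 'rV[R]_(m + m) -> 'rV[R]_(n + n)) (z : 'rV[R]_(m + m)) :=
  exists rho L, 0 < rho /\ hol_ball f z rho L.

Lemma cdiffP {m n} (f : 'rV[R]_(m + m) -> 'rV[R]_(n + n)) z A : isD f z A ->
  Jmx *m A = A *m Jmx -> cdiff f z.
Proof. by move=> fA AJ; split; [have [] := fA|rewrite (jac_isD fA)]. Qed.

(** On the complex line through [z] in a unit direction [v], the coordinates of [f - f z] satisfy
    the hypotheses of [polar_cauchy]. The vector exp(it) v is only bounded by 2 in the sup norm,
    which halves the radius and turns 2M into 4M. Imaginary coordinates reduce to real ones in the
    direction [v *m Jmx]. *)
Lemma cauchy_estimate m n (f : 'rV[R]_(m + m) -> 'rV[R]_(n + n)) z rho L M :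
  0 < rho -> hol_ball f z rho L ->
  (forall y, `|y - z| < rho -> `|f y - f z| <= M) ->
  forall v : 'rV[R]_(m + m), `|v *m jac f z| * rho <= 4 * M * `|v|.
Proof.
move=> rho0 Hf0 HM.
have Hf y : `|y - z| < rho -> (differentiable f y /\ forall v, 'd f y (v *m Jmx) = 'd f y v *m Jmx) /\
    forall v, `|'d f y v| <= L * `|v|.
  move=> /Hf0[[df cJ] bd]; split; last by move=> v; rewrite jacE.
  by split => // v; rewrite !jacE -!mulmxA cJ.
have M0 : 0 <= M by rewrite (le_trans _ (HM z _))// subrr normr0.
have L0 (w : 'rV[R]_(m + m)) : 0 <= L * `|w|.
  by rewrite (le_trans _ ((Hf z _).2 w))// subrr normr0.
have key v j : `|v| = 1 -> forall r, 0 < r < rho / 2 -> `|('d f z v) 0 (lshift n j)| * r <= 2 * M.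
  move=> v1.
  pose u (t : R) := cos t *: v + sin t *: (v *m Jmx).
  have u2 t : `|u t| <= 2.
    rewrite (le_trans (ler_normD _ _))// !normrZ v1 mulr1.
    have : `|cos t| <= 1 by rewrite ler_norml cos_geN1 cos_le1.
    have : `|sin t| <= 1 by rewrite ler_norml sin_geN1 sin_le1.
    have := norm_Jmx v; rewrite v1 => h1 h2 h3.
    have : `|sin t| * `|v *m Jmx| <= 1 by rewrite -[leRHS]mulr1 ler_pM.
    by lra.
  have inb (r t : R) : 0 < r < rho / 2 -> `|z + r *: u t - z| < rho.
    move=> /andP[r0 rr]; rewrite addrC addKr normrZ gtr0_norm//.
    have : r * `|u t| <= r * 2 by rewrite ler_pM2l.
    by lra.
  pose Fl (x : 'rV[R]_(m + m)) := (f x - f z) 0 (lshift n j).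
  pose Fr (x : 'rV[R]_(m + m)) := (f x - f z) 0 (rshift n j).
  have dF k (x : 'rV[R]_(m + m)) : `|x - z| < rho ->
     is_diff x (fun x => (f x - f z) 0 k) (fun w => 'd f x w 0 k).
    move=> xz; have [[df _] _] := Hf x xz.
    have [d1 e1] := diff_coord k df.
    have -> : (fun x => (f x - f z) 0 k) = (fun x => f x 0 k) - cst (f z 0 k).
      by apply/funext => y; rewrite !mxE.
    apply: DiffDef; first exact: differentiableB.
    rewrite diffB// e1 diff_cst; apply/funext => w; exact: subr0.
  have dr (r t : R) : is_derive r 1 (fun r : R => z + r *: u t) (u t).
    have D : is_derive r 1 (fun r : R => r *: u t) (u t).
      apply: DeriveDef; first exact/derivable1_diffP.
      by rewrite deriveE// diff_val scale1r.
    by have := is_deriveD (is_derive_cst z r 1) D; rewrite add0r.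
  have dt (r t : R) : is_derive t 1 (fun t : R => z + r *: u t) (r *: (u t *m Jmx)).
    have dsc (g : R -> R) g' (w : 'rV[R]_(m + m)) : is_derive t 1 g g' ->
        is_derive t 1 (fun t => g t *: w) (g' *: w).
      move=> [dg eg]; have dg' : differentiable g t by exact/derivable1_diffP.
      apply: DeriveDef; first by apply/derivable1_diffP; exact: differentiableZl.
      by rewrite deriveE ?diffZl -?deriveE ?eg//; exact: differentiableZl.
    have D1 := dsc _ _ v (is_derive_cos t).
    have D2 := dsc _ _ (v *m Jmx) (is_derive_sin t).
    have D3 := is_deriveZ r (is_deriveD D1 D2).
    have -> : r *: (u t *m Jmx) = 0 + r *: (- sin t *: v + cos t *: (v *m Jmx)).
      by rewrite add0r /u mulmxDl -!scalemxAl JmxK scalerN scaleNr addrC.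
    exact: is_deriveD (is_derive_cst z t 1) D3.
  have chain (g : R -> 'rV[R]_(m + m)) g' (s : R) k : is_derive s 1 g g' -> `|g s - z| < rho ->
      is_derive s 1 (fun s => (f (g s) - f z) 0 k) ('d f (g s) g' 0 k).
    move=> [dg eg] gz; have dg' : differentiable g s by exact/derivable1_diffP.
    have dFg := dF k _ gz.
    have df : differentiable ((fun x => (f x - f z) 0 k) \o g) s.
      by apply: differentiable_comp => //; exact: ex_diff.
    apply: DeriveDef; first exact: diff_derivable.
    rewrite deriveE// (@diff_comp _ _ _ _ g (fun x => (f x - f z) 0 k) s)//.
    by rewrite diff_val -eg (deriveE _ dg').
  apply: (@polar_cauchy R (fun r t => Fl (z + r *: u t)) (fun r t => Fr (z + r *: u t))
    (fun r t => 'd f (z + r *: u t) (u t) 0 (lshift n j))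
    (fun r t => 'd f (z + r *: u t) (u t) 0 (rshift n j)) _ (rho / 2) (L * 2) M).
  - move=> r t rr; have zr := inb r t rr.
    have [[_ cJ] _] := Hf _ zr.
    have E1 := chain _ _ _ (lshift n j) (dt r t) zr.
    have E2 := chain _ _ _ (rshift n j) (dt r t) zr.
    rewrite linearZ mxE cJ Jmx_lshift mulrN in E1.
    rewrite linearZ mxE cJ Jmx_rshift in E2.
    exact: And4 (chain _ _ _ (lshift n j) (dr r t) zr) (chain _ _ _ (rshift n j) (dr r t) zr) E1 E2.
  - move=> r t rr; have zr := inb r t rr.
    have [_ bd] := Hf _ zr; have L1 : 0 <= L by have := L0 v; rewrite v1 mulr1.
    have bd2 : `|'d f (z + r *: u t) (u t)| <= L * 2 by rewrite (le_trans (bd _))// ler_wpM2l.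
    by split; rewrite (le_trans (coord_le_norm _ _ _))//; exact: HM.
  - by move=> r t; rewrite /u sinD2pi cosD2pi.
  - move=> e e0; have [|[df cJ] _] := Hf z; first by rewrite subrr normr0.
    have e4 : 0 < e / 4 by rewrite divr_gt0.
    have /nbhs_norm0P[d /= d0 Hd] := diff_approx df e4.
    exists (d / 2); first by rewrite divr_gt0.
    move=> r t /andP[r0 rd].
    have ru : `|r *: u t| <= r * 2 by rewrite normrZ gtr0_norm// ler_pM2l.
    have /= H1 : `|f (z + r *: u t) - f z - 'd f z (r *: u t)| <= e / 4 * `|r *: u t|.
      by apply: Hd => /=; rewrite (le_lt_trans ru)//; lra.
    set E := f (z + r *: u t) - f z - 'd f z (r *: u t) in H1.
    have H2 : `|E| <= e / 2 * r.
      by apply: le_trans H1 _; rewrite (_ : e / 2 * r = e / 4 * (r * 2)); [rewrite ler_pM2l|field].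
    have EE k : (f (z + r *: u t) - f z) 0 k = E 0 k + r * (cos t * 'd f z v 0 k + sin t * ('d f z v *m Jmx) 0 k).
      have -> : E = f (z + r *: u t) - f z - r *: (cos t *: 'd f z v + sin t *: ('d f z v *m Jmx)).
        by rewrite /E -cJ /u; congr (_ - _); rewrite linearZ/= linearD/= 2!linearZ.
      by rewrite !mxE; ring.
    have -> : Fl (z + r *: u t) * cos t + Fr (z + r *: u t) * sin t - r * 'd f z v 0 (lshift n j)
       = E 0 (lshift n j) * cos t + E 0 (rshift n j) * sin t.
      rewrite /Fl /Fr !EE Jmx_lshift Jmx_rshift.
      have := cos2Dsin2 t; set A := 'd f z v 0 _; set B := 'd f z v 0 _ => cs.
      rewrite -[r * A in X in _ - X]mulr1 -cs; ring.
    rewrite (le_trans (ler_normD _ _))// !normrM.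
    have h2 : `|cos t| <= 1 by rewrite ler_norml cos_geN1 cos_le1.
    have h3 : `|sin t| <= 1 by rewrite ler_norml sin_geN1 sin_le1.
    have h4 : `|E 0 (lshift n j)| * `|cos t| <= e / 2 * r * 1 by rewrite ler_pM// (le_trans (coord_le_norm _ _ _)).
    have h5 : `|E 0 (rshift n j)| * `|sin t| <= e / 2 * r * 1 by rewrite ler_pM// (le_trans (coord_le_norm _ _ _)).
    by lra.
have key2 v k : `|v| = 1 -> `|('d f z v) 0 k| * rho <= 4 * M.
  have lim (x : R) : (forall r, 0 < r < rho / 2 -> `|x| * r <= 2 * M) -> `|x| * rho <= 4 * M.
    move=> H; apply/ler_addgt0Pr => e e0.
    pose dd := Num.min (rho / 4) (e / (2 * (`|x| + 1))).
    have x1 : 0 < 2 * (`|x| + 1) by rewrite mulr_gt0// ltr_wpDl.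
    have d0 : 0 < dd by rewrite lt_min !divr_gt0.
    have d1 : dd <= rho / 4 by rewrite ge_min lexx.
    have d2 : dd * (2 * (`|x| + 1)) <= e by rewrite -ler_pdivlMr// ge_min lexx orbT.
    have := H (rho / 2 - dd); have -> : 0 < rho / 2 - dd < rho / 2 by lra.
    move=> /(_ isT).
    have := mulr_ge0 (normr_ge0 x) (ltW d0).
    nra.
  move=> v1; have [|E _] := Hf z; first by rewrite subrr normr0.
  rewrite -(splitK k); case: (fintype.split k) => j /=; apply: lim => r rr.
    exact: key.
  have vJ1 : `|v *m Jmx| = 1.
    apply/eqP; rewrite eq_le -v1 norm_Jmx/= -normrN -JmxK; exact: norm_Jmx.
  by have := key _ j vJ1 r rr; rewrite E.2 Jmx_lshift normrN.
move=> v; rewrite -jacE; have [->|v0] := eqVneq v 0; first by rewrite linear0 !normr0 mul0r mulr0.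
have nv : 0 < `|v| by rewrite normr_gt0.
have v1 : `| (`|v|^-1 *: v) | = 1 by rewrite normrZ normfV normr_id mulVf// gt_eqF.
rewrite -ler_pdivlMr//; apply: norm_rV_le.
  by rewrite divr_ge0 ?mulr_ge0// ltW.
move=> k; rewrite ler_pdivlMr// -ler_pdivrMr//.
by have := key2 _ k v1; rewrite linearZ mxE normrM normfV normr_id [X in _ -> X <= _]mulrC mulrA.
Qed.

Lemma Jcomm_sub {m n} (A B : 'M[R]_(m + m, n + n)) :
  Jmx *m A = A *m Jmx -> Jmx *m B = B *m Jmx -> Jmx *m (A - B) = (A - B) *m Jmx.
Proof. by move=> a b; rewrite mulmxBr mulmxBl a b. Qed.

Lemma segment_ball m (x y z : 'rV[R]_m) rho t : 0 <= t <= 1 ->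
  `|x - z| < rho -> `|y - z| < rho -> `|x + t *: (y - x) - z| < rho.
Proof.
move=> /andP[t0 t1] xz yz.
have -> : x + t *: (y - x) - z = (1 - t) *: (x - z) + t *: (y - z).
  by rewrite scalerBl scale1r !scalerBr; apply/rowP => j; rewrite !mxE; ring.
rewrite (le_lt_trans (ler_normD _ _))// !normrZ (ger0_norm t0) ger0_norm ?subr_ge0//.
have [e|e] := leP (`|x - z|) (`|y - z|).
  have : (1 - t) * `|x - z| <= (1 - t) * `|y - z| by rewrite ler_wpM2l// subr_ge0.
  by lra.
have : t * `|y - z| <= t * `|x - z| by rewrite ler_wpM2l// ltW.
by lra.
Qed.

Lemma near_dist {V : normedModType R} (z : V) e : 0 < e -> \forall y \near z, `|y - z| < e.
Proof. by move=> e0; apply/nbhs_normP; exists e => //= y; rewrite distrC. Qed.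

Lemma near0_lt {V : normedModType R} e : 0 < e -> \forall h \near (0 : V), `|h| < e.
Proof. by move=> /(near_dist (0 : V)); apply: filterS => h; rewrite subr0. Qed.

Lemma mx_coord_row {m k} (A : 'M[R]_(m, k)) i j : A i j = ((delta_mx 0 i : 'rV[R]_m) *m A) 0 j.
Proof. by rewrite -rowE mxE. Qed.

Lemma norm_delta_mx m (j : 'I_m) : `|delta_mx 0 j : 'rV[R]_m| = 1.
Proof.
apply/eqP; rewrite eq_le; apply/andP; split.
  by apply: norm_rV_le => // l; rewrite mxE; case: eqP => _; case: eqP => _; rewrite ?normr0 ?normr1.
by have := coord_le_norm (delta_mx 0 j : 'rV[R]_m) 0 j; rewrite mxE !eqxx normr1.
Qed.

Section HolBall.
Context {m n : nat}.
Variables (f : 'rV[R]_(m + m) -> 'rV[R]_(n + n)) (z : 'rV[R]_(m + m)) (rho L : R).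
Hypothesis rho0 : 0 < rho.
Hypothesis Hf : hol_ball f z rho L.

Lemma hol_ball_ge0 (v : 'rV[R]_(m + m)) : 0 <= L * `|v|.
Proof. by have [|_ /(_ v)] := @Hf z; [rewrite subrr normr0|apply: le_trans]. Qed.

Lemma hol_ball_lip (x y : 'rV[R]_(m + m)) : `|x - z| < rho -> `|y - z| < rho ->
  `|f y - f x| <= L * `|y - x|.
Proof.
move=> xz yz; apply: mean_value_rV; first exact: hol_ball_ge0.
move=> t t01; have [|[df _] bd] := @Hf (x + t *: (y - x)); first exact: segment_ball.
by split => //; rewrite jacE.
Qed.

(** For close points, Cauchy's estimate is applied to the difference [g w = f (w + (y - x)) - f w],
    which is bounded by twice [L * |y - x|] on a ball of radius [rho / 4]; this gives 4 * 2 * 4 =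
    32. For distant points the bound [L] on both derivatives is enough. *)
Lemma hol_ball_jac_lip (x y v : 'rV[R]_(m + m)) : `|x - z| < rho / 2 -> `|y - z| < rho / 2 ->
  `|v *m jac f y - v *m jac f x| <= 32 * L / rho * `|y - x| * `|v|.
Proof.
move=> xz yz; have half : rho / 2 < rho by rewrite ltr_pdivrMr// ltr_pMr// ltr1n.
have xz1 := lt_trans xz half; have yz1 := lt_trans yz half.
have L0 := hol_ball_ge0.
have [yx|yx] := ltP (`|y - x|) (rho / 4).
  pose g w := f (w + (y - x)) - f w.
  have Hw (w : 'rV[R]_(m + m)) : `|w - x| < rho / 4 -> `|w - z| < rho /\ `|w + (y - x) - z| < rho.
    move=> wx; have := ler_distD x w z; have := ler_normD (w - x) (y - z).
    have -> : w + (y - x) - z = w - x + (y - z) by apply/rowP => j; rewrite !mxE; ring.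
    by move: wx xz yz; lra.
  have Hg (w : 'rV[R]_(m + m)) : `|w - x| < rho / 4 -> isD g w (jac f (w + (y - x)) - jac f w).
    move=> /Hw[w1 w2]; apply: isD_sub; last by apply: isD_jac; have [[]] := Hf w1.
    by apply: isd_shift; apply: isD_jac; have [[]] := Hf w2.
  have rho4 : 0 < rho / 4 by rewrite divr_gt0.
  have b1 : hol_ball g x (rho / 4) (L + L).
    move=> w wx; have gw := Hg w wx; have [w1 w2] := Hw w wx.
    have [[_ c1] d1] := Hf w1; have [[_ c2] d2] := Hf w2.
    split; first exact: cdiffP gw (Jcomm_sub c2 c1).
    move=> u; rewrite (jac_isD gw) mulmxBr mulrDl.
    exact: le_trans (ler_normB _ _) (lerD (d2 u) (d1 u)).
  have b2 w : `|w - x| < rho / 4 -> `|g w - g x| <= L * `|y - x| + L * `|y - x|.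
    move=> wx; have [w1 w2] := Hw w wx; rewrite (le_trans (ler_normB _ _))// lerD//.
      have -> : y - x = w + (y - x) - w by rewrite [w + _]addrC addrK.
      exact: hol_ball_lip.
    by rewrite /g [x + _]addrC subrK; exact: hol_ball_lip.
  have := cauchy_estimate rho4 b1 b2 v.
  have gx : isD g x (jac f y - jac f x).
    have xx : `|x - x| < rho / 4 by rewrite subrr normr0.
    have h := Hg x xx; have E : x + (y - x) = y by rewrite addrC subrK.
    by rewrite E in h; exact: h.
  rewrite (jac_isD gx) mulmxBr => H.
  set N := `|_ - _| in H *; set Y := `|y - x| in H *.
  rewrite (_ : 32 * L / rho * Y * `|v| = (4 * (L * Y + L * Y) * `|v|) / (rho / 4)).
    by rewrite ler_pdivlMr.
  by field; rewrite gt_eqF.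
have : `|v *m jac f y - v *m jac f x| <= L * `|v| + L * `|v|.
  by rewrite (le_trans (ler_normB _ _))// lerD//; [exact: (Hf yz1).2|exact: (Hf xz1).2].
move=> /le_trans; apply.
have -> : 32 * L / rho * `|y - x| * `|v| = 32 * (L * `|v|) * (`|y - x| / rho) by field; rewrite gt_eqF.
have h : 4^-1 <= `|y - x| / rho by rewrite ler_pdivlMr// mulrC.
have := ler_wpM2l (mulr_ge0 (ler0n R 32) (L0 v)) h.
by have := L0 v; lra.
Qed.

Lemma hol_ball_taylor (x h : 'rV[R]_(m + m)) : `|x - z| < rho / 2 -> `|x + h - z| < rho / 2 ->
  `|f (x + h) - f x - h *m jac f x| <= 32 * L / rho * `|h| * `|h|.
Proof.
move=> xz hz; have hx : x + h - x = h by rewrite addrC addKr.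
have seg (t : R) : 0 <= t <= 1 -> `|x + t *: h - z| < rho / 2.
  by move=> t01; have := segment_ball t01 xz hz; rewrite hx.
have half : rho / 2 < rho by rewrite ltr_pdivrMr// ltr_pMr// ltr1n.
pose g w := f w - w *m jac f x.
have dg (w : 'rV[R]_(m + m)) : `|w - z| < rho / 2 -> isD g w (jac f w - jac f x).
  move=> wz; apply: isD_sub; last exact: isD_mulmxr.
  by apply: isD_jac; have [[]] := Hf (lt_trans wz half).
have -> : f (x + h) - f x - h *m jac f x = g (x + h) - g x.
  by rewrite /g mulmxDl; apply/rowP => j; rewrite !mxE; ring.
have L0 := hol_ball_ge0.
have E (a : R) : 32 * L / rho * (a * `|h|) * `|h| = a * (32 * (L * `|h|) * (`|h| / rho)).
  by field; rewrite gt_eqF.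
have E0 : 0 <= 32 * (L * `|h|) * (`|h| / rho).
  apply: mulr_ge0; first by apply: mulr_ge0 => //; exact: L0.
  by apply: divr_ge0 => //; exact: ltW.
have E1 : 32 * L / rho * `|h| * `|h| = 32 * (L * `|h|) * (`|h| / rho).
  by have := E 1; rewrite !mul1r.
rewrite E1; apply: mean_value_rV; first exact: E0.
move=> t t01; rewrite hx; have [dgt e] := dg _ (seg t t01); split; first exact: dgt.
rewrite e mulmxBr; apply: le_trans (hol_ball_jac_lip _ xz (seg t t01)) _.
rewrite (_ : x + t *: h - x = t *: h); last by rewrite addrC addKr.
have /andP[t0 t1] := t01; rewrite normrZ (ger0_norm t0) E.
by rewrite ler_piMl.
Qed.

Lemma hol_ball_sub (x : 'rV[R]_(m + m)) r : `|x - z| + r <= rho -> hol_ball f x r L.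
Proof.
move=> H y yx; apply: Hf; have := ler_distD x y z; move: yx H; lra.
Qed.

End HolBall.

Lemma near_ballP {m} (z : 'rV[R]_m) (P : set 'rV[R]_m) :
  (\forall y \near z, P y) <-> exists2 r, 0 < r & forall y, `|y - z| < r -> P y.
Proof.
split=> [/nbhs_normP[r /= r0 H]|[r r0 H]].
  by exists r => // y yz; apply: H; rewrite /= distrC.
by apply/nbhs_normP; exists r => //= y; rewrite /= distrC => /H.
Qed.

Lemma hol_near {m n} (f : 'rV[R]_(m + m) -> 'rV[R]_(n + n)) z : hol f z ->
  exists2 r, 0 < r & forall y, `|y - z| < r -> hol f y.
Proof.
move=> [rho [L [rho0 H]]]; have r2 : 0 < rho / 2 by rewrite divr_gt0.
exists (rho / 2) => // y yz; exists (rho / 2), L; split => //.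
by apply: (hol_ball_sub H); move: yz; lra.
Qed.

Lemma hol_cdiff {m n} (f : 'rV[R]_(m + m) -> 'rV[R]_(n + n)) z : hol f z -> cdiff f z.
Proof. by move=> [rho [L [rho0 H]]]; have [|] := H z; rewrite ?subrr ?normr0. Qed.

Lemma hol_isD {m n} (f : 'rV[R]_(m + m) -> 'rV[R]_(n + n)) z : hol f z -> isD f z (jac f z).
Proof. by move=> /hol_cdiff[d _]; exact: isD_jac. Qed.

Section Limit.
Context {T : Type} (U : set_system T) {UU : UltraFilter U} {m n : nat}.
Variables (F : T -> 'rV[R]_(m + m) -> 'rV[R]_(n + n)) (f : 'rV[R]_(m + m) -> 'rV[R]_(n + n)).
Variables (z : 'rV[R]_(m + m)) (rho L : R).
Hypothesis rho0 : 0 < rho.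
Hypothesis HF : \forall i \near U, hol_ball (F i) z rho L.
Hypothesis Ff : forall y, `|y - z| < rho -> F i y @[i --> U] --> f y.

(* The quadratic Taylor estimate is uniform in [i], so it passes to the limit. *)
Lemma hol_limit : cdiff f z /\ (forall v : 'rV[R]_(m + m), `|v *m jac f z| <= L * `|v|) /\
  forall v : 'rV[R]_(m + m), v *m jac (F i) z @[i --> U] --> v *m jac f z.
Proof.
have zz : `|z - z| < rho by rewrite subrr normr0.
have [A HA] : exists A : 'M[R]_(m + m, n + n), forall e, 0 < e ->
    \forall i \near U, forall j k, `|jac (F i) z j k - A j k| <= e.
  apply: (@ultra_mx _ _ U _ _ _ (fun i => jac (F i) z) (L * 1)).
  apply: filterS HF => i /(_ z zz)[_ H] j k.
  rewrite mx_coord_row (le_trans (coord_le_norm _ _ _))// -(norm_delta_mx j).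
  exact: H.
have HvA (v : 'rV[R]_(m + m)) : v *m jac (F i) z @[i --> U] --> v *m A.
  apply/cvgrPdist_le => e e0.
  pose K := (m + m)%:R * (`|v| + 1) : R.
  have K0 : 0 < K + 1 by rewrite ltr_wpDl// mulr_ge0// addr_ge0.
  have := HA (e / (K + 1)) (divr_gt0 e0 K0); apply: filterS => i H.
  rewrite -mulmxBr; apply: le_trans (mulmx_norm_le v (e := e / (K + 1)) _ _) _.
  - by rewrite divr_ge0// ltW.
  - by move=> j k; rewrite !mxE distrC.
  - rewrite mulrAC mulrA -mulrA mulrCA ler_piMr// ?(ltW e0)//.
    rewrite ler_pdivrMr// mul1r /K.
    by rewrite -[leLHS]addr0 lerD// ler_wpM2l// lerDl.
have HL (v : 'rV[R]_(m + m)) : `|v *m A| <= L * `|v|.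
  by apply: cvg_norm_le (HvA v) _; apply: filterS HF => i /(_ z zz)[_].
have fA : isD f z A.
  apply: isD_intro => e e0.
  have r2 : 0 < rho / 2 by rewrite divr_gt0.
  have e2 : 0 < e / (`|32 * L / rho| + 1) by rewrite divr_gt0// ltr_wpDl.
  apply: filterS2 (near0_lt r2) (near0_lt e2) => h hr hh.
  have zh : `|z + h - z| < rho / 2 by rewrite addrC addKr.
  have zhr : `|z + h - z| < rho by move: zh rho0; lra.
  have cv : (F i (z + h) - F i z - h *m jac (F i) z) @[i --> U] --> f (z + h) - f z - h *m A.
    by apply: cvgB (HvA h); apply: cvgB; exact: Ff.
  have : `|f (z + h) - f z - h *m A| <= 32 * L / rho * `|h| * `|h|.
    apply: cvg_norm_le cv _.
    apply: filterS HF => i Hi; apply: (hol_ball_taylor rho0 Hi) => //.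
    by rewrite subrr normr0 divr_gt0.
  move=> /le_trans; apply; apply: ler_wpM2r => //.
  move/ltW: hh; rewrite ler_pdivlMr ?ltr_wpDl// mulrDr mulr1 => hh; apply: le_trans hh.
  by rewrite mulrC -[leLHS]addr0 lerD// ler_wpM2l// ler_norm.
have jA := jac_isD fA; rewrite jA; split; last by split.
apply: (cdiffP fA); apply: mulmxrI => v.
have c1 := HvA (v *m Jmx).
have c2 : (v *m jac (F i) z) *m Jmx @[i --> U] --> (v *m A) *m Jmx.
  exact: cvg_comp (HvA v) (@continuous_mulmxr R _ _ Jmx (v *m A)).
rewrite !mulmxA.
have Heq : {near U, (fun i => (v *m jac (F i) z) *m Jmx) =1 (fun i => v *m Jmx *m jac (F i) z)}.
  by apply: filterS HF => i /(_ z zz)[[_ cJ] _]; rewrite -!mulmxA cJ.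
have c3 : v *m Jmx *m jac (F i) z @[i --> U] --> (v *m A) *m Jmx.
  by apply: cvg_trans c2; apply: near_eq_cvg Heq.
exact: cvg_unique c1 c3.
Qed.

End Limit.

End Hol.

(** * Derivatives of holomorphic maps are holomorphic *)

Section Hol2.
Context {R : realType}.

Lemma cvg_coarser {T : Type} {S : nbhsType} (F G : set_system T) (a : T -> S) (l : S) :
  F `<=` G -> a i @[i --> F] --> l -> a i @[i --> G] --> l.
Proof. by move=> sFG al P /al; exact: sFG. Qed.

Lemma isD_quot {m k} (f : 'rV[R]_m -> 'rV[R]_k) z A v : isD f z A ->
  t^-1 *: (f (z + t *: v) - f z) @[t --> (0 : R)^'] --> v *m A.
Proof.
move=> /(isd_derive v)[cv <-].
move: cv; rewrite /derivable /derive => /cvg_ex[l cl].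
rewrite (cvg_lim _ cl)//; apply: cvg_trans cl.
by apply: near_eq_cvg; apply: nearW => t; rewrite /= [z + _]addrC.
Qed.

Section Derivative.
Context {m n : nat}.
Variables (f : 'rV[R]_(m + m) -> 'rV[R]_(n + n)) (z : 'rV[R]_(m + m)) (rho L : R).
Hypothesis rho0 : 0 < rho.
Hypothesis Hf : hol_ball f z rho L.

Let quot v (t : R) (x : 'rV[R]_(m + m)) := t^-1 *: (f (x + t *: v) - f x).

Lemma hol_ball_quot v y : `|y - z| < rho / 4 -> \forall t \near (0 : R)^',
  hol_ball (quot v t) y (rho / 8) (32 * L / rho * `|v|).
Proof.
move=> yz; have r8 : 0 < rho / 8 / (`|v| + 1) by rewrite !divr_gt0// ltr_wpDl.
rewrite near_withinE; apply: filterS (near0_lt r8) => t; rewrite ltr_pdivlMr ?ltr_wpDl// => tv t0 x xy.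
have tv8 : `|t *: v| < rho / 8.
  by rewrite normrZ (le_lt_trans _ tv)// ler_wpM2l// lerDl.
have x1 : `|x - z| < rho / 2 by have := ler_distD y x z; move: xy yz rho0; lra.
have x2 : `|x + t *: v - z| < rho / 2.
  have -> : x + t *: v - z = x - z + t *: v by rewrite addrAC.
  have := ler_normD (x - z) (t *: v).
  by have := ler_distD y x z; move: xy yz tv8 rho0; lra.
have half : rho / 2 < rho by rewrite ltr_pdivrMr// ltr_pMr// ltr1n.
have [c1 _] := Hf (lt_trans x1 half); have [c2 _] := Hf (lt_trans x2 half).
have D : isD (quot v t) x (t^-1 *: (jac f (x + t *: v) - jac f x)).
  by apply: isD_scale; apply: isD_sub (isD_jac (cdiff_differentiable c1)); apply: isd_shift; exact: isD_jac (cdiff_differentiable c2).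
split.
  apply: (cdiffP D).
  by rewrite -scalemxAr -scalemxAl (Jcomm_sub (cdiff_J c2) (cdiff_J c1)).
move=> u; rewrite (jac_isD D) -scalemxAr mulmxBr normrZ.
have := hol_ball_jac_lip rho0 Hf u x1 x2.
have -> : x + t *: v - x = t *: v by rewrite [x + _]addrC addrK.
rewrite normrZ => H; apply: le_trans (ler_wpM2l (normr_ge0 _) H) _.
have tn : `|t| != 0 by rewrite normr_eq0.
rewrite le_eqVlt normfV; apply/orP; left; apply/eqP.
by field; rewrite tn gt_eqF.
Qed.

Lemma hol_ball_quot_cvg v y : `|y - z| < rho ->
  quot v t y @[t --> (0 : R)^'] --> v *m jac f y.
Proof. by move=> yz; apply: isD_quot; apply: isD_jac; have [[]] := Hf yz. Qed.

(** The derivative is the limit of difference quotients, which are holomorphic with uniform bounds,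
    so [hol_limit] applies along an ultrafilter finer than the punctured neighbourhoods of 0. The
    derivative of a quotient along [u] is the quotient of the derivative along [u]; comparing the
    two limits gives the symmetry of second derivatives. *)
Lemma hol_ball_jac v : hol_ball (fun y => v *m jac f y) z (rho / 4) (32 * L / rho * `|v|) /\
  forall y, `|y - z| < rho / 4 -> forall u,
    u *m jac (fun y => v *m jac f y) y = v *m jac (fun y => u *m jac f y) y.
Proof.
have [U [UU sU]] := @ultraFilterLemma R ((0 : R)^') _.
have r8 : 0 < rho / 8 by rewrite divr_gt0.
have main w y : `|y - z| < rho / 4 -> cdiff (fun y => w *m jac f y) y /\
   (forall u : 'rV[R]_(m + m), `|u *m jac (fun y => w *m jac f y) y| <= 32 * L / rho * `|w| * `|u|) /\
   forall u : 'rV[R]_(m + m), u *m jac (quot w t) y @[t --> U] --> u *m jac (fun y => w *m jac f y) y.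
  move=> yz; apply: (@hol_limit R R U UU m n (quot w) (fun y => w *m jac f y) y (rho / 8)) => //.
    by apply: sU; exact: hol_ball_quot.
  move=> x xy; apply: (cvg_coarser sU); apply: hol_ball_quot_cvg.
  by have := ler_distD y x z; move: xy yz rho0; lra.
split; first by move=> y yz; have [c [b _]] := main v y yz.
move=> y yz u; have [_ [_ c1]] := main v y yz.
have [[du _] _] := main u y yz.
have c2 : t^-1 *: ((u *m jac f (y + t *: v)) - u *m jac f y) @[t --> U] -->
    v *m jac (fun y => u *m jac f y) y.
  by have H := isD_quot (v := v) (isD_jac du); move=> P /H; exact: sU.
suff c3 : u *m jac (quot v t) y @[t --> U] --> v *m jac (fun y => u *m jac f y) y.
  exact: cvg_unique (c1 u) c3.
apply: cvg_trans c2; apply: near_eq_cvg; apply: sU.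
have r8v : 0 < rho / 8 / (`|v| + 1) by rewrite !divr_gt0// ltr_wpDl.
have N : \forall t \near (0 : R)^', `|t| < rho / 8 / (`|v| + 1) /\ t != 0.
  by rewrite near_withinE; apply: filterS (near0_lt r8v) => t.
apply: filterS N => t []; rewrite ltr_pdivlMr ?ltr_wpDl// => tv t0.
have tv8 : `|t *: v| < rho / 8.
  by rewrite normrZ (le_lt_trans _ tv)// ler_wpM2l// lerDl.
have y1 : `|y - z| < rho by move: yz rho0; lra.
have y2 : `|y + t *: v - z| < rho.
  have -> : y + t *: v - z = y - z + t *: v by rewrite addrAC.
  by have := ler_normD (y - z) (t *: v); move: yz tv8 rho0; lra.
have [[d1 _] _] := Hf y1; have [[d2 _] _] := Hf y2.
have D : isD (quot v t) y (t^-1 *: (jac f (y + t *: v) - jac f y)).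
  by apply: isD_scale; apply: isD_sub (isD_jac d1); apply: isd_shift; exact: isD_jac d2.
by rewrite (jac_isD D) -scalemxAr mulmxBr.
Qed.

End Derivative.

Lemma hol_jac {m n} (f : 'rV[R]_(m + m) -> 'rV[R]_(n + n)) z v : hol f z ->
  hol (fun y => v *m jac f y) z.
Proof.
move=> [rho [L [rho0 H]]]; have [H1 _] := hol_ball_jac rho0 H v.
by exists (rho / 4), (32 * L / rho * `|v|); split => //; rewrite divr_gt0.
Qed.

Lemma hol_jac_sym {m n} (f : 'rV[R]_(m + m) -> 'rV[R]_(n + n)) z u v : hol f z ->
  u *m jac (fun y => v *m jac f y) z = v *m jac (fun y => u *m jac f y) z.
Proof.
move=> [rho [L [rho0 H]]]; have [_ H2] := hol_ball_jac rho0 H v.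
by apply: H2; rewrite subrr normr0 divr_gt0.
Qed.

Lemma cdiff_comp {m n k} (f : 'rV[R]_(m + m) -> 'rV[R]_(n + n))
    (g : 'rV[R]_(n + n) -> 'rV[R]_(k + k)) z : cdiff f z -> cdiff g (f z) ->
  cdiff (fun x => g (f x)) z /\ jac (fun x => g (f x)) z = jac f z *m jac g (f z).
Proof.
move=> [df cf] [dg cg]; have D := isD_comp (isD_jac df) (isD_jac dg).
split; last exact: jac_isD D.
by apply: (cdiffP D); rewrite mulmxA cf -mulmxA cg mulmxA.
Qed.

Lemma hol_continuous {m n} (f : 'rV[R]_(m + m) -> 'rV[R]_(n + n)) z : hol f z ->
  {for z, continuous f}.
Proof. by move=> /hol_isD /isd_continuous. Qed.

Lemma hol_comp {m n k} (f : 'rV[R]_(m + m) -> 'rV[R]_(n + n))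
    (g : 'rV[R]_(n + n) -> 'rV[R]_(k + k)) z : hol f z -> hol g (f z) ->
  hol (fun x => g (f x)) z.
Proof.
move=> [rho [L [rho0 Hf]]] [sig [K [sig0 Hg]]].
have s1 : 0 < sig / (`|L| + 1) by rewrite divr_gt0// ltr_wpDl.
exists (Num.min rho (sig / (`|L| + 1))), (`|K| * `|L|).
split; first by rewrite lt_min rho0 s1.
move=> y; rewrite lt_min => /andP[y1 y2].
have zz : `|z - z| < rho by rewrite subrr normr0.
have fy : `|f y - f z| < sig.
  apply: le_lt_trans (hol_ball_lip rho0 Hf zz y1) _.
  apply: le_lt_trans (_ : _ <= `|L| * `|y - z|) _; first by rewrite ler_wpM2r// ler_norm.
  move: y2; rewrite ltr_pdivlMr ?ltr_wpDl// => /(le_lt_trans _); apply.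
  by rewrite mulrC ler_wpM2l// lerDl.
have [cf bf] := Hf y y1; have [cg bg] := Hg (f y) fy.
have [c e] := cdiff_comp cf cg; split; first exact: c.
move=> v; rewrite e mulmxA; apply: le_trans (bg _) _.
apply: le_trans (_ : _ <= `|K| * `|v *m jac f y|) _; first by rewrite ler_wpM2r// ler_norm.
rewrite -mulrA ler_wpM2l//; apply: le_trans (bf v) _.
by rewrite ler_wpM2r// ler_norm.
Qed.

Lemma cdiff_near {m n} (f g : 'rV[R]_(m + m) -> 'rV[R]_(n + n)) (z : 'rV[R]_(m + m)) :
  {near z, f =1 g} -> cdiff f z -> cdiff g z /\ jac g z = jac f z.
Proof.
move=> fg [df cf]; have D := isd_near fg (isD_jac df).
by split; [exact: (cdiffP D)|exact: jac_isD].
Qed.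

Lemma jac_near {m n} (f g : 'rV[R]_(m + m) -> 'rV[R]_(n + n)) (z : 'rV[R]_(m + m)) :
  {near z, f =1 g} -> cdiff f z -> jac g z = jac f z.
Proof. by move=> fg cf; have [] := cdiff_near fg cf. Qed.

Lemma hol_near_eq {m n} (f g : 'rV[R]_(m + m) -> 'rV[R]_(n + n)) (z : 'rV[R]_(m + m)) r :
  0 < r -> (forall y, `|y - z| < r -> f y = g y) -> hol f z -> hol g z.
Proof.
move=> r0 fg [rho [L [rho0 Hf]]]; exists (Num.min rho r), L.
split; first by rewrite lt_min rho0.
move=> y; rewrite lt_min => /andP[y1 y2]; have [c b] := Hf y y1.
have e : {near y, f =1 g}.
  apply/near_ballP; exists (r - `|y - z|); first by rewrite subr_gt0.
  by move=> w wy; apply: fg; have := ler_distD y w z; move: wy; lra.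
have [cg jg] := cdiff_near e c; split; first exact: cg.
by move=> v; rewrite jg; exact: b.
Qed.

Lemma hol_affine {m n} (A : 'M[R]_(m + m, n + n)) (b : 'rV[R]_(n + n)) z :
  Jmx *m A = A *m Jmx -> hol (fun x => x *m A + b) z /\ jac (fun x => x *m A + b) z = A.
Proof.
move=> JA; have D (y : 'rV[R]_(m + m)) : isD (fun x => x *m A + b) y A.
  by apply: isd_ext (isdD (isD_mulmxr A y) (isd_cst b y)) => v; rewrite addr0.
have [C C0 HC] := mulmx_bounded A.
split; last exact: jac_isD.
exists 1, C; split; first exact: ltr01.
move=> y _; split; first exact: cdiffP (D y) JA.
by move=> v; rewrite (jac_isD (D y)).
Qed.

End Hol2.

(** * The holomorphic inverse function theorem *)

Section Inverse.
Context {R : realType}.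

Lemma continuous_rVP {m k} (g : 'rV[R]_m -> 'rV[R]_k) w : {for w, continuous g} <->
  forall e, 0 < e -> exists2 d, 0 < d & forall x, `|x - w| < d -> `|g x - g w| < e.
Proof.
split=> [H e e0|H P].
  have N : nbhs (g w) (fun y => `|y - g w| < e) by apply/near_ballP; exists e.
  by have /near_ballP := H _ N.
move=> /near_ballP[e e0 HP]; have [d d0 Hd] := H e e0.
by apply/near_ballP; exists d => // x /Hd /HP.
Qed.

Lemma inj_unitmx {m} (A : 'M[R]_m) : (forall v : 'rV_m, v *m A = 0 -> v = 0) -> A \in unitmx.
Proof.
move=> H; rewrite -row_free_unit -kermx_eq0; apply/rowV0P => v /sub_kermxP; exact: H.
Qed.

Lemma half_absorb (b p q x : R) : x <= b * p -> b * p <= b * q + x / 2 -> x <= 2 * b * q.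
Proof. by lra. Qed.

Lemma unitmx_bound {m} (A : 'M[R]_m) : A \in unitmx ->
  exists2 b, 0 < b & forall v : 'rV_m, `|v| <= b * `|v *m A|.
Proof.
move=> uA; have [C C0 H] := mulmx_bounded (invmx A).
by exists C => // v; rewrite -[in leLHS](mulmxK uA v) H.
Qed.

Lemma continuous_dist {V : normedModType R} (z : V) : continuous ((fun y => `|y - z|) : V -> R).
Proof. by move=> y; apply: cvg_norm; exact: isd_continuous (isdB (isd_id y) (isd_cst z y)). Qed.

Section Newton.
Context {m : nat}.
Variables (f : 'rV[R]_m -> 'rV[R]_m) (z0 : 'rV[R]_m) (A : 'M[R]_m) (b r : R).
Hypothesis r0 : 0 < r.
Hypothesis b0 : 0 < b.
Hypothesis uA : A \in unitmx.
Hypothesis bA : forall v : 'rV_m, `|v| <= b * `|v *m A|.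
Hypothesis Hf : forall y, `|y - z0| < r -> differentiable f y /\
  forall v : 'rV_m, `|v *m jac f y - v *m A| <= (2 * b)^-1 * `|v|.

Lemma newton_approx (x y : 'rV_m) : `|x - z0| < r -> `|y - z0| < r ->
  `|f y - f x - (y - x) *m A| <= (2 * b)^-1 * `|y - x|.
Proof.
move=> xz yz; pose g w := f w - w *m A.
have -> : f y - f x - (y - x) *m A = g y - g x.
  by rewrite /g mulmxBl; apply/rowP => j; rewrite !mxE; ring.
apply: mean_value_rV; first by rewrite mulr_ge0// invr_ge0 mulr_ge0// ltW.
move=> t t01; have tz := segment_ball t01 xz yz.
have [d B] := Hf tz; have [dg e] := isD_sub (isD_jac d) (isD_mulmxr A (x + t *: (y - x))).
by split; [exact: dg|rewrite e mulmxBr].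
Qed.

Lemma newton_inj (x y : 'rV_m) : `|x - z0| < r -> `|y - z0| < r ->
  `|y - x| <= 2 * b * `|f y - f x|.
Proof.
move=> xz yz; have H := newton_approx xz yz; have := bA (y - x).
have : `|(y - x) *m A| <= `|f y - f x| + (2 * b)^-1 * `|y - x|.
  have := ler_normB (f y - f x) (f y - f x - (y - x) *m A).
  by rewrite opprB addrC subrK => /le_trans; apply; rewrite lerD2l.
move=> /(ler_wpM2l (ltW b0)); rewrite mulrDr.
have -> : b * ((2 * b)^-1 * `|y - x|) = `|y - x| / 2 by field; rewrite gt_eqF.
by lra.
Qed.

(** A minimiser of [|f y - w|] on the closed ball of radius [r / 2] exists by compactness. By
    [newton_inj] and the choice of [r / (8 * b)] it lies in the interior. If the minimum were
    positive, a damped Newton step would decrease it. *)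
Lemma newton_surj (w : 'rV_m) : `|w - f z0| < r / (8 * b) ->
  exists2 y, `|y - z0| < r & f y = w.
Proof.
move=> wf; have b8 : 0 < 8 * b by rewrite mulr_gt0.
have wf8 : 8 * b * `|w - f z0| < r by rewrite mulrC -ltr_pdivlMr.
pose K := [set y : 'rV[R]_m | `|y - z0| <= r / 2].
have half : r / 2 < r by rewrite ltr_pdivrMr// ltr_pMr// ltr1n.
have Kr y : K y -> `|y - z0| < r by move=> /le_lt_trans; apply.
have Kz : K z0 by rewrite /K /= subrr normr0 divr_ge0// ltW.
have cK : compact K.
  apply: bounded_closed_compact.
    exists (r / 2 + `|z0|); split; [exact: num_real|move=> x Cx v /= vC].
    by rewrite (le_trans _ (ltW Cx))// -[v](subrK z0) (le_trans (ler_normD _ _))// lerD2r.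
  rewrite [X in closed X](_ : _ = (fun v => `|v - z0|) @^-1` [set x | x <= r / 2])//.
  by apply: closed_comp; [move=> v _; exact: continuous_dist|exact: closed_le].
have fc : {within K, continuous (fun y => `|f y - w|)}.
  apply: continuous_in_subspaceT => y; rewrite inE => /Kr /Hf[d _].
  have c := isd_continuous (isdB (isD_jac d) (isd_cst w y)).
  by move: c; move/cvg_norm.
have [y Ky ymin] : exists2 y, K y & forall x, K x -> `|f y - w| <= `|f x - w|.
  have [|y yK H] := @EVT_min_rV R m (fun y => `|f y - w|) K _ cK fc; first by exists z0.
  by exists y; [rewrite inE in yK|move=> x Kx; apply: H; rewrite inE].
exists y; first exact: Kr.
apply/eqP; rewrite -subr_eq0 -normr_le0 leNgt; apply/negP => p0.
set p := `|f y - w| in p0.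
have pz : p <= `|w - f z0| by rewrite distrC; exact: ymin.
have yz : `|y - z0| < r / 2.
  have zz : `|z0 - z0| < r by rewrite subrr normr0.
  have := newton_inj zz (Kr _ Ky).
  have := ler_distD w (f y) (f z0); rewrite -/p => h1 h2.
  have : 2 * b * `|f y - f z0| <= 2 * b * (p + `|w - f z0|) by rewrite ler_wpM2l// mulr_ge0// ltW.
  have : 2 * b * p <= 2 * b * `|w - f z0| by rewrite ler_wpM2l// mulr_ge0// ltW.
  by move: wf8 h2; lra.
pose d := (w - f y) *m invmx A.
have dA : d *m A = w - f y by rewrite mulmxKV.
have dp : `|d| <= b * p by rewrite (le_trans (bA d))// dA distrC.
(* The step length [t] is positive, at most 1, and small enough for [y + t *: d] to stay in the
   closed ball. *)
pose t := Num.min 1 ((r / 2 - `|y - z0|) / (`|d| + 1)).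
have d1 : 0 < `|d| + 1 by rewrite ltr_wpDl.
have t0 : 0 < t by rewrite lt_min ltr01 divr_gt0// subr_gt0.
have t1 : t <= 1 by rewrite ge_min lexx.
have td : t * (`|d| + 1) <= r / 2 - `|y - z0| by rewrite -ler_pdivlMr// ge_min lexx orbT.
pose y' := y + t *: d.
have yd : y' - y = t *: d by rewrite /y' addrC addKr.
have Ky' : K y'.
  rewrite /K /= /y' addrAC (le_trans (ler_normD _ _))// normrZ (gtr0_norm t0).
  by move: td; rewrite mulrDr mulr1; move: t0; lra.
have := newton_approx (Kr _ Ky) (Kr _ Ky'); rewrite yd -scalemxAl dA normrZ (gtr0_norm t0) => H.
have : `|f y' - w| <= (1 - t) * p + (2 * b)^-1 * (t * (b * p)).
  have -> : f y' - w = (1 - t) *: (f y - w) + (f y' - f y - t *: (w - f y)).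
    by apply/rowP => j; rewrite !mxE; ring.
  rewrite (le_trans (ler_normD _ _))// lerD//.
    by rewrite normrZ ger0_norm// subr_ge0.
  apply: le_trans H _; rewrite ler_wpM2l// ?invr_ge0 ?mulr_ge0// ?(ltW b0)//.
  by rewrite ler_wpM2l// ltW.
have -> : (2 * b)^-1 * (t * (b * p)) = t * p / 2 by field; rewrite gt_eqF.
have := ymin _ Ky'; rewrite -/p.
have : 0 < t * p by rewrite mulr_gt0.
by lra.
Qed.

End Newton.

Lemma isD_inverse {m} (f g : 'rV[R]_m -> 'rV[R]_m) (y : 'rV_m) A : isD f (g y) A -> A \in unitmx ->
  {for y, continuous g} -> (\forall w \near y, f (g w) = w) -> isD g y (invmx A).
Proof.
move=> fA uA gc fg; have [b b0 bA] := unitmx_bound uA.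
apply: isD_intro => e e0.
pose e1 := Num.min (2 * b)^-1 (e / (2 * b * b)).
have b2 : 0 < 2 * b by rewrite mulr_gt0.
have e10 : 0 < e1 by rewrite lt_min invr_gt0 b2 divr_gt0// mulr_gt0.
have /near_ballP[d d0 Hd] := isD_approx fA e10.
have : \forall w \near y, `|g w - g y| < d.
  move/cvgrPdist_lt : gc => /(_ d d0).
  by apply: filterS => w; rewrite distrC.
move=> gd; have : \forall w \near y, `|g w - g y| < d /\ f (g w) = w by exact: filterI gd fg.
move=> /near_ballP[d' d'0 Hd'].
have fgy : f (g y) = y by have [|_] := Hd' y; rewrite ?subrr ?normr0.
apply/near_ballP; exists d' => // h; rewrite subr0 => hd.
have [|g1 g2] := Hd' (y + h); first by rewrite addrC addKr.
set k := g (y + h) - g y in g1 *.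
have := Hd k; rewrite subr0 => /(_ g1); rewrite {1}/k [g y + _]addrC subrK g2 fgy.
have -> : y + h - y = h by rewrite addrC addKr.
move=> H; have H1 : `|k| <= 2 * b * `|h|.
  have : `|k *m A| <= `|h| + (2 * b)^-1 * `|k|.
    have := ler_normB h (h - k *m A); rewrite opprB addrC subrK => /le_trans; apply.
    by rewrite lerD2l (le_trans H)// ler_wpM2r// ge_min lexx.
  move=> /(ler_wpM2l (ltW b0)) /(le_trans (bA k)); rewrite mulrDr.
  have -> : b * ((2 * b)^-1 * `|k|) = `|k| / 2 by field; rewrite gt_eqF.
  by lra.
have := bA (k - h *m invmx A); rewrite mulmxBl mulmxKV// => /le_trans; apply.
rewrite distrC; apply: le_trans (ler_wpM2l (ltW b0) H) _.
have : e1 * `|k| <= e / (2 * b * b) * (2 * b * `|h|).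
  by rewrite ler_pM// ?(ltW e10)// ge_min lexx orbT.
move=> /(ler_wpM2l (ltW b0)) /le_trans; apply.
by rewrite le_eqVlt; apply/orP; left; apply/eqP; field; rewrite gt_eqF.
Qed.

(** The radius is shrunk until the Lipschitz estimate for the derivative keeps it within
    [(2 * b)^-1] of its value at [z0], as the Newton estimates require; [d] caps the radius so that
    the inverse takes values in a prescribed neighbourhood. The inverse of an invertible derivative
    commuting with J commutes with J, and its norm is at most [2 * b]. *)
Lemma hol_inverse {m} (f : 'rV[R]_(m + m) -> 'rV[R]_(m + m)) z0 d :
  hol f z0 -> jac f z0 \in unitmx -> 0 < d ->
  exists r e b (g : 'rV[R]_(m + m) -> 'rV[R]_(m + m)),
  [/\ 0 < r <= d, 0 < e, 0 < b,
   (forall x y, `|x - z0| < r -> `|y - z0| < r -> `|y - x| <= b * `|f y - f x|) &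
   forall w, `|w - f z0| < e -> [/\ `|g w - z0| < r, f (g w) = w, hol f (g w), hol g w &
      jac f (g w) \in unitmx /\ jac g w = invmx (jac f (g w))]].
Proof.
move=> [rho [L [rho0 Hf]]] uA d0; have [b b0 bA] := unitmx_bound uA.
set A := jac f z0 in uA bA.
have L0 v := hol_ball_ge0 rho0 Hf v.
have q0 : 0 < 32 * `|L| / rho + 1 by rewrite ltr_wpDl// divr_ge0 ?mulr_ge0// ltW.
pose r := Num.min d (Num.min (rho / 2) ((2 * b)^-1 / (32 * `|L| / rho + 1))).
have b2 : 0 < 2 * b by rewrite mulr_gt0.
have r0 : 0 < r by rewrite !lt_min d0 !divr_gt0// invr_gt0.
have rd : r <= d by rewrite ge_min lexx.
have rr : r <= rho / 2 by rewrite ge_min [X in _ || X]ge_min lexx orbT.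
have half : rho / 2 < rho by rewrite ltr_pdivrMr// ltr_pMr// ltr1n.
have rb : r * (32 * `|L| / rho + 1) <= (2 * b)^-1.
  by rewrite -ler_pdivlMr// ge_min [X in _ || X]ge_min lexx !orbT.
have Hr y : `|y - z0| < r -> differentiable f y /\
  forall v : 'rV_(m + m), `|v *m jac f y - v *m A| <= (2 * b)^-1 * `|v|.
  move=> yr; have y2 := lt_le_trans yr rr.
  have [[df _] _] := Hf y (lt_trans y2 half); split => // v.
  have zz : `|z0 - z0| < rho / 2 by rewrite subrr normr0 divr_gt0.
  apply: le_trans (hol_ball_jac_lip rho0 Hf v zz y2) _; apply: ler_wpM2r => //.
  apply: le_trans rb; apply: le_trans (_ : _ <= 32 * `|L| / rho * `|y - z0|) _.
    by rewrite ler_wpM2r// ler_wpM2r ?invr_ge0 ?(ltW rho0)// ler_wpM2l// ler_norm.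
  rewrite mulrC; apply: ler_pM => //.
  - by rewrite divr_ge0 ?mulr_ge0// ltW.
  - exact: ltW.
  - by rewrite lerDl.
have e0 : 0 < r / (8 * b) by rewrite divr_gt0// mulr_gt0.
have [g Hg] : exists g : 'rV[R]_(m + m) -> 'rV[R]_(m + m), forall w, `|w - f z0| < r / (8 * b) ->
    `|g w - z0| < r /\ f (g w) = w.
  have Hex w : exists y : 'rV[R]_(m + m), `|w - f z0| < r / (8 * b) -> `|y - z0| < r /\ f y = w.
    case: (pselect (`|w - f z0| < r / (8 * b))) => [wf|nwf]; last by exists 0.
    by have [y y1 y2] := newton_surj r0 b0 uA bA Hr wf; exists y.
  by have [g Hg] := choice Hex; exists g.
have inj := newton_inj b0 bA Hr.
have bAy y : `|y - z0| < r -> forall v : 'rV_(m + m), `|v| <= 2 * b * `|v *m jac f y|.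
  move=> yr v; have [_ /(_ v) H] := Hr y yr.
  have := bA v; have : `|v *m A| <= `|v *m jac f y| + (2 * b)^-1 * `|v|.
    have := ler_normB (v *m jac f y) (v *m jac f y - v *m A); rewrite opprB addrC subrK.
    by move=> /le_trans; apply; rewrite lerD2l.
  move=> /(ler_wpM2l (ltW b0)); rewrite mulrDr.
  have -> : b * ((2 * b)^-1 * `|v|) = `|v| / 2 by field; rewrite gt_eqF.
  by move=> h1 h2; exact: half_absorb h2 h1.
have uAy y : `|y - z0| < r -> jac f y \in unitmx.
  move=> yr; apply: inj_unitmx => v v0; have := bAy y yr v.
  by rewrite v0 normr0 mulr0 normr_le0 => /eqP.
have gD w : `|w - f z0| < r / (8 * b) -> isD g w (invmx (jac f (g w))).
  move=> wf; have [g1 g2] := Hg w wf; have [df _] := Hr _ g1.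
  have nw : \forall x \near w, `|x - f z0| < r / (8 * b).
    apply/near_ballP; exists (r / (8 * b) - `|w - f z0|); first by rewrite subr_gt0.
    by move=> x xw; have := ler_distD w x (f z0); move: xw; lra.
  apply: isD_inverse (isD_jac df) (uAy _ g1) _ _.
    apply/continuous_rVP => ee ee0; have /near_ballP[s s0 Hs] := nw.
    exists (Num.min s (ee / (2 * b))); first by rewrite lt_min s0 divr_gt0.
    move=> x; rewrite lt_min => /andP[/Hs /Hg[x1 x2] xe].
    apply: le_lt_trans (inj _ _ g1 x1) _; rewrite g2 x2.
    by rewrite mulrC -ltr_pdivlMr.
  by apply: filterS nw => x /Hg[].
exists r, (r / (8 * b)), (2 * b), g; split;
  [by rewrite r0 rd|exact: e0|exact: b2|by move=> x y xz yz; exact: inj|].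
move=> w wf; have [g1 g2] := Hg w wf.
have h1 : hol f (g w).
  exists (rho / 2), L; split; first exact: divr_gt0.
  apply: (hol_ball_sub Hf); move: (g1) (rr); clear; set x := `|_|; lra.
have h2 : hol g w.
  exists (r / (8 * b) - `|w - f z0|), (2 * b); split; first by rewrite subr_gt0.
  move=> x xw; have xf : `|x - f z0| < r / (8 * b).
    by apply: le_lt_trans (ler_distD w x (f z0)) _; rewrite -ltrBrDr.
  have [x1 x2] := Hg x xf; have ux := uAy _ x1.
  have [c _] := Hf (g x) (lt_trans (lt_le_trans x1 rr) half).
  split.
    apply: (cdiffP (gD x xf)); have cJ := cdiff_J c.
    apply: (can_inj (mulKmx ux)); rewrite !mulmxA -cJ mulmxV; last exact: ux.
    by rewrite mul1mx -!mulmxA mulmxV; [rewrite mulmx1|exact: ux].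
  move=> v; rewrite (jac_isD (gD x xf)); have := bAy _ x1 (v *m invmx (jac f (g x))).
  by rewrite mulmxKV; last exact: ux.
split; [exact: g1|exact: g2|exact: h1|exact: h2|].
by split; [exact: uAy|exact: jac_isD (gD w wf)].
Qed.

End Inverse.

(** * Smooth functions and their calculus *)

Section Smooth.
Context {R : realType}.

Lemma delta_row_sum {m} (v : 'rV[R]_m) : v = \sum_i v 0 i *: delta_mx 0 i.
Proof.
apply/rowP => j; rewrite summxE (bigD1 j)//= big1 ?addr0.
  by rewrite !mxE !eqxx mulr1.
by move=> i ij; rewrite !mxE eqxx/= eq_sym (negbTE ij) mulr0.
Qed.

Lemma derivable_line {V W : normedModType R} (f : V -> W) (x v : V) (t : R) :
  derivable f (x + t *: v) v ->
  is_derive t 1 (fun s : R => f (x + s *: v)) ('D_v f (x + t *: v)).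
Proof.
have E : (fun h : R => h^-1 *: (((fun s : R => f (x + s *: v)) \o shift t) (h *: (1 : R)) - f (x + t *: v))) =
   (fun h : R => h^-1 *: ((f \o shift (x + t *: v)) (h *: v) - f (x + t *: v))).
  apply/funext => h /=; congr (_ *: (f _ - _)).
  by rewrite [h *: 1]mulr1 scalerDl addrCA.
by move=> df; apply: DeriveDef; rewrite /derivable /derive E.
Qed.

(** The reciprocal of the sum of all reciprocals is below every radius; the summand 1 keeps it
    meaningful for an empty index type. *)
Lemma finite_radius (I : finType) (P : I -> R -> Prop) :
  (forall i, exists2 r, 0 < r & P i r) -> (forall i r r', r' <= r -> P i r -> P i r') ->
  exists2 r, 0 < r & forall i, P i r.
Proof.
move=> H mono; have /choice[r Hr] : forall i, exists r, 0 < r /\ P i r.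
  by move=> i; have [r r0 Pr] := H i; exists r.
have rV (i : I) : 0 < (r i)^-1 by rewrite invr_gt0; have [] := Hr i.
have S0 : 0 < \sum_i (r i)^-1 + 1 by rewrite ltr_wpDl// sumr_ge0// => i _; exact: ltW.
exists (\sum_i (r i)^-1 + 1)^-1; first by rewrite invr_gt0.
move=> i; apply: mono (Hr i).2; rewrite -[leRHS]invrK lef_pV2 ?posrE//.
by rewrite (bigD1 i)//= -addrA lerDl addr_ge0// sumr_ge0// => j _; exact: ltW.
Qed.

(** [Ck_on] only provides directional derivatives. Continuity of the partial derivatives gives a
    total differential by changing one coordinate at a time and applying the mean value theorem to
    each change. *)
Lemma C1_differentiable {m} (U : set 'rV[R]_m) (f : 'rV[R]_m -> R) z :
  open U -> U z -> Ck_on 1 U f -> differentiable f z.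
Proof.
move=> oU Uz [_ Hf]; pose e_ i : 'rV[R]_m := delta_mx 0 i; pose D i := 'D_(e_ i) f.
have Df i x : U x -> derivable f x (e_ i) by have [H _] := Hf (e_ i); exact: H.
have Dc i x : U x -> {for x, continuous (D i)}.
  by have [_ [H _]] := Hf (e_ i); exact: H.
pose A : 'M[R]_(m, 1) := \matrix_(i, j) D i z.
pose F (x : 'rV[R]_m) : 'rV[R]_1 := const_mx (f x).
suff FA : isD F z A.
  have [d _] := isd_coord 0 FA.
  have -> : f = (fun x => F x 0 0) by apply/funext => x; rewrite mxE.
  exact: d.
have /near_ballP[r0 r00 HU] : \forall y \near z, U y by exact: open_nbhs_nbhs.
apply: isD_intro => e e0; pose e1 := e / (m%:R + 1).
have e10 : 0 < e1 by rewrite divr_gt0// ltr_wpDl.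
have [r1 r10 H1] : exists2 r, 0 < r & forall i y, `|y - z| < r -> `|D i y - D i z| <= e1.
  apply: finite_radius => [i|i r' r'' rr H y yz]; last by apply: H; exact: lt_le_trans rr.
  have /cvgrPdist_le/(_ e1 e10)/near_ballP[r rr H] := Dc i z Uz.
  by exists r => // y /H; rewrite distrC.
apply/near_ballP; exists (Num.min r0 r1); first by rewrite lt_min r00.
move=> h; rewrite subr0 lt_min => /andP[h0 h1].
(* [hk k] keeps the first [k] coordinates of [h], so the increments from [hk k] to [hk k.+1]
   telescope to [h]. *)
pose hk (k : nat) : 'rV[R]_m := \row_j (if (j < k)%N then h 0 j else 0).
have hkS (k : 'I_m) : hk k.+1 = hk k + h 0 k *: e_ k.
  apply/rowP => j; rewrite !mxE eqxx/= ltnS leq_eqVlt.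
  have [->|jk] := eqVneq j k; first by rewrite eqxx ltnn add0r mulr1.
  by rewrite -val_eqE in jk; rewrite (negbTE jk) /= mulr0 addr0.
have hkn (k : 'I_m) (t : R) : 0 <= t <= 1 -> `|hk k + (t * h 0 k) *: e_ k| <= `|h|.
  move=> /andP[t0 t1]; apply: norm_rV_le => // j; rewrite !mxE eqxx/=.
  have [->|jk] := eqVneq j k.
    rewrite ltnn add0r mulr1 normrM ger0_norm// (le_trans _ (coord_le_norm h 0 k))//.
    by rewrite ler_piMl.
  by rewrite mulr0 addr0; case: ifP => _; rewrite ?normr0// coord_le_norm.
have step (k : 'I_m) : `|f (z + hk k.+1) - f (z + hk k) - h 0 k * D k z| <= e1 * `|h|.
  pose g t := f (z + hk k + t *: (h 0 k *: e_ k)).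
  have zt (t : R) : 0 <= t <= 1 -> `|z + hk k + t *: (h 0 k *: e_ k) - z| <= `|h|.
    move=> t01; rewrite scalerA (_ : _ - z = hk k + (t * h 0 k) *: e_ k); first exact: hkn.
    by apply/rowP => j; rewrite !mxE; ring.
  have dv x : U x -> derivable f x (h 0 k *: e_ k) /\ 'D_(h 0 k *: e_ k) f x = h 0 k * D k x.
    move=> Ux; have [H _] := Hf (h 0 k *: e_ k); split; first exact: H.
    have [->|hk0] := eqVneq (h 0 k) 0; first by rewrite scale0r mul0r derive0.
    have d1 := derivable_line (t := 0) (x := x) (v := e_ k) (f := f); rewrite scale0r addr0 in d1.
    have := d1 (Df k x Ux); have d2 := derivable_line (t := 0) (x := x) (v := h 0 k *: e_ k) (f := f).
    rewrite scale0r addr0 in d2; move: (d2 (H x Ux)) => D2 D1.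
    have Dm : is_derive (0 : R) 1 (fun s : R => s * h 0 k) (h 0 k).
      by apply: is_derive_eq; rewrite /GRing.scale/= mulr0 add0r mulr1.
    have z0 : (0 : R) = (fun s : R => s * h 0 k) 0 by rewrite /= mul0r.
    rewrite z0 in D1; have := @is_derive1_comp _ (fun s => f (x + s *: e_ k)) (fun s : R => s * h 0 k) _ _ _ D1 Dm.
    rewrite mulrC => D3.
    have E : (fun s : R => f (x + s *: e_ k)) \o (fun s : R => s * h 0 k) = (fun s : R => f (x + s *: (h 0 k *: e_ k))).
      by apply/funext => s /=; rewrite scalerA.
    by rewrite E in D3; rewrite -(@derive_val _ _ _ _ _ _ _ D2) (@derive_val _ _ _ _ _ _ _ D3).
  have UU (t : R) : 0 <= t <= 1 -> U (z + hk k + t *: (h 0 k *: e_ k)).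
    by move=> t01; apply: HU; rewrite (le_lt_trans (zt t t01)).
  have [||t t01 E] := @MVT_segment R g (fun t => h 0 k * D k (z + hk k + t *: (h 0 k *: e_ k))) 0 1 ler01.
  - move=> t; rewrite in_itv/= => /andP[t0 t1].
    have /UU Ut : 0 <= t <= 1 by rewrite !ltW.
    have [d1 e2] := dv _ Ut; have := derivable_line d1; rewrite e2; exact.
  - apply: derivable_within_continuous => t; rewrite in_itv/= => /UU Ut.
    by have [d1 e2] := dv _ Ut; have [] := derivable_line d1.
  have g1 : g 1 = f (z + hk k.+1) by rewrite /g hkS scale1r addrA.
  have g0 : g 0 = f (z + hk k) by rewrite /g scale0r addr0.
  rewrite in_itv/= in t01; rewrite -g1 -g0 E subr0 mulr1 -mulrBr normrM mulrC ler_pM//.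
    by apply: H1; rewrite (le_lt_trans (zt t t01)).
  exact: coord_le_norm.
have tele : f (z + h) - f z = \sum_(k < m) (f (z + hk k.+1) - f (z + hk k)).
  have -> : \sum_(k < m) (f (z + hk k.+1) - f (z + hk k)) = f (z + hk m) - f (z + hk 0).
    by rewrite -(telescope_sumr (fun k => f (z + hk k)) (leq0n m)) big_mkord.
  have -> : hk 0 = 0 by apply/rowP => j; rewrite !mxE.
  have -> : hk m = h by apply/rowP => j; rewrite !mxE ltn_ord.
  by rewrite addr0.
apply: norm_rV_le; first by rewrite mulr_ge0// ltW.
move=> j; have -> : (F (z + h) - F z - h *m A) 0 j = \sum_(k < m) (f (z + hk k.+1) - f (z + hk k) - h 0 k * D k z).
  by rewrite [RHS]sumrB -tele !mxE; congr (_ - _); apply: eq_bigr => k _; rewrite mxE.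
rewrite (le_trans (ler_norm_sum _ _ _))//.
apply: le_trans (_ : _ <= \sum_(k < m) e1 * `|h|) _; first by apply: ler_sum => k _; exact: step.
rewrite sumr_const card_ord -mulr_natl mulrA ler_wpM2r// /e1 mulrCA ler_piMr// ?(ltW e0)//.
by rewrite ler_pdivrMr ?ltr_wpDl// mul1r lerDl.
Qed.

Section Calculus.
Context {m : nat}.
Implicit Types (U : set 'rV[R]_m) (f g : 'rV[R]_m -> R).

Lemma open_near_eq U f g z : open U -> (forall x, U x -> f x = g x) -> U z -> {near z, f =1 g}.
Proof.
by move=> oU fg Uz; have : \forall y \near z, U y by [exact: open_nbhs_nbhs]; apply: filterS => y /fg.
Qed.

Lemma near_eq_continuous f g z : {near z, f =1 g} -> {for z, continuous f} -> {for z, continuous g}.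
Proof.
move=> /near_ballP[r r0 fg] fc P; have <- : f z = g z by apply: fg; rewrite subrr normr0.
move=> /fc /near_ballP[r' r'0 H]; apply/near_ballP; exists (Num.min r r').
  by rewrite lt_min r0.
by move=> y; rewrite lt_min => /andP[/fg e /H]; rewrite /preimage /= e.
Qed.

Lemma Ck_on_ext k U f g : open U -> (forall z, U z -> f z = g z) -> Ck_on k U f -> Ck_on k U g.
Proof.
move=> oU; elim: k f g => [|k IH] f g fg.
  move=> [fc _]; split => // z Uz; exact: near_eq_continuous (open_near_eq oU fg Uz) (fc z Uz).
move=> [fc fd]; split.
  by move=> z Uz; exact: near_eq_continuous (open_near_eq oU fg Uz) (fc z Uz).
move=> v; have [d1 d2] := fd v; split.
  by move=> z Uz; apply: near_eq_derivable (open_near_eq oU fg Uz) (d1 z Uz).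
apply: IH _ d2 => z Uz; apply: near_eq_derive; exact: open_near_eq oU fg Uz.
Qed.

Lemma Ck_onS k U f : Ck_on k.+1 U f -> Ck_on k U f.
Proof.
elim: k f => [|k IH] f [fc fd]; first by split.
by split => // v; have [d1 d2] := fd v; split => //; exact: IH.
Qed.

Lemma Ck_on_cst k U c : Ck_on k U (fun=> c).
Proof.
elim: k c => [|k IH] c; first by split => // z _; exact: cst_continuous.
split=> [z _|v]; first exact: cst_continuous.
split=> [z _|]; first exact: derivable_cst.
have -> : 'D_v (fun=> c) = (fun=> 0) :> ('rV[R]_m -> R) by apply/funext => z; exact: derive_cst.
exact: IH.
Qed.

Lemma Ck_onD k U f g : open U -> Ck_on k U f -> Ck_on k U g -> Ck_on k U (fun z => f z + g z).
Proof.
move=> oU; elim: k f g => [|k IH] f g.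
  by move=> [fc _] [gc _]; split => // z Uz; apply: continuousD; [exact: fc|exact: gc].
move=> [fc fd] [gc gd]; split; first by move=> z Uz; apply: continuousD; [exact: fc|exact: gc].
move=> v; have [d1 d2] := fd v; have [d3 d4] := gd v; split.
  by move=> z Uz; apply: derivableD; [exact: d1|exact: d3].
apply: Ck_on_ext oU _ (IH _ _ d2 d4) => z Uz.
by rewrite -[RHS]/('D_v (f + g) z) deriveD//; [exact: d1|exact: d3].
Qed.

Lemma Ck_onM k U f g : open U -> Ck_on k U f -> Ck_on k U g -> Ck_on k U (fun z => f z * g z).
Proof.
move=> oU; elim: k f g => [|k IH] f g.
  by move=> [fc _] [gc _]; split => // z Uz; apply: continuousM; [exact: fc|exact: gc].
move=> Hf Hg; have fk := Ck_onS Hf; have gk := Ck_onS Hg.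
move: Hf Hg => [fc fd] [gc gd]; split; first by move=> z Uz; apply: continuousM; [exact: fc|exact: gc].
move=> v; have [d1 d2] := fd v; have [d3 d4] := gd v; split.
  by move=> z Uz; apply: derivableM; [exact: d1|exact: d3].
apply: Ck_on_ext oU _ (Ck_onD oU (IH _ _ fk d4) (IH _ _ gk d2)) => z Uz.
by rewrite -[RHS]/('D_v (f * g) z) deriveM//; [exact: d1|exact: d3].
Qed.

Lemma Ck_on_sum k U (I : Type) (r : seq I) (f : I -> 'rV[R]_m -> R) : open U ->
  (forall i, Ck_on k U (f i)) -> Ck_on k U (fun z => \sum_(i <- r) f i z).
Proof.
move=> oU H; elim: r => [|i r IH].
  by apply: Ck_on_ext oU _ (Ck_on_cst k U 0) => z _; rewrite big_nil.
by apply: Ck_on_ext oU _ (Ck_onD oU (H i) IH) => z _; rewrite big_cons.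
Qed.

Lemma smooth_differentiable U f z : open U -> smooth_on U f -> U z -> differentiable f z.
Proof. by move=> oU sf Uz; exact: C1_differentiable oU Uz (sf 1%N). Qed.

Lemma smooth_derive U f v : smooth_on U f -> smooth_on U ('D_v f).
Proof. by move=> sf k; have [_ /(_ v)[]] := sf k.+1. Qed.

End Calculus.

Lemma Ck_on_hol {m n} k (U : set 'rV[R]_(m + m)) (F : 'rV[R]_(m + m) -> 'rV[R]_(n + n)) i :
  open U -> (forall z, U z -> hol F z) -> Ck_on k U (fun z => F z 0 i).
Proof.
move=> oU; elim: k F => [|k IH] F HF.
  by split => // z /HF /hol_isD /(isd_coord i) /isd_continuous.
split; first by move=> z /HF /hol_isD /(isd_coord i) /isd_continuous.
move=> v; split; first by move=> z /HF /hol_isD /(isd_coord i) /(isd_derive v)[].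
apply: Ck_on_ext oU _ (IH (fun z => v *m jac F z) _); last by move=> z /HF; exact: hol_jac.
by move=> z /HF /hol_isD /(isd_coord i) /(isd_derive v)[_ ->].
Qed.

(** By the chain rule a derivative of the composite is a sum of products of coordinates of
    [v *m jac F] with partial derivatives of [f] along [F]; the former are holomorphic, the latter
    are covered by induction. *)
Lemma Ck_on_comp_hol {m n} k (U : set 'rV[R]_(m + m)) (V : set 'rV[R]_(n + n))
    (F : 'rV[R]_(m + m) -> 'rV[R]_(n + n)) f :
  open U -> open V -> (forall z, U z -> hol F z /\ V (F z)) -> smooth_on V f ->
  Ck_on k U (fun z => f (F z)).
Proof.
move=> oU oV HF; elim: k f => [|k IH] f sf.
  split => // z /HF[hF VF].
  have [d _] := isd_comp (hol_isD hF) (IsDiff (smooth_differentiable oV sf VF) (fun=> erefl)).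
  exact: differentiable_continuous.
have dz z : U z -> isd (fun z => f (F z)) z (fun v => 'd f (F z) (v *m jac F z)).
  move=> /HF[hF VF].
  exact: isd_comp (hol_isD hF) (IsDiff (smooth_differentiable oV sf VF) (fun=> erefl)).
split; first by move=> z /dz /isd_continuous.
move=> v; split; first by move=> z /dz /(isd_derive v)[].
apply: Ck_on_ext oU _ (Ck_on_sum (index_enum 'I_(n + n)) oU
  (fun i => Ck_onM oU (Ck_on_hol k i oU (F := fun z => v *m jac F z) _) (IH _ (smooth_derive (delta_mx 0 i) sf)))).
  move=> z Uz; have [_ ->] := isd_derive v (dz z Uz).
  have [hF VF] := HF z Uz; rewrite [in RHS](delta_row_sum (v *m jac F z)) linear_sum.
  apply: eq_bigr => i _; rewrite linearZ/=; congr (_ * _).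
  by rewrite deriveE//; exact: smooth_differentiable oV sf VF.
by move=> i z /HF[hF _]; exact: hol_jac.
Qed.

End Smooth.

(** * The Gauss equation *)

Section Bilin.
Context {R : realType}.

Lemma bilinE {m} (A : 'M[R]_m) u v : bilin A u v = \sum_i \sum_j u 0 i * A i j * v 0 j.
Proof.
rewrite /bilin mxE exchange_big/=; apply: eq_bigr => j _.
by rewrite !mxE mulr_suml.
Qed.

Lemma bilinDl {m} (A : 'M[R]_m) u u' v : bilin A (u + u') v = bilin A u v + bilin A u' v.
Proof. by rewrite /bilin !mulmxDl mxE. Qed.

Lemma bilinDr {m} (A : 'M[R]_m) u v v' : bilin A u (v + v') = bilin A u v + bilin A u v'.
Proof. by rewrite /bilin linearD/= mulmxDr mxE. Qed.

Lemma bilinZl {m} (A : 'M[R]_m) c u v : bilin A (c *: u) v = c * bilin A u v.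
Proof. by rewrite /bilin -!scalemxAl mxE. Qed.

Lemma bilinZr {m} (A : 'M[R]_m) c u v : bilin A u (c *: v) = c * bilin A u v.
Proof. by rewrite /bilin linearZ/= -scalemxAr mxE. Qed.

Lemma bilinNl {m} (A : 'M[R]_m) u v : bilin A (- u) v = - bilin A u v.
Proof. by rewrite -scaleN1r bilinZl mulN1r. Qed.

Lemma bilinNr {m} (A : 'M[R]_m) u v : bilin A u (- v) = - bilin A u v.
Proof. by rewrite -scaleN1r bilinZr mulN1r. Qed.

Lemma bilinBl {m} (A : 'M[R]_m) u u' v : bilin A (u - u') v = bilin A u v - bilin A u' v.
Proof. by rewrite bilinDl bilinNl. Qed.

Lemma bilinBr {m} (A : 'M[R]_m) u v v' : bilin A u (v - v') = bilin A u v - bilin A u v'.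
Proof. by rewrite bilinDr bilinNr. Qed.

Lemma bilin0l {m} (A : 'M[R]_m) v : bilin A 0 v = 0.
Proof. by rewrite /bilin !mul0mx mxE. Qed.

Lemma bilin0r {m} (A : 'M[R]_m) v : bilin A v 0 = 0.
Proof. by rewrite /bilin trmx0 mulmx0 mxE. Qed.

Lemma bilin_mxD {m} (A B : 'M[R]_m) u v : bilin (A + B) u v = bilin A u v + bilin B u v.
Proof. by rewrite /bilin mulmxDr mulmxDl mxE. Qed.

Lemma bilin_mxZ {m} c (A : 'M[R]_m) u v : bilin (c *: A) u v = c * bilin A u v.
Proof. by rewrite /bilin -scalemxAr -scalemxAl mxE. Qed.

Lemma bilin_delta {m} (A : 'M[R]_m) i j : bilin A (delta_mx 0 i) (delta_mx 0 j) = A i j.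
Proof. by rewrite /bilin -rowE trmx_delta -colE !mxE. Qed.

Lemma bilin_tr {m} (A : 'M[R]_m) u v : bilin A^T u v = bilin A v u.
Proof.
rewrite !bilinE exchange_big/=; apply: eq_bigr => i _; apply: eq_bigr => j _.
by rewrite mxE; ring.
Qed.

Lemma bilin_sym {m} (A : 'M[R]_m) u v : A^T = A -> bilin A u v = bilin A v u.
Proof. by move=> s; rewrite -{1}s bilin_tr. Qed.

Lemma bilin_mulmx {m k} (A : 'M[R]_k) (D : 'M[R]_(m, k)) u v :
  bilin A (u *m D) (v *m D) = bilin (D *m A *m D^T) u v.
Proof. by rewrite /bilin trmx_mul !mulmxA. Qed.

Lemma bilin_ext {m} (A B : 'M[R]_m) : (forall u v, bilin A u v = bilin B u v) -> A = B.
Proof. by move=> H; apply/matrixP => i j; rewrite -!bilin_delta. Qed.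

End Bilin.

Section MatrixField.
Context {R : realType}.

Lemma differentiable_bigsum {V : normedModType R} (I : Type) (r : seq I) (f : I -> V -> R) z :
  (forall i, differentiable (f i) z) -> differentiable (fun x => \sum_(i <- r) f i x) z.
Proof.
move=> H; elim: r => [|i r IH].
  have -> : (fun x => \sum_(i <- [::]) f i x) = cst 0 by apply/funext => x; rewrite big_nil.
  exact: differentiable_cst.
have -> : (fun x => \sum_(j <- i :: r) f j x) = f i + (fun x => \sum_(j <- r) f j x).
  by apply/funext => x; rewrite big_cons.
exact: differentiableD.
Qed.

Lemma differentiable_bigprod {V : normedModType R} (I : Type) (r : seq I) (f : I -> V -> R) z :
  (forall i, differentiable (f i) z) -> differentiable (fun x => \prod_(i <- r) f i x) z.
Proof.
move=> H; elim: r => [|i r IH].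
  have -> : (fun x => \prod_(i <- [::]) f i x) = cst 1 by apply/funext => x; rewrite big_nil.
  exact: differentiable_cst.
have -> : (fun x => \prod_(j <- i :: r) f j x) = f i * (fun x => \prod_(j <- r) f j x).
  by apply/funext => x; rewrite big_cons.
exact: differentiableM.
Qed.

Lemma differentiable_Ml {V : normedModType R} c (f : V -> R) z :
  differentiable f z -> differentiable (fun x => c * f x) z.
Proof. by move=> df; exact: (differentiableM (differentiable_cst c z) df). Qed.

Lemma differentiable_det {V : normedModType R} {m} (A : V -> 'M[R]_m) z :
  (forall i j, differentiable (fun x => A x i j) z) -> differentiable (fun x => \det (A x)) z.
Proof.
move=> H; rewrite /determinant; apply: differentiable_bigsum => s.
by apply: differentiable_Ml; exact: differentiable_bigprod.
Qed.

(** Cramer's formula holds on the neighbourhood where [A] is invertible, and there [invmx] is the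
    true inverse. *)
Lemma differentiable_invmx {V : normedModType R} {m} (A : V -> 'M[R]_m) z :
  (forall i j, differentiable (fun x => A x i j) z) -> (\forall x \near z, A x \in unitmx) ->
  forall i j, differentiable (fun x => invmx (A x) i j) z.
Proof.
move=> H uA i j; pose f x := (\det (A x))^-1 * cofactor (A x) j i.
have fE : {near z, f =1 (fun x => invmx (A x) i j)}.
  by apply: filterS uA => x ux; rewrite /f /invmx ux !mxE.
have df : differentiable f z.
  have -> : f = (fun x => (\det (A x))^-1) * (fun x => cofactor (A x) j i) by [].
  apply: differentiableM.
    apply: differentiableV; first exact: differentiable_det.
    by have := nbhs_singleton uA; rewrite unitmxE unitfE.
  rewrite /cofactor; apply: differentiable_Ml; apply: differentiable_det => k l.
  have -> : (fun x => row' j (col' i (A x)) k l) = (fun x => A x (lift j k) (lift i l)).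
    by apply/funext => x; rewrite !mxE.
  exact: H.
by have [] := near_eq_diff fE df.
Qed.

End MatrixField.

(** * The curvature tensor with all indices lowered *)

Section LowerRiemann.
Context {R : realType} {m : nat}.
Variables (G : 'rV[R]_m -> 'M[R]_m) (U : set 'rV[R]_m).
Hypothesis oU : open U.
Hypothesis Gsym : forall z, U z -> (G z)^T = G z.
Hypothesis Gunit : forall z, U z -> G z \in unitmx.
Hypothesis Gsmooth : forall i j, smooth_on U (fun z => G z i j).
Implicit Types (a b c d e f : 'I_m).

(** The Christoffel symbols of the first kind, with the lowered index last. *)
Definition chris_low a b e z : R := 2^-1 *
  (partial a (fun y => G y b e) z + partial b (fun y => G y a e) z - partial e (fun y => G y a b) z).

Lemma G_diff a b z : U z -> differentiable (fun z => G z a b) z.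
Proof. exact: smooth_differentiable oU (Gsmooth a b). Qed.

Lemma partialG_diff c a b z : U z -> differentiable (partial c (fun z => G z a b)) z.
Proof. exact: smooth_differentiable oU (smooth_derive _ (Gsmooth a b)). Qed.

Lemma near_U z : U z -> \forall y \near z, U y.
Proof. by move=> Uz; exact: open_nbhs_nbhs. Qed.

Lemma GinvD a b z : U z -> differentiable (fun z => invmx (G z) a b) z.
Proof.
move=> Uz; apply: differentiable_invmx; first by move=> i j; exact: G_diff.
by apply: filterS (near_U Uz) => y; exact: Gunit.
Qed.

Lemma chris_low_diff a b e z : U z -> differentiable (chris_low a b e) z.
Proof.
move=> Uz; have -> : chris_low a b e = cst 2^-1 * (partial a (fun y => G y b e) +
  partial b (fun y => G y a e) - partial e (fun y => G y a b)) by [].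
apply: differentiableM; first exact: differentiable_cst.
by apply: differentiableB; [apply: differentiableD|]; exact: partialG_diff.
Qed.

Lemma sum_mulV {k} (A : 'M[R]_k) (x : 'I_k -> R) i : A \in unitmx ->
  \sum_d A i d * (\sum_e invmx A d e * x e) = x i.
Proof.
move=> uA; have E (B : 'M[R]_k) (y : 'I_k -> R) j : \sum_d B j d * y d = (B *m (\col_d y d)) j 0.
  by rewrite mxE; apply: eq_bigr => d _; rewrite mxE.
under eq_bigr do rewrite (E (invmx A)); rewrite E.
have -> : \col_d (invmx A *m \col_e x e) d 0 = invmx A *m \col_e x e.
  by apply/colP => d; rewrite mxE.
by rewrite mulKVmx// mxE.
Qed.

Lemma sum_Vmul {k} (A : 'M[R]_k) (x : 'I_k -> R) i : A \in unitmx ->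
  \sum_d invmx A i d * (\sum_e A d e * x e) = x i.
Proof.
move=> uA; have := @sum_mulV _ (invmx A) x i; rewrite unitmx_inv invmxK; exact.
Qed.

Lemma sum4 {k} (x y p q : 'I_k -> R) : \sum_d (x d - y d + (p d - q d)) =
  \sum_d x d - \sum_d y d + (\sum_d p d - \sum_d q d).
Proof. by rewrite big_split/= !sumrB. Qed.

Lemma christoffelE d a b z : christoffel G d a b z = \sum_e invmx (G z) d e * chris_low a b e z.
Proof.
by rewrite /christoffel mulr_sumr; apply: eq_bigr => e _; rewrite /chris_low mulrCA.
Qed.

Lemma christoffel_diff d a b z : U z -> differentiable (christoffel G d a b) z.
Proof.
move=> Uz; have -> : christoffel G d a b = (fun z => \sum_e invmx (G z) d e * chris_low a b e z).
  by apply/funext => y; exact: christoffelE.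
apply: differentiable_bigsum => e.
exact: (differentiableM (GinvD d e Uz) (chris_low_diff a b e Uz)).
Qed.

Lemma lower_christoffel f b c z : U z ->
  \sum_d G z f d * christoffel G d b c z = chris_low b c f z.
Proof.
move=> Uz; under eq_bigr do rewrite christoffelE.
exact: (sum_mulV _ _ (Gunit Uz)).
Qed.

(** This is the compatibility of the Levi-Civita connection with the metric. *)
Lemma partialG_split a f d z : U z ->
  partial a (fun y => G y f d) z = chris_low a f d z + chris_low a d f z.
Proof.
move=> Uz; have s i j k : partial i (fun y => G y j k) z = partial i (fun y => G y k j) z.
  by apply: near_eq_derive; apply: filterS (near_U Uz) => y Uy; rewrite -{1}(Gsym Uy) mxE.
by rewrite /chris_low (s a d f) (s f a d); field.
Qed.

Lemma derive_prodR (p q : 'rV[R]_m -> R) z v : differentiable p z -> differentiable q z ->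
  'D_v (fun y => p y * q y) z = 'D_v p z * q z + p z * 'D_v q z.
Proof.
move=> dp dq; rewrite -[LHS]/('D_v (p * q) z) deriveM; [|exact: diff_derivable|exact: diff_derivable].
by rewrite addrC /GRing.scale/= mulrC.
Qed.

Lemma derive_bigsumR (I : Type) (r : seq I) (p : I -> 'rV[R]_m -> R) z v :
  (forall i, differentiable (p i) z) ->
  'D_v (fun y => \sum_(i <- r) p i y) z = \sum_(i <- r) 'D_v (p i) z.
Proof.
move=> H; elim: r => [|i r IH].
  rewrite big_nil (_ : (fun y => _) = cst 0) ?derive_cst//.
  by apply/funext => y; rewrite big_nil.
rewrite big_cons -IH (_ : (fun y => \sum_(j <- i :: r) p j y) = p i + (fun y => \sum_(j <- r) p j y)).
  by rewrite deriveD//; apply: diff_derivable => //; exact: differentiable_bigsum.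
by apply/funext => y; rewrite big_cons.
Qed.

Lemma sum_regroup (X Y : R) (p1 p2 p3 q1 q2 q3 : 'I_m -> R) :
  X - \sum_d (p1 d + p2 d) * p3 d - (Y - \sum_d (q1 d + q2 d) * q3 d) +
    (\sum_d p2 d * p3 d - \sum_d q2 d * q3 d) = X - Y - \sum_d (p1 d * p3 d - q1 d * q3 d).
Proof.
have E (r1 r2 r3 : 'I_m -> R) : \sum_d (r1 d + r2 d) * r3 d = \sum_d r1 d * r3 d + \sum_d r2 d * r3 d.
  by rewrite -big_split/=; apply: eq_bigr => d _; rewrite mulrDl.
by rewrite !E sumrB; ring.
Qed.

(** The product rule moves [G] inside the derivative of the Christoffel symbols, so the inverse
    metric is never differentiated. By metric compatibility the derivative of [G] produces two
    terms, one of which cancels against the quadratic terms of the curvature. *)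
Lemma lower_riemann f c a b z : U z ->
  \sum_d G z f d * riemann G d c a b z =
  partial a (chris_low b c f) z - partial b (chris_low a c f) z
  - \sum_d (chris_low a f d z * christoffel G d b c z - chris_low b f d z * christoffel G d a c z).
Proof.
move=> Uz.
have key a' b' : \sum_d G z f d * partial a' (christoffel G d b' c) z =
    partial a' (chris_low b' c f) z - \sum_d (chris_low a' f d z + chris_low a' d f z) * christoffel G d b' c z.
  have -> : partial a' (chris_low b' c f) z = partial a' (fun y => \sum_d G y f d * christoffel G d b' c y) z.
    by apply: near_eq_derive; apply: filterS (near_U Uz) => y Uy; rewrite lower_christoffel.
  rewrite {2}/partial derive_bigsumR; last first.
    by move=> d; exact: (differentiableM (G_diff f d Uz) (christoffel_diff d b' c Uz)).
  rewrite -sumrB; apply: eq_bigr => d _.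
  rewrite derive_prodR; [|exact: G_diff|exact: christoffel_diff].
  by rewrite -(partialG_split a' f d Uz) /partial; ring.
have q a' b' : \sum_d G z f d * (\sum_e christoffel G d a' e z * christoffel G e b' c z) =
    \sum_e chris_low a' e f z * christoffel G e b' c z.
  under eq_bigr do rewrite mulr_sumr; rewrite exchange_big/=; apply: eq_bigr => e _.
  under eq_bigr do rewrite mulrA; rewrite -mulr_suml; congr (_ * _).
  exact: lower_christoffel.
pose x a' b' d := G z f d * partial a' (christoffel G d b' c) z.
pose y a' b' d := G z f d * (\sum_e christoffel G d a' e z * christoffel G e b' c z).
have kx a' b' : \sum_d x a' b' d = _ := key a' b'.
have ky a' b' : \sum_d y a' b' d = _ := q a' b'.
transitivity (\sum_d (x a b d - x b a d + (y a b d - y b a d))).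
  apply: eq_bigr => d _; rewrite /riemann /x /y sumrB; move: (partial _ _ z) (partial _ _ z) => X Y.
  by rewrite mulrDr !mulrBr.
apply: etrans (sum4 (x a b) (x b a) (y a b) (y b a)) _.
apply: etrans (f_equal2 (fun u v => u + v) (f_equal2 (fun u v => u - v) (kx a b) (kx b a))
  (f_equal2 (fun u v => u - v) (ky a b) (ky b a))) _.
move: (partial a _ z) (partial b _ z) => X Y.
exact: (sum_regroup X Y (fun d => chris_low a f d z) (fun d => chris_low a d f z) (fun d => christoffel G d b c z)
  (fun d => chris_low b f d z) (fun d => chris_low b d f z) (fun d => christoffel G d a c z)).
Qed.

Lemma scalarE z : U z -> local_scalar_curvature G z =
  \sum_b \sum_c \sum_a \sum_f invmx (G z) b c * invmx (G z) a f *
   (partial a (chris_low b c f) z - partial b (chris_low a c f) z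
    - \sum_d \sum_e invmx (G z) d e * (chris_low a f d z * chris_low b c e z - chris_low b f d z * chris_low a c e z)).
Proof.
move=> Uz; rewrite /local_scalar_curvature; apply: eq_bigr => b _; apply: eq_bigr => c _.
rewrite /ricci mulr_sumr; apply: eq_bigr => a _.
have -> : riemann G a c a b z = \sum_f invmx (G z) a f * (\sum_d G z f d * riemann G d c a b z).
  by rewrite (sum_Vmul _ _ (Gunit Uz)).
rewrite mulr_sumr; apply: eq_bigr => f _; rewrite lower_riemann// mulrA; congr (_ * (_ - _)).
apply: eq_bigr => d _; rewrite !christoffelE !mulr_sumr -sumrB; apply: eq_bigr => e _.
by rewrite mulrBr !(mulrCA (invmx (G z) d e)).
Qed.

End LowerRiemann.

(** * Derivatives of matrix fields and of bilinear forms *)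

Section MatrixCalculus.
Context {R : realType}.

Lemma isdM {V : normedModType R} (f g : V -> R) z df dg : isd f z df -> isd g z dg ->
  isd (fun x => f x * g x) z (fun v => df v * g z + f z * dg v).
Proof.
move=> [d1 e1] [d2 e2]; split; first exact: (differentiableM d1 d2).
move=> v; rewrite -[LHS]/('d (f * g) z v) (diffM d1 d2) -e1 -e2.
by rewrite -[LHS]/(f z * 'd g z v + g z * 'd f z v) addrC (mulrC (g z)).
Qed.

Lemma isd_bigsum {V : normedModType R} (I : Type) (r : seq I) (f : I -> V -> R) z df :
  (forall i, isd (f i) z (df i)) ->
  isd (fun x => \sum_(i <- r) f i x) z (fun v => \sum_(i <- r) df i v).
Proof.
move=> H; elim: r => [|i r IH].
  have -> : (fun x => \sum_(i <- [::]) f i x) = (fun=> 0) by apply/funext => x; rewrite big_nil.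
  by apply: isd_ext (isd_cst 0 z) => v; rewrite big_nil.
have -> : (fun x => \sum_(j <- i :: r) f j x) = (fun x => f i x + \sum_(j <- r) f j x).
  by apply/funext => x; rewrite big_cons.
by apply: isd_ext (isdD (H i) IH) => v; rewrite big_cons.
Qed.

Lemma isd_bilin {V : normedModType R} {m} (A : V -> 'M[R]_m) (u v : V -> 'rV[R]_m) z
    (dA : V -> 'M[R]_m) (du dv : V -> 'rV[R]_m) :
  (forall i j, isd (fun x => A x i j) z (fun x => dA x i j)) -> isd u z du -> isd v z dv ->
  isd (fun x => bilin (A x) (u x) (v x)) z (fun x => bilin (dA x) (u z) (v z) +
    bilin (A z) (du x) (v z) + bilin (A z) (u z) (dv x)).
Proof.
move=> hA hu hv.
have -> : (fun x => bilin (A x) (u x) (v x)) = (fun x => \sum_i \sum_j u x 0 i * A x i j * v x 0 j).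
  by apply/funext => x; rewrite bilinE.
have H i j := isdM (isdM (isd_coord i hu) (hA i j)) (isd_coord j hv).
apply: isd_ext (isd_bigsum _ (fun i => isd_bigsum _ (H i))) => x.
rewrite !bilinE -!big_split/=; apply: eq_bigr => i _; rewrite -!big_split/=; apply: eq_bigr => j _.
ring.
Qed.

Definition dmx {k} (K : 'rV[R]_k -> 'M[R]_k) (a p : 'rV[R]_k) : 'M[R]_k :=
  \matrix_(i, j) 'D_a (fun y => K y i j) p.

Section Field.
Context {k : nat}.
Variables (K : 'rV[R]_k -> 'M[R]_k) (W : set 'rV[R]_k).
Hypothesis oW : open W.
Hypothesis sK : forall i j, smooth_on W (fun z => K z i j).
Implicit Types (a b u v w p : 'rV[R]_k).

Lemma derive_row (f : 'rV[R]_k -> R) p a : differentiable f p ->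
  'D_a f p = \sum_l a 0 l * 'D_(delta_mx 0 l) f p.
Proof.
move=> df; rewrite deriveE// {1}(delta_row_sum a) linear_sum/=; apply: eq_bigr => l _.
by rewrite linearZ/= -deriveE.
Qed.

Lemma K_diff i j p : W p -> differentiable (fun z => K z i j) p.
Proof. exact: smooth_differentiable oW (sK i j). Qed.

Lemma K_smooth_d i j a : smooth_on W (fun p => dmx K a p i j).
Proof.
have -> : (fun p => dmx K a p i j) = 'D_a (fun y => K y i j) by apply/funext => p; rewrite mxE.
exact: smooth_derive.
Qed.

Lemma dmxE i j a p : W p -> dmx K a p i j = \sum_l a 0 l * dmx K (delta_mx 0 l) p i j.
Proof. by move=> Wp; rewrite mxE derive_row; [apply: eq_bigr => l _; rewrite mxE|exact: K_diff]. Qed.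

Lemma dmx_isd i j p : W p -> isd (fun y => K y i j) p (fun a => dmx K a p i j).
Proof. by move=> Wp; split; [exact: K_diff|move=> v; rewrite mxE deriveE//; exact: K_diff]. Qed.

Lemma dmxD a b p : W p -> dmx K (a + b) p = dmx K a p + dmx K b p.
Proof.
by move=> Wp; apply/matrixP => i j; rewrite [RHS]mxE -!(isd_val (dmx_isd i j Wp)) linearD.
Qed.

Lemma dmxZ c a p : W p -> dmx K (c *: a) p = c *: dmx K a p.
Proof.
by move=> Wp; apply/matrixP => i j; rewrite [RHS]mxE -!(isd_val (dmx_isd i j Wp)) linearZ.
Qed.

End Field.

(** [dmx] is linear in its direction. Expanding [u y] in the standard basis separates the moving
    direction from the moving base point and leaves only the product and chain rules. *)
Lemma isd_dmx {V : normedModType R} {k} (K : 'rV[R]_k -> 'M[R]_k) (W : set 'rV[R]_k) (F u : V -> 'rV[R]_k) z dF du i j :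
  open W -> (forall i j, smooth_on W (fun z => K z i j)) -> W (F z) ->
  isd F z dF -> isd u z du ->
  isd (fun y => dmx K (u y) (F y) i j) z
    (fun x => (dmx (dmx K (u z)) (dF x) (F z) + dmx K (du x) (F z)) i j).
Proof.
move=> oW sK Wz hF hu.
have H l : isd (fun y => u y 0 l * dmx K (delta_mx 0 l) (F y) i j) z (fun x =>
    du x 0 l * dmx K (delta_mx 0 l) (F z) i j + u z 0 l * dmx (dmx K (delta_mx 0 l)) (dF x) (F z) i j).
  by have := isdM (isd_coord l hu) (isd_comp hF (dmx_isd oW (fun i j => K_smooth_d sK i j _) i j Wz)).
have N : {near z, (fun y => \sum_l u y 0 l * dmx K (delta_mx 0 l) (F y) i j) =1
    (fun y => dmx K (u y) (F y) i j)}.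
  have : \forall y \near z, W (F y).
    by apply: (isd_continuous hF); exact: open_nbhs_nbhs.
  by apply: filterS => y Wy; rewrite (dmxE oW sK).
apply: isd_near N _; apply: isd_ext (isd_bigsum _ H) => x.
rewrite big_split/= mxE addrC; congr (_ + _); last by rewrite [RHS](dmxE oW sK).
rewrite [RHS]mxE.
rewrite (@near_eq_derive _ _ _ _ (fun y => \sum_l u z 0 l * dmx K (delta_mx 0 l) y i j)); last first.
  by apply: filterS (open_nbhs_nbhs (conj oW Wz)) => y Wy; rewrite (dmxE oW sK).
rewrite derive_bigsumR; last first.
  by move=> l; apply: differentiable_Ml; exact: smooth_differentiable oW (K_smooth_d sK i j _) Wz.
apply: eq_bigr => l _; rewrite derive_prodR; last 2 first.
- exact: differentiable_cst.
- exact: smooth_differentiable oW (K_smooth_d sK i j _) Wz.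
by rewrite derive_cst mul0r add0r [in LHS]mxE.
Qed.

End MatrixCalculus.

(* [ring] and [field] compare atoms up to conversion, which diverges in practice on bilinear forms. *)
Ltac hide_forms := repeat match goal with
  | |- context [bilin ?A ?u ?v] => generalize (bilin A u v); intro
  end.
Ltac form_ring := hide_forms; ring.

(** * Jets, second fundamental form and ambient curvature *)

Section Gauss.
Context {R : realType} {n N : nat}.
Variables (F : 'rV[R]_(n + n) -> 'rV[R]_(N + N)) (U : set 'rV[R]_(n + n)).
Variables (K : 'rV[R]_(N + N) -> 'M[R]_(N + N)) (W : set 'rV[R]_(N + N)).
Hypothesis oU : open U.
Hypothesis oW : open W.
Hypothesis hF : forall z, U z -> hol F z /\ W (F z).
Hypothesis Ksym : forall p, W p -> (K p)^T = K p.
Hypothesis Kunit : forall p, W p -> K p \in unitmx.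
Hypothesis sK : forall i j, smooth_on W (fun z => K z i j).
Implicit Types (z u v w : 'rV[R]_(n + n)) (p a b c f : 'rV[R]_(N + N)).

Definition pullb z : 'M[R]_(n + n) := jac F z *m K (F z) *m (jac F z)^T.
Hypothesis Gunit : forall z, U z -> pullb z \in unitmx.

Definition jet1 u z : 'rV[R]_(N + N) := u *m jac F z.
Definition jet2 u v z : 'rV[R]_(N + N) := u *m jac (jet1 v) z.
(** The ambient Christoffel symbols of the first kind, contracted with three vectors. [dchrisK]
    below is their derivative in the direction [f] with these vectors held fixed. *)
Definition chrisK p a b c : R :=
  2^-1 * (bilin (dmx K a p) b c + bilin (dmx K b p) a c - bilin (dmx K c p) a b).
Definition dchrisK p f a b c : R :=
  2^-1 * (bilin (dmx (dmx K a) f p) b c + bilin (dmx (dmx K b) f p) a c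
          - bilin (dmx (dmx K c) f p) a b).
(** The ambient Christoffel symbols of the second kind: the vector that represents the linear form
    [chrisK p a b] in the metric [K p]. *)
Definition gam p a b : 'rV[R]_(N + N) := (\row_i chrisK p a b (delta_mx 0 i)) *m invmx (K p).
(** The covariant second derivative of [F] in the ambient connection. It still contains a tangential
    part, which [normal_form] discards. *)
Definition sff u v z : 'rV[R]_(N + N) := jet2 u v z + gam (F z) (jet1 u z) (jet1 v z).
(** The lowered ambient curvature tensor, the inner product of R(a, b)c with f, in the shape given
    by [lower_riemann]. *)
Definition riemK p a b c f : R := dchrisK p a b c f - dchrisK p b a c f
  - bilin (K p) (gam p b c) (gam p a f) + bilin (K p) (gam p a c) (gam p b f).
(** The ambient inner product of the components orthogonal to the image of the derivative of [F];
    the double sum is the inner product of the tangential components. *)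
Definition normal_form z a b : R := bilin (K (F z)) a b - \sum_d \sum_e invmx (pullb z) d e *
  (bilin (K (F z)) a (jet1 (delta_mx 0 d) z) * bilin (K (F z)) b (jet1 (delta_mx 0 e) z)).

Local Notation e i := (delta_mx 0 i : 'rV[R]_(n + n)).

Lemma chrisKDr p a b c c' : W p -> chrisK p a b (c + c') = chrisK p a b c + chrisK p a b c'.
Proof.
move=> Wp; rewrite /chrisK (dmxD oW sK)//; move: (dmx K a p) (dmx K b p) (dmx K c p) (dmx K c' p) => A B C C'.
by rewrite !bilinDr bilin_mxD; form_ring.
Qed.

Lemma chrisKZr p a b t c : W p -> chrisK p a b (t *: c) = t * chrisK p a b c.
Proof.
move=> Wp; rewrite /chrisK (dmxZ oW sK)//; move: (dmx K a p) (dmx K b p) (dmx K c p) => A B C.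
by rewrite !bilinZr bilin_mxZ; form_ring.
Qed.

Lemma chrisK_sumr p a b (I : Type) (r : seq I) (c : I -> 'rV[R]_(N + N)) : W p ->
  chrisK p a b (\sum_(i <- r) c i) = \sum_(i <- r) chrisK p a b (c i).
Proof.
move=> Wp; elim: r => [|i r IH]; last by rewrite !big_cons chrisKDr// IH.
by rewrite !big_nil -[0](scale0r 0) chrisKZr// mul0r.
Qed.

Lemma bilin_gam p a b c : W p -> bilin (K p) (gam p a b) c = chrisK p a b c.
Proof.
move=> Wp; rewrite /bilin /gam -mulmxA mulmxA mulmxKV ?Kunit// mxE.
rewrite {2}(delta_row_sum c) chrisK_sumr//; apply: eq_bigr => i _.
by rewrite chrisKZr// !mxE mulrC.
Qed.

Lemma bilin_dmx_sym p a b c : W p -> bilin (dmx K a p) b c = bilin (dmx K a p) c b.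
Proof.
move=> Wp; apply: bilin_sym; apply/matrixP => i j; rewrite !mxE.
apply: near_eq_derive; apply: filterS (open_nbhs_nbhs (conj oW Wp)) => y Wy.
by rewrite -{1}(Ksym Wy) mxE.
Qed.

Lemma chrisK_sym p a b c : W p -> chrisK p a b c = chrisK p b a c.
Proof. by move=> Wp; rewrite /chrisK (bilin_dmx_sym c a b Wp); form_ring. Qed.

Lemma jet1_isd u z : U z -> isd (jet1 u) z (fun x => jet2 x u z).
Proof. by move=> Uz; apply: hol_isD; apply: hol_jac; exact: (hF Uz).1. Qed.

Lemma jet2_isd u v z : U z -> isd (jet2 u v) z (fun x => x *m jac (jet2 u v) z).
Proof. by move=> Uz; apply: hol_isD; do 2!apply: hol_jac; exact: (hF Uz).1. Qed.

Lemma jet2_sym u v z : U z -> jet2 u v z = jet2 v u z.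
Proof. by move=> Uz; apply: hol_jac_sym; exact: (hF Uz).1. Qed.

Lemma jet3_sym u v w z : U z -> u *m jac (jet2 v w) z = v *m jac (jet2 u w) z.
Proof. by move=> Uz; apply: hol_jac_sym; apply: hol_jac; exact: (hF Uz).1. Qed.

Lemma F_isd z : U z -> isd F z (fun x => jet1 x z).
Proof. by move=> Uz; apply: hol_isD; exact: (hF Uz).1. Qed.

Lemma KF_isd z i j : U z -> isd (fun y => K (F y) i j) z (fun x => dmx K (jet1 x z) (F z) i j).
Proof. by move=> Uz; exact: (isd_comp (F_isd Uz) (dmx_isd oW sK i j (hF Uz).2)). Qed.

Lemma pullb_bilin z u v : bilin (pullb z) u v = bilin (K (F z)) (jet1 u z) (jet1 v z).
Proof. by rewrite bilin_mulmx. Qed.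

Lemma partial_pullb (a b c : 'I_(n + n)) z : U z -> partial a (fun y => pullb y b c) z =
  bilin (dmx K (jet1 (delta_mx 0 a) z) (F z)) (jet1 (delta_mx 0 b) z) (jet1 (delta_mx 0 c) z) +
  bilin (K (F z)) (jet2 (delta_mx 0 a) (delta_mx 0 b) z) (jet1 (delta_mx 0 c) z) +
  bilin (K (F z)) (jet1 (delta_mx 0 b) z) (jet2 (delta_mx 0 a) (delta_mx 0 c) z).
Proof.
move=> Uz; have -> : (fun y => pullb y b c) =
    (fun y => bilin (K (F y)) (jet1 (delta_mx 0 b) y) (jet1 (delta_mx 0 c) y)).
  by apply/funext => y; rewrite -pullb_bilin bilin_delta.
have H := isd_bilin (fun i j => KF_isd i j Uz) (jet1_isd (delta_mx 0 b) Uz) (jet1_isd (delta_mx 0 c) Uz).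
exact: (@derive_val _ _ _ _ _ _ _ (isd_derive (delta_mx 0 a) H)).
Qed.

Lemma K_symb p a b : W p -> bilin (K p) a b = bilin (K p) b a.
Proof. by move=> Wp; apply: bilin_sym; exact: Ksym. Qed.

Lemma chris_low_pullb (a b c : 'I_(n + n)) z : U z -> chris_low pullb a b c z =
  bilin (K (F z)) (jet2 (delta_mx 0 a) (delta_mx 0 b) z) (jet1 (delta_mx 0 c) z) +
  chrisK (F z) (jet1 (delta_mx 0 a) z) (jet1 (delta_mx 0 b) z) (jet1 (delta_mx 0 c) z).
Proof.
move=> Uz; have Wz := (hF Uz).2; rewrite /chris_low !partial_pullb// /chrisK.
rewrite (jet2_sym (delta_mx 0 b) (delta_mx 0 a) Uz) (jet2_sym (delta_mx 0 c) (delta_mx 0 a) Uz).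
rewrite (jet2_sym (delta_mx 0 c) (delta_mx 0 b) Uz).
move: (K_symb (jet1 (delta_mx 0 b) z) (jet2 (delta_mx 0 a) (delta_mx 0 c) z) Wz).
by hide_forms => ->; field.
Qed.

(** The tangential part of the ambient covariant derivative is the induced Levi-Civita
    connection. *)
Lemma chris_low_sff (a b c : 'I_(n + n)) z : U z -> chris_low pullb a b c z =
  bilin (K (F z)) (sff (delta_mx 0 a) (delta_mx 0 b) z) (jet1 (delta_mx 0 c) z).
Proof. by move=> Uz; rewrite chris_low_pullb// /sff bilinDl bilin_gam//; exact: (hF Uz).2. Qed.

Lemma isd_trilin (u v w : 'rV[R]_(n + n) -> 'rV[R]_(N + N)) z du dv dw : U z ->
  isd u z du -> isd v z dv -> isd w z dw ->
  isd (fun y => bilin (dmx K (u y) (F y)) (v y) (w y)) z (fun x =>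
    bilin (dmx (dmx K (u z)) (jet1 x z) (F z)) (v z) (w z) + bilin (dmx K (du x) (F z)) (v z) (w z) +
    bilin (dmx K (u z) (F z)) (dv x) (w z) + bilin (dmx K (u z) (F z)) (v z) (dw x)).
Proof.
move=> Uz hu hv hw.
have H := isd_bilin (fun i j => isd_dmx i j oW sK (hF Uz).2 (F_isd Uz) hu) hv hw.
by apply: isd_ext H => x; rewrite bilin_mxD.
Qed.

Lemma isd_chrisK (u v w : 'rV[R]_(n + n) -> 'rV[R]_(N + N)) z du dv dw : U z ->
  isd u z du -> isd v z dv -> isd w z dw ->
  isd (fun y => chrisK (F y) (u y) (v y) (w y)) z (fun x =>
    dchrisK (F z) (jet1 x z) (u z) (v z) (w z) + chrisK (F z) (du x) (v z) (w z) +
    chrisK (F z) (u z) (dv x) (w z) + chrisK (F z) (u z) (v z) (dw x)).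
Proof.
move=> Uz hu hv hw; have H := isdZ 2^-1 (isdB (isdD (isd_trilin Uz hu hv hw) (isd_trilin Uz hv hu hw))
  (isd_trilin Uz hw hu hv)).
apply: isd_ext H => x; rewrite /chrisK /dchrisK; change ((2^-1 : R) *: ?x) with ((2^-1 : R) * x); form_ring.
Qed.

Lemma partial_chris_low (a b c f : 'I_(n + n)) z : U z ->
  partial a (chris_low pullb b c f) z =
  bilin (dmx K (jet1 (e a) z) (F z)) (jet2 (e b) (e c) z) (jet1 (e f) z) +
  bilin (K (F z)) (e a *m jac (jet2 (e b) (e c)) z) (jet1 (e f) z) +
  bilin (K (F z)) (jet2 (e b) (e c) z) (jet2 (e a) (e f) z) +
  (dchrisK (F z) (jet1 (e a) z) (jet1 (e b) z) (jet1 (e c) z) (jet1 (e f) z) +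
   chrisK (F z) (jet2 (e a) (e b) z) (jet1 (e c) z) (jet1 (e f) z) +
   chrisK (F z) (jet1 (e b) z) (jet2 (e a) (e c) z) (jet1 (e f) z) +
   chrisK (F z) (jet1 (e b) z) (jet1 (e c) z) (jet2 (e a) (e f) z)).
Proof.
move=> Uz.
rewrite /partial (@near_eq_derive _ _ _ _ (fun y => bilin (K (F y)) (jet2 (e b) (e c) y) (jet1 (e f) y) +
  chrisK (F y) (jet1 (e b) y) (jet1 (e c) y) (jet1 (e f) y))); last first.
  by apply: filterS (open_nbhs_nbhs (conj oU Uz)) => y Uy; rewrite chris_low_pullb.
have H := isdD (isd_bilin (fun i j => KF_isd i j Uz) (jet2_isd (e b) (e c) Uz) (jet1_isd (e f) Uz))
  (isd_chrisK Uz (jet1_isd (e b) Uz) (jet1_isd (e c) Uz) (jet1_isd (e f) Uz)).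
exact: (@derive_val _ _ _ _ _ _ _ (isd_derive (e a) H)).
Qed.

Lemma dmx_chrisK p a b c : W p -> bilin (dmx K a p) b c = chrisK p a b c + chrisK p a c b.
Proof.
move=> Wp; rewrite /chrisK; move: (bilin_dmx_sym a c b Wp) (bilin_dmx_sym b c a Wp) (bilin_dmx_sym c b a Wp).
by hide_forms => *; subst; field.
Qed.

Ltac hide_chris := repeat match goal with
  | |- context [chrisK ?p ?a ?b ?c] => generalize (chrisK p a b c); intro
  | |- context [dchrisK ?p ?f ?a ?b ?c] => generalize (dchrisK p f a b c); intro
  end.

(** The third derivatives of [F] are symmetric and cancel. The products of second derivatives with
    each other and with Christoffel symbols complete to inner products of [sff]; what remains is the
    ambient curvature. *)
Lemma gauss_low (a b c f : 'I_(n + n)) z : U z ->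
  partial a (chris_low pullb b c f) z - partial b (chris_low pullb a c f) z =
  riemK (F z) (jet1 (e a) z) (jet1 (e b) z) (jet1 (e c) z) (jet1 (e f) z) +
  bilin (K (F z)) (sff (e b) (e c) z) (sff (e a) (e f) z) -
  bilin (K (F z)) (sff (e a) (e c) z) (sff (e b) (e f) z).
Proof.
move=> Uz; have Wz := (hF Uz).2; rewrite !partial_chris_low//.
rewrite (jet2_sym (e b) (e a) Uz) (jet3_sym (e b) (e a) (e c) Uz).
have S x y x' y' : bilin (K (F z)) (sff x y z) (sff x' y' z) =
    bilin (K (F z)) (jet2 x y z) (jet2 x' y' z) + chrisK (F z) (jet1 x z) (jet1 y z) (jet2 x' y' z)
    + chrisK (F z) (jet1 x' z) (jet1 y' z) (jet2 x y z)
    + bilin (K (F z)) (gam (F z) (jet1 x z) (jet1 y z)) (gam (F z) (jet1 x' z) (jet1 y' z)).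
  rewrite /sff bilinDl !bilinDr (K_symb (jet2 x y z) (gam _ _ _) Wz) !(bilin_gam _ _ (jet2 _ _ _) Wz).
  hide_chris; form_ring.
move: {S}(S (e b) (e c) (e a) (e f)) (S (e a) (e c) (e b) (e f)) => -> ->; rewrite /riemK !(dmx_chrisK _ _ _ Wz).
move: (chrisK_sym (jet1 (e b) z) (jet2 (e a) (e c) z) (jet1 (e f) z) Wz).
move: (chrisK_sym (jet1 (e a) z) (jet2 (e b) (e c) z) (jet1 (e f) z) Wz).
hide_chris; hide_forms => *; subst; ring.
Qed.

Lemma pullb_smooth i j : smooth_on U (fun z => pullb z i j).
Proof.
move=> k; have -> : (fun z => pullb z i j) = (fun z => \sum_d \sum_c
    jet1 (delta_mx 0 i) z 0 d * K (F z) d c * jet1 (delta_mx 0 j) z 0 c).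
  by apply/funext => y; rewrite -bilinE -pullb_bilin bilin_delta.
apply: Ck_on_sum => // d; apply: Ck_on_sum => // c; apply: Ck_onM => //; first apply: Ck_onM => //.
- by apply: Ck_on_hol => // z Uz; apply: hol_jac; exact: (hF Uz).1.
- exact: (Ck_on_comp_hol _ oU oW hF (sK d c)).
- by apply: Ck_on_hol => // z Uz; apply: hol_jac; exact: (hF Uz).1.
Qed.

Lemma pullb_sym z : U z -> (pullb z)^T = pullb z.
Proof. by move=> Uz; rewrite /pullb !trmx_mul trmxK mulmxA Ksym//; exact: (hF Uz).2. Qed.

Lemma mulrB_swap (r a b c d : R) : r * (a * b - c * d) = r * (b * a) - r * (d * c).
Proof. by rewrite mulrBr (mulrC a) (mulrC c). Qed.

Lemma sub_regroup (r b1 b2 s1 s2 : R) : r + b1 - b2 - (s1 - s2) = r + (b1 - s1) - (b2 - s2).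
Proof. by ring. Qed.

(** The quadratic Christoffel terms of [scalarE] are, by [chris_low_sff], the inner products of the
    tangential parts of [sff]. Subtracting them turns the ambient inner products of [gauss_low] into
    [normal_form]. *)
Lemma gauss_equation z : U z ->
  local_scalar_curvature pullb z =
  \sum_b \sum_c \sum_a \sum_f invmx (pullb z) b c * invmx (pullb z) a f *
   (riemK (F z) (jet1 (e a) z) (jet1 (e b) z) (jet1 (e c) z) (jet1 (e f) z) +
    normal_form z (sff (e b) (e c) z) (sff (e a) (e f) z) -
    normal_form z (sff (e a) (e c) z) (sff (e b) (e f) z)).
Proof.
move=> Uz; rewrite (scalarE oU pullb_sym Gunit pullb_smooth Uz).
apply: eq_bigr => b _; apply: eq_bigr => c _; apply: eq_bigr => a _; apply: eq_bigr => f _.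
congr (_ * _); rewrite gauss_low// /normal_form.
pose x d e' := invmx (pullb z) d e' * (bilin (K (F z)) (sff (e b) (e c) z) (jet1 (e d) z) *
  bilin (K (F z)) (sff (e a) (e f) z) (jet1 (e e') z)).
pose y d e' := invmx (pullb z) d e' * (bilin (K (F z)) (sff (e a) (e c) z) (jet1 (e d) z) *
  bilin (K (F z)) (sff (e b) (e f) z) (jet1 (e e') z)).
have invS i j : invmx (pullb z) i j = invmx (pullb z) j i.
  by rewrite -{1}(pullb_sym Uz) -trmx_inv mxE.
have -> : \sum_d \sum_e' invmx (pullb z) d e' * (chris_low pullb a f d z * chris_low pullb b c e' z -
    chris_low pullb b f d z * chris_low pullb a c e' z) = \sum_d \sum_e' x d e' - \sum_d \sum_e' y d e'.
  rewrite exchange_big/= -sumrB; apply: eq_bigr => i _; rewrite -sumrB; apply: eq_bigr => j _.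
  rewrite !chris_low_sff// /x /y (invS j i).
  exact: mulrB_swap.
exact: sub_regroup.
Qed.

End Gauss.

(** * Unitary frames and traces *)

Section Frames.
Context {R : realType} {n : nat}.
Variable G : 'M[R]_(n + n).
Implicit Types u v : 'rV[R]_(n + n).
Hypothesis Gsym : G^T = G.
Hypothesis GJ : forall u v, bilin G (u *m Jmx) (v *m Jmx) = bilin G u v.
Hypothesis Gpos : forall u, u != 0 -> 0 < bilin G u u.

Lemma bilinJ u v : bilin G (u *m Jmx) v = - bilin G u (v *m Jmx).
Proof. by rewrite -[bilin G (u *m Jmx) v]GJ JmxK bilinNl. Qed.

Lemma bilin_self_J u : bilin G u (u *m Jmx) = 0.
Proof.
have := bilinJ u u; rewrite (bilin_sym (u *m Jmx) u Gsym).
by move: (bilin _ _ _) => x e; lra.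
Qed.

Lemma pos_unitmx : G \in unitmx.
Proof.
apply: inj_unitmx => v vG; apply/eqP/negP => /negP /Gpos.
by rewrite /bilin vG mul0mx mxE ltxx.
Qed.

(** Orthogonality to the first [k] vectors and to their images under J amounts to 2k linear
    equations, fewer than the 2n unknowns. *)
Lemma orthogonal_vector k (x : nat -> 'rV[R]_(n + n)) : (k < n)%N -> exists2 u, u != 0 &
  forall i, (i < k)%N -> bilin G u (x i) = 0 /\ bilin G u (x i *m Jmx) = 0.
Proof.
move=> kn; pose A : 'M[R]_(n + n, k + k) :=
  G *m (col_mx (\matrix_(i < k) x i) (\matrix_(i < k) (x i *m Jmx)))^T.
have : kermx A != 0.
  rewrite -mxrank_eq0 mxrank_ker -lt0n subn_gt0 (leq_ltn_trans (rank_leq_col A))//.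
  by rewrite -addnS leq_add// ltnW.
case/rowV0Pn => u /sub_kermxP uA u0; exists u => // i ik.
have E (j : 'I_(k + k)) : bilin G u (row j (col_mx (\matrix_(i < k) x i) (\matrix_(i < k) (x i *m Jmx)))) = 0.
  by rewrite /bilin tr_row colE mulmxA -(mulmxA u) -/A uA mul0mx mxE.
have := E (lshift k (Ordinal ik)); have := E (rshift k (Ordinal ik)).
by rewrite rowKu rowKd !rowK.
Qed.

Lemma orthonormal_vectors k : (k <= n)%N -> exists x : nat -> 'rV[R]_(n + n), forall i j,
  (i < k)%N -> (j < k)%N -> bilin G (x i) (x j) = (i == j)%:R /\ bilin G (x i) (x j *m Jmx) = 0.
Proof.
elim: k => [|k IH] kn; first by exists (fun=> 0).
have [x Hx] := IH (ltnW kn); have [u u0 Hu] := orthogonal_vector x kn.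
pose s := (Num.sqrt (bilin G u u))^-1.
have uu := Gpos u0.
have s2 : s * s * bilin G u u = 1.
  rewrite /s -invfM -expr2 sqr_sqrtr ?(ltW uu)// mulVf// gt_eqF//.
exists (fun i => if (i < k)%N then x i else s *: u) => i j.
rewrite !ltnS => ik jk; case: ifPn => ik'; case: ifPn => jk'.
- exact: Hx.
- rewrite -scalemxAl !bilinZr (bilin_sym (x i) u Gsym) (Hu _ ik').1 mulr0.
  have -> : bilin G (x i) (u *m Jmx) = - bilin G (x i *m Jmx) u by rewrite bilinJ opprK.
  rewrite (bilin_sym (x i *m Jmx) u Gsym) (Hu _ ik').2 oppr0 mulr0.
  by rewrite (_ : i == j = false)//; apply/eqP => e; move: jk'; rewrite -e ik'.
- rewrite !bilinZl (Hu _ jk').1 (Hu _ jk').2 mulr0.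
  by rewrite (_ : i == j = false)//; apply/eqP => e; move: ik'; rewrite e jk'.
- have -> : i = k by apply/eqP; rewrite eqn_leq ik leqNgt.
  have -> : j = k by apply/eqP; rewrite eqn_leq jk leqNgt.
  by rewrite eqxx -scalemxAl !bilinZl !bilinZr bilin_self_J !mulr0 mulrA s2.
Qed.

(** The rows of [L] are n orthonormal vectors followed by their images under J; this order makes [L]
    commute with [Jmx]. *)
Lemma unitary_frame : exists L : 'M[R]_(n + n), L *m G *m L^T = 1%:M /\ Jmx *m L = L *m Jmx.
Proof.
have [x Hx] := orthonormal_vectors (leqnn n).
pose L : 'M[R]_(n + n) := col_mx (\matrix_(i < n) x i) (\matrix_(i < n) (x i *m Jmx)).
have Ll (i : 'I_n) : row (lshift n i) L = x i by rewrite rowKu rowK.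
have Lr (i : 'I_n) : row (rshift n i) L = x i *m Jmx by rewrite rowKd rowK.
exists L; split.
  apply/matrixP => i j; rewrite -[LHS]bilin_delta -bilin_mulmx -!rowE !mxE.
  case: (split_ordP i) => i' ->; case: (split_ordP j) => j' ->; rewrite ?Ll ?Lr.
  - by rewrite (Hx i' j' (ltn_ord _) (ltn_ord _)).1 eq_lshift.
  - by rewrite (Hx i' j' (ltn_ord _) (ltn_ord _)).2 eq_lrshift.
  - by rewrite bilinJ (Hx i' j' (ltn_ord _) (ltn_ord _)).2 oppr0 eq_rlshift.
  - by rewrite GJ (Hx i' j' (ltn_ord _) (ltn_ord _)).1 eq_rshift.
apply/row_matrixP => i; rewrite !row_mul.
case: (split_ordP i) => i' ->; rewrite ?Ll ?Lr.
  have -> : row (lshift n i') Jmx = delta_mx 0 (rshift n i') :> 'rV[R]_(n + n).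
    by rewrite rowKu row_row_mx row0 row1 -delta_mx_rshift.
  by rewrite -rowE Lr.
have -> : row (rshift n i') Jmx = - delta_mx 0 (lshift n i') :> 'rV[R]_(n + n).
  by rewrite rowKd row_row_mx row0 raddfN/= row1 -[LHS]/(row_mx (- _) 0) delta_mx_lshift opp_row_mx oppr0.
by rewrite mulNmx -rowE Ll JmxK.
Qed.

Lemma frame_inverse (L : 'M[R]_(n + n)) : L *m G *m L^T = 1%:M -> invmx G = L^T *m L.
Proof.
move=> H; have uL : L^T \in unitmx by have /mulmx1_unit [] := H.
have E : G *m L^T *m L = 1%:M by apply: mulmx1C; rewrite mulmxA.
by rewrite -[LHS]mulmx1 -E -!mulmxA mulKmx// pos_unitmx.
Qed.

Lemma frame_trace (L : 'M[R]_(n + n)) (beta : 'rV[R]_(n + n) -> 'rV[R]_(n + n) -> R) :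
  L *m G *m L^T = 1%:M ->
  (forall u v, beta u v = \sum_b \sum_c u 0 b * v 0 c * beta (delta_mx 0 b) (delta_mx 0 c)) ->
  \sum_b \sum_c invmx G b c * beta (delta_mx 0 b) (delta_mx 0 c) = \sum_p beta (row p L) (row p L).
Proof.
move=> H Hb; under [RHS]eq_bigr do rewrite Hb.
rewrite [RHS]exchange_big/=; apply: eq_bigr => b _; rewrite [RHS]exchange_big/=; apply: eq_bigr => c _.
rewrite (frame_inverse H) mxE mulr_suml; apply: eq_bigr => p _.
by rewrite !mxE.
Qed.

End Frames.

(** * Multilinear forms in coordinates *)

Section Multilinear.
Context {R : realType} {m : nat}.

Definition lin_form (f : 'rV[R]_m -> R) := forall t u v, f (t *: u + v) = t * f u + f v.

Lemma lin_formE f u : lin_form f -> f u = \sum_b u 0 b * f (delta_mx 0 b).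
Proof.
move=> Lf; rewrite {1}(delta_row_sum u).
have f0 : f 0 = 0 by have := Lf 1 0 0; rewrite scaler0 addr0 mul1r => /eqP; rewrite -subr_eq0 opprD addrA subrr sub0r oppr_eq0 => /eqP.
elim: (index_enum _) => [|i r IH]; first by rewrite !big_nil.
by rewrite !big_cons Lf IH.
Qed.

Lemma bilin_formE (beta : 'rV[R]_m -> 'rV[R]_m -> R) u v :
  (forall w, lin_form (fun x => beta x w)) -> (forall w, lin_form (beta w)) ->
  beta u v = \sum_b \sum_c u 0 b * v 0 c * beta (delta_mx 0 b) (delta_mx 0 c).
Proof.
move=> H1 H2; rewrite (lin_formE u (H1 v)); apply: eq_bigr => b _.
by rewrite (lin_formE v (H2 _)) mulr_sumr; apply: eq_bigr => c _; rewrite mulrA.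
Qed.

Section Closure.
Context {k : nat}.
Implicit Types (f g : 'rV[R]_m -> R) (A : 'M[R]_k) (phi : 'rV[R]_m -> 'rV[R]_k).

Lemma lin_formD f g : lin_form f -> lin_form g -> lin_form (fun x => f x + g x).
Proof. by move=> Hf Hg t u v; rewrite Hf Hg; ring. Qed.

Lemma lin_formB f g : lin_form f -> lin_form g -> lin_form (fun x => f x - g x).
Proof. by move=> Hf Hg t u v; rewrite Hf Hg; ring. Qed.

Lemma lin_formZ c f : lin_form f -> lin_form (fun x => c * f x).
Proof. by move=> Hf t u v; rewrite Hf; ring. Qed.

Lemma lin_formZr c f : lin_form f -> lin_form (fun x => f x * c).
Proof. by move=> Hf t u v; rewrite Hf; ring. Qed.

Lemma lin_form_mx (Phi : 'rV[R]_m -> 'M[R]_k) (v w : 'rV[R]_k) :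
  (forall t a b, Phi (t *: a + b) = t *: Phi a + Phi b) -> lin_form (fun a => bilin (Phi a) v w).
Proof. by move=> H t a b; rewrite H bilin_mxD bilin_mxZ. Qed.

Lemma lin_form_l phi A v :
  (forall t a b, phi (t *: a + b) = t *: phi a + phi b) -> lin_form (fun a => bilin A (phi a) v).
Proof. by move=> H t a b; rewrite H bilinDl bilinZl. Qed.

Lemma lin_form_r phi A v :
  (forall t a b, phi (t *: a + b) = t *: phi a + phi b) -> lin_form (fun a => bilin A v (phi a)).
Proof. by move=> H t a b; rewrite H bilinDr bilinZr. Qed.

End Closure.

Lemma lin_form_sum (I : Type) (r : seq I) (f : I -> 'rV[R]_m -> R) :
  (forall i, lin_form (f i)) -> lin_form (fun x => \sum_(i <- r) f i x).
Proof.
move=> H t u v; rewrite mulr_sumr -big_split/=; apply: eq_bigr => i _; exact: H.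
Qed.

End Multilinear.

Lemma lin_form_comp {R : realType} {m k} (f : 'rV[R]_k -> R) (phi : 'rV[R]_m -> 'rV[R]_k) :
  lin_form f -> (forall t a b, phi (t *: a + b) = t *: phi a + phi b) -> lin_form (fun a => f (phi a)).
Proof. by move=> Hf H t a b; rewrite H Hf. Qed.

Lemma frame_trace4 {R : realType} {n} (G L : 'M[R]_(n + n))
    (T : 'rV[R]_(n + n) -> 'rV[R]_(n + n) -> 'rV[R]_(n + n) -> 'rV[R]_(n + n) -> R) :
  (forall u, u != 0 -> 0 < bilin G u u) -> L *m G *m L^T = 1%:M ->
  (forall b c d, lin_form (fun x => T x b c d)) -> (forall a c d, lin_form (fun x => T a x c d)) ->
  (forall a b d, lin_form (fun x => T a b x d)) -> (forall a b c, lin_form (fun x => T a b c x)) ->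
  \sum_b \sum_c \sum_a \sum_f invmx G b c * invmx G a f *
    T (delta_mx 0 a) (delta_mx 0 b) (delta_mx 0 c) (delta_mx 0 f) =
  \sum_p \sum_q T (row q L) (row p L) (row p L) (row q L).
Proof.
move=> Gpos H Ta Tb Tc Tf.
pose beta u v := \sum_q T (row q L) u v (row q L).
rewrite -(@frame_trace _ _ G Gpos L beta H); last first.
  by move=> u v; apply: bilin_formE => w; apply: lin_form_sum => q.
apply: eq_bigr => b _; apply: eq_bigr => c _; rewrite /beta.
rewrite -(@frame_trace _ _ G Gpos L (fun x y => T x (delta_mx 0 b) (delta_mx 0 c) y) H); last first.
  move=> u v; exact: (bilin_formE (beta := fun x y => T x (delta_mx 0 b) (delta_mx 0 c) y)).
rewrite mulr_sumr; apply: eq_bigr => a _; rewrite mulr_sumr; apply: eq_bigr => f _.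
by rewrite mulrA.
Qed.

Definition bilin_lin := (@bilinDl, @bilinDr, @bilinZl, @bilinZr, @bilin_mxD, @bilin_mxZ).

Ltac expand_forms := repeat match goal with
  | |- context [dmx ?A ?a ?p] => generalize (dmx A a p); intro
  | |- context [gam ?A ?p ?a ?b] => generalize (gam A p a b); intro
  end; rewrite !bilin_lin; hide_forms.

(** * Multilinearity of the curvature terms and the Gauss equation in a frame *)

Section GaussKahler.
Context {R : realType} {n N : nat}.
Variables (F : 'rV[R]_(n + n) -> 'rV[R]_(N + N)) (U : set 'rV[R]_(n + n)).
Variables (K : 'rV[R]_(N + N) -> 'M[R]_(N + N)) (W : set 'rV[R]_(N + N)).
Hypothesis oU : open U.
Hypothesis oW : open W.
Hypothesis hF : forall z, U z -> hol F z /\ W (F z).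
Hypothesis Ksym : forall p, W p -> (K p)^T = K p.
Hypothesis Kpos : forall p u, W p -> u != 0 -> 0 < bilin (K p) u u.
Hypothesis sK : forall i j, smooth_on W (fun z => K z i j).
Implicit Types (z u v w : 'rV[R]_(n + n)) (p a b c f : 'rV[R]_(N + N)).

Let Kunit p : W p -> K p \in unitmx.
Proof. by move=> Wp; apply: pos_unitmx => u; exact: Kpos. Qed.

Lemma jet1_lin t u v z : jet1 F (t *: u + v) z = t *: jet1 F u z + jet1 F v z.
Proof. by rewrite /jet1 mulmxDl scalemxAl. Qed.

Lemma jet2_linl t u v w z : jet2 F (t *: u + v) w z = t *: jet2 F u w z + jet2 F v w z.
Proof. by rewrite /jet2 mulmxDl scalemxAl. Qed.

Lemma dmx_lin p t a b : W p -> dmx K (t *: a + b) p = t *: dmx K a p + dmx K b p.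
Proof. by move=> Wp; rewrite (dmxD oW sK)// (dmxZ oW sK). Qed.

Lemma dmx2_linl p t a b c : W p ->
  dmx (dmx K c) (t *: a + b) p = t *: dmx (dmx K c) a p + dmx (dmx K c) b p.
Proof.
move=> Wp; have s i j := K_smooth_d sK i j c.
by rewrite (dmxD oW s)// (dmxZ oW s).
Qed.

Lemma dmx2_linr p t a b c : W p ->
  dmx (dmx K (t *: a + b)) c p = t *: dmx (dmx K a) c p + dmx (dmx K b) c p.
Proof.
move=> Wp; apply/matrixP => i j; rewrite [RHS]mxE [X in _ = X + _]mxE.
have E (A : 'rV[R]_(N + N) -> 'M[R]_(N + N)) : dmx A c p i j = 'D_c (fun y => A y i j) p by rewrite mxE.
apply: etrans (E _) _; apply: esym.
apply: etrans (f_equal2 (fun x y => t * x + y) (E (dmx K a)) (E (dmx K b))) _; apply: esym.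
rewrite (@near_eq_derive _ _ _ _ ((t *: (fun y => dmx K a y i j)) + (fun y => dmx K b y i j))); last first.
  by apply: filterS (open_nbhs_nbhs (conj oW Wp)) => y Wy; rewrite dmx_lin// [LHS]mxE [X in X + _ = _]mxE.
have d e : derivable (fun y => dmx K e y i j) p c.
  by apply: diff_derivable; exact: smooth_differentiable oW (K_smooth_d sK i j e) Wp.
by rewrite deriveD; [rewrite deriveZ; [|exact: d]|apply: derivableZ; exact: d|exact: d].
Qed.

Opaque dmx bilin.

Lemma chrisK_lin1 p t a a' b c : W p ->
  chrisK K p (t *: a + a') b c = t * chrisK K p a b c + chrisK K p a' b c.
Proof.
move=> Wp; rewrite /chrisK dmx_lin//; expand_forms; ring.
Qed.

Lemma gam_linl p t a a' b : W p -> gam K p (t *: a + a') b = t *: gam K p a b + gam K p a' b.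
Proof.
move=> Wp; rewrite /gam scalemxAl -mulmxDl; congr (_ *m _).
by apply/rowP => i; rewrite !mxE chrisK_lin1.
Qed.

Lemma gam_sym p a b : W p -> gam K p a b = gam K p b a.
Proof.
move=> Wp; rewrite /gam; congr (_ *m _).
by apply/rowP => i; rewrite !mxE (chrisK_sym oW Ksym).
Qed.

Lemma gam_linr p t a a' b : W p -> gam K p b (t *: a + a') = t *: gam K p b a + gam K p b a'.
Proof. by move=> Wp; rewrite !(gam_sym b _ Wp) gam_linl. Qed.

Opaque gam.

Lemma dchrisK_lin1 p a b c : W p -> lin_form (fun f => dchrisK K p f a b c).
Proof.
move=> Wp; apply: lin_formZ; apply: lin_formB; [apply: lin_formD|];
  by apply: lin_form_mx => t x y; exact: dmx2_linl.
Qed.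

Lemma dchrisK_lin2 p f b c : W p -> lin_form (fun a => dchrisK K p f a b c).
Proof.
move=> Wp; apply: lin_formZ; apply: lin_formB; [apply: lin_formD|].
- by apply: lin_form_mx => t x y; exact: dmx2_linr.
- exact: (@lin_form_l _ _ _ (fun x => x)).
- exact: (@lin_form_l _ _ _ (fun x => x)).
Qed.

Lemma dchrisK_lin3 p f a c : W p -> lin_form (fun b => dchrisK K p f a b c).
Proof.
move=> Wp; apply: lin_formZ; apply: lin_formB; [apply: lin_formD|].
- exact: (@lin_form_l _ _ _ (fun x => x)).
- by apply: lin_form_mx => t x y; exact: dmx2_linr.
- exact: (@lin_form_r _ _ _ (fun x => x)).
Qed.

Lemma dchrisK_lin4 p f a b : W p -> lin_form (dchrisK K p f a b).
Proof.
move=> Wp; apply: lin_formZ; apply: lin_formB; [apply: lin_formD|].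
- exact: (@lin_form_r _ _ _ (fun x => x)).
- exact: (@lin_form_r _ _ _ (fun x => x)).
- by apply: lin_form_mx => t x y; exact: dmx2_linr.
Qed.

Lemma riemK_lin1 p b c f : W p -> lin_form (fun a => riemK K p a b c f).
Proof.
move=> Wp; apply: lin_formD; [apply: lin_formB; [apply: lin_formB|]|].
- exact: dchrisK_lin1.
- exact: dchrisK_lin2.
- by apply: lin_form_r => t x y; exact: gam_linl.
- by apply: lin_form_l => t x y; exact: gam_linl.
Qed.

Lemma riemK_skew p a b c f : riemK K p a b c f = - riemK K p b a c f.
Proof. by rewrite /riemK; move: (dchrisK _ _ _ _ _ _) (dchrisK _ _ _ _ _ _); hide_forms => *; ring. Qed.

Lemma riemK_lin2 p a c f : W p -> lin_form (fun b => riemK K p a b c f).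
Proof.
move=> Wp t b b'; rewrite !(riemK_skew p a) (riemK_lin1 a c f Wp).
by move: (riemK _ _ _ _ _ _) (riemK _ _ _ _ _ _) => x y; ring.
Qed.

Lemma riemK_lin3 p a b f : W p -> lin_form (fun c => riemK K p a b c f).
Proof.
move=> Wp; apply: lin_formD; [apply: lin_formB; [apply: lin_formB|]|].
- exact: dchrisK_lin3.
- exact: dchrisK_lin3.
- by apply: lin_form_l => t x y; exact: gam_linr.
- by apply: lin_form_l => t x y; exact: gam_linr.
Qed.

Lemma riemK_lin4 p a b c : W p -> lin_form (riemK K p a b c).
Proof.
move=> Wp; apply: lin_formD; [apply: lin_formB; [apply: lin_formB|]|].
- exact: dchrisK_lin4.
- exact: dchrisK_lin4.
- by apply: lin_form_r => t x y; exact: gam_linr.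
- by apply: lin_form_r => t x y; exact: gam_linr.
Qed.

Opaque jet1 jet2.

Lemma sff_linl t u v w z : U z -> sff F K (t *: u + v) w z = t *: sff F K u w z + sff F K v w z.
Proof.
move=> Uz; have E2 := gam_linl t (jet1 F u z) (jet1 F v z) (jet1 F w z) (hF Uz).2.
rewrite -(jet1_lin t u v z) in E2; rewrite /sff E2 (jet2_linl t u v w z).
move: (jet2 _ _ _ _) (jet2 _ _ _ _) (gam _ _ _ _) (gam _ _ _ _) => a b c d.
by rewrite scalerDr addrACA.
Qed.

Lemma sff_sym u v z : U z -> sff F K u v z = sff F K v u z.
Proof. by move=> Uz; rewrite /sff (jet2_sym hF u v Uz) gam_sym//; exact: (hF Uz).2. Qed.

Lemma sff_linr t u v w z : U z -> sff F K w (t *: u + v) z = t *: sff F K w u z + sff F K w v z.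
Proof. by move=> Uz; rewrite !(sff_sym w _ Uz) sff_linl. Qed.

Opaque sff.

Lemma normal_form_linl z b : lin_form (fun a => normal_form F K z a b).
Proof.
apply: lin_formB; first exact: (@lin_form_l _ _ _ (fun x => x)).
apply: lin_form_sum => d; apply: lin_form_sum => e; apply: lin_formZ; apply: lin_formZr.
exact: (@lin_form_l _ _ _ (fun x => x)).
Qed.

Lemma normal_form_sym z a b : U z -> normal_form F K z a b = normal_form F K z b a.
Proof.
move=> Uz; have Wz := (hF Uz).2; rewrite /normal_form (bilin_sym a b (Ksym Wz)); congr (_ - _).
rewrite exchange_big/=; apply: eq_bigr => d _; apply: eq_bigr => e _.
rewrite -{1}(pullb_sym hF Ksym Uz) -trmx_inv mxE; form_ring.
Qed.

Lemma normal_form_linr z a : U z -> lin_form (normal_form F K z a).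
Proof. by move=> Uz t b b'; rewrite !(normal_form_sym a _ Uz) normal_form_linl. Qed.

Opaque normal_form riemK.

Hypothesis Gpos : forall z u, U z -> u != 0 -> 0 < bilin (pullb F K z) u u.

Lemma gauss_frame z (L : 'M[R]_(n + n)) : U z -> L *m pullb F K z *m L^T = 1%:M ->
  let x i := row i L in
  local_scalar_curvature (pullb F K) z = \sum_i \sum_j
   (riemK K (F z) (jet1 F (x j) z) (jet1 F (x i) z) (jet1 F (x i) z) (jet1 F (x j) z) +
    normal_form F K z (sff F K (x i) (x i) z) (sff F K (x j) (x j) z) -
    normal_form F K z (sff F K (x j) (x i) z) (sff F K (x i) (x j) z)).
Proof.
move=> Uz HL x; have Gunit y : U y -> pullb F K y \in unitmx.
  by move=> Uy; apply: pos_unitmx => u; exact: Gpos.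
rewrite (gauss_equation oU oW hF Ksym Kunit sK Gunit Uz).
pose T u v w s := riemK K (F z) (jet1 F u z) (jet1 F v z) (jet1 F w z) (jet1 F s z) +
    normal_form F K z (sff F K v w z) (sff F K u s z) -
    normal_form F K z (sff F K u w z) (sff F K v s z).
have Wz := (hF Uz).2.
rewrite -[RHS]/(\sum_i \sum_j T (row j L) (row i L) (row i L) (row j L)).
have := @frame_trace4 R n (pullb F K z) L T (fun u => Gpos Uz) HL; apply.
- move=> b c d; apply: lin_formB; [apply: lin_formD|].
  + by apply: lin_form_comp (riemK_lin1 _ _ _ Wz) _ => t u v; exact: jet1_lin.
  + by apply: lin_form_comp (normal_form_linr _ Uz) _ => t u v; exact: sff_linl.
  + by apply: (lin_form_comp (normal_form_linl _ _)) => t u v; exact: sff_linl.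
- move=> b c d; apply: lin_formB; [apply: lin_formD|].
  + by apply: lin_form_comp (riemK_lin2 _ _ _ Wz) _ => t u v; exact: jet1_lin.
  + by apply: (lin_form_comp (normal_form_linl _ _)) => t u v; exact: sff_linl.
  + by apply: lin_form_comp (normal_form_linr _ Uz) _ => t u v; exact: sff_linl.
- move=> b c d; apply: lin_formB; [apply: lin_formD|].
  + by apply: lin_form_comp (riemK_lin3 _ _ _ Wz) _ => t u v; exact: jet1_lin.
  + by apply: (lin_form_comp (normal_form_linl _ _)) => t u v; exact: sff_linr.
  + by apply: (lin_form_comp (normal_form_linl _ _)) => t u v; exact: sff_linr.
- move=> b c d; apply: lin_formB; [apply: lin_formD|].
  + by apply: lin_form_comp (riemK_lin4 _ _ _ Wz) _ => t u v; exact: jet1_lin.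
  + by apply: lin_form_comp (normal_form_linr _ Uz) _ => t u v; exact: sff_linr.
  + by apply: lin_form_comp (normal_form_linr _ Uz) _ => t u v; exact: sff_linr.
Qed.

End GaussKahler.
Transparent dmx bilin gam jet1 jet2 sff normal_form riemK.

(** * Kähler metrics on open subsets of complex coordinate space *)

Section KahlerMetric.
Context {R : realType}.

Record kahler_metric {N} (W : set 'rV[R]_(N + N)) (K : 'rV[R]_(N + N) -> 'M[R]_(N + N)) : Prop :=
  KahlerMetric {
  km_open : open W;
  km_sym : forall p, W p -> (K p)^T = K p;
  km_pos : forall p u, W p -> u != 0 -> 0 < bilin (K p) u u;
  km_J : forall p a b, W p -> bilin (K p) (a *m Jmx) (b *m Jmx) = bilin (K p) a b;
  km_smooth : forall i j, smooth_on W (fun z => K z i j);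
  km_closed : forall p a b c, W p ->
    let om b c y := bilin (K y) (b *m Jmx) c in
    'D_a (om b c) p + 'D_b (om c a) p + 'D_c (om a b) p = 0
}.

Section Pointwise.
Context {N : nat} (W : set 'rV[R]_(N + N)) (K : 'rV[R]_(N + N) -> 'M[R]_(N + N)).
Hypothesis HK : kahler_metric W K.
Implicit Types (p a b c f : 'rV[R]_(N + N)).

Lemma km_unit p : W p -> K p \in unitmx.
Proof. by move=> Wp; apply: pos_unitmx => u; exact: (km_pos HK). Qed.

Lemma bilin_dmx p a b c : W p -> 'D_a (fun y => bilin (K y) b c) p = bilin (dmx K a p) b c.
Proof.
move=> Wp; have H := isd_bilin (fun i j => dmx_isd (km_open HK) (km_smooth HK) i j Wp) (isd_cst b p) (isd_cst c p).
apply: etrans (@derive_val _ _ _ _ _ _ _ (isd_derive a H)) _.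
by rewrite bilin0l bilin0r !addr0.
Qed.

Lemma dmx_closed p a b c : W p ->
  bilin (dmx K a p) (b *m Jmx) c + bilin (dmx K b p) (c *m Jmx) a + bilin (dmx K c p) (a *m Jmx) b = 0.
Proof. by move=> Wp; rewrite -!bilin_dmx//; exact: (km_closed HK). Qed.

Lemma dmx_J p a b c : W p ->
  bilin (dmx K a p) (b *m Jmx) (c *m Jmx) = bilin (dmx K a p) b c.
Proof.
move=> Wp; rewrite -!bilin_dmx//; apply: near_eq_derive.
by apply: filterS (open_nbhs_nbhs (conj (km_open HK) Wp)) => y Wy; exact: (km_J HK).
Qed.

Lemma km_Jl p a b : W p -> bilin (K p) (a *m Jmx) b = - bilin (K p) a (b *m Jmx).
Proof. by move=> Wp; apply: bilinJ => u v; exact: (km_J HK). Qed.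

Lemma dmx_Jl p a b c : W p -> bilin (dmx K a p) (b *m Jmx) c = - bilin (dmx K a p) b (c *m Jmx).
Proof. by move=> Wp; apply: bilinJ => u v; exact: dmx_J. Qed.

(** This is the parallelism of J. Closedness of the Kähler form is used for (a, c, b) and for (Ja,
    b, Jc); together with the symmetry and J-invariance of the derivatives of the metric the two
    identities combine linearly to the claim. *)
Lemma chrisK_J p a b c : W p -> chrisK K p (a *m Jmx) b c = - chrisK K p a b (c *m Jmx).
Proof.
move=> Wp; have S := bilin_dmx_sym (km_open HK) (km_sym HK).
have E1 := dmx_closed a c b Wp.
have E2 := dmx_closed (a *m Jmx) b (c *m Jmx) Wp.
rewrite !JmxK !dmx_J// !bilinNl in E2.
rewrite /chrisK (dmx_Jl b a c Wp) (dmx_Jl c a b Wp).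
have E3 := dmx_Jl a c b Wp; have E4 := dmx_Jl b a c Wp; have E5 := dmx_Jl c b a Wp.
have E6 := S _ a c (b *m Jmx) Wp; have E7 := S _ b c (a *m Jmx) Wp; have E8 := S _ c b (a *m Jmx) Wp.
have E9 := S _ a (c *m Jmx) b Wp; have E10 := S _ b c (a *m Jmx) Wp; have E11 := S _ (c *m Jmx) a b Wp.
have E12 := S _ (a *m Jmx) b c Wp; have E13 := dmx_Jl c a b Wp; have E14 := S _ c a (b *m Jmx) Wp.
move: E1 E2 E3 E4 E5 E6 E7 E8 E9 E10 E11 E12 E13 E14; hide_forms; clear.
by move=> *; lra.
Qed.

Lemma gam_J p a b : W p -> gam K p (a *m Jmx) b = gam K p a b *m Jmx.
Proof.
move=> Wp; have uK := km_unit Wp.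
have H c : bilin (K p) (gam K p (a *m Jmx) b) c = bilin (K p) (gam K p a b *m Jmx) c.
  rewrite km_Jl// !(bilin_gam (km_open HK) (@km_unit) (km_smooth HK))//.
  exact: chrisK_J.
apply: (can_inj (mulmxK uK)); apply/rowP => i.
by have := H (delta_mx 0 i); rewrite /bilin trmx_delta -!colE !mxE.
Qed.

End Pointwise.
End KahlerMetric.

Section GaussFrame.
Context {R : realType} {n N : nat}.
Variables (F : 'rV[R]_(n + n) -> 'rV[R]_(N + N)) (U : set 'rV[R]_(n + n)).
Variables (K : 'rV[R]_(N + N) -> 'M[R]_(N + N)) (W : set 'rV[R]_(N + N)).
Hypothesis HK : kahler_metric W K.
Hypothesis oU : open U.
Hypothesis hF : forall z, U z -> hol F z /\ W (F z).
Implicit Types (z u v w : 'rV[R]_(n + n)) (p a b c f : 'rV[R]_(N + N)).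

Lemma jet1_J u z : U z -> jet1 F (u *m Jmx) z = jet1 F u z *m Jmx.
Proof. by move=> Uz; rewrite /jet1 -!mulmxA (cdiff_J (hol_cdiff (hF Uz).1)). Qed.

Lemma jet2_J u v z : U z -> jet2 F (u *m Jmx) v z = jet2 F u v z *m Jmx.
Proof.
move=> Uz; have /hol_cdiff h := hol_jac v (hF Uz).1.
by rewrite /jet2 -!mulmxA -(cdiff_J h).
Qed.

Lemma sff_J u v z : U z -> sff F K (u *m Jmx) v z = sff F K u v z *m Jmx.
Proof.
move=> Uz; have E1 := gam_J HK (jet1 F u z) (jet1 F v z) (hF Uz).2.
rewrite -(jet1_J u Uz) in E1; rewrite /sff E1 (jet2_J u v Uz).
by rewrite mulmxDl.
Qed.

(** The trace of [sff] over a vector and its image under J vanishes: complex submanifolds are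
    minimal. *)
Lemma sff_JJ u z : U z -> sff F K (u *m Jmx) (u *m Jmx) z = - sff F K u u z.
Proof.
move=> Uz; have s := sff_sym (km_open HK) hF (km_sym HK).
by rewrite sff_J// s// sff_J// JmxK.
Qed.

Lemma pullb_J z u v : U z -> bilin (pullb F K z) (u *m Jmx) (v *m Jmx) = bilin (pullb F K z) u v.
Proof. by move=> Uz; rewrite !pullb_bilin !jet1_J// (km_J HK)//; exact: (hF Uz).2. Qed.

Lemma dmx_pullb u v w z : U z -> 'D_u (fun y => bilin (pullb F K y) v w) z =
  bilin (dmx K (jet1 F u z) (F z)) (jet1 F v z) (jet1 F w z) +
  bilin (K (F z)) (jet2 F u v z) (jet1 F w z) + bilin (K (F z)) (jet1 F v z) (jet2 F u w z).
Proof.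
move=> Uz; have -> : (fun y => bilin (pullb F K y) v w) = (fun y => bilin (K (F y)) (jet1 F v y) (jet1 F w y)).
  by apply/funext => y; rewrite pullb_bilin.
have H := isd_bilin (fun i j => KF_isd (km_open HK) hF (km_smooth HK) i j Uz) (jet1_isd hF v Uz) (jet1_isd hF w Uz).
exact: (@derive_val _ _ _ _ _ _ _ (isd_derive u H)).
Qed.

(** Only closedness needs an argument. Differentiating the pulled back form produces the ambient
    exterior derivative, which vanishes, and terms with second derivatives of [F], which cancel in
    the cyclic sum by their symmetry. *)
Lemma pullb_kahler : (forall z u, U z -> u != 0 -> u *m jac F z != 0) -> kahler_metric U (pullb F K).
Proof.
move=> inj; split => //.
- by move=> z Uz; exact: (pullb_sym hF (km_sym HK)).
- by move=> z u Uz u0; rewrite pullb_bilin; apply: (km_pos HK); [exact: (hF Uz).2|exact: inj].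
- by move=> z u v Uz; exact: pullb_J.
- by move=> i j; exact: (pullb_smooth oU (km_open HK) hF (km_smooth HK)).
move=> z u v w Uz om; have Wz := (hF Uz).2.
have E x y t : 'D_x (om y t) z = bilin (dmx K (jet1 F x z) (F z)) (jet1 F y z *m Jmx) (jet1 F t z) +
    bilin (K (F z)) (jet2 F x y z *m Jmx) (jet1 F t z) - bilin (K (F z)) (jet2 F x t z *m Jmx) (jet1 F y z).
  rewrite /om dmx_pullb//.
  have -> : jet2 F x (y *m Jmx) z = jet2 F x y z *m Jmx.
    by rewrite (jet2_sym hF x _ Uz) (jet2_J y x Uz) (jet2_sym hF y x Uz).
  rewrite (jet1_J y Uz); congr (_ + _).
  move: (km_Jl HK (jet2 F x t z) (jet1 F y z) Wz).
  move: (bilin_sym (jet1 F y z *m Jmx) (jet2 F x t z) (km_sym HK Wz)).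
  by hide_forms; move=> *; lra.
rewrite !E; have C := dmx_closed HK (jet1 F u z) (jet1 F v z) (jet1 F w z) Wz.
rewrite (jet2_sym hF v u Uz) (jet2_sym hF w u Uz) (jet2_sym hF w v Uz).
move: C; hide_forms; move=> *; lra.
Qed.

Hypothesis inj : forall z u, U z -> u != 0 -> u *m jac F z != 0.

Lemma gauss_kahler z (L : 'M[R]_(n + n)) : U z -> L *m pullb F K z *m L^T = 1%:M ->
  Jmx *m L = L *m Jmx ->
  let x i := row i L in
  local_scalar_curvature (pullb F K) z = \sum_i \sum_j
   (riemK K (F z) (jet1 F (x j) z) (jet1 F (x i) z) (jet1 F (x i) z) (jet1 F (x j) z) -
    normal_form F K z (sff F K (x i) (x j) z) (sff F K (x i) (x j) z)).
Proof.
move=> Uz HL JL x; have HG := pullb_kahler inj.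
have lin := normal_form_linl.
rewrite (gauss_frame oU (km_open HK) hF (km_sym HK) (km_pos HK) (km_smooth HK) (km_pos HG) Uz HL).
pose rr i j := riemK K (F z) (jet1 F (x j) z) (jet1 F (x i) z) (jet1 F (x i) z) (jet1 F (x j) z).
pose t1 i j := normal_form F K z (sff F K (x i) (x i) z) (sff F K (x j) (x j) z).
pose t2 i j := normal_form F K z (sff F K (x i) (x j) z) (sff F K (x i) (x j) z).
(* The second half of the frame consists of the images of the first half under J, and [sff_JJ] makes
   the two halves cancel. *)
have t20 : \sum_i \sum_j t1 i j = 0.
  have lr := normal_form_linr hF (km_sym HK) _ Uz.
  rewrite big_split_ord/= [X in _ + X](_ : _ = - \sum_i \sum_j t1 (lshift n i) j) ?subrr//.
  rewrite -sumrN; apply: eq_bigr => i _; rewrite -sumrN; apply: eq_bigr => j _.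
  rewrite /t1; have -> : x (rshift n i) = x (lshift n i) *m Jmx.
    rewrite /x !rowE -mulmxA -JL mulmxA; congr (_ *m _).
    have -> : delta_mx 0 (lshift n i) = row_mx (delta_mx 0 i) 0 :> 'rV[R]_(n + n).
      by rewrite delta_mx_lshift.
    by rewrite JmxE oppr0 delta_mx_rshift.
  rewrite sff_JJ//; have := lin R n N F K z (sff F K (x j) (x j) z) (-1) (sff F K (x (lshift n i)) (x (lshift n i)) z) 0.
  have /= := lin R n N F K z (sff F K (x j) (x j) z) 1 0 0.
  rewrite !scaler0 !addr0 scaleN1r mul1r => /eqP; rewrite -subr_eq subrr eq_sym => /eqP ->.
  by rewrite addr0 mulN1r.
transitivity (\sum_i \sum_j (rr i j + t1 i j - t2 i j)).
  apply: eq_bigr => i _; apply: eq_bigr => j _; congr (_ - _).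
  by rewrite /t2 (sff_sym (km_open HK) hF (km_sym HK) (x i) (x j) Uz).
transitivity (\sum_i \sum_j (rr i j - t2 i j) + \sum_i \sum_j t1 i j); last by rewrite t20 addr0.
rewrite -big_split/=; apply: eq_bigr => i _; rewrite -big_split/=; apply: eq_bigr => j _.
by rewrite addrAC.
Qed.

Lemma normal_formE z a b : normal_form F K z a b = bilin (K (F z)) a b -
  (a *m K (F z) *m (jac F z)^T *m invmx (pullb F K z) *m (b *m K (F z) *m (jac F z)^T)^T) 0 0.
Proof.
rewrite /normal_form; congr (_ - _).
set al := a *m K (F z) *m (jac F z)^T; set be := b *m K (F z) *m (jac F z)^T.
have E c d : bilin (K (F z)) c (jet1 F (delta_mx 0 d) z) = (c *m K (F z) *m (jac F z)^T) 0 d.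
  by rewrite /bilin /jet1 trmx_mul mulmxA trmx_delta -colE mxE.
rewrite -/(bilin (invmx (pullb F K z)) al be) bilinE; apply: eq_bigr => d _; apply: eq_bigr => e _.
by rewrite !E -/al -/be; move: (al 0 d) (be 0 e) => x y; ring.
Qed.

(** [tau] is the coordinate vector of the orthogonal projection of [a] to the tangent space. Hence
    the diagonal of [normal_form] is the square length of the normal component, and in particular it
    is nonnegative. *)
Lemma normal_form_self z a : U z -> let tau := a *m K (F z) *m (jac F z)^T *m invmx (pullb F K z) in
  normal_form F K z a a = bilin (K (F z)) (a - tau *m jac F z) (a - tau *m jac F z).
Proof.
move=> Uz tau; have HG := pullb_kahler inj; have uG := km_unit HG Uz.
rewrite normal_formE; set al := a *m K (F z) *m (jac F z)^T.
have E1 : bilin (K (F z)) a (tau *m jac F z) = (tau *m al^T) 0 0.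
  rewrite (bilin_sym _ _ (km_sym HK (hF Uz).2)) /bilin /al !trmx_mul trmxK (km_sym HK (hF Uz).2).
  by rewrite !mulmxA.
have E2 : bilin (K (F z)) (tau *m jac F z) (tau *m jac F z) = (tau *m al^T) 0 0.
  rewrite bilin_mulmx -/(pullb F K z) /bilin {1}/tau -/al mulmxKV// /tau -/al trmx_mul.
  have -> : (invmx (pullb F K z))^T = invmx (pullb F K z) by rewrite trmx_inv (km_sym HG Uz).
  by rewrite mulmxA.
rewrite bilinBl !bilinBr (bilin_sym (tau *m jac F z) a (km_sym HK (hF Uz).2)) E1 E2 -/tau.
by move: ((tau *m al^T) 0 0) (bilin _ _ _) => x y; ring.
Qed.

End GaussFrame.

(** * Independence of the scalar curvature from the chart *)

Section ChartInvariance.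
Context {R : realType} {n : nat}.

Lemma near_christoffel {m} (G G' : 'rV[R]_m -> 'M[R]_m) (U : set 'rV[R]_m) d a b z :
  open U -> (forall y, U y -> G y = G' y) -> U z -> christoffel G d a b z = christoffel G' d a b z.
Proof.
move=> oU E Uz; rewrite /christoffel; congr (_ * _); apply: eq_bigr => e _.
have P c i j : partial c (fun y => G y i j) z = partial c (fun y => G' y i j) z.
  by apply: near_eq_derive; apply: filterS (open_nbhs_nbhs (conj oU Uz)) => y Uy; rewrite E.
by rewrite E// !P.
Qed.

Lemma local_scalar_curvature_eq {m} (G G' : 'rV[R]_m -> 'M[R]_m) (U : set 'rV[R]_m) z :
  open U -> (forall y, U y -> G y = G' y) -> U z ->
  local_scalar_curvature G z = local_scalar_curvature G' z.
Proof.
move=> oU E Uz; apply: eq_bigr => b _; apply: eq_bigr => c _.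
apply: f_equal2; first by rewrite (E z Uz).
apply: eq_bigr => a _.
have H1 d a' b' c' : partial a' (christoffel G d b' c') z = partial a' (christoffel G' d b' c') z.
  by apply: near_eq_derive; apply: filterS (open_nbhs_nbhs (conj oU Uz)) => y Uy; exact: near_christoffel oU E Uy.
have H2 : \sum_(e < m) (christoffel G a a e z * christoffel G e b c z - christoffel G a b e z * christoffel G e a c z) =
  \sum_(e < m) (christoffel G' a a e z * christoffel G' e b c z - christoffel G' a b e z * christoffel G' e a c z).
  by apply: eq_bigr => e _; rewrite !(near_christoffel _ _ _ oU E Uz).
exact: (f_equal2 (fun x y => x + y) (f_equal2 (fun x y => x - y) (H1 a a b c) (H1 a b a c)) H2).
Qed.

Variables (F : 'rV[R]_(n + n) -> 'rV[R]_(n + n)) (U : set 'rV[R]_(n + n)).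
Variables (K : 'rV[R]_(n + n) -> 'M[R]_(n + n)) (W : set 'rV[R]_(n + n)).
Hypothesis HK : kahler_metric W K.

(** In equal dimensions every ambient vector is tangent, so no normal component is left. *)
Lemma normal_form_square (f : 'rV[R]_(n + n) -> 'rV[R]_(n + n)) z a b :
  jac f z \in unitmx -> K (f z) \in unitmx -> (K (f z))^T = K (f z) -> normal_form f K z a b = 0.
Proof.
move=> uD uK sK; rewrite normal_formE !trmx_mul trmxK sK !mulmxA.
set D := jac f z.
have uG : pullb f K z \in unitmx by rewrite /pullb -/D !unitmx_mul uD uK unitmx_tr uD.
have E : K (f z) *m D^T *m invmx (pullb f K z) *m D = 1%:M.
  by apply: mulmx1C; rewrite !mulmxA mulmxV.
rewrite -(mulmxA a) -(mulmxA a) -(mulmxA a) E mulmx1.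
by rewrite subrr.
Qed.

Hypothesis oU : open U.
Hypothesis hF : forall z, U z -> hol F z /\ W (F z).
Hypothesis uF : forall z, U z -> jac F z \in unitmx.

(** The Gauss equation is applied twice, to [F] with the frame [L] and to the identity with the
    image frame [L *m jac F z]. Both normal terms vanish, and both sides become the same trace of
    [riemK]. The transformation law of Christoffel symbols is thus avoided. *)
Lemma scalar_chart_change z : U z ->
  local_scalar_curvature (pullb F K) z = local_scalar_curvature K (F z).
Proof.
move=> Uz; have Wz := (hF Uz).2.
have inj y (u : 'rV[R]_(n + n)) : U y -> u != 0 -> u *m jac F y != 0.
  by move=> Uy; apply: contra => /eqP e; rewrite -[u](mulmxK (uF Uy)) e mul0mx.
have HG := pullb_kahler HK oU hF inj.
have [L [HL JL]] := unitary_frame (km_sym HG Uz) (fun u v => km_J HG u v Uz) (fun u => km_pos HG Uz).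
have idD (y : 'rV[R]_(n + n)) : jac id y = 1%:M.
  by apply: jac_isD; apply: isd_ext (isd_id y) => v; rewrite mulmx1.
have hid : forall y, W y -> hol id y /\ W (id y).
  move=> y Wy; split => //; have [+ _] := @hol_affine R n n 1%:M 0 y (etrans (mulmx1 _) (esym (mul1mx _))).
  by apply: hol_near_eq ltr01 _ => x _; rewrite mulmx1 addr0.
have idK : pullb id K = K by apply/funext => y; rewrite /pullb idD mul1mx trmx1 mulmx1.
have idinj y (u : 'rV[R]_(n + n)) : W y -> u != 0 -> u *m jac id y != 0 by rewrite idD mulmx1.
rewrite (gauss_kahler HK oU hF inj Uz HL JL).
have HL2 : (L *m jac F z) *m pullb id K (F z) *m (L *m jac F z)^T = 1%:M.
  by rewrite idK -HL /pullb trmx_mul !mulmxA.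
have JL2 : Jmx *m (L *m jac F z) = (L *m jac F z) *m Jmx.
  by rewrite mulmxA JL -!mulmxA (cdiff_J (hol_cdiff (hF Uz).1)).
have := gauss_kahler HK (km_open HK) hid idinj Wz HL2 JL2; rewrite idK => ->.
apply: eq_bigr => i _; apply: eq_bigr => j _.
have uK := km_unit HK Wz; have sK := km_sym HK Wz.
have Z1 a b : normal_form F K z a b = 0 := normal_form_square a b (uF Uz) uK sK.
have Z2 a b : normal_form id K (F z) a b = 0.
  by apply: normal_form_square; rewrite // idD unitmx1.
apply: etrans (f_equal2 (fun x y => x - y) erefl (Z1 _ _)) _; apply: esym.
apply: etrans (f_equal2 (fun x y => x - y) erefl (Z2 _ _)) _; apply: esym.
have E k : jet1 id (row k (L *m jac F z)) (F z) = jet1 F (row k L) z.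
  by rewrite /jet1 idD mulmx1 row_mul.
by rewrite !E.
Qed.

End ChartInvariance.

(** * Bounds for a metric near a point *)

Section LocalBounds.
Context {R : realType} {N : nat}.
Variables (W : set 'rV[R]_(N + N)) (K : 'rV[R]_(N + N) -> 'M[R]_(N + N)).
Hypothesis HK : kahler_metric W K.
Implicit Types (p a b c f : 'rV[R]_(N + N)).

(** These are the only data of the ambient metric that enter the constants of the graphs. The lower
    bound has [C] on the side of the form, so that every clause survives an increase of [C]. *)
Record metric_bounds (C : R) p : Prop := MetricBounds {
  mb_in : W p;
  mb_upper : forall a b, `|bilin (K p) a b| <= C * `|a| * `|b|;
  mb_lower : forall a, `|a| ^+ 2 <= C * bilin (K p) a a;
  mb_gam : forall a b, `|gam K p a b| <= C * `|a| * `|b|;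
  mb_riem : forall a b c f, `|riemK K p a b c f| <= C * `|a| * `|b| * `|c| * `|f|
}.

Lemma lin_form_bound {m} (f : 'rV[R]_m -> R) e : lin_form f -> 0 <= e ->
  (forall i, `|f (delta_mx 0 i)| <= e) -> forall u, `|f u| <= m%:R * e * `|u|.
Proof.
move=> Lf e0 H u; rewrite (lin_formE u Lf) (le_trans (ler_norm_sum _ _ _))//.
rewrite -mulrA mulr_natl -[X in _ *+ X]card_ord -sumr_const.
by apply: ler_sum => i _; rewrite normrM mulrC ler_pM// coord_le_norm.
Qed.

Lemma bilin_linl {m} (A : 'M[R]_m) v : lin_form (fun u => bilin A u v).
Proof. by move=> t x y; rewrite bilinDl bilinZl. Qed.

Lemma bilin_linr {m} (A : 'M[R]_m) u : lin_form (bilin A u).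
Proof. by move=> t x y; rewrite bilinDr bilinZr. Qed.

Lemma bilin_bound {m} (A : 'M[R]_m) e : 0 <= e -> (forall i j, `|A i j| <= e) ->
  forall u v, `|bilin A u v| <= m%:R * (m%:R * e) * `|u| * `|v|.
Proof.
move=> e0 H u v.
have H1 j : `|bilin A u (delta_mx 0 j)| <= m%:R * e * `|u|.
  apply: (lin_form_bound (bilin_linl A _) e0) => i; rewrite bilin_delta; exact: H.
have := lin_form_bound (bilin_linr A u) _ H1; rewrite !mulr_ge0// => /(_ isT v).
by rewrite !mulrA.
Qed.

Lemma differentiable_bilin {V : normedModType R} {m} (A : V -> 'M[R]_m) (u v : V -> 'rV[R]_m) z :
  (forall i j, differentiable (fun x => A x i j) z) ->
  (forall i, differentiable (fun x => u x 0 i) z) -> (forall i, differentiable (fun x => v x 0 i) z) ->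
  differentiable (fun x => bilin (A x) (u x) (v x)) z.
Proof.
move=> dA du dv.
have -> : (fun x => bilin (A x) (u x) (v x)) = (fun x => \sum_i \sum_j u x 0 i * A x i j * v x 0 j).
  by apply/funext => x; rewrite bilinE.
apply: differentiable_bigsum => i; apply: differentiable_bigsum => j.
exact: (differentiableM (differentiableM (du i) (dA i j)) (dv j)).
Qed.

Lemma dmx_diff a p i j : W p -> differentiable (fun q => dmx K a q i j) p.
Proof. by move=> Wp; exact: smooth_differentiable (km_open HK) (K_smooth_d (km_smooth HK) i j a) Wp. Qed.

Lemma dmx2_diff a b p i j : W p -> differentiable (fun q => dmx (dmx K a) b q i j) p.
Proof.
move=> Wp; apply: smooth_differentiable (km_open HK) _ Wp.
by apply: K_smooth_d => k l; exact: K_smooth_d (km_smooth HK) k l a.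
Qed.

Lemma chrisK_diff a b c p : W p -> differentiable (fun q => chrisK K q a b c) p.
Proof.
move=> Wp; apply: differentiable_Ml; apply: differentiableB; first apply: differentiableD.
all: by apply: differentiable_bilin => // i j; exact: dmx_diff.
Qed.

Lemma dchrisK_diff f a b c p : W p -> differentiable (fun q => dchrisK K q f a b c) p.
Proof.
move=> Wp; apply: differentiable_Ml; apply: differentiableB; first apply: differentiableD.
all: by apply: differentiable_bilin => // i j; exact: dmx2_diff.
Qed.

Lemma gam_diff a b p i : W p -> differentiable (fun q => gam K q a b 0 i) p.
Proof.
move=> Wp; have -> : (fun q => gam K q a b 0 i) =
    (fun q => \sum_j chrisK K q a b (delta_mx 0 j) * invmx (K q) j i).
  by apply/funext => q; rewrite /gam mxE; apply: eq_bigr => j _; rewrite mxE.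
apply: differentiable_bigsum => j; apply: differentiableM; first exact: chrisK_diff.
have dK k l : differentiable (fun q => K q k l) p := K_diff (km_open HK) (km_smooth HK) k l Wp.
apply: (differentiable_invmx dK).
have : \forall y \near p, W y := open_nbhs_nbhs (conj (km_open HK) Wp).
by apply: filterS => y Wy; exact: (km_unit HK Wy).
Qed.

Lemma riemK_diff a b c f p : W p -> differentiable (fun q => riemK K q a b c f) p.
Proof.
move=> Wp; have dK i j : differentiable (fun q => K q i j) p := K_diff (km_open HK) (km_smooth HK) i j Wp.
apply: differentiableD; first apply: differentiableB; first apply: differentiableB.
- exact: dchrisK_diff.
- exact: dchrisK_diff.
- by apply: differentiable_bilin => // i; exact: gam_diff.
- by apply: differentiable_bilin => // i; exact: gam_diff.
Qed.

Lemma near_bounded (f : 'rV[R]_(N + N) -> R) p : differentiable f p ->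
  exists2 C, 0 <= C & \forall q \near p, `|f q| <= C.
Proof.
move=> /differentiable_continuous cf; exists (`|f p| + 1); first by rewrite addr_ge0.
have : \forall q \near p, `|f q - f p| < 1.
  have /cvgrPdist_lt /(_ 1 ltr01) H := cf; apply: filterS H => q; by rewrite distrC.
apply: filterS => q H; rewrite -[f q](subrK (f p)) (le_trans (ler_normD _ _))// addrC lerD2l.
exact: ltW.
Qed.

Lemma near_bounded_fin (I : finType) (f : I -> 'rV[R]_(N + N) -> R) p :
  (forall i, differentiable (f i) p) ->
  exists2 C, 0 <= C & \forall q \near p, forall i, `|f i q| <= C.
Proof.
move=> H; have /choice [C HC] : forall i, exists C : R, 0 <= C /\ \forall q \near p, `|f i q| <= C.
  by move=> i; have [C C0 HC] := near_bounded (H i); exists C.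
exists (\sum_i C i); first by apply: sumr_ge0 => i _; exact: (HC i).1.
have : \forall q \near p, forall i, `|f i q| <= C i by apply: (@filter_forall _ _ (fun i q => `|f i q| <= C i) _ (nbhs_filter p)) => i; exact: (HC i).2.
apply: filterS => q Hq i; rewrite (le_trans (Hq i))// (bigD1 i)//= lerDl.
by apply: sumr_ge0 => j _; exact: (HC j).1.
Qed.

(** In the coordinates of a unitary frame the form is a sum of squares, and returning to the
    standard coordinates is a bounded linear map. *)
Lemma metric_lower_at (G : 'M[R]_(N + N)) : G^T = G ->
  (forall u v, bilin G (u *m Jmx) (v *m Jmx) = bilin G u v) -> (forall u, u != 0 -> 0 < bilin G u u) ->
  exists2 C, 0 < C & forall a, `|a| ^+ 2 <= C * bilin G a a.
Proof.
move=> Gs GJ Gp; have [L [HL _]] := unitary_frame Gs GJ Gp.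
have [C C0 HC] := mulmx_bounded L.
have inv := frame_inverse Gp HL; have uG := pos_unitmx Gp.
exists (C ^+ 2); first by rewrite exprn_gt0.
move=> a; pose b := a *m G *m L^T.
have aE : a = b *m L by rewrite /b -!mulmxA -inv mulmxV// mulmx1.
have bb : bilin G a a = \sum_i b 0 i ^+ 2.
  have -> : bilin G a a = (b *m b^T) 0 0.
    by rewrite /bilin {2}aE /b !trmx_mul trmxK Gs !mulmxA.
  by move: b {aE} => b; rewrite mxE; apply: eq_bigr => i _; rewrite mxE expr2.
have b0 : 0 <= bilin G a a by rewrite bb sumr_ge0// => i _; rewrite sqr_ge0.
have bn : `|b| <= Num.sqrt (bilin G a a).
  apply: norm_rV_le => [|i]; first exact: sqrtr_ge0.
  rewrite -sqrtr_sqr ler_wsqrtr// bb (bigD1 i)//= lerDl sumr_ge0// => j _; exact: sqr_ge0.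
have : `|a| <= C * Num.sqrt (bilin G a a).
  by rewrite {1}aE (le_trans (HC b))// ler_pM2l.
move=> /(fun h => lerXn2r 2 (normr_ge0 a) (mulr_ge0 (ltW C0) (sqrtr_ge0 _)) h).
by rewrite exprMn sqr_sqrtr.
Qed.

Lemma absorb (k c : R) : 0 <= k -> 0 < c -> k * (k * (2 * c * (k * k + 1))^-1) * (2 * c) <= 1.
Proof.
move=> k0 c0; have k1 : 0 < k * k + 1 by rewrite ltr_wpDl// mulr_ge0.
have -> : k * (k * (2 * c * (k * k + 1))^-1) * (2 * c) = k * k / (k * k + 1).
  by field; rewrite !gt_eqF.
by rewrite ler_pdivrMr// mul1r lerDl.
Qed.

Local Notation e i := (delta_mx 0 i : 'rV[R]_(N + N)).

Lemma metric_bounds_near p0 : W p0 -> exists r C, [/\ 0 < r, 0 < C &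
  forall p, `|p - p0| < r -> metric_bounds C p].
Proof.
move=> Wp; have oW := km_open HK.
have dK (ij : 'I_(N + N) * 'I_(N + N)) : differentiable (fun q => K q ij.1 ij.2) p0 :=
  K_diff (km_open HK) (km_smooth HK) ij.1 ij.2 Wp.
have [C1 C10 H1] := near_bounded_fin dK.
have [C2 C20 H2] := @near_bounded_fin _ (fun (t : 'I_(N + N) * 'I_(N + N) * 'I_(N + N)) q => gam K q (e t.1.1) (e t.1.2) 0 t.2) p0
   (fun t => gam_diff (e t.1.1) (e t.1.2) t.2 Wp).
have [C3 C30 H3] := @near_bounded_fin _ (fun (t : ('I_(N + N) * 'I_(N + N)) * ('I_(N + N) * 'I_(N + N))) q =>
   riemK K q (e t.1.1) (e t.1.2) (e t.2.1) (e t.2.2)) p0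
   (fun t => riemK_diff (e t.1.1) (e t.1.2) (e t.2.1) (e t.2.2) Wp).
have [C4 C40 H4] := metric_lower_at (km_sym HK Wp) (fun u v => km_J HK u v Wp) (fun u => km_pos HK Wp).
pose k : R := (N + N)%:R; have k0 : 0 <= k by exact: ler0n.
(* [eps] is so small that the change of the form between [p0] and [q] costs at most half of the
   lower bound at [p0]; this replaces [C4] by [2 * C4]. *)
pose eps := (2 * C4 * (k * k + 1))^-1.
have eps0 : 0 < eps by rewrite invr_gt0 !mulr_gt0// ltr_wpDl// mulr_ge0.
have H5 : \forall q \near p0, forall ij : 'I_(N + N) * 'I_(N + N), `|K q ij.1 ij.2 - K p0 ij.1 ij.2| <= eps.
  apply: (@filter_forall _ _ (fun (ij : 'I_(N + N) * 'I_(N + N)) q => `|K q ij.1 ij.2 - K p0 ij.1 ij.2| <= eps) _ (nbhs_filter p0)) => ij; have /differentiable_continuous := dK ij.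
  move=> /cvgrPdist_lt /(_ eps eps0); apply: filterS => q; rewrite distrC; exact: ltW.
have /near_ballP [r r0 Hr] : \forall q \near p0, metric_bounds
    (k * (k * C1) + 2 * C4 + k * (k * C2) + k * (k * (k * (k * C3)))) q; last first.
  by exists r, (k * (k * C1) + 2 * C4 + k * (k * C2) + k * (k * (k * (k * C3)))); split => //;
    apply: ltr_wpDr; [do ?apply: mulr_ge0|apply: ltr_wpDr; [do ?apply: mulr_ge0|apply: ltr_wpDl; [do ?apply: mulr_ge0|rewrite mulr_gt0]]].
have c1 : 0 <= k * (k * C1) by do ?apply: mulr_ge0.
have c2 : 0 <= k * (k * C2) by do ?apply: mulr_ge0.
have c3 : 0 <= k * (k * (k * (k * C3))) by do ?apply: mulr_ge0.
have c4 : 0 <= 2 * C4 by rewrite mulr_ge0// ltW.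
near=> q.
have Wq : W q by near: q; exact: open_nbhs_nbhs.
have q1 : forall i, `|K q i.1 i.2| <= C1 by near: q.
have q2 : forall t : 'I_(N + N) * 'I_(N + N) * 'I_(N + N), `|gam K q (e t.1.1) (e t.1.2) 0 t.2| <= C2 by near: q.
have q3 : forall t : ('I_(N + N) * 'I_(N + N)) * ('I_(N + N) * 'I_(N + N)),
   `|riemK K q (e t.1.1) (e t.1.2) (e t.2.1) (e t.2.2)| <= C3 by near: q.
have q5 : forall ij : 'I_(N + N) * 'I_(N + N), `|K q ij.1 ij.2 - K p0 ij.1 ij.2| <= eps by near: q.
have Ksym := km_sym HK; have sK := km_smooth HK.
split => //.
- move=> a b; have := bilin_bound C10 (fun i j => q1 (i, j)) a b.
  move=> /le_trans; apply; rewrite -/k ler_wpM2r// ler_wpM2r//.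
  by move: c1 c2 c3 c4; clear; lra.
- move=> a; have h0 := H4 a.
  have h1 := bilin_bound (A := K q - K p0) (ltW eps0) (fun i j => _).
  have {}h1 : `|bilin (K q - K p0) a a| <= k * (k * eps) * `|a| * `|a|.
    by apply: h1 => i j; rewrite !mxE; exact: (q5 (i, j)).
  have E : bilin (K q - K p0) a a = bilin (K q) a a - bilin (K p0) a a.
    by rewrite bilin_mxD -scaleN1r bilin_mxZ mulN1r.
  rewrite E -mulrA -expr2 in h1.
  have h2 : k * (k * eps) * (2 * C4) <= 1.
    exact: absorb.
  have h3 : 0 <= k * (k * eps) by do ?apply: mulr_ge0 => //; exact: ltW.
  have h4 := sqr_ge0 `|a|.
  have h6 : 0 <= bilin (K q) a a.
    by have [->|a0] := eqVneq a 0; [rewrite bilin0l|exact: ltW (km_pos HK Wq a0)].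
  suff : `|a| ^+ 2 <= 2 * C4 * bilin (K q) a a.
    move=> /le_trans; apply; rewrite ler_wpM2r//; move: c1 c2 c3 c4; clear; lra.
  move: h0 h1 h2 h3 h4 h6 C40; move: (bilin (K q) a a) (bilin (K p0) a a) (`|a| ^+ 2) (k * (k * eps)).
  clear => x y s t h0 h1 h2 h3 h4 h6 C40.
  have : y - x <= t * s by rewrite (le_trans _ h1)// distrC ler_norm.
  by move=> h; nra.
- move=> a b; apply: norm_rV_le => [|i].
    by rewrite !mulr_ge0// !addr_ge0.
  have L1 v : lin_form (fun u => gam K q u v 0 i).
    move=> t x y; have := gam_linl oW sK t x y v Wq; move: (gam _ _ _ _) (gam _ _ x _) (gam _ _ _ _) => g1 g2 g3 ->.
    by rewrite !mxE.
  have L2 u : lin_form (fun v => gam K q u v 0 i).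
    move=> t x y; have := gam_linr oW Ksym sK t x y u Wq; move: (gam _ _ _ _) (gam _ _ _ x) (gam _ _ _ _) => g1 g2 g3 ->.
    by rewrite !mxE.
  have B1 j : `|gam K q a (e j) 0 i| <= k * C2 * `|a|.
    exact: (lin_form_bound (L1 (e j)) C20 (fun l => q2 (l, j, i))).
  have := lin_form_bound (L2 a) _ B1 b; rewrite !mulr_ge0// => /(_ isT).
  move=> /le_trans; apply; rewrite !mulrA -/k ler_wpM2r// ler_wpM2r// -!mulrA.
  by move: c1 c2 c3 c4; clear; lra.
- move=> a b c f.
  have q4 i1 i2 i3 i4 : `|riemK K q (e i1) (e i2) (e i3) (e i4)| <= C3.
    by have := q3 ((i1, i2), (i3, i4)).
  have r1 i j l : `|riemK K q a (e i) (e j) (e l)| <= k * C3 * `|a|.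
    have L1 := riemK_lin1 oW sK (e i) (e j) (e l) Wq.
    exact: (lin_form_bound L1 C30 (fun t => q4 t i j l) a).
  have r2 j l : `|riemK K q a b (e j) (e l)| <= k * (k * C3 * `|a|) * `|b|.
    by apply: (lin_form_bound (riemK_lin2 oW sK a (e j) (e l) Wq)) => [|t]; [rewrite !mulr_ge0|exact: r1].
  have r3 l : `|riemK K q a b c (e l)| <= k * (k * (k * C3 * `|a|) * `|b|) * `|c|.
    by apply: (lin_form_bound (riemK_lin3 oW Ksym sK a b (e l) Wq)) => [|t]; [rewrite !mulr_ge0|exact: r2].
  have r4 : `|riemK K q a b c f| <= k * (k * (k * (k * C3 * `|a|) * `|b|) * `|c|) * `|f|.
    by apply: (lin_form_bound (riemK_lin4 oW Ksym sK a b c Wq)) => [|t]; [rewrite !mulr_ge0|exact: r3].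
  apply: (le_trans r4); rewrite ler_wpM2r//.
  have -> : k * (k * (k * (k * C3 * `|a|) * `|b|) * `|c|) = k * (k * (k * (k * C3))) * `|a| * `|b| * `|c|.
    by move: (k * C3) => x; ring.
  rewrite ler_wpM2r// ler_wpM2r// ler_wpM2r//.
  by move: c1 c2 c3 c4; clear; lra.
Unshelve. all: by end_near.
Qed.

End LocalBounds.

(** * A priori bound for second derivatives *)

Lemma frame_expand {R : realType} {n} (G L : 'M[R]_(n + n)) (x : 'rV[R]_(n + n)) :
  (forall u, u != 0 -> 0 < bilin G u u) -> L *m G *m L^T = 1%:M ->
  x = \sum_l bilin G x (row l L) *: row l L.
Proof.
move=> Gp HL; have inv := frame_inverse Gp HL; have uG := pos_unitmx Gp.
have {1}-> : x = (x *m G *m L^T) *m L by rewrite -!mulmxA -inv mulmxV// mulmx1.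
rewrite {1}(mulmx_sum_row _ L); apply: eq_bigr => l _; congr (_ *: _).
by rewrite /bilin tr_row colE !mulmxA -colE [in RHS]mxE.
Qed.

Lemma le_sqr_add1 {R : realType} (a b : R) : a ^+ 2 <= b -> a <= b + 1.
Proof. by move=> h; nra. Qed.

(** Here [D] is the tangent map, [j] a second derivative, [g] its Christoffel correction and [w] the
    normal component of [j + g]. Since [P] inverts [D] and kills [j], applying it determines the
    tangential coordinates [tau], and then [j] is recovered from [w] and [g]. *)
Lemma section_solve {R : realType} {m k} (P : 'M[R]_(k, m)) (D : 'M[R]_(m, k))
    (j g w : 'rV[R]_k) (tau : 'rV[R]_m) : D *m P = 1%:M -> j *m P = 0 -> w = j + g - tau *m D ->
  tau = g *m P - w *m P /\ j = w - g + tau *m D.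
Proof.
move=> DP jP ->; split; last by rewrite addrAC subrK addrK.
by rewrite mulmxBl mulmxDl -mulmxA DP mulmx1 jP add0r opprB addrCA subrr addr0.
Qed.

Section SecondDerivativeBound.
Context {R : realType} {n N : nat}.
Variables (F : 'rV[R]_(n + n) -> 'rV[R]_(N + N)) (U : set 'rV[R]_(n + n)).
Variables (K : 'rV[R]_(N + N) -> 'M[R]_(N + N)) (W : set 'rV[R]_(N + N)).
Hypothesis HK : kahler_metric W K.
Hypothesis oU : open U.
Hypothesis hF : forall z, U z -> hol F z /\ W (F z).
Variable P : 'M[R]_(N + N, n + n).
Hypothesis FP : forall y, U y -> jac F y *m P = 1%:M.
Variables (C La R0 : R).
Hypothesis C0 : 0 < C.
Hypothesis La0 : 0 < La.
Hypothesis boundP : forall w : 'rV[R]_(N + N), `|w *m P| <= La * `|w|.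
Variable z : 'rV[R]_(n + n).
Hypothesis Uz : U z.
Hypothesis Hb : metric_bounds W K C (F z).
Hypothesis boundD : forall v : 'rV[R]_(n + n), `|v *m jac F z| <= La * `|v|.
Hypothesis scal : R0 <= local_scalar_curvature (pullb F K) z.

Lemma section_immersion y (u : 'rV[R]_(n + n)) : U y -> u != 0 -> u *m jac F y != 0.
Proof.
move=> Uy; apply: contra => /eqP e.
by rewrite -[u]mulmx1 -(FP Uy) mulmxA e mul0mx.
Qed.

(** The product [jac F *m P] is constant on [U], so its derivative vanishes. *)
Lemma jet2_section (u v : 'rV[R]_(n + n)) : jet2 F u v z *m P = 0.
Proof.
have H : isD (fun y => jet1 F v y *m P) z (jac (jet1 F v) z *m P).
  exact: (isD_comp (jet1_isd hF v Uz) (isD_mulmxr P _)).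
have H0 : isD (fun y => jet1 F v y *m P) z 0.
  have N0 : {near z, (fun _ : 'rV[R]_(n + n) => v) =1 (fun y => jet1 F v y *m P)}.
    by apply: filterS (open_nbhs_nbhs (conj oU Uz)) => y Uy; rewrite /jet1 -mulmxA FP// mulmx1.
  by apply: isd_near N0 _; apply: isd_ext (isd_cst v z) => x; rewrite mulmx0.
by rewrite /jet2 -mulmxA -(jac_isD H) (jac_isD H0) mulmx0.
Qed.

(** [X] bounds the vectors of a unitary frame, [B] the square length of each normal component, [B1]
    the sup norm of that component, and [S2] the second derivatives along the frame. *)
Let k : R := (n + n)%:R.
Let X := La ^+ 2 * C + 1.
Let B := k * k * (C * (La * X) ^+ 4) - R0.
Let B1 := Num.sqrt (C * B).
Let S2 := B1 + C * (La * X) ^+ 2 + La * (La * (C * (La * X) ^+ 2) + La * B1).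

Lemma frame_bound (x : 'rV[R]_(n + n)) : bilin (pullb F K z) x x = 1 -> `|x| <= X.
Proof.
move=> x1; have h := mb_lower Hb (jet1 F x z); rewrite -pullb_bilin x1 mulr1 in h.
have h1 : `|x| <= La * `|jet1 F x z|.
  by rewrite -{1}[x]mulmx1 -(FP Uz) mulmxA boundP.
have h2 : `|x| ^+ 2 <= La ^+ 2 * C.
  apply: le_trans (_ : (La * `|jet1 F x z|) ^+ 2 <= _); first by rewrite lerXn2r ?nnegrE// mulr_ge0// ltW.
  by rewrite exprMn ler_wpM2l// exprn_ge0// ltW.
exact: le_sqr_add1.
Qed.

Lemma ler_sum2 {I : finType} (f : I -> I -> R) i j : (forall i' j', 0 <= f i' j') -> f i j <= \sum_i' \sum_j' f i' j'.
Proof.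
move=> f0; rewrite (bigD1 i)//= (bigD1 j)//= -addrA lerDl addr_ge0// sumr_ge0// => i' _.
by rewrite sumr_ge0.
Qed.

(** All normal terms of the Gauss equation enter with the same sign, so a lower bound for their
    total, the scalar curvature, bounds each of them separately. The tangential part of the second
    derivative then follows from [section_solve]. *)
Lemma jet2_frame_bound (L : 'M[R]_(n + n)) i j :
  L *m pullb F K z *m L^T = 1%:M -> Jmx *m L = L *m Jmx ->
  `|jet2 F (row i L) (row j L) z| <= S2.
Proof.
move=> HL JL; have G1 l : bilin (pullb F K z) (row l L) (row l L) = 1.
  by rewrite !rowE bilin_mulmx HL bilin_delta !mxE eqxx.
have X0 : 0 <= X by rewrite addr_ge0// mulr_ge0 ?exprn_ge0 ?ltW.
have fb l := frame_bound (G1 l).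
have jb l : `|jet1 F (row l L) z| <= La * X.
  by rewrite (le_trans (boundD _))// ler_pM2l.
have LX0 : 0 <= La * X by rewrite mulr_ge0// ltW.
have imm := section_immersion.
have gk := gauss_kahler HK oU hF imm Uz HL JL; move: scal; rewrite gk.
pose rr i j := riemK K (F z) (jet1 F (row j L) z) (jet1 F (row i L) z) (jet1 F (row i L) z) (jet1 F (row j L) z).
pose nf i j := normal_form F K z (sff F K (row i L) (row j L) z) (sff F K (row i L) (row j L) z).
move=> {}gk; have {}gk : R0 <= \sum_i \sum_j (rr i j - nf i j) by exact: gk.
have nf0 i' j' : 0 <= nf i' j'.
  rewrite /nf (normal_form_self HK oU hF imm _ Uz); set a := (_ - _).
  by have [->|a0] := eqVneq a 0; [rewrite bilin0l|exact: ltW (km_pos HK (mb_in Hb) a0)].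
have rb i' j' : rr i' j' <= C * (La * X) ^+ 4.
  apply: le_trans (ler_norm _) _; apply: le_trans (mb_riem Hb _ _ _ _) _.
  have -> : C * (La * X) ^+ 4 = C * (La * X) * (La * X) * (La * X) * (La * X) by ring.
  by do 4?[apply: ler_pM => //; first by do ?apply: mulr_ge0 => //; exact: ltW]; rewrite ler_pM2l.
have nfB : nf i j <= B.
  have h1 : \sum_i \sum_j rr i j <= k * k * (C * (La * X) ^+ 4).
    apply: le_trans (_ : \sum_(i' < n + n) \sum_(j' < n + n) C * (La * X) ^+ 4 <= _).
      by apply: ler_sum => i' _; apply: ler_sum => j' _; exact: rb.
    by rewrite !sumr_const !card_ord -mulrnA -mulr_natl natrM.
  have h2 : nf i j <= \sum_i \sum_j nf i j by exact: ler_sum2.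
  have h3 : \sum_i \sum_j (rr i j - nf i j) = \sum_i \sum_j rr i j - \sum_i \sum_j nf i j.
    by rewrite -sumrB; apply: eq_bigr => i' _; rewrite -sumrB.
  rewrite h3 in gk; rewrite /B; move: gk h1 h2; move: (\sum_i _) (\sum_i _) (nf i j) (k * k * _).
  move=> x y t s g1 g2 g3; apply: le_trans g3 _.
  apply: le_trans (_ : y - R0 <= _); last exact: lerB.
  by rewrite lerBrDr addrC -lerBrDr.
move: nfB; rewrite /nf (normal_form_self HK oU hF imm _ Uz).
set S := sff F K _ _ z; set tau := S *m _ *m _ *m _; set w := S - _ => nfB.
have wB : `|w| <= B1.
  rewrite -[`|w|]ger0_norm// -sqrtr_sqr ler_wsqrtr// (le_trans (mb_lower Hb w))//.
  by rewrite ler_pM2l.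
pose g := gam K (F z) (jet1 F (row i L) z) (jet1 F (row j L) z).
have gB : `|g| <= C * (La * X) ^+ 2.
  rewrite (le_trans (mb_gam Hb _ _))// expr2 mulrA.
  by apply: ler_pM => //; [by rewrite mulr_ge0// ltW|by rewrite ler_pM2l].
have [tE jE] := @section_solve _ _ _ P (jac F z) (jet2 F (row i L) (row j L) z) g w tau
  (FP Uz) (jet2_section _ _) erefl.
have tB : `|tau| <= La * (C * (La * X) ^+ 2) + La * B1.
  rewrite tE (le_trans (ler_normB _ _))//; apply: lerD; rewrite (le_trans (boundP _))// ler_pM2l//.
rewrite jE (le_trans (ler_normD _ _))//; apply: lerD.
  by rewrite (le_trans (ler_normB _ _))//; apply: lerD.
by rewrite (le_trans (boundD _))// ler_pM2l.
Qed.

Lemma jet2_bound (u v : 'rV[R]_(n + n)) :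
  `|jet2 F u v z| <= k * k * (C * La ^+ 2 * X) ^+ 2 * S2 * `|u| * `|v|.
Proof.
have imm := section_immersion; have HG := pullb_kahler HK oU hF imm.
have [L [HL JL]] := unitary_frame (km_sym HG Uz) (fun u v => km_J HG u v Uz) (fun u => km_pos HG Uz).
have G1 l : bilin (pullb F K z) (row l L) (row l L) = 1.
  by rewrite !rowE bilin_mulmx HL bilin_delta !mxE eqxx.
have X0 : 0 <= X by rewrite addr_ge0// mulr_ge0 ?exprn_ge0 ?ltW.
pose co (u : 'rV[R]_(n + n)) l := bilin (pullb F K z) u (row l L).
have cob x l : `|co x l| <= C * La ^+ 2 * X * `|x|.
  rewrite /co pullb_bilin (le_trans (mb_upper Hb _ _))//.
  have -> : C * La ^+ 2 * X * `|x| = C * (La * `|x|) * (La * X) by ring.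
  apply: ler_pM => //; first by rewrite mulr_ge0// ltW.
    by rewrite ler_pM2l// boundD.
  by rewrite (le_trans (boundD _))// ler_pM2l// frame_bound.
have coE x : x = \sum_l co x l *: row l L.
  rewrite /co; exact: (@frame_expand _ _ _ L x (fun u => km_pos HG Uz) HL).
have S20 : 0 <= S2.
  have B10 : 0 <= B1 by exact: sqrtr_ge0.
  have a0 : 0 <= C * (La * X) ^+ 2 by rewrite mulr_ge0 ?exprn_ge0 ?mulr_ge0// ltW.
  by rewrite /S2; do ?[apply: addr_ge0 => //|apply: mulr_ge0 => //]; exact: ltW.
have lin2 (w : 'rV[R]_(n + n)) (I : Type) (r : seq I) (c : I -> R) (x : I -> 'rV[R]_(n + n)) :
    jet2 F (\sum_(l <- r) c l *: x l) w z = \sum_(l <- r) c l *: jet2 F (x l) w z.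
  rewrite /jet2 mulmx_suml; apply: eq_bigr => l _; exact: esym (scalemxAl _ _ _).
have sym (a b : 'rV[R]_(n + n)) : jet2 F a b z = jet2 F b a z := jet2_sym hF a b Uz.
have h1 l : `|jet2 F u (row l L) z| <= k * (C * La ^+ 2 * X * `|u|) * S2.
  rewrite {1}(coE u) lin2 (le_trans (ler_norm_sum _ _ _))//.
  rewrite -mulrA /k mulr_natl -[X in _ *+ X]card_ord -sumr_const; apply: ler_sum => l' _.
  by rewrite normrZ ler_pM// jet2_frame_bound.
rewrite {1}(coE v) sym lin2 (le_trans (ler_norm_sum _ _ _))//.
have -> : k * k * (C * La ^+ 2 * X) ^+ 2 * S2 * `|u| * `|v| =
  k * ((C * La ^+ 2 * X * `|v|) * (k * (C * La ^+ 2 * X * `|u|) * S2)) by ring.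
rewrite {1}/k mulr_natl -[X in _ *+ X]card_ord -sumr_const; apply: ler_sum => l _.
by rewrite normrZ ler_pM// sym h1.
Qed.

End SecondDerivativeBound.

(** The quantifiers express uniformity: [B] is fixed before the map, its domain, the metric and the
    projection. *)
Definition jet2_bd {R : realType} n N (C La R0 B : R) := forall (F : 'rV[R]_(n + n) -> 'rV[R]_(N + N))
  (U : set 'rV[R]_(n + n)) (K : 'rV[R]_(N + N) -> 'M[R]_(N + N)) (W : set 'rV[R]_(N + N)), kahler_metric W K -> open U ->
  (forall z, U z -> hol F z /\ W (F z)) -> forall P : 'M[R]_(N + N, n + n),
  (forall y, U y -> jac F y *m P = 1%:M) -> (forall w : 'rV[R]_(N + N), `|w *m P| <= La * `|w|) ->
  forall z, U z -> metric_bounds W K C (F z) ->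
  (forall v : 'rV[R]_(n + n), `|v *m jac F z| <= La * `|v|) ->
  R0 <= local_scalar_curvature (pullb F K) z ->
  forall u v, `|jet2 F u v z| <= B * `|u| * `|v|.

Lemma jet2_bd_ex {R : realType} n N (C La R0 : R) : 0 < C -> 0 < La ->
  exists2 B, 0 < B & jet2_bd n N C La R0 B.
Proof.
move=> C0 La0; have [B HB] : exists B, jet2_bd n N C La R0 B.
  (* The constant of [jet2_bound] is built from [n], [C], [La] and [R0] alone, so it can be chosen
     before the remaining data. *)
  eexists => F U K W HK oU hF P FP bP z Uz Hb bD sc u v.
  exact: (jet2_bound HK oU hF FP C0 La0 bP Uz Hb bD sc).
exists (`|B| + 1) => [|F U K W HK oU hF P FP bP z Uz Hb bD sc u v]; first by rewrite ltr_wpDl.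
rewrite (le_trans (HB F U K W HK oU hF P FP bP z Uz Hb bD sc u v))// -!mulrA ler_wpM2r ?mulr_ge0//.
by rewrite (le_trans (ler_norm B))// lerDl.
Qed.

(** * Passage to the limit in the scalar curvature *)

Lemma cvg_near_ext {T : Type} (Fl : set_system T) {FF : Filter Fl} {S : nbhsType}
    (u v : T -> S) (l : S) :
  (\forall i \near Fl, u i = v i) -> u i @[i --> Fl] --> l -> v i @[i --> Fl] --> l.
Proof. by move=> E H; apply: cvg_trans H; exact: (near_eq_cvg (f := u) (g := v)). Qed.

Section FilterLimits.
Context {R : realType} {T : Type} (Fl : set_system T) {FF : ProperFilter Fl}.
Local Notation "u ~> l" := (u i @[i --> Fl] --> (l : R)) (at level 70).

Lemma cvg_bigsum (I : Type) (r : seq I) (u : I -> T -> R) l :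
  (forall j, u j ~> l j) -> (fun i => \sum_(j <- r) u j i) ~> \sum_(j <- r) l j.
Proof.
move=> H; elim: r => [|j r IH].
  by rewrite big_nil (_ : (fun i => _) = fun=> 0); [exact: cvg_cst|apply/funext => i; rewrite big_nil].
rewrite big_cons (_ : (fun i => _) = (u j \+ (fun i => \sum_(j <- r) u j i))).
  exact: cvgD.
by apply/funext => i; rewrite big_cons.
Qed.

Lemma cvg_bigprod (I : Type) (r : seq I) (u : I -> T -> R) l :
  (forall j, u j ~> l j) -> (fun i => \prod_(j <- r) u j i) ~> \prod_(j <- r) l j.
Proof.
move=> H; elim: r => [|j r IH].
  by rewrite big_nil (_ : (fun i => _) = fun=> 1); [exact: cvg_cst|apply/funext => i; rewrite big_nil].
rewrite big_cons (_ : (fun i => _) = (u j \* (fun i => \prod_(j <- r) u j i))).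
  exact: cvgM.
by apply/funext => i; rewrite big_cons.
Qed.

Definition mcvg {m k} (A : T -> 'M[R]_(m, k)) (B : 'M[R]_(m, k)) := forall a b, (fun i => A i a b) ~> B a b.

Lemma mcvg_rV {m} (u : T -> 'rV[R]_m) (l : 'rV[R]_m) : u i @[i --> Fl] --> l -> mcvg u l.
Proof.
move=> ul a b; rewrite (ord1 a); have c := @coord_continuous R 1 m 0 b l.
exact: cvg_comp ul c.
Qed.

Lemma cvg_det {m} (A : T -> 'M[R]_m) B : mcvg A B -> (fun i => \det (A i)) ~> \det B.
Proof.
move=> AB; apply: cvg_bigsum => s; apply: cvgM; first exact: cvg_cst.
by apply: cvg_bigprod => j; exact: AB.
Qed.

Lemma mcvg_invmx {m} (A : T -> 'M[R]_m) B : mcvg A B -> B \in unitmx ->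
  (\forall i \near Fl, A i \in unitmx) -> mcvg (fun i => invmx (A i)) (invmx B).
Proof.
move=> AB uB uA a b.
apply: (@cvg_near_ext _ _ _ _ (fun i => (\det (A i))^-1 * cofactor (A i) b a)).
  by apply: filterS uA => i ui; rewrite /invmx ui !mxE.
have -> : invmx B a b = (\det B)^-1 * cofactor B b a by rewrite /invmx uB !mxE.
apply: cvgM; first by apply: cvgV; [rewrite -unitfE -unitmxE|exact: cvg_det].
apply: cvgM; first exact: cvg_cst.
by apply: cvg_det => c d; rewrite !mxE; under eq_fun do rewrite !mxE; exact: AB.
Qed.

Lemma mcvg_mulmx {m k l} (A : T -> 'M[R]_(m, k)) (A' : T -> 'M[R]_(k, l)) B B' :
  mcvg A B -> mcvg A' B' -> mcvg (fun i => A i *m A' i) (B *m B').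
Proof.
move=> h h' a b; rewrite mxE; under eq_fun do rewrite mxE.
by apply: cvg_bigsum => c; apply: cvgM; [exact: h|exact: h'].
Qed.

Lemma mcvg_tr {m k} (A : T -> 'M[R]_(m, k)) B : mcvg A B -> mcvg (fun i => (A i)^T) B^T.
Proof. by move=> h a b; rewrite mxE; under eq_fun do rewrite mxE; exact: h. Qed.

Lemma mcvgD {m k} (A A' : T -> 'M[R]_(m, k)) B B' : mcvg A B -> mcvg A' B' ->
  mcvg (fun i => A i + A' i) (B + B').
Proof. by move=> h h' a b; rewrite mxE; under eq_fun do rewrite mxE; apply: cvgD; [exact: h|exact: h']. Qed.

Lemma mcvg_bilin {m} (A : T -> 'M[R]_m) B (u v : T -> 'rV[R]_m) u' v' :
  mcvg A B -> mcvg u u' -> mcvg v v' -> (fun i => bilin (A i) (u i) (v i)) ~> bilin B u' v'.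
Proof.
move=> hA hu hv; apply: mcvg_mulmx; last exact: mcvg_tr.
exact: mcvg_mulmx.
Qed.

(** Convergence of a linear form with a moving argument reduces to its values on the standard basis.
    Multilinear forms are treated by using this in one slot after the other. *)
Lemma cvg_lin_form {m} (f : T -> 'rV[R]_m -> R) g (u : T -> 'rV[R]_m) u' :
  (\forall i \near Fl, lin_form (f i)) -> lin_form g ->
  (forall j, (fun i => f i (delta_mx 0 j)) ~> g (delta_mx 0 j)) -> mcvg u u' ->
  (fun i => f i (u i)) ~> g u'.
Proof.
move=> lf lg fg uu; rewrite (lin_formE u' lg).
apply: (@cvg_near_ext _ _ _ _ (fun i => \sum_b u i 0 b * f i (delta_mx 0 b))).
  by apply: filterS lf => i /lin_formE ->.
by apply: cvg_bigsum => b; apply: cvgM; [exact: uu|exact: fg].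
Qed.

End FilterLimits.

Section ScalarLimit.
Context {R : realType} {n N : nat}.
Variables (K : 'rV[R]_(N + N) -> 'M[R]_(N + N)) (W : set 'rV[R]_(N + N)).
Hypothesis HK : kahler_metric W K.

Definition immersed (F : 'rV[R]_(n + n) -> 'rV[R]_(N + N)) z := exists U : set 'rV[R]_(n + n),
  [/\ open U, U z, forall y, U y -> hol F y /\ W (F y) &
    forall y (u : 'rV[R]_(n + n)), U y -> u != 0 -> u *m jac F y != 0].

Local Notation e i := (delta_mx 0 i : 'rV[R]_(n + n)).

Lemma immersed_gauss F z : immersed F z -> [/\ W (F z), pullb F K z \in unitmx &
  local_scalar_curvature (pullb F K) z =
  \sum_b \sum_c \sum_a \sum_f invmx (pullb F K z) b c * invmx (pullb F K z) a f *
   (riemK K (F z) (jet1 F (e a) z) (jet1 F (e b) z) (jet1 F (e c) z) (jet1 F (e f) z) +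
    normal_form F K z (sff F K (e b) (e c) z) (sff F K (e a) (e f) z) -
    normal_form F K z (sff F K (e a) (e c) z) (sff F K (e b) (e f) z))].
Proof.
move=> [U [oU Uz hF inj]]; have HG := pullb_kahler HK oU hF inj.
split; [exact: (hF _ Uz).2|exact: (km_unit HG Uz)|].
exact: (gauss_equation oU (km_open HK) hF (km_sym HK) (@km_unit _ _ _ _ HK) (km_smooth HK) (@km_unit _ _ _ _ HG) Uz).
Qed.

Context {T : Type} (Fl : set_system T) {FF : ProperFilter Fl}.
Local Notation "u ~> l" := (u i @[i --> Fl] --> (l : R)) (at level 70).

Section AtPoint.
Variables (p : T -> 'rV[R]_(N + N)) (q : 'rV[R]_(N + N)).
Hypothesis pq : p i @[i --> Fl] --> q.
Hypothesis Wq : W q.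

Let Wp : \forall i \near Fl, W (p i).
Proof. exact: pq (open_nbhs_nbhs (conj (km_open HK) Wq)). Qed.

Lemma cvg_at_diff (f : 'rV[R]_(N + N) -> R) : differentiable f q -> (fun i => f (p i)) ~> f q.
Proof. by move=> /differentiable_continuous cf; exact: cvg_comp pq cf. Qed.

Lemma mcvg_gam (a b : T -> 'rV[R]_(N + N)) a' b' : mcvg Fl a a' -> mcvg Fl b b' ->
  mcvg Fl (fun i => gam K (p i) (a i) (b i)) (gam K q a' b').
Proof.
move=> ha hb k j; rewrite (ord1 k).
have L1 y v : W y -> lin_form (fun u => gam K y u v 0 j).
  by move=> Wy t x x'; rewrite (gam_linl (km_open HK) (km_smooth HK) t x x' v Wy) 2!mxE.
have L2 y u : W y -> lin_form (fun v => gam K y u v 0 j).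
  by move=> Wy t x x'; rewrite (gam_linr (km_open HK) (km_sym HK) (km_smooth HK) t x x' u Wy) 2!mxE.
apply: (@cvg_lin_form _ _ _ _ _ (fun i v => gam K (p i) (a i) v 0 j) (fun v => gam K q a' v 0 j)) => //.
- by apply: filterS Wp => i Wi; exact: L2.
- exact: L2.
move=> s; apply: (@cvg_lin_form _ _ _ _ _ (fun i u => gam K (p i) u (delta_mx 0 s) 0 j)
  (fun u => gam K q u (delta_mx 0 s) 0 j)) => //.
- by apply: filterS Wp => i Wi; exact: L1.
- exact: L1.
by move=> s'; apply: (@cvg_at_diff (fun y => gam K y _ _ 0 j)); exact: (gam_diff HK).
Qed.

Lemma cvg_riemK (a b c f : T -> 'rV[R]_(N + N)) a' b' c' f' :
  mcvg Fl a a' -> mcvg Fl b b' -> mcvg Fl c c' -> mcvg Fl f f' ->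
  (fun i => riemK K (p i) (a i) (b i) (c i) (f i)) ~> riemK K q a' b' c' f'.
Proof.
move=> ha hb hc hf; have oW := km_open HK; have Ks := km_sym HK; have sK := km_smooth HK.
apply: (@cvg_lin_form _ _ _ _ _ (fun i => riemK K (p i) (a i) (b i) (c i)) (riemK K q a' b' c')) => //.
- by apply: filterS Wp => i Wi; exact: (riemK_lin4 oW Ks sK).
- exact: (riemK_lin4 oW Ks sK).
move=> s1; apply: (@cvg_lin_form _ _ _ _ _ (fun i v => riemK K (p i) (a i) (b i) v (delta_mx 0 s1))
  (fun v => riemK K q a' b' v (delta_mx 0 s1))) => //.
- by apply: filterS Wp => i Wi; exact: (riemK_lin3 oW Ks sK).
- exact: (riemK_lin3 oW Ks sK).
move=> s2; apply: (@cvg_lin_form _ _ _ _ _ (fun i v => riemK K (p i) (a i) v (delta_mx 0 s2) (delta_mx 0 s1))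
  (fun v => riemK K q a' v (delta_mx 0 s2) (delta_mx 0 s1))) => //.
- by apply: filterS Wp => i Wi; exact: (riemK_lin2 oW sK).
- exact: (riemK_lin2 oW sK).
move=> s3; apply: (@cvg_lin_form _ _ _ _ _ (fun i v => riemK K (p i) v (delta_mx 0 s3) (delta_mx 0 s2) (delta_mx 0 s1))
  (fun v => riemK K q v (delta_mx 0 s3) (delta_mx 0 s2) (delta_mx 0 s1))) => //.
- by apply: filterS Wp => i Wi; exact: (riemK_lin1 oW sK).
- exact: (riemK_lin1 oW sK).
by move=> s4; apply: (@cvg_at_diff (fun y => riemK K y _ _ _ _)); exact: (riemK_diff HK).
Qed.

End AtPoint.

Lemma cvg_scalar_curvature (F : T -> 'rV[R]_(n + n) -> 'rV[R]_(N + N)) f z :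
  (\forall i \near Fl, immersed (F i) z) -> immersed f z ->
  F i z @[i --> Fl] --> f z ->
  (forall u, jet1 (F i) u z @[i --> Fl] --> jet1 f u z) ->
  (forall u v, jet2 (F i) u v z @[i --> Fl] --> jet2 f u v z) ->
  (fun i => local_scalar_curvature (pullb (F i) K) z) ~> local_scalar_curvature (pullb f K) z.
Proof.
move=> HF Hf C0 C1 C2; have [Wz uG E] := immersed_gauss Hf.
move: E; generalize (local_scalar_curvature (pullb f K) z) => s ->.
apply: (@cvg_near_ext _ _ _ _ (fun i => \sum_b \sum_c \sum_a \sum_d
   invmx (pullb (F i) K z) b c * invmx (pullb (F i) K z) a d *
   (riemK K (F i z) (jet1 (F i) (e a) z) (jet1 (F i) (e b) z) (jet1 (F i) (e c) z) (jet1 (F i) (e d) z) +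
    normal_form (F i) K z (sff (F i) K (e b) (e c) z) (sff (F i) K (e a) (e d) z) -
    normal_form (F i) K z (sff (F i) K (e a) (e c) z) (sff (F i) K (e b) (e d) z)))).
  by apply: filterS HF => i /immersed_gauss [_ _ ->].
have M1 u : mcvg Fl (fun i => jet1 (F i) u z) (jet1 f u z) by apply: mcvg_rV; exact: C1.
have M2 u v : mcvg Fl (fun i => jet2 (F i) u v z) (jet2 f u v z) by apply: mcvg_rV; exact: C2.
have MK : mcvg Fl (fun i => K (F i z)) (K (f z)).
  move=> a b; apply: (@cvg_at_diff (fun i => F i z) (f z) C0 (fun y => K y a b)).
  exact: (K_diff (km_open HK) (km_smooth HK) a b Wz).
have MG : mcvg Fl (fun i => pullb (F i) K z) (pullb f K z).
  move=> a b.
  have E g : bilin (K (g z)) (jet1 g (e a) z) (jet1 g (e b) z) = pullb g K z a b.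
    exact: etrans (esym (pullb_bilin g K z (e a) (e b))) (bilin_delta (pullb g K z) a b).
  apply: (@cvg_near_ext _ _ _ _ (fun i => bilin (K (F i z)) (jet1 (F i) (e a) z) (jet1 (F i) (e b) z))).
    by apply: nearW => i; exact: E.
  by move: (E f); generalize (pullb f K z a b) => l <-; exact: mcvg_bilin.
have MI : mcvg Fl (fun i => invmx (pullb (F i) K z)) (invmx (pullb f K z)).
  by apply: mcvg_invmx => //; apply: filterS HF => i /immersed_gauss [].
have MS u v : mcvg Fl (fun i => sff (F i) K u v z) (sff f K u v z).
  by apply: mcvgD => //; exact: mcvg_gam.
have MN u v u' v' : (fun i => normal_form (F i) K z (sff (F i) K u v z) (sff (F i) K u' v' z)) ~>
    normal_form f K z (sff f K u v z) (sff f K u' v' z).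
  apply: cvgB; first exact: mcvg_bilin.
  apply: cvg_bigsum => a; apply: cvg_bigsum => b; apply: cvgM; first exact: MI.
  by apply: cvgM; exact: mcvg_bilin.
apply: cvg_bigsum => b; apply: cvg_bigsum => c; apply: cvg_bigsum => a; apply: cvg_bigsum => d.
apply: cvgM; first by apply: cvgM; exact: MI.
by apply: cvgB => //; apply: cvgD => //; apply: cvg_riemK.
Qed.

End ScalarLimit.

(** * Isometric maps have locally bounded derivatives *)

Section IsometricHol.
Context {R : realType}.

Lemma Ck_on_sub {m} k (U V : set 'rV[R]_m) f : V `<=` U -> Ck_on k U f -> Ck_on k V f.
Proof.
move=> VU; elim: k f => [|k IH] f [c H]; split => //; try by move=> z /VU; exact: c.
by move=> v; have [d ck] := H v; split; [move=> z /VU; exact: d|exact: IH].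
Qed.

Lemma open_dist_lt {m} (a : 'rV[R]_m) r : open [set z | `|z - a| < r].
Proof.
rewrite openE => z /= zr; apply/near_ballP; exists (r - `|z - a|); first by rewrite subr_gt0.
move=> y yz; rewrite /= -(subrK z y) -addrA (le_lt_trans (ler_normD _ _))//.
by rewrite -ltrBrDr.
Qed.

Lemma kahler_metric_sub {N} (U V : set 'rV[R]_(N + N)) K : open V ->
  kahler_metric U K -> (forall z, V z -> U z) -> kahler_metric V K.
Proof.
move=> oV HK VU; split => //.
- by move=> z /VU; exact: km_sym HK z.
- by move=> z u /VU; exact: km_pos HK z u.
- by move=> z u v /VU; exact: km_J HK z u v.
- by move=> i j k; apply: Ck_on_sub (km_smooth HK i j k).
- by move=> z u v w /VU; exact: km_closed HK z u v w.
Qed.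

(** The upper bound of the source metric and the lower bound of the target metric control the norm
    of an isometric derivative. Continuity of [F] keeps nearby values in the region where the target
    bounds hold. *)
Lemma isometric_hol {m n} (U : set 'rV[R]_(m + m)) (V : set 'rV[R]_(n + n)) F K K' z :
  kahler_metric U K -> kahler_metric V K' -> U z -> V (F z) ->
  (forall y, U y -> V (F y) -> cdiff F y /\ forall u : 'rV[R]_(m + m),
     bilin (K' (F y)) (u *m jac F y) (u *m jac F y) = bilin (K y) u u) -> hol F z.
Proof.
move=> HK HK' Uz Vz H.
have [r [C [r0 C0 HC]]] := metric_bounds_near HK Uz.
have [r' [C' [r'0 C'0 HC']]] := metric_bounds_near HK' Vz.
have [dz _] := H _ Uz Vz.
have cF : {for z, continuous F} by apply: differentiable_continuous; exact: cdiff_differentiable dz.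
have [d d0 Hd] := (continuous_rVP F z).1 cF r' r'0.
exists (Num.min r d), (Num.sqrt (C * C')); split; first by rewrite lt_min r0.
move=> y; rewrite lt_min => /andP[yr yd].
have My := HC y yr; have My' := HC' (F y) (Hd y yd).
have [dy Iy] := H y (mb_in My) (mb_in My'); split=> // v.
have h1 := mb_lower My' (v *m jac F y); rewrite Iy in h1.
have h2 : bilin (K y) v v <= C * `|v| * `|v| := le_trans (ler_norm _) (mb_upper My v v).
have CC : 0 <= C * C' by rewrite mulr_ge0// ltW.
have h3 : `|v *m jac F y| ^+ 2 <= (Num.sqrt (C * C') * `|v|) ^+ 2.
  rewrite exprMn sqr_sqrtr//; apply: le_trans h1 _.
  have -> : C * C' * `|v| ^+ 2 = C' * (C * `|v| * `|v|) by ring.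
  by rewrite ler_pM2l.
by rewrite -(@ler_pXn2r _ 2) ?nnegrE// mulr_ge0// sqrtr_ge0.
Qed.

Lemma holomorphic_on_cdiff {m n} (U : set 'rV[R]_(m + m)) (F : 'rV[R]_(m + m) -> 'rV[R]_(n + n)) z :
  holomorphic_on U F -> U z -> cdiff F z.
Proof.
move=> H Uz; have [d J] := H z Uz; split => //.
by apply: mulmxrI => v; rewrite !mulmxA -!jacE J.
Qed.

Lemma hol_holomorphic_on {m n} (U : set 'rV[R]_(m + m)) (F : 'rV[R]_(m + m) -> 'rV[R]_(n + n)) :
  (forall z, U z -> hol F z) -> holomorphic_on U F.
Proof.
move=> H z /H /hol_cdiff [d J]; split => // v.
by rewrite !jacE -!mulmxA J.
Qed.

End IsometricHol.

(** * The metric in the charts of a Kähler manifold *)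

Section Atlas.
Context {R : realType} {n : nat} (M : kahlerManifold R n).
Implicit Types (x y : M) (c : chart R M (n + n)) (u v w : 'rV[R]_(n + n)).

Lemma bilin_metric c x u v : bilin (metric c x) u v = bilin (kform c x) u (v *m Jmx).
Proof. by rewrite /metric /bilin trmx_mul !mulmxA. Qed.

Lemma chart_at_atlas x : atlas (chart_at x).
Proof. by rewrite /chart_at; case: cid2. Qed.

Lemma chart_at_dom x : dom (chart_at x) x.
Proof. by rewrite /chart_at; case: cid2. Qed.

Lemma image_cinv c z : (cmap c @` dom c) z -> dom c (cinv c z) /\ cmap c (cinv c z) = z.
Proof. by move=> [x dx <-]; rewrite cmapK. Qed.

Lemma image_cmap c x : dom c x -> (cmap c @` dom c) (cmap c x).
Proof. by move=> dx; exists x. Qed.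

Lemma metric_kahler c : atlas c ->
  kahler_metric (cmap c @` dom c) (fun z => metric c (cinv c z)).
Proof.
move=> ac; have S z u v : (cmap c @` dom c) z ->
    bilin (metric c (cinv c z)) u v = bilin (metric c (cinv c z)) v u.
  move=> /image_cinv [dz _]; rewrite !bilin_metric (kform_alternating (v *m Jmx) u ac dz).
  by rewrite -(kform_11 (v *m Jmx) u ac dz) JmxK bilinNl opprK.
split.
- exact: codom_open.
- by move=> z Uz; apply: bilin_ext => u v; rewrite bilin_tr S.
- by move=> z u /image_cinv [dz _] u0; rewrite bilin_metric; exact: kform_positive.
- by move=> z u v /image_cinv [dz _]; rewrite !bilin_metric kform_11.
- move=> i j k; have -> : (fun z => metric c (cinv c z) i j) =
      (fun z => \sum_l (Jmx^T : 'M[R]_(n + n)) l j * kform c (cinv c z) i l).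
    by apply/funext => z; rewrite mxE; apply: eq_bigr => l _; rewrite mulrC.
  apply: Ck_on_sum; first exact: codom_open.
  move=> l; apply: Ck_onM; [exact: codom_open|exact: Ck_on_cst|exact: kform_smooth].
- move=> z u v w Uz om.
  have E a b : {near z, om a b =1 (fun q : 'rV[R]_(n + n) => bilin (kform c (cinv c q)) a b)}.
    have N : \forall q \near z, (cmap c @` dom c) q := open_nbhs_nbhs (conj (@codom_open _ _ _ c) Uz).
    by apply: filterS N => q /image_cinv [dq _]; rewrite /om bilin_metric kform_11.
  by rewrite !(near_eq_derive _ (E _ _)); exact: (kform_closed u v w ac Uz).
Qed.

Lemma transition_isometry c c' x u v : atlas c -> atlas c' -> dom c x -> dom c' x ->
  let T := cmap c' \o cinv c in
  bilin (metric c' x) (u *m jac T (cmap c x)) (v *m jac T (cmap c x)) = bilin (metric c x) u v.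
Proof.
move=> ac ac' dx dx' T.
have cd : cdiff T (cmap c x) by apply: holomorphic_on_cdiff (atlas_holomorphic ac ac') _; exists x.
rewrite !bilin_metric -mulmxA -(cdiff_J cd) mulmxA.
by have := kform_transition u (v *m Jmx) ac ac' dx dx'; rewrite /= !jacE.
Qed.

Lemma transition_near c c' x : dom c x -> dom c' x ->
  \forall z \near cmap c x, (cmap c @` dom c) z /\ dom c' (cinv c z).
Proof.
move=> dx dx'; have N1 : nbhs (cmap c x) (cmap c @` dom c).
  by apply: open_nbhs_nbhs; split; [exact: codom_open|exists x].
have N2 : nbhs (cmap c x) (cinv c @^-1` dom c').
  apply: (cinv_continuous (image_cmap dx)); rewrite cmapK//.
  by apply: open_nbhs_nbhs; split; [exact: dom_open|].
by apply: filterS2 N1 N2.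
Qed.

(** The atlas only provides complex differentiability of a transition map. The map also preserves
    the metric, and [isometric_hol] supplies the missing bound. *)
Lemma transition_hol c c' x : atlas c -> atlas c' -> dom c x -> dom c' x ->
  hol (cmap c' \o cinv c) (cmap c x).
Proof.
move=> ac ac' dx dx'.
have [r r0 Hr] := (near_ballP _ _).1 (transition_near dx dx').
have oB : open [set z : 'rV[R]_(n + n) | `|z - cmap c x| < r].
  exact: open_dist_lt.
have HK := metric_kahler ac; have HK' := metric_kahler ac'.
have HKB := kahler_metric_sub oB HK (fun z zr => (Hr z zr).1).
apply: (isometric_hol HKB HK') => /=.
- by rewrite subrr normr0.
- by rewrite cmapK//; exists x.
move=> y yr _; have [/image_cinv [dy ey] dy'] := Hr y yr.
split.
  by apply: holomorphic_on_cdiff (atlas_holomorphic ac ac') _; exists (cinv c y).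
by move=> u; have := transition_isometry u u ac ac' dy dy'; rewrite /= ey (cmapK dy').
Qed.

End Atlas.

(** * Holomorphic isometries in charts *)

Section IsometryLocal.
Context {R : realType} {m n : nat} (M : kahlerManifold R m) (M' : kahlerManifold R n).
Variable phi : M -> M'.
Hypothesis Hphi : holomorphic_isometry phi.

Lemma isometry_bilin c c' x u v : atlas c -> atlas c' -> dom c x -> dom c' (phi x) ->
  let F := cmap c' \o phi \o cinv c in
  cdiff F (cmap c x) /\
  bilin (metric c' (phi x)) (u *m jac F (cmap c x)) (v *m jac F (cmap c x)) = bilin (metric c x) u v.
Proof.
move=> ac ac' dx dx' F.
have cd : cdiff F (cmap c x) by apply: holomorphic_on_cdiff (Hphi.1.2 _ _ ac ac') _; exists x.
split => //; rewrite !bilin_metric -mulmxA -(cdiff_J cd) mulmxA.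
by have := Hphi.2 _ _ _ u (v *m Jmx) ac ac' dx dx'; rewrite /= !jacE.
Qed.

Lemma isometry_near (c : chart R M (m + m)) (c' : chart R M' (n + n)) x : dom c x -> dom c' (phi x) ->
  \forall z \near cmap c x, (cmap c @` dom c) z /\ dom c' (phi (cinv c z)).
Proof.
move=> dx dx'; have N1 : nbhs (cmap c x) (cmap c @` dom c).
  by apply: open_nbhs_nbhs; split; [exact: codom_open|exists x].
have N2 : nbhs (cmap c x) (cinv c @^-1` (phi @^-1` dom c')).
  apply: (cinv_continuous (image_cmap dx)); rewrite cmapK//; apply: Hphi.1.1.
  by apply: open_nbhs_nbhs; split; [exact: dom_open|].
by apply: filterS2 N1 N2.
Qed.

Lemma isometry_hol c c' x : atlas c -> atlas c' -> dom c x -> dom c' (phi x) ->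
  hol (cmap c' \o phi \o cinv c) (cmap c x).
Proof.
move=> ac ac' dx dx'.
have [r r0 Hr] := (near_ballP _ _).1 (isometry_near dx dx').
have oB : open [set z : 'rV[R]_(m + m) | `|z - cmap c x| < r].
  exact: open_dist_lt.
have HKB := kahler_metric_sub oB (metric_kahler ac) (fun z zr => (Hr z zr).1).
apply: (isometric_hol HKB (metric_kahler ac')) => /=.
- by rewrite subrr normr0.
- by rewrite cmapK//; exists (phi x).
move=> y yr _; have [/image_cinv [dy ey] dy'] := Hr y yr.
have [cd _] := isometry_bilin 0 0 ac ac' dy dy'; rewrite ey in cd.
split => // u; have [_] := isometry_bilin u u ac ac' dy dy'.
by rewrite /= ey (cmapK dy').
Qed.

Lemma isometry_pullb c c' x : atlas c -> atlas c' -> dom c x -> dom c' (phi x) ->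
  metric c x = pullb (cmap c' \o phi \o cinv c) (fun z => metric c' (cinv c' z)) (cmap c x).
Proof.
move=> ac ac' dx dx'; apply: bilin_ext => u v.
have [_ <-] := isometry_bilin u v ac ac' dx dx'.
by rewrite pullb_bilin /jet1 /= cmapK// cmapK.
Qed.

End IsometryLocal.

(** * The Riemannian distance *)

Section C1At.
Context {R : realType}.

Lemma mcvg_cvg {T : Type} (Fl : set_system T) {FF : ProperFilter Fl} {m}
    (u : T -> 'rV[R]_m) (l : 'rV[R]_m) : mcvg Fl u l -> u i @[i --> Fl] --> l.
Proof.
move=> H; apply/cvgrPdist_le => e e0.
have : \forall i \near Fl, forall j : 'I_m, `|u i 0 j - l 0 j| <= e.
  apply: (@filter_forall _ _ (fun j i => `|u i 0 j - l 0 j| <= e) _ FF) => j.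
  by have /cvgrPdist_le /(_ e e0) := H 0 j; apply: filterS => i; rewrite distrC.
apply: filterS => i Hi; apply: norm_rV_le; first exact: ltW.
by move=> j; rewrite !mxE distrC.
Qed.

Lemma cvg_lim_eq {T : Type} {Fl : set_system T} {S : nbhsType} (u : T -> S) (l l' : S) :
  u i @[i --> Fl] --> l -> l = l' -> u i @[i --> Fl] --> l'.
Proof. by move=> H <-. Qed.

Lemma near_continuous {T S : topologicalType} (f g : T -> S) t :
  (\forall s \near t, f s = g s) -> {for t, continuous f} -> {for t, continuous g}.
Proof.
move=> E c; have c' : f s @[s --> t] --> g t by rewrite -(nbhs_singleton E).
exact: cvg_near_ext E c'.
Qed.

Section Abstract.
Context {V : normedModType R}.
Implicit Types (g h : R -> V) (s t : R).

Definition C1_at g t := (\forall s \near t, derivable g s 1) /\ {for t, continuous (derive1 g)}.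

Lemma is_derive1 g s : derivable g s 1 -> is_derive s (1 : R) g (derive1 g s).
Proof. by move=> d; split => //; rewrite derive1E. Qed.

Lemma derive1_val g s d : is_derive s (1 : R) g d -> derive1 g s = d.
Proof. by move=> H; rewrite derive1E; exact: derive_val. Qed.

Lemma near_derive1 g h s : (\forall x \near s, g x = h x) ->
  derive1 g s = derive1 h s /\ (derivable g s 1 -> derivable h s 1).
Proof.
move=> gh; split; first by rewrite !derive1E; exact: near_eq_derive.
exact: near_eq_derivable.
Qed.

Lemma C1_at_near g h t : (\forall x \near t, g x = h x) -> C1_at g t -> C1_at h t.
Proof.
move=> /near_join gh [d c]; split.
  by apply: filterS2 gh d => s /near_derive1 [_ H] /H.
by apply: near_continuous c; apply: filterS gh => s /near_derive1 [].
Qed.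

Lemma derivable_cont g s : derivable g s 1 -> {for s, continuous g}.
Proof. by move=> /derivable1_diffP; exact: differentiable_continuous. Qed.

Lemma C1_at_cont g t : C1_at g t -> {for t, continuous g}.
Proof. by move=> [d _]; apply: derivable_cont; exact: nbhs_singleton d. Qed.

Lemma C1_at_intro g g' t : (\forall s \near t, is_derive s (1 : R) g (g' s)) ->
  {for t, continuous g'} -> C1_at g t.
Proof.
move=> E c; split; first by apply: filterS E => s [].
by apply: near_continuous c; apply: filterS E => s /derive1_val.
Qed.

Lemma is_derive_affine (a b s : R) : is_derive s (1 : R) (fun t => a + t * b) b.
Proof.
apply: (isd_curve _ _ _).2; have -> : (fun t : R => a + t * b) = (fun t => a + b *: (t : R^o)).
  by apply/funext => t; rewrite mulrC.
by apply: isd_ext (isdD (isd_cst a s) (isdZ b (isd_id s))) => v; rewrite add0r /GRing.scale/= mulrC.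
Qed.

Lemma continuous_affine (a b : R) : continuous (fun t : R => a + t * b).
Proof. by move=> s; exact: derive_cont (is_derive_affine a b s). Qed.

Lemma derive1_affine g (a b s : R) : derivable g (a + s * b) 1 ->
  is_derive s (1 : R) (fun t => g (a + t * b)) (b *: derive1 g (a + s * b)).
Proof.
move=> /is_derive1 /isd_curve H.
exact: (is_derive_isd (is_derive_affine a b s) H).
Qed.

Lemma C1_at_affine g (a b t : R) : C1_at g (a + t * b) -> C1_at (fun t => g (a + t * b)) t.
Proof.
move=> [d c]; apply: (@C1_at_intro _ (fun s => b *: derive1 g (a + s * b))).
  have N : \forall s \near t, derivable g (a + s * b) 1 := @continuous_affine a b t _ d.
  apply: filterS N => s; exact: derive1_affine.
by apply: cvgZr; exact: cvg_comp (@continuous_affine a b t) c.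
Qed.

End Abstract.

Lemma derive1_hol {m n} (F : 'rV[R]_(m + m) -> 'rV[R]_(n + n)) (g : R -> 'rV[R]_(m + m)) (s : R) :
  hol F (g s) -> derivable g s 1 ->
  is_derive s (1 : R) (fun t => F (g t)) (derive1 g s *m jac F (g s)).
Proof. by move=> hF dg; exact: is_derive_isd (is_derive1 dg) (hol_isD hF). Qed.

Lemma mcvg_jac {m n} (F : 'rV[R]_(m + m) -> 'rV[R]_(n + n)) z : hol F z -> mcvg (nbhs z) (jac F) (jac F z).
Proof.
move=> hF a b; have c0 : mcvg (nbhs z) (fun y => (delta_mx 0 a : 'rV[R]_(m + m)) *m jac F y)
    ((delta_mx 0 a : 'rV[R]_(m + m)) *m jac F z).
  by apply: mcvg_rV; exact: hol_continuous (hol_jac (delta_mx 0 a) hF).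
have c := c0 0 b.
have e y : (delta_mx 0 a *m jac F y) 0 b = jac F y a b := esym (mx_coord_row _ a b).
by apply: cvg_near_ext (cvg_lim_eq c (e z)); apply: nearW => y; exact: e.
Qed.

Lemma mcvg_comp {m k} {T : Type} (Fl : set_system T) {FF : ProperFilter Fl} {S : topologicalType}
  (g : T -> S) (l : S) (A : S -> 'M[R]_(m, k)) B :
  g i @[i --> Fl] --> l -> mcvg (nbhs l) A B -> mcvg Fl (fun i => A (g i)) B.
Proof. by move=> gl H a b; exact: cvg_comp gl (H a b). Qed.

Lemma C1_at_comp {m n} (F : 'rV[R]_(m + m) -> 'rV[R]_(n + n)) (g : R -> 'rV[R]_(m + m)) (t : R) :
  hol F (g t) -> C1_at g t -> C1_at (fun s => F (g s)) t.
Proof.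
move=> hF gt; have [d c] := gt; have cg := C1_at_cont gt.
have hn : \forall s \near t, hol F (g s).
  have [r r0 Hr] := hol_near hF; have N := (near_ballP _ _).2 (ex_intro2 _ _ r r0 Hr).
  exact: cg _ N.
apply: (@C1_at_intro _ _ (fun s => derive1 g s *m jac F (g s))).
  by apply: filterS2 hn d => s; exact: derive1_hol.
have L : derive1 g s *m jac F (g s) @[s --> t] --> derive1 g t *m jac F (g t).
  have c1 : mcvg (nbhs t) (derive1 g) (derive1 g t) by apply: mcvg_rV.
  have FFt : ProperFilter (nbhs t) := nbhs_pfilter t.
  have c2 : mcvg (nbhs t) (fun s => jac F (g s)) (jac F (g t)) := @mcvg_comp _ _ _ _ FFt _ _ _ _ _ cg (mcvg_jac hF).
  by apply: mcvg_cvg; exact: (@mcvg_mulmx _ _ _ FFt _ _ _ _ _ _ _ c1 c2).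
exact: L.
Qed.

End C1At.

(** * Curves, speed and arc length *)

Section Curves.
Context {R : realType} {n : nat} (M : kahlerManifold R n).
Implicit Types (x y : M) (c : chart R M (n + n)) (gamma : R -> M) (t s : R).

(** The charts obtained from graphs are not members of the atlas. Everything about curves is
    therefore proved for charts that are holomorphically compatible with it. *)
Definition compat c := forall c', atlas c' -> forall x, dom c x -> dom c' x ->
  hol (cmap c' \o cinv c) (cmap c x) /\ hol (cmap c \o cinv c') (cmap c' x).

Lemma atlas_compat c : atlas c -> compat c.
Proof. by move=> ac c' ac' x dx dx'; split; exact: transition_hol. Qed.

Lemma compat_compat c c' x : compat c -> compat c' -> dom c x -> dom c' x ->
  hol (cmap c' \o cinv c) (cmap c x).
Proof.
move=> hc hc' dx dx'; pose c0 := chart_at x; have a0 := chart_at_atlas x; have d0 := chart_at_dom x.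
have [h1 _] := hc _ a0 x dx d0; have [_ h2] := hc' _ a0 x dx' d0.
have h12 : hol (fun z => cmap c' (cinv c0 (cmap c0 (cinv c z)))) (cmap c x).
  by apply: (@hol_comp _ _ _ _ (cmap c0 \o cinv c) (cmap c' \o cinv c0)) => //=; rewrite cmapK.
have [r r0 Hr] := (near_ballP _ _).1 (transition_near dx d0).
apply: hol_near_eq r0 _ h12 => y /Hr [_ dy] /=.
by rewrite cmapK.
Qed.

(* The metric in a chart that need not belong to the atlas. *)
Definition gram c x : 'M[R]_(n + n) :=
  pullb (cmap (chart_at x) \o cinv c) (fun z => metric (chart_at x) (cinv (chart_at x) z)) (cmap c x).

Lemma gram_bilin c x u v : dom c x ->
  let T := cmap (chart_at x) \o cinv c in
  bilin (gram c x) u v = bilin (metric (chart_at x) x) (u *m jac T (cmap c x)) (v *m jac T (cmap c x)).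
Proof. by move=> dx T; rewrite /gram pullb_bilin /= cmapK// cmapK//; exact: chart_at_dom. Qed.

Lemma gram_atlas c x : atlas c -> dom c x -> gram c x = metric c x.
Proof.
move=> ac dx; apply: bilin_ext => u v; rewrite gram_bilin//.
by rewrite transition_isometry//; [exact: chart_at_atlas|exact: chart_at_dom].
Qed.

Lemma near_dom c gamma t : {for t, continuous gamma} -> dom c (gamma t) ->
  \forall s \near t, dom c (gamma s).
Proof.
move=> ct dt; have : nbhs (gamma t) (dom c) by apply: open_nbhs_nbhs; split => //; exact: dom_open.
exact: ct.
Qed.

Lemma curve_change c c' gamma t : {for t, continuous gamma} -> dom c (gamma t) ->
  \forall s \near t, (cmap c' \o cinv c) ((cmap c \o gamma) s) = (cmap c' \o gamma) s.
Proof.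
by move=> ct dt; apply: filterS (near_dom ct dt) => s ds /=; rewrite cmapK.
Qed.

Lemma C1_transfer c c' gamma t : compat c -> compat c' -> {for t, continuous gamma} ->
  dom c (gamma t) -> dom c' (gamma t) -> C1_at (cmap c \o gamma) t -> C1_at (cmap c' \o gamma) t.
Proof.
move=> hc hc' ct dt dt' H; apply: C1_at_near (curve_change c' ct dt) _.
exact: (C1_at_comp (compat_compat hc hc' dt dt') H).
Qed.

Lemma C1_curve_compat gamma t c : C1_curve gamma -> 0 <= t <= 1 -> compat c -> dom c (gamma t) ->
  C1_at (cmap c \o gamma) t.
Proof.
move=> H t01 hc dt; have [ct Ht] : _ /\ _ := H t t01.
have a0 := chart_at_atlas (gamma t).
exact: (C1_transfer (atlas_compat a0) hc ct (chart_at_dom _) dt (Ht _ a0 (chart_at_dom _))).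
Qed.

Lemma C1_curve_intro gamma : (forall t, 0 <= t <= 1 -> {for t, continuous gamma} /\
  exists c, [/\ compat c, dom c (gamma t) & C1_at (cmap c \o gamma) t]) -> C1_curve gamma.
Proof.
move=> H t t01; have [ct [c [hc dt Hc]]] := H t t01; split; first exact: ct.
move=> c' ac' dt'.
exact: (C1_transfer hc (atlas_compat ac') ct dt dt' Hc).
Qed.

Lemma speed_compat c gamma s : compat c -> {for s, continuous gamma} -> dom c (gamma s) ->
  derivable (cmap c \o gamma) s 1 ->
  let v := derive1 (cmap c \o gamma) s in speed gamma s = Num.sqrt (bilin (gram c (gamma s)) v v).
Proof.
move=> hc cs ds dv v; rewrite /speed gram_bilin//.
have h := (hc _ (chart_at_atlas (gamma s)) (gamma s) ds (chart_at_dom _)).1.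
have E := derive1_val (derive1_hol h dv).
have [E' _] := near_derive1 (curve_change (chart_at (gamma s)) cs ds).
by rewrite /velocity -E' E.
Qed.

Lemma speed_near c gamma t : atlas c -> {for t, continuous gamma} -> dom c (gamma t) ->
  (\forall s \near t, derivable (cmap c \o gamma) s 1) ->
  \forall s \near t, {for s, continuous gamma} /\ 
    let v := derive1 (cmap c \o gamma) s in speed gamma s = Num.sqrt (bilin (metric c (gamma s)) v v).
Proof.
move=> ac ct dt dv; have dn := near_dom ct dt; have dj := near_join dn.
apply: filterS3 dn dv dj => s ds dvs dns.
have cs : {for s, continuous gamma}.
  have c1 := derivable_cont dvs.
  have c2 : cinv c (cmap c (gamma u)) @[u --> s] --> cinv c (cmap c (gamma s)).
    exact: cvg_comp c1 (cinv_continuous (image_cmap ds)).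
  rewrite (cmapK ds) in c2.
  by apply: cvg_near_ext c2; apply: filterS dns => u /cmapK.
by split; [exact: cs|rewrite (speed_compat (atlas_compat ac) cs ds dvs) gram_atlas].
Qed.

Lemma speed_continuous_chart c gamma t : C1_curve gamma -> 0 <= t <= 1 -> atlas c ->
  dom c (gamma t) -> {for t, continuous (speed gamma)}.
Proof.
move=> H t01 ac dt; have [ct Ht] : _ /\ _ := H t t01.
have [d cv] := Ht c ac dt.
have E := speed_near ac ct dt d; have HK := metric_kahler ac.
have MK : mcvg (nbhs (cmap c (gamma t))) (fun z => metric c (cinv c z)) (metric c (cinv c (cmap c (gamma t)))).
  move=> i j; have Uz := image_cmap dt.
  exact: differentiable_continuous (smooth_differentiable (km_open HK) (km_smooth HK i j) Uz).
have cg : {for t, continuous (cmap c \o gamma)} := C1_at_cont (Ht c ac dt).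
have c1 : mcvg (nbhs t) (velocity c gamma) (velocity c gamma t) by apply: mcvg_rV.
have FFt : ProperFilter (nbhs t) := nbhs_pfilter t.
have c2 : mcvg (nbhs t) (fun s => metric c (cinv c (cmap c (gamma s)))) _ := @mcvg_comp _ _ _ _ _ FFt _ _ _ _ _ cg MK.
have L0 := @mcvg_bilin _ _ _ FFt _ _ _ _ _ _ _ c2 c1 c1.
have L : Num.sqrt (bilin (metric c (cinv c (cmap c (gamma s)))) (velocity c gamma s) (velocity c gamma s))
    @[s --> t] --> Num.sqrt (bilin (metric c (cinv c (cmap c (gamma t)))) (velocity c gamma t) (velocity c gamma t)).
  exact: cvg_comp L0 (@sqrt_continuous R _).
apply: (@near_continuous _ _ (fun s => Num.sqrt (bilin (metric c (cinv c (cmap c (gamma s)))) (velocity c gamma s) (velocity c gamma s)))).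
  by apply: filterS2 (near_dom ct dt) E => s ds [_ Es]; rewrite (cmapK ds); exact: esym Es.
exact: L.
Qed.

Lemma speed_continuous gamma t : C1_curve gamma -> 0 <= t <= 1 -> {for t, continuous (speed gamma)}.
Proof.
by move=> H t01; exact: (speed_continuous_chart H t01 (chart_at_atlas _) (chart_at_dom _)).
Qed.

Lemma speed_ge0 gamma t : 0 <= speed gamma t.
Proof. exact: sqrtr_ge0. Qed.

Lemma clamp_continuous : continuous (fun s : R => Num.max 0 (Num.min 1 s)).
Proof.
move=> s; apply: continuous_max; first exact: cst_continuous.
by apply: continuous_min => //; exact: cst_continuous.
Qed.

(** The speed extended by its end values. The extension is continuous on the whole line, so a
    primitive is differentiable from both sides at 0 and 1. *)
Definition csp gamma s := speed gamma (Num.max 0 (Num.min 1 s)).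

Lemma clamp01 (s : R) : 0 <= Num.max 0 (Num.min 1 s) <= 1.
Proof. by rewrite le_max lexx/= ge_max ler01/= ge_min lexx. Qed.

Lemma clamp_id (s : R) : 0 <= s <= 1 -> Num.max 0 (Num.min 1 s) = s.
Proof. by move=> /andP[s0 s1]; rewrite min_r// max_r. Qed.

Lemma csp_id gamma s : 0 <= s <= 1 -> csp gamma s = speed gamma s.
Proof. by move=> s01; rewrite /csp clamp_id. Qed.

Lemma csp_continuous gamma : C1_curve gamma -> continuous (csp gamma).
Proof.
move=> H s; exact: continuous_comp (@clamp_continuous s) (speed_continuous H (clamp01 s)).
Qed.

(** Integration starts at -1 so that 0 is an interior point; only differences of values are used as
    lengths. *)
Definition arclen gamma t : R := \int[lebesgue_measure]_(s in `[-1, t]) csp gamma s.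

Lemma arc_derive gamma t : C1_curve gamma -> 0 <= t <= 1 -> is_derive t 1 (arclen gamma) (speed gamma t).
Proof.
move=> H t01; have := @primitive_exists R (-1) 2 (csp gamma) (fun s _ => csp_continuous H (x := s)) t.
rewrite (csp_id gamma t01); apply.
by case/andP: t01 => t0 t1; rewrite (lt_le_trans (ltrN10 _) t0) (le_lt_trans t1)// ltr1n.
Qed.

Definition reparam gamma (a b : R) : R -> M := fun t => gamma (a + t * (b - a)).

Lemma affine01 (a b t : R) : 0 <= a <= 1 -> 0 <= b <= 1 -> 0 <= t <= 1 -> 0 <= a + t * (b - a) <= 1.
Proof. by move=> /andP[a0 a1] /andP[b0 b1] /andP[t0 t1]; apply/andP; split; nra. Qed.

Lemma reparam_C1 gamma a b : C1_curve gamma -> 0 <= a <= 1 -> 0 <= b <= 1 -> C1_curve (reparam gamma a b).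
Proof.
move=> H a01 b01; apply: C1_curve_intro => t t01; have s01 := affine01 a01 b01 t01.
have [ct Ht] : _ /\ _ := H _ s01.
split; first exact: continuous_comp (@continuous_affine R a (b - a) t) ct.
exists (chart_at (gamma (a + t * (b - a)))); have ac := chart_at_atlas (gamma (a + t * (b - a))).
split; [exact: atlas_compat|exact: chart_at_dom|].
exact: (C1_at_affine (g := cmap _ \o gamma) (Ht _ ac (chart_at_dom _))).
Qed.

Lemma reparam_speed gamma a b t : C1_curve gamma -> 0 <= a <= 1 -> 0 <= b <= 1 -> 0 <= t <= 1 ->
  speed (reparam gamma a b) t = `|b - a| * speed gamma (a + t * (b - a)).
Proof.
move=> H a01 b01 t01; have s01 := affine01 a01 b01 t01; have [ct Ht] : _ /\ _ := H _ s01.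
have ac := chart_at_atlas (gamma (a + t * (b - a))); have dt := chart_at_dom (gamma (a + t * (b - a))).
rewrite /speed /reparam /velocity; have [d _] := Ht _ ac dt.
rewrite (derive1_val (derive1_affine (nbhs_singleton d))).
by rewrite bilinZl bilinZr mulrA -expr2 sqrtrM ?sqr_ge0// sqrtr_sqr.
Qed.

Lemma reparam_length gamma a b : C1_curve gamma -> 0 <= a <= 1 -> 0 <= b <= 1 ->
  curve_length (reparam gamma a b) = `|arclen gamma b - arclen gamma a|.
Proof.
move=> H a01 b01.
pose f t := `|b - a| * csp gamma (a + t * (b - a)).
have fc : continuous f.
  move=> t; apply: cvgMr; exact: cvg_comp (@continuous_affine R a (b - a) t) (csp_continuous H (x := _)).
have Ef : curve_length (reparam gamma a b) = \int[lebesgue_measure]_(t in `[0, 1]) f t.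
  apply: eq_Rintegral => t; rewrite inE/= in_itv/= => t01.
  apply: etrans (reparam_speed H a01 b01 t01) _.
  by rewrite /f (csp_id gamma (affine01 a01 b01 t01)).
have f0 t : 0 <= f t by rewrite mulr_ge0// speed_ge0.
(* [sg] is the sign of the parameter change, since a reparametrisation may reverse the curve. *)
pose sg : R := if a <= b then 1 else -1.
have sgE : sg * (b - a) = `|b - a|.
  rewrite /sg; case: leP => h; first by rewrite mul1r ger0_norm// subr_ge0.
  by rewrite mulN1r ltr0_norm// subr_lt0.
have D t : 0 <= t <= 1 -> is_derive t 1 (fun t => sg * arclen gamma (a + t * (b - a))) (f t).
  move=> t01; have s01 := affine01 a01 b01 t01.
  have h := @is_derive1_comp R (arclen gamma) (fun t => a + t * (b - a)) t _ _ (arc_derive H s01)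
    (is_derive_affine a (b - a) t).
  have -> : f t = sg *: (speed gamma (a + t * (b - a)) * (b - a)).
    by rewrite /f (csp_id gamma s01) -sgE /GRing.scale/=; move: (speed _ _) => q; ring.
  exact: is_deriveZ.
have I : \int[lebesgue_measure]_(t in `[0, 1]) f t = sg * arclen gamma b - sg * arclen gamma a.
  have := @Rintegral_derive R 0 1 f (fun t => sg * arclen gamma (a + t * (b - a))) ltr01.
  have -> : a + 1 * (b - a) = b by ring.
  have -> : a + 0 * (b - a) = a by ring.
  apply => t t01.
  - exact: fc.
  - exact: derive_cont (D t t01).
  - by apply: D; case/andP: t01 => t0 t1; rewrite !ltW.
have I0 : 0 <= \int[lebesgue_measure]_(t in `[0, 1]) f t by apply: Rintegral_ge0.
rewrite Ef I -mulrBr; rewrite I -mulrBr in I0.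
rewrite -[LHS]ger0_norm// normrM; suff -> : `|sg| = 1 by rewrite mul1r.
by rewrite /sg; case: ifP; rewrite ?normrN normr1.
Qed.

Lemma curve_length_arc gamma : C1_curve gamma -> curve_length gamma = `|arclen gamma 1 - arclen gamma 0|.
Proof.
move=> H; have z01 : 0 <= (0 : R) <= 1 by rewrite lexx ler01.
have o01 : 0 <= (1 : R) <= 1 by rewrite lexx ler01.
rewrite -(reparam_length H z01 o01); congr curve_length; by apply/funext => t; rewrite /reparam subr0 mulr1 add0r.
Qed.

Lemma arc_mono gamma a b : C1_curve gamma -> 0 <= a -> a <= b -> b <= 1 -> arclen gamma a <= arclen gamma b.
Proof.
move=> H a0 ab b1; have [->//|nab] := eqVneq a b.
have lab : a < b by rewrite lt_neqAle nab.
have [||t _ E] := @MVT R (arclen gamma) (speed gamma) a b lab.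
- move=> t; rewrite in_itv/= => /andP[t0 t1]; apply: arc_derive => //.
  by rewrite !ltW// ?(le_lt_trans a0)// (lt_le_trans t1).
- apply: within_continuousW => t /andP[t0 t1]; apply: derive_cont (arc_derive H _).
  by rewrite (le_trans a0)// (le_trans t1).
by rewrite -subr_ge0 E mulr_ge0 ?speed_ge0 ?subr_ge0.
Qed.

Lemma joined_piece gamma a b : C1_curve gamma -> 0 <= a <= 1 -> 0 <= b <= 1 ->
  joined_by_length (gamma a) (gamma b) `|arclen gamma b - arclen gamma a|.
Proof.
move=> H a01 b01; have := Joined_cons (reparam_C1 H a01 b01) (Joined_refl _).
rewrite reparam_length// addr0 /reparam mul0r addr0 mul1r addrC subrK.
exact.
Qed.

Lemma joined_trans x y z l l' : joined_by_length x y l -> joined_by_length y z l' ->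
  joined_by_length x z (l + l').
Proof.
move=> H H'; elim: H H' => {x y l} [x|gamma y l Hg _ IH] H'; first by rewrite add0r.
by rewrite -addrA; apply: Joined_cons Hg _; exact: IH.
Qed.

Lemma joined_ge0 x y l : joined_by_length x y l -> 0 <= l.
Proof.
by elim=> {x y l} [//|gamma y l Hg _ l0]; rewrite addr_ge0// curve_length_arc.
Qed.

Lemma joined_sym x y l : joined_by_length x y l -> joined_by_length y x l.
Proof.
elim=> {x y l} [x|gamma y l Hg _ IH]; first exact: Joined_refl.
rewrite addrC; apply: joined_trans IH _; rewrite curve_length_arc// distrC.
by apply: joined_piece; rewrite // ?lexx ?ler01.
Qed.

(** Along the piece that contains the required length, the intermediate value theorem for [arclen]
    gives the point; earlier pieces are removed by induction. This is the source of almost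
    midpoints. *)
Lemma joined_split x y l r : joined_by_length x y l -> 0 <= r <= l ->
  exists z, joined_by_length x z r /\ joined_by_length z y (l - r).
Proof.
move=> H; elim: H r => {x y l} [x|gamma y l Hg Hj IH] r /andP[r0 rl].
  have -> : r = 0 by apply/eqP; rewrite eq_le rl.
  by exists x; rewrite subr0; split; exact: Joined_refl.
have [rc|cr] := leP r (curve_length gamma).
  have arcc : {within `[0, 1], continuous (arclen gamma)}.
    by apply: within_continuousW => t t01; exact: derive_cont (arc_derive Hg t01).
  have m01 := arc_mono Hg (lexx 0) ler01 (lexx 1).
  rewrite curve_length_arc// ger0_norm ?subr_ge0// in rc.
  have [|t] := @IVT R (arclen gamma) 0 1 (arclen gamma 0 + r) ler01 arcc.
    by rewrite min_l// max_r// lerDl r0/= addrC -lerBrDr.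
  rewrite in_itv/= => t01 Et; exists (gamma t); split.
    have := joined_piece Hg (a := 0) (b := t) _ t01; rewrite Et addrC addKr ger0_norm//.
    by apply; rewrite lexx ler01.
  have o01 : 0 <= (1 : R) <= 1 by rewrite lexx ler01.
  have A1 := joined_piece Hg t01 o01; have [t0 t1] := andP t01.
  rewrite ger0_norm ?subr_ge0 ?(arc_mono Hg t0 t1 (lexx _))// in A1.
  have -> : curve_length gamma + l - r = arclen gamma 1 - arclen gamma t + l.
    by rewrite curve_length_arc// ger0_norm ?subr_ge0// Et; ring.
  exact: joined_trans A1 Hj.
have [|z [h1 h2]] := IH (r - curve_length gamma).
  by rewrite subr_ge0 (ltW cr)/= lerBlDl.
exists z; split.
  by rewrite -(subrK (curve_length gamma) r) addrC; exact: Joined_cons Hg h1.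
by have -> : curve_length gamma + l - r = l - (r - curve_length gamma) by ring.
Qed.

End Curves.

(** * The Euclidean norm on row vectors *)

Section EuclideanNorm.
Context {R : realType} {m : nat}.
Implicit Types (u v w : 'rV[R]_m).

Definition dotp u v : R := \sum_i u 0 i * v 0 i.
(** The norm of matrices is the sup norm. A comparison of distances with factors close to 1 needs
    the norm of the inner product that the metric equals at the centre of a chart. *)
Definition enorm v : R := Num.sqrt (dotp v v).

Lemma dotpC u v : dotp u v = dotp v u.
Proof. by apply: eq_bigr => i _; rewrite mulrC. Qed.

Lemma dotpDl u v w : dotp (u + v) w = dotp u w + dotp v w.
Proof. by rewrite /dotp -big_split/=; apply: eq_bigr => i _; rewrite mxE mulrDl. Qed.

Lemma dotpZl a u v : dotp (a *: u) v = a * dotp u v.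
Proof. by rewrite /dotp mulr_sumr; apply: eq_bigr => i _; rewrite mxE mulrA. Qed.

Lemma dotpDr u v w : dotp w (u + v) = dotp w u + dotp w v.
Proof. by rewrite dotpC dotpDl !(dotpC w). Qed.

Lemma dotpZr a u v : dotp v (a *: u) = a * dotp v u.
Proof. by rewrite dotpC dotpZl (dotpC v). Qed.

Lemma dotpBl u v w : dotp (u - v) w = dotp u w - dotp v w.
Proof. by rewrite dotpDl -scaleN1r dotpZl mulN1r. Qed.

Lemma dotp_ge0 v : 0 <= dotp v v.
Proof. by apply: sumr_ge0 => i _; rewrite -expr2 sqr_ge0. Qed.

Lemma enorm_ge0 v : 0 <= enorm v.
Proof. exact: sqrtr_ge0. Qed.

Lemma enorm_sqr v : enorm v ^+ 2 = dotp v v.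
Proof. by rewrite sqr_sqrtr// dotp_ge0. Qed.

Lemma norm_le_enorm v : `|v| <= enorm v.
Proof.
apply: norm_rV_le => [|j]; first exact: enorm_ge0.
rewrite -sqrtr_sqr ler_wsqrtr// /dotp (bigD1 j)//= -expr2 lerDl sumr_ge0// => i _.
by rewrite -expr2 sqr_ge0.
Qed.

Lemma enorm_le v : enorm v <= (m%:R + 1) * `|v|.
Proof.
have h : dotp v v <= m%:R * `|v| ^+ 2.
  rewrite mulr_natl -[X in _ *+ X]card_ord -sumr_const; apply: ler_sum => i _.
  by rewrite -expr2 -[v 0 i ^+ 2]ger0_norm ?sqr_ge0// normrX lerXn2r ?nnegrE// coord_le_norm.
rewrite -(@ler_pXn2r _ 2) ?nnegrE ?enorm_ge0 ?mulr_ge0 ?addr_ge0// enorm_sqr (le_trans h)//.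
rewrite exprMn ler_wpM2r ?sqr_ge0//.
have : 0 <= m%:R :> R by []. 
by move: (m%:R : R) => a a0; nra.
Qed.

Lemma cauchy_schwarz u v : dotp u v <= enorm u * enorm v.
Proof.
have [uv0|uv0] := leP (dotp u v) 0; first by rewrite (le_trans uv0)// mulr_ge0// enorm_ge0.
rewrite -(@ler_pXn2r _ 2) ?nnegrE ?(ltW uv0) ?mulr_ge0 ?enorm_ge0// exprMn !enorm_sqr.
have h t : 0 <= dotp u u - 2 * t * dotp u v + t ^+ 2 * dotp v v.
  have := dotp_ge0 (u - t *: v); rewrite dotpBl dotpC dotpBl dotpZl (dotpC _ (u - _)) dotpZr.
  by rewrite dotpBl dotpZl (dotpC v u); congr (_ <= _); ring.
move: (dotp_ge0 v) h uv0; move: (dotp u u) (dotp v v) (dotp u v) => a b c b0 h c0.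
have [b_0|bn] := eqVneq b 0.
  have := h ((a + 1) / (2 * c)); rewrite b_0 mulr0 addr0.
  have -> : 2 * ((a + 1) / (2 * c)) * c = a + 1 by field; rewrite gt_eqF.
  by rewrite opprD addrA subrr sub0r oppr_ge0 ler10.
have bp : 0 < b by rewrite lt_neqAle eq_sym bn.
have := h (c / b).
have -> : a - 2 * (c / b) * c + (c / b) ^+ 2 * b = (a * b - c ^+ 2) / b by field.
by rewrite pmulr_lge0 ?invr_gt0// subr_ge0.
Qed.

Lemma enormD u v : enorm (u + v) <= enorm u + enorm v.
Proof.
rewrite -(@ler_pXn2r _ 2) ?nnegrE ?addr_ge0 ?enorm_ge0// sqrrD !enorm_sqr.
rewrite dotpDl !dotpDr (dotpC v u); have := cauchy_schwarz u v.
by move: (dotp u u) (dotp v v) (dotp u v) (enorm u * enorm v) => a b c d; rewrite -mulr_natl => h; lra.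
Qed.

Lemma enormN v : enorm (- v) = enorm v.
Proof. by rewrite /enorm -scaleN1r dotpZl dotpZr !mulN1r opprK. Qed.

Lemma enorm0 : enorm (0 : 'rV[R]_m) = 0.
Proof. by rewrite /enorm -(scale0r 0) dotpZl mul0r sqrtr0. Qed.

Lemma enormZ a v : enorm (a *: v) = `|a| * enorm v.
Proof. by rewrite /enorm dotpZl dotpZr mulrA -expr2 sqrtrM ?sqr_ge0// sqrtr_sqr. Qed.

Lemma enorm_distC u v : enorm (u - v) = enorm (v - u).
Proof. by rewrite -enormN opprB. Qed.

Lemma enorm_triangle u v w : enorm (u - w) <= enorm (u - v) + enorm (v - w).
Proof. by have := enormD (u - v) (v - w); rewrite addrA subrK. Qed.

Lemma enorm_dist_lt (x y z : 'rV[R]_m) e : 0 < e -> `|x - y| < e / (m%:R + 1) ->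
  `|enorm (x - z) - enorm (y - z)| < e.
Proof.
move=> e0 xy; have m0 : 0 < m%:R + 1 :> R by rewrite ltr_wpDl.
have h : enorm (x - y) < e by rewrite (le_lt_trans (enorm_le _))// mulrC -ltr_pdivlMr.
have h1 := enorm_triangle x y z; have h2 := enorm_triangle y x z.
rewrite (enorm_distC y x) in h2.
move: h h1 h2; move: (enorm (x - y)) (enorm (x - z)) (enorm (y - z)) => a b c h h1 h2.
by rewrite ltr_norml; apply/andP; split; lra.
Qed.

Lemma enorm_continuous (z : 'rV[R]_m) : continuous (fun y : 'rV[R]_m => enorm (y - z)).
Proof.
move=> y; apply/(@cvgrPdist_lt _ _ _ (nbhs y) (nbhs_filter y)) => e e0.
apply/near_ballP; exists (e / (m%:R + 1)); first by rewrite divr_gt0// ltr_wpDl.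
by move=> x xy; rewrite distrC; exact: enorm_dist_lt.
Qed.

Lemma enorm_ball_open z r : open [set y : 'rV[R]_m | enorm (y - z) < r].
Proof.
rewrite openE => y /= yr; apply/near_ballP; exists ((r - enorm (y - z)) / (m%:R + 1)).
  by rewrite divr_gt0 ?subr_gt0// ltr_wpDl.
move=> x xy; have := @enorm_dist_lt x y z (r - enorm (y - z)) _ xy.
by rewrite subr_gt0 => /(_ yr) /(le_lt_trans (ler_norm _)); rewrite ltrD2r.
Qed.

Lemma enorm_ball_compact (z : 'rV[R]_m) r : compact [set y : 'rV[R]_m | enorm (y - z) <= r].
Proof.
apply: bounded_closed_compact; first last.
  have : closed ((fun q : 'rV[R]_m => enorm (q - z)) @^-1` [set x | x <= r]).
    by apply: closed_comp => [q _|]; [exact: enorm_continuous|exact: closed_le].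
  exact.
exists (`|z| + `|r|); split; first exact: num_real.
  move=> b hb y /= yr; rewrite -(subrK z y) (le_trans (ler_normD _ _))// (le_trans _ (ltW hb))//.
  by rewrite addrC lerD2l (le_trans (norm_le_enorm _))// (le_trans yr)// ler_norm.
Qed.

End EuclideanNorm.

(** Induction over the unit interval: the supremum of the parameters up to which [P] holds is
    attained by the closure clause, and the extension clause forces it to be 1. *)
Lemma seg_ind {R : realType} (P : R -> Prop) : P 0 ->
  (forall t, 0 <= t < 1 -> (forall s, 0 <= s <= t -> P s) ->
     exists2 d, 0 < d & forall s, t <= s < t + d -> s <= 1 -> P s) ->
  (forall t, 0 < t <= 1 -> (forall s, 0 <= s < t -> P s) -> P t) ->
  forall t, 0 <= t <= 1 -> P t.
Proof.
move=> P0 Pop Pcl.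
pose A := [set t | 0 <= t <= 1 /\ forall s, 0 <= s <= t -> P s].
have A0 : A 0.
  by split; [rewrite lexx ler01|move=> s /andP[s0 s1]; have -> : s = 0 by apply/eqP; rewrite eq_le s1].
have hsA : has_sup A by split; [exists 0|exists 1 => t [/andP[]]].
pose T := sup A.
have T0 : 0 <= T by exact: ub_le_sup hsA.2 _ A0.
have T1 : T <= 1 by apply: sup_le_ub; [exists 0|move=> t [/andP[]]].
have below s : 0 <= s < T -> P s.
  move=> /andP[s0 sT]; have [|t At] := @sup_adherent R A (T - s) _ hsA; first by rewrite subr_gt0.
  by rewrite subKr => st; apply: At.2; rewrite s0 ltW.
have PT : forall s, 0 <= s <= T -> P s.
  move=> s /andP[s0]; rewrite le_eqVlt => /orP[/eqP ->|sT]; last by apply: below; rewrite s0.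
  move: T0; rewrite le_eqVlt => /orP[/eqP <- //|Tp].
  by apply: Pcl => //; rewrite Tp.
suff : T = 1 by move=> e t; rewrite -e; exact: PT.
apply/eqP; rewrite eq_le T1/= leNgt; apply/negP => Tl1.
have [|d d0 Pd] := Pop T _ PT; first by rewrite T0.
pose t := Num.min 1 (T + d / 2).
have Tt : T < t by rewrite lt_min Tl1/= ltrDl divr_gt0.
have td : t < T + d.
  by rewrite gt_min ltrD2l ltr_pdivrMr// mulr_natr mulr2n ltrDl d0 orbT.
have t1 : t <= 1 by rewrite ge_min lexx.
suff : A t by move=> At; have := ub_le_sup hsA.2 At; rewrite leNgt Tt.
split; first by rewrite t1 (le_trans T0)// ltW.
move=> s /andP[s0 st]; have [sT|Ts] := leP s T; first by apply: PT; rewrite s0.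
by apply: Pd; [rewrite (ltW Ts)/= (le_lt_trans st)|exact: le_trans st t1].
Qed.

Lemma isd_lin_scale {R : realType} {V : normedModType R} (v : V) (t : R) :
  isd (fun s : R => s *: v) t (fun s => s *: v).
Proof.
have H : is_diff t (fun s : R => s *: v) (fun s => s *: v) by exact: is_diff_scalel.
by split; [exact: ex_diff|move=> u; rewrite diff_val].
Qed.

Lemma is_derive_dotp {R : realType} {m} (d : 'rV[R]_m) (g : R -> 'rV[R]_m) (s : R) g' :
  is_derive s (1 : R) g g' -> is_derive s (1 : R) (fun t => dotp (g t) d) (dotp g' d).
Proof.
move=> /isd_curve H; apply: (isd_curve _ _ _).2.
have E i : isd (fun t => g t 0 i * d 0 i) s (fun t => t *: (g' 0 i * d 0 i)).
  have := isdZ (d 0 i) (isd_coord i H).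
  have -> : (fun t => g t 0 i * d 0 i) = (fun t => d 0 i *: (g t 0 i : R^o)).
    by apply/funext => t; rewrite mulrC.
  by apply: isd_ext => t; rewrite mxE /GRing.scale/=; ring.
have := isd_bigsum (index_enum _) E; apply: isd_ext => t.
by rewrite -scaler_sumr.
Qed.

(** * Lengths of curves inside a chart *)

Section ChartEstimates.
Context {R : realType} {n : nat} (M : kahlerManifold R n).
Implicit Types (x y : M) (c : chart R M (n + n)) (u v w z : 'rV[R]_(n + n)).

Lemma segment_joined c w w' mu : compat c ->
  (forall t : R, 0 <= t <= 1 -> (cmap c @` dom c) (w + t *: (w' - w))) ->
  (forall t : R, 0 <= t <= 1 ->
     bilin (gram c (cinv c (w + t *: (w' - w)))) (w' - w) (w' - w) <= mu ^+ 2) -> 0 <= mu ->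
  exists2 l, joined_by_length (cinv c w) (cinv c w') l & l <= mu.
Proof.
move=> hc Hi Hm mu0; pose a (t : R) := w + t *: (w' - w).
pose gamma t := cinv c (a t).
have ad (t : R) : is_derive t (1 : R) a (w' - w).
  apply: (isd_curve _ _ _).2.
  have H := isdD (isd_cst w t) (isd_lin_scale (w' - w) t).
  by apply: isd_ext H => v; rewrite add0r.
have ac (t : R) : {for t, continuous a}.
  by apply: derivable_cont; case: (ad t).
have cg (t : R) : 0 <= t <= 1 -> {for t, continuous gamma}.
  by move=> t01; exact: cvg_comp (ac t) (cinv_continuous (Hi t t01)).
have ne (t : R) : 0 <= t <= 1 -> \forall s \near t, a s = (cmap c \o gamma) s.
  move=> t01; have N : \forall z \near a t, (cmap c @` dom c) z.
    exact: open_nbhs_nbhs (conj (@codom_open _ _ _ c) (Hi t t01)).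
  have N' : \forall s \near t, (cmap c @` dom c) (a s) := ac t _ N.
  by apply: filterS N' => s /image_cinv [_ e]; rewrite /gamma /= e.
have dg (t : R) : 0 <= t <= 1 -> dom c (gamma t) by move=> t01; exact: (image_cinv (Hi t t01)).1.
have C1a (t : R) : C1_at a t.
  apply: (@C1_at_intro _ _ _ (fun=> w' - w)); last exact: cst_continuous.
  by apply: (@filterE _ (nbhs t)) => s; exact: ad.
have C1 : C1_curve gamma.
  apply: C1_curve_intro => t t01; split; first exact: cg.
  exists c; split => //; first exact: dg.
  exact: C1_at_near (ne t t01) (C1a t).
have sp (t : R) : 0 <= t <= 1 -> speed gamma t <= mu.
  move=> t01; have [e d] := near_derive1 (ne t t01).
  have da : derivable a t 1 by case: (ad t).
  rewrite (speed_compat hc (cg t t01) (dg t t01) (d da)) -e (derive1_val (ad t)).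
  rewrite -[leRHS]ger0_norm// -sqrtr_sqr ler_wsqrtr//; exact: Hm.
have z01 : 0 <= (0 : R) <= 1 by rewrite lexx ler01.
have o01 : 0 <= (1 : R) <= 1 by rewrite lexx ler01.
have J := joined_piece C1 z01 o01.
rewrite /gamma /a scale0r addr0 scale1r addrC subrK in J.
exists `|arclen gamma 1 - arclen gamma 0| => //.
have [||t t01 E] := @MVT R (arclen gamma) (speed gamma) 0 1 ltr01.
- move=> t; rewrite in_itv/= => /andP[t0 t1]; apply: arc_derive C1 _.
  by rewrite !ltW.
- by apply: within_continuousW => t t01; apply: derive_cont (arc_derive C1 t01).
rewrite E subr0 mulr1 ger0_norm ?speed_ge0//; apply: sp.
by move: t01; rewrite in_itv/= => /andP[t0 t1]; rewrite !ltW.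
Qed.

Section Exit.
Variables (c : chart R M (n + n)) (z0 : 'rV[R]_(n + n)) (r mu : R).
Hypothesis hc : compat c.
Hypothesis mu0 : 0 < mu.
Hypothesis HB : forall z, enorm (z - z0) < r -> (cmap c @` dom c) z /\
  forall v, dotp v v <= mu ^+ 2 * bilin (gram c (cinv c z)) v v.

(** The curve is paired with its own total displacement [d]. By the Cauchy-Schwarz inequality the
    derivative of that pairing is at most [mu * enorm d] times the speed, so [h] does not decrease;
    dividing by [enorm d] avoids differentiating a norm along the curve. *)
Lemma curve_displacement gamma (t : R) : C1_curve gamma -> 0 <= t <= 1 ->
  (forall s : R, 0 <= s <= t -> dom c (gamma s) /\ enorm (cmap c (gamma s) - z0) < r) ->
  enorm (cmap c (gamma t) - cmap c (gamma 0)) <= mu * (arclen gamma t - arclen gamma 0).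
Proof.
move=> H t01 Hs; have [t0 t1] := andP t01.
have [->|tn] := eqVneq t 0; first by rewrite !subrr enorm0 mulr0.
have tp : 0 < t by rewrite lt_neqAle eq_sym tn.
pose d := cmap c (gamma t) - cmap c (gamma 0).
have m0 : 0 <= mu * (arclen gamma t - arclen gamma 0).
  by rewrite mulr_ge0 ?(ltW mu0)// subr_ge0 (arc_mono H).
have [d0|dn] := eqVneq (enorm d) 0; first by rewrite -/d d0.
have dp : 0 < enorm d by rewrite lt_neqAle eq_sym dn enorm_ge0.
pose h (s : R) := (mu * enorm d) * arclen gamma s - dotp (cmap c (gamma s)) d.
pose v (s : R) := derive1 (cmap c \o gamma) s.
have D (s : R) : 0 <= s <= t -> is_derive s (1 : R) h (mu * enorm d * speed gamma s - dotp (v s) d).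
  move=> st; have s01 : 0 <= s <= 1 by case/andP: st => s0 s1; rewrite s0 (le_trans s1).
  have [ds _] := Hs s st; have [dv _] := C1_curve_compat H s01 hc ds.
  have h1 := arc_derive H s01; have h2 := is_derive_dotp d (is_derive1 (nbhs_singleton dv)).
  exact: (is_deriveB (is_deriveZ (mu * enorm d) h1) h2).
have D0 (s : R) : 0 <= s <= t -> 0 <= mu * enorm d * speed gamma s - dotp (v s) d.
  move=> st; have s01 : 0 <= s <= 1 by case/andP: st => s0 s1; rewrite s0 (le_trans s1).
  have [ds es] := Hs s st; have C1 := C1_curve_compat H s01 hc ds.
  have [cs _] : _ /\ _ := H s s01.
  have [_ /(_ (v s)) hb] := HB es; rewrite (cmapK ds) in hb.
  rewrite subr_ge0 (le_trans (cauchy_schwarz _ _))// mulrAC ler_wpM2r ?enorm_ge0//.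
  rewrite (speed_compat hc cs ds (nbhs_singleton C1.1)) -/(v s).
  rewrite -[mu]ger0_norm ?(ltW mu0)// -sqrtr_sqr -sqrtrM ?sqr_ge0//.
  exact: ler_wsqrtr.
have [||s st E] := @MVT R h (fun s => mu * enorm d * speed gamma s - dotp (v s) d) 0 t tp.
- by move=> s; rewrite in_itv/= => /andP[s0 s1]; apply: D; rewrite !ltW.
- by apply: within_continuousW => s st; exact: derive_cont (D s st).
move: st; rewrite in_itv/= => /andP[s0 s1].
have : 0 <= h t - h 0 by rewrite E subr0 mulr_ge0//; apply: D0; rewrite !ltW.
have -> : h t - h 0 = enorm d * (mu * (arclen gamma t - arclen gamma 0)) - enorm d ^+ 2.
  rewrite enorm_sqr {3}/d dotpBl /h; move: (dotp _ _) (dotp _ _) (arclen _ _) (arclen _ _) => a b p q; ring.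
by rewrite expr2 -mulrBr pmulr_rge0// subr_ge0.
Qed.

(** Induction along the curve, with the displacement bound keeping it in the smaller closed ball of
    radius [r']. A curve cannot leave the domain of the chart while its coordinates stay in this
    ball: the image of the ball is compact, hence closed in a Hausdorff space. *)
Lemma curve_inside gamma : C1_curve gamma -> dom c (gamma 0) ->
  enorm (cmap c (gamma 0) - z0) + mu * curve_length gamma < r ->
  forall t : R, 0 <= t <= 1 -> dom c (gamma t) /\ enorm (cmap c (gamma t) - z0) < r.
Proof.
move=> H d0 Hr; have z01 : 0 <= (0 : R) <= 1 by rewrite lexx ler01.
have o01 : 0 <= (1 : R) <= 1 by rewrite lexx ler01.
have Lg : curve_length gamma = arclen gamma 1 - arclen gamma 0.
  by rewrite curve_length_arc// ger0_norm// subr_ge0 (arc_mono H) ?ler01.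
have L0 : 0 <= curve_length gamma by rewrite Lg subr_ge0 (arc_mono H) ?ler01.
pose r' := enorm (cmap c (gamma 0) - z0) + mu * curve_length gamma.
have near_in (t : R) : 0 <= t <= 1 -> dom c (gamma t) /\ enorm (cmap c (gamma t) - z0) < r ->
    \forall s \near t, dom c (gamma s) /\ enorm (cmap c (gamma s) - z0) < r.
  move=> t01 [dt et]; have [ct _] : _ /\ _ := H t t01.
  have N1 := near_dom ct dt.
  have cg : {for t, continuous (cmap c \o gamma)} := C1_at_cont (C1_curve_compat H t01 hc dt).
  have N2 : \forall s \near t, enorm (cmap c (gamma s) - z0) < r.
    have N : nbhs (cmap c (gamma t)) [set z : 'rV[R]_(n + n) | enorm (z - z0) < r].
      by apply: open_nbhs_nbhs; split; [exact: enorm_ball_open|].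
    exact: cg _ N.
  by apply: filterS2 N1 N2 => s; split.
have bound (t : R) : 0 <= t <= 1 ->
    (forall s : R, 0 <= s <= t -> dom c (gamma s) /\ enorm (cmap c (gamma s) - z0) < r) ->
    enorm (cmap c (gamma t) - z0) <= r'.
  move=> t01 Hs; have [t0 t1] := andP t01.
  rewrite (le_trans (enorm_triangle _ (cmap c (gamma 0)) _))// addrC lerD2l.
  apply: le_trans (curve_displacement H t01 Hs) _; rewrite (ler_pM2l mu0) Lg.
  by apply: lerB; [exact: (arc_mono H t0 t1 (lexx _))|exact: lexx].
apply: seg_ind.
- by split => //; rewrite (le_lt_trans _ Hr)// lerDl mulr_ge0// ltW.
- move=> t /andP[t0 t1] Hs; have t01 : 0 <= t <= 1 by rewrite t0 ltW.
  have := near_in t t01 (Hs t _); rewrite t0 lexx => /(_ isT) /nbhs_ballP [e /= e0 He].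
  exists e => // s /andP[ts ste] _; apply: He.
  by rewrite /ball/= ler0_norm ?subr_le0// opprB ltrBlDl.
- move=> t /andP[t0 t1] Hs; have t01 : 0 <= t <= 1 by rewrite (ltW t0).
  have [ct _] : _ /\ _ := H t t01.
  pose Kc := [set z : 'rV[R]_(n + n) | enorm (z - z0) <= r'].
  have KB z : Kc z -> enorm (z - z0) < r by move=> /le_lt_trans; apply.
  have cK : compact (cinv c @` Kc).
    have cKc : compact Kc := @enorm_ball_compact _ _ z0 r'.
    apply: continuous_compact _ cKc.
    apply: continuous_in_subspaceT => z; rewrite inE => /KB /HB [iz _].
    exact: (cinv_continuous iz).
  have clK : closed (cinv c @` Kc) := compact_closed (@carrier_hausdorff _ _ M) cK.
  have : (cinv c @` Kc) (gamma t).
    apply: clK => A /ct /nbhs_ballP [e /= e0 He].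
    pose s := Num.max (t / 2) (t - e / 2).
    have st : s < t.
      by rewrite gt_max ltr_pdivrMr// mulr_natr mulr2n ltrDr t0 ltrBlDr ltrDl divr_gt0.
    have s0 : 0 <= s by rewrite le_max divr_ge0// ltW.
    have se : `|t - s| < e.
      rewrite gtr0_norm ?subr_gt0// ltrBlDl -ltrBlDr lt_max; apply/orP; right.
      by rewrite ltrD2l ltrN2 ltr_pdivrMr// mulr_natr mulr2n ltrDl.
    exists (gamma s); split; last by apply: He; rewrite /ball/=.
    have Hss : forall s' : R, 0 <= s' <= s -> dom c (gamma s') /\ enorm (cmap c (gamma s') - z0) < r.
      by move=> s' /andP[s'0 s's]; apply: Hs; rewrite s'0 (le_lt_trans s's).
    exists (cmap c (gamma s)); last by apply: cmapK; apply: (Hss s _).1; rewrite s0 lexx.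
    by apply: bound Hss; rewrite s0 ltW// (lt_le_trans st).
  move=> [z Kz <-]; have [iz _] := HB (KB _ Kz).
  by have [dz ez] := image_cinv iz; rewrite ez; split => //; exact: KB.
Qed.

Lemma joined_inside x y l : joined_by_length x y l -> dom c x ->
  enorm (cmap c x - z0) + mu * l < r ->
  dom c y /\ enorm (cmap c y - cmap c x) <= mu * l.
Proof.
elim=> {x y l} [x|gamma y l H Hj IH] dx Hr; first by rewrite subrr enorm0 mulr0.
have l0 := joined_ge0 Hj.
have Hr1 : enorm (cmap c (gamma 0) - z0) + mu * curve_length gamma < r.
  by rewrite (le_lt_trans _ Hr)// lerD2l ler_pM2l// lerDl.
have inn := curve_inside H dx Hr1.
have o01 : 0 <= (1 : R) <= 1 by rewrite lexx ler01.
have [d1 e1] := inn 1 o01.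
have disp : enorm (cmap c (gamma 1) - cmap c (gamma 0)) <= mu * curve_length gamma.
  rewrite (le_trans (curve_displacement H o01 inn))// curve_length_arc//.
  by rewrite ler_pM2l// ler_norm.
have [|dy ey] := IH d1.
  rewrite (le_lt_trans _ Hr)// mulrDr addrA lerD2r.
  rewrite (le_trans (enorm_triangle _ (cmap c (gamma 0)) _))//.
  by rewrite addrC; apply: lerD.
split => //; rewrite (le_trans (enorm_triangle _ (cmap c (gamma 1)) _))// mulrDr addrC.
exact: lerD.
Qed.

End Exit.
End ChartEstimates.

(** * The Riemannian distance and its topology *)

Section Distance.
Context {R : realType} {n : nat} (M : kahlerManifold R n).
Implicit Types (x y z : M) (c : chart R M (n + n)).

Lemma joined_refl0 x : joined_by_length x x 0.
Proof. exact: Joined_refl. Qed.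

Lemma rdist_le x y l : joined_by_length x y l -> rdist x y <= l.
Proof. by move=> H; apply: inf_lbound H; exists 0 => r; exact: joined_ge0. Qed.

Lemma rdist_ge0 x y : 0 <= rdist x y.
Proof.
(* For points that no curve joins, the infimum of the empty set is 0. *)
rewrite /rdist; have [->|/set0P ne] := eqVneq [set l | joined_by_length x y l] set0.
  by rewrite inf0.
by apply: lb_le_inf => // r; exact: joined_ge0.
Qed.

Lemma rdist_xx x : rdist x x = 0.
Proof. by apply/eqP; rewrite eq_le rdist_ge0 rdist_le//; exact: joined_refl0. Qed.

Lemma rdist_sym x y : rdist x y = rdist y x.
Proof.
by rewrite /rdist; congr inf; apply/seteqP; split => l /joined_sym.
Qed.

(* [C] controls the metric in the chart on the Euclidean ball of radius [r] around [cmap c x]. *)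
Definition chart_ball c x r C := [/\ compat c, dom c x, 0 < r, 0 < C &
  forall w, enorm (w - cmap c x) < r -> (cmap c @` dom c) w /\
    forall v, dotp v v <= C ^+ 2 * bilin (gram c (cinv c w)) v v /\
              bilin (gram c (cinv c w)) v v <= C ^+ 2 * dotp v v].

Lemma enorm_convex {m} (a w w' : 'rV[R]_m) r (t : R) : 0 <= t <= 1 ->
  enorm (w - a) < r -> enorm (w' - a) < r -> enorm (w + t *: (w' - w) - a) < r.
Proof.
move=> /andP[t0 t1] wr wr'.
have -> : w + t *: (w' - w) - a = (1 - t) *: (w - a) + t *: (w' - a).
  by apply/rowP => i; rewrite !mxE; ring.
rewrite (le_lt_trans (enormD _ _))// !enormZ ger0_norm ?subr_ge0// ger0_norm//.
have e1 := enorm_ge0 (w - a); have e2 := enorm_ge0 (w' - a).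
move: (enorm (w - a)) (enorm (w' - a)) wr wr' e1 e2 => p q wr wr' e1 e2.
have [->|tn] := eqVneq t 0; first by rewrite subr0 mul1r mul0r addr0.
have tp : 0 < t by rewrite lt_neqAle eq_sym tn.
have : t * q < t * r by rewrite ltr_pM2l.
have : (1 - t) * p <= (1 - t) * r by rewrite ler_wpM2l ?subr_ge0// ltW.
by move=> h1 h2; lra.
Qed.

Section ChartBall.
Variables (c : chart R M (n + n)) (x : M) (r a b : R).
Hypothesis hc : compat c.
Hypothesis dx : dom c x.
Hypothesis a0 : 0 < a.
Hypothesis b0 : 0 < b.
Hypothesis HB : forall w, enorm (w - cmap c x) < r -> (cmap c @` dom c) w /\
    forall v, dotp v v <= a ^+ 2 * bilin (gram c (cinv c w)) v v /\
              bilin (gram c (cinv c w)) v v <= b ^+ 2 * dotp v v.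

Lemma chart_joined w w' : enorm (w - cmap c x) < r -> enorm (w' - cmap c x) < r ->
  exists2 l, joined_by_length (cinv c w) (cinv c w') l & l <= b * enorm (w' - w).
Proof.
move=> wr wr'; apply: segment_joined => //.
- by move=> t t01; exact: (HB (enorm_convex t01 wr wr')).1.
- move=> t t01; rewrite exprMn enorm_sqr.
  exact: ((HB (enorm_convex t01 wr wr')).2 _).2.
- by rewrite mulr_ge0 ?enorm_ge0// ltW.
Qed.

Lemma chart_rdist_le w w' : enorm (w - cmap c x) < r -> enorm (w' - cmap c x) < r ->
  rdist (cinv c w) (cinv c w') <= b * enorm (w' - w).
Proof. by move=> wr wr'; have [l /rdist_le H1 H2] := chart_joined wr wr'; exact: le_trans H1 H2. Qed.

Lemma chart_joined_ge y y' l : dom c y -> joined_by_length y y' l ->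
  enorm (cmap c y - cmap c x) + a * l < r ->
  dom c y' /\ enorm (cmap c y' - cmap c y) <= a * l.
Proof.
move=> dy J Hr; apply: (@joined_inside _ _ _ c (cmap c x) r a) J dy Hr => //.
by move=> z /HB [h1 h2]; split => // v; exact: (h2 v).1.
Qed.

(** The infimum need not be attained, so the strict inequality provides a slack [s] for an almost
    shortest curve. The existence of some curve is assumed because otherwise the distance would be
    the infimum of the empty set. *)
Lemma chart_rdist_ge y y' : dom c y -> (exists l, joined_by_length y y' l) ->
  enorm (cmap c y - cmap c x) + a * rdist y y' < r ->
  dom c y' /\ enorm (cmap c y' - cmap c y) <= a * rdist y y'.
Proof.
move=> dy [l0 J0] Hr.
have hinf : has_inf [set l | joined_by_length y y' l].
  by split; [exists l0|exists 0 => l; exact: joined_ge0].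
have H e : 0 < e -> enorm (cmap c y - cmap c x) + a * (rdist y y' + e) < r ->
    dom c y' /\ enorm (cmap c y' - cmap c y) <= a * (rdist y y' + e).
  move=> e0 Hre; have [l J le] := inf_adherent e0 hinf.
  have al : a * l <= a * (rdist y y' + e) by rewrite ler_pM2l// ltW.
  have [|d1 d2] := chart_joined_ge dy J; first by rewrite (le_lt_trans _ Hre)// lerD2l.
  by split => //; exact: le_trans d2 al.
pose s := r - (enorm (cmap c y - cmap c x) + a * rdist y y').
have s0 : 0 < s by rewrite subr_gt0.
have He e : 0 < e -> e < s / a -> enorm (cmap c y - cmap c x) + a * (rdist y y' + e) < r.
  by move=> e0; rewrite ltr_pdivlMr// => es; rewrite mulrDr addrA -ltrBrDl mulrC.
have sa : 0 < s / a by rewrite divr_gt0.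
have h2 : 0 < s / a / 2 by rewrite divr_gt0.
have [|d1 _] := H _ h2 (He _ h2 _); first by rewrite ltr_pdivrMr// mulr_natr mulr2n ltrDl.
split => //; apply/ler_addgt0Pr => e e0.
pose e' := Num.min (e / a) (s / a / 2).
have e'0 : 0 < e' by rewrite lt_min h2 divr_gt0.
have e's : e' < s / a.
  by rewrite gt_min; apply/orP; right; rewrite ltr_pdivrMr// mulr_natr mulr2n ltrDl.
have [_ d2] := H _ e'0 (He _ e'0 e's).
rewrite (le_trans d2)// mulrDr lerD2l mulrC -ler_pdivlMr// ge_min lexx//.
Qed.

End ChartBall.

Lemma gram_local x : exists r C, chart_ball (chart_at x) x r C.
Proof.
have ac := chart_at_atlas x; have dx := chart_at_dom x.
have [r [C [r0 C0 H]]] := metric_bounds_near (metric_kahler ac) (image_cmap dx).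
pose k : R := (n + n)%:R + 1; have k0 : 0 < k by rewrite ltr_wpDl.
(* The factor [k] converts between the sup norm and the Euclidean norm; [C + 1] is used because the
   constant enters squared and [C <= (C + 1) ^+ 2]. *)
exists r, (k * (C + 1)); split => //; first exact: atlas_compat.
  by rewrite mulr_gt0// addr_gt0.
move=> w wr; have Hw := H w (le_lt_trans (norm_le_enorm _) wr).
have Iw := mb_in Hw; have [dw ew] := image_cinv Iw.
have k1 : 1 <= k by rewrite lerDr.
split => // v; rewrite gram_atlas//.
have h1 := mb_lower Hw v; have h2 := le_trans (ler_norm _) (mb_upper Hw v v).
have h3 := enorm_le v; have h4 := norm_le_enorm v; have h5 := normr_ge0 v.
rewrite -/k in h3; rewrite -!enorm_sqr -mulrA -expr2 in h2 *.
have g0 : 0 <= bilin (metric (chart_at x) (cinv (chart_at x) w)) v v.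
  have := le_trans (sqr_ge0 _) h1; by rewrite pmulr_rge0.
move: (bilin _ _ _) (enorm v) (`|v|) h1 h2 h3 h4 h5 g0 => g e q h1 h2 h3 h4 h5 g0.
have CC : C <= (C + 1) ^+ 2 by nra.
have k2 : 1 <= k ^+ 2 by rewrite exprn_ege1.
rewrite exprMn; split.
  have e0 : 0 <= e := le_trans h5 h4.
  have kq0 : 0 <= k * q by rewrite mulr_ge0// ltW.
  have : e ^+ 2 <= (k * q) ^+ 2 by rewrite lerXn2r ?nnegrE.
  move=> h; apply: le_trans h _; rewrite (exprMn 2 k q) -(mulrA (k ^+ 2)).
  by apply: ler_wpM2l; rewrite ?sqr_ge0// (le_trans h1)// ler_wpM2r.
rewrite (le_trans h2)//.
have e2 : q ^+ 2 <= e ^+ 2 by rewrite lerXn2r ?nnegrE// (le_trans h5).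
apply: ler_pM => //; [exact: ltW|exact: sqr_ge0|].
rewrite (le_trans CC)// ler_peMl ?sqr_ge0//.
Qed.

Lemma near_joined x e : 0 < e -> \forall y \near x, exists2 l, joined_by_length x y l & l < e.
Proof.
move=> e0; have [r [C [hc dx r0 C0 HB]]] := gram_local x.
pose c := chart_at x; pose d := Num.min r (e / C).
have d0 : 0 < d by rewrite lt_min r0 divr_gt0.
have N1 : \forall y \near x, dom c y by apply: open_nbhs_nbhs; split; [exact: dom_open|].
have N2 : \forall y \near x, enorm (cmap c y - cmap c x) < d.
  have N : nbhs (cmap c x) [set z : 'rV[R]_(n + n) | enorm (z - cmap c x) < d].
    by apply: open_nbhs_nbhs; split; [exact: enorm_ball_open|rewrite /= subrr enorm0].
  exact: (cmap_continuous dx) _ N.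
apply: filterS2 N1 N2 => y dy; rewrite lt_min => /andP[yr ye].
have x0 : enorm (cmap c x - cmap c x) < r by rewrite subrr enorm0.
have [l J le] := chart_joined hc C0 HB x0 yr.
rewrite !cmapK// in J; exists l => //; rewrite (le_lt_trans le)//.
by rewrite mulrC -ltr_pdivlMr.
Qed.

Lemma rdist_near x e : 0 < e -> \forall y \near x, rdist x y < e.
Proof.
by move=> /(near_joined x); apply: filterS => y [l /rdist_le h]; exact: le_lt_trans.
Qed.

Hypothesis conn : connected [set: M].

Lemma all_joined x y : exists l, joined_by_length x y l.
Proof.
pose A := [set y | exists l, joined_by_length x y l].
have oA : open A.
  rewrite openE => z [l Jl]; apply: filterS (near_joined z ltr01) => w [l' Jl' _].
  by exists (l + l'); exact: joined_trans Jl Jl'.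
have cA : closed A.
  rewrite -[A]setCK; apply: open_closedC; rewrite openE => z nz.
  apply: filterS (near_joined z ltr01) => w [l' Jl' _] [l Jl]; apply: nz.
  by exists (l + l'); apply: joined_trans Jl (joined_sym Jl').
suff : A = setT by move=> AT; have : A y by rewrite AT.
apply: conn; first by exists x, 0; exact: joined_refl0.
- by exists A; rewrite ?setTI.
- by exists A; rewrite ?setTI.
Qed.

Lemma has_inf_joined x y : has_inf [set l | joined_by_length x y l].
Proof.
by have [l0 J0] := all_joined x y; split; [exists l0|exists 0 => l; exact: joined_ge0].
Qed.

Lemma rdist_lt x y e : 0 < e -> exists2 l, joined_by_length x y l & l < rdist x y + e.
Proof. by move=> e0; have [l J le] := inf_adherent e0 (has_inf_joined x y); exists l. Qed.

Lemma rdist_triangle x y z : rdist x z <= rdist x y + rdist y z.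
Proof.
apply/ler_addgt0Pr => e e0; have e2 : 0 < e / 2 by rewrite divr_gt0.
have [l1 J1 h1] := rdist_lt x y e2; have [l2 J2 h2] := rdist_lt y z e2.
rewrite (le_trans (rdist_le (joined_trans J1 J2)))// [e]splitr addrACA.
by apply: lerD; exact: ltW.
Qed.

(** Together with [rdist_near] this says that the distance induces the topology of the manifold. *)
Lemma rdist_nbhs x A : nbhs x A -> exists2 e, 0 < e & forall y, rdist x y < e -> A y.
Proof.
move=> Ax; have [r [C [hc dx r0 C0 HB]]] := gram_local x; pose c := chart_at x.
have : nbhs (cmap c x) (cinv c @^-1` A).
  by apply: (cinv_continuous (image_cmap dx)); rewrite cmapK.
move=> /near_ballP [d d0 Hd].
pose e := Num.min r d / C; have e0 : 0 < e by rewrite divr_gt0// lt_min r0.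
exists e => // y; rewrite ltr_pdivlMr// lt_min mulrC => /andP[h1 h2].
have [|dy ey] := chart_rdist_ge hc C0 HB dx (all_joined x y); first by rewrite subrr enorm0 add0r.
rewrite -(cmapK dy); apply: Hd.
by rewrite (le_lt_trans (norm_le_enorm _))// (le_lt_trans ey).
Qed.

(** A length metric has almost intermediate points at every prescribed distance, obtained by cutting
    an almost shortest curve. *)
Lemma rdist_split x y l e : 0 <= l <= rdist x y -> 0 < e ->
  exists z, rdist x z <= l /\ rdist z y <= rdist x y - l + e.
Proof.
move=> /andP[l0 ld] e0; have [k J ke] := rdist_lt x y e0.
have [|z [J1 J2]] := joined_split (r := l) J; first by rewrite l0 (le_trans ld)// rdist_le.
exists z; split; first exact: rdist_le.
rewrite (le_trans (rdist_le J2))// addrAC lerD2r; exact: ltW.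
Qed.

End Distance.

(** * Holomorphic isometries preserve lengths of curves *)

Section IsometryDistance.
Context {R : realType} {m n : nat} (M : kahlerManifold R m) (M' : kahlerManifold R n).
Variable phi : M -> M'.
Hypothesis Hphi : holomorphic_isometry phi.

Lemma isometry_curve gamma : C1_curve gamma ->
  C1_curve (phi \o gamma) /\ curve_length (phi \o gamma) = curve_length gamma.
Proof.
move=> H.
have key (t : R) : 0 <= t <= 1 -> let c := chart_at (gamma t) in let c' := chart_at (phi (gamma t)) in
    let F := cmap c' \o phi \o cinv c in
    [/\ {for t, continuous (phi \o gamma)}, hol F (cmap c (gamma t)), C1_at (cmap c \o gamma) t &
      \forall s \near t, F ((cmap c \o gamma) s) = (cmap c' \o (phi \o gamma)) s].
  move=> t01 c c' F; have [ct Ht] : _ /\ _ := H t t01.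
  have ac := chart_at_atlas (gamma t); have dt := chart_at_dom (gamma t).
  split.
  - exact: cvg_comp ct (@Hphi.1.1 (gamma t)).
  - exact: (isometry_hol Hphi ac (chart_at_atlas (phi (gamma t))) dt (chart_at_dom (phi (gamma t)))).
  - exact: Ht _ ac dt.
  - by apply: filterS (near_dom ct dt) => s ds; rewrite /F /= cmapK.
split.
  apply: C1_curve_intro => t t01; have [ct hF C1 E] := key t t01; split => //.
  exists (chart_at (phi (gamma t))); split.
  - exact: atlas_compat (chart_at_atlas _).
  - exact: chart_at_dom.
  - exact: C1_at_near E (C1_at_comp hF C1).
apply: eq_Rintegral => t; rewrite inE/= in_itv/= => t01.
have [ct hF C1 E] := key t t01; rewrite /speed /velocity /=.
have d := derive1_hol hF (nbhs_singleton C1.1).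
have [<- _] := near_derive1 E; rewrite (derive1_val d).
congr Num.sqrt.
have [_ e] := isometry_bilin Hphi (derive1 (cmap (chart_at (gamma t)) \o gamma) t)
  (derive1 (cmap (chart_at (gamma t)) \o gamma) t) (chart_at_atlas (gamma t)) (chart_at_atlas (phi (gamma t)))
  (chart_at_dom _) (chart_at_dom _).
exact: e.
Qed.

Lemma isometry_joined x y l : joined_by_length x y l -> joined_by_length (phi x) (phi y) l.
Proof.
elim=> {x y l} [x|gamma y l H _ IH]; first exact: Joined_refl.
have [C1 <-] := isometry_curve H.
exact: (Joined_cons C1 IH).
Qed.

Lemma isometry_lipschitz x y : connected [set: M] -> rdist (phi x) (phi y) <= rdist x y.
Proof.
move=> conn; apply/ler_addgt0Pr => e e0; have [l J le] := rdist_lt conn x y e0.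
by rewrite (le_trans (rdist_le (isometry_joined J)))// ltW.
Qed.

End IsometryDistance.

(** * Parametrisations of uniform size *)

Section LocalSections.
Context {R : realType} {n N : nat} (M : kahlerManifold R n) (M' : kahlerManifold R N).
Variable phi : M -> M'.
Hypothesis Hphi : holomorphic_isometry phi.
Variable ch : chart R M' (N + N).
Hypothesis ach : atlas ch.
Variables (P : 'M[R]_(N + N, n + n)) (a : 'rV[R]_(N + N)) (eta : R).
Hypothesis JP : Jmx *m P = P *m Jmx.
Implicit Types (x y : M) (c : chart R M (n + n)) (w v z : 'rV[R]_(n + n)) (s t : 'rV[R]_(n + n) -> M).

Local Notation Kh := (fun q : 'rV[R]_(N + N) => metric ch (cinv ch q)).

(* A [C]-linear projection [P] of the ambient chart; the charts of [M] to be built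
   are local inverses [s] of [prj]. *)
Definition prj y : 'rV[R]_(n + n) := (cmap ch (phi y) - a) *m P.
Definition lrep c : 'rV[R]_(n + n) -> 'rV[R]_(N + N) := cmap ch \o phi \o cinv c.
Definition srep s : 'rV[R]_(n + n) -> 'rV[R]_(N + N) := cmap ch \o phi \o s.

(** At [w] the map [s] is a holomorphic right inverse of [prj] whose image has slope at most [La]
    and stays within [eta] of the base point [a]. The conditions are local at [w], so two such maps
    that agree on an overlap can be glued. *)
Record good (La : R) s w : Prop := Good {
  g_cont : {for w, continuous s};
  g_dom : dom ch (phi (s w));
  g_prj : prj (s w) = w;
  g_size : `|cmap ch (phi (s w)) - a| < eta;
  g_hol : forall c, atlas c -> dom c (s w) -> hol (cmap c \o s) w;
  g_slope : forall v, `|v *m jac (srep s) w| <= La * `|v|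
}.

Lemma lrep_hol c y : atlas c -> dom c y -> dom ch (phi y) -> hol (lrep c) (cmap c y).
Proof. by move=> ac dy dy'; exact: (isometry_hol Hphi ac ach dy dy'). Qed.

Lemma lrep_inj c y v : atlas c -> dom c y -> dom ch (phi y) -> v *m jac (lrep c) (cmap c y) = 0 -> v = 0.
Proof.
move=> ac dy dy' v0; have [_ e] := isometry_bilin Hphi v v ac ach dy dy'.
move: e; rewrite -/(lrep c) v0 bilin0l => e; apply/eqP/negP => /negP vn.
have := km_pos (metric_kahler ac) (image_cmap dy) vn.
by rewrite (cmapK dy) -e ltxx.
Qed.

Lemma phi_near y : dom ch (phi y) -> \forall z \near y, dom ch (phi z).
Proof.
move=> dy; have : nbhs (phi y) (dom ch) by apply: open_nbhs_nbhs; split; [exact: dom_open|].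
exact: Hphi.1.1.
Qed.

Lemma prj_continuous y : dom ch (phi y) -> {for y, continuous prj}.
Proof.
move=> dy; have c1 : cmap ch (phi z) @[z --> y] --> cmap ch (phi y).
  exact: (cvg_comp _ _ (@Hphi.1.1 y) (cmap_continuous dy)).
have c2 : cmap ch (phi z) - a @[z --> y] --> cmap ch (phi y) - a by apply: cvgB c1 (cvg_cst _).
exact: (cvg_comp _ _ c2 (@continuous_mulmxr _ _ _ P _)).
Qed.

Lemma affine_hol (q : 'rV[R]_(N + N)) : hol (fun p : 'rV[R]_(N + N) => (p - a) *m P) q /\
  jac (fun p : 'rV[R]_(N + N) => (p - a) *m P) q = P.
Proof.
have -> : (fun p : 'rV[R]_(N + N) => (p - a) *m P) = (fun p => p *m P + (- (a *m P))).
  by apply/funext => p; rewrite mulmxBl.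
exact: hol_affine.
Qed.

Lemma srep_lrep s w c : {for w, continuous s} -> dom c (s w) ->
  \forall w' \near w, lrep c ((cmap c \o s) w') = srep s w'.
Proof.
move=> cs ds; have : nbhs (s w) (dom c) by apply: open_nbhs_nbhs; split; [exact: dom_open|].
by move=> N1; have N2 : \forall w' \near w, dom c (s w') := cs _ N1; apply: filterS N2 => w' dw'; rewrite /lrep /srep /= cmapK.
Qed.

Lemma good_srep La s w : good La s w -> hol (srep s) w /\
  forall c, atlas c -> dom c (s w) ->
    jac (srep s) w = jac (cmap c \o s) w *m jac (lrep c) (cmap c (s w)).
Proof.
move=> gs.
have key c : atlas c -> dom c (s w) -> hol (srep s) w /\
    jac (srep s) w = jac (cmap c \o s) w *m jac (lrep c) (cmap c (s w)).
  move=> ac dc; have h1 := g_hol gs ac dc; have h2 := lrep_hol ac dc (g_dom gs).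
  have hc : hol (fun w' => lrep c ((cmap c \o s) w')) w by exact: hol_comp h1 h2.
  have E := srep_lrep (g_cont gs) dc.
  have [r r0 Hr] := (near_ballP _ _).1 E.
  split; first exact: hol_near_eq r0 Hr hc.
  rewrite (jac_near E (hol_cdiff hc)).
  by rewrite (cdiff_comp (hol_cdiff h1) (hol_cdiff h2)).2.
have := key _ (chart_at_atlas (s w)) (chart_at_dom (s w)) => -[h _].
by split => // c ac dc; have [_ ->] := key c ac dc.
Qed.

Lemma good_near La s t w : (\forall w' \near w, s w' = t w') -> good La s w -> good La t w.
Proof.
move=> E gs; have e := nbhs_singleton E; case: (gs) => h1 h2 h3 h4 h5 h6.
have [r r0 Hr] := (near_ballP _ _).1 E.
split.
- exact: near_continuous E h1.
- by rewrite -e.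
- by rewrite -e.
- by rewrite -e.
- rewrite -e => c ac dc; apply: (hol_near_eq r0 _ (h5 c ac dc)) => y /Hr /= -> //.
- move=> v; suff -> : jac (srep t) w = jac (srep s) w by [].
  apply: jac_near (hol_cdiff (good_srep gs).1).
  by apply: filterS E => y; rewrite /srep /= => ->.
Qed.

Lemma good_section La s w : (\forall w' \near w, good La s w') -> jac (srep s) w *m P = 1%:M.
Proof.
move=> G; have [h _] := good_srep (nbhs_singleton G); have [hP jP] := affine_hol (srep s w).
have [_ e] := cdiff_comp (hol_cdiff h) (hol_cdiff hP); rewrite jP in e; rewrite -e.
apply: jac_isD; have I : isD (fun y : 'rV[R]_(n + n) => y) w 1%:M.
  by apply: isd_ext (isd_id w) => v; rewrite mulmx1.
by apply: isd_near I; apply: filterS G => w' gw; have := g_prj gw; rewrite /prj /srep /= => ->.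
Qed.

Lemma mulmx_section {k m} (X : 'rV[R]_k) (A : 'M[R]_(k, m)) (B : 'M[R]_(m, k)) : A *m B = 1%:M -> X *m A *m B = X.
Proof. by move=> h; rewrite -mulmxA h mulmx1. Qed.

(** The slope is rewritten as a property of the tangent space at one point in a chart of the
    manifold. In this form it passes to a limit point where no section is available yet. *)
Lemma good_chart_slope La Lb s w c : (\forall w' \near w, good La s w') -> atlas c -> dom c (s w) ->
  (forall v, `|v *m jac (srep s) w| <= Lb * `|v|) ->
  forall v, `|v *m jac (lrep c) (cmap c (s w))| <= Lb * `|v *m jac (lrep c) (cmap c (s w)) *m P|.
Proof.
move=> G ac dc sl v; have gs := nbhs_singleton G; have e := good_section G.
have [_ /(_ c ac dc) ej] := good_srep gs.
set A := jac (cmap c \o s) w in ej; set D := jac (lrep c) _ in ej *.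
have AD : A *m (D *m P) = 1%:M by rewrite mulmxA -ej.
have DA := mulmx1C AD.
have -> : v *m D = (v *m (D *m P)) *m jac (srep s) w by rewrite ej -mulmxA (mulmxA (D *m P)) DA mul1mx.
rewrite (mulmx_section (v *m (D *m P)) e); exact: sl.
Qed.

Lemma slope_near (F : 'rV[R]_(n + n) -> 'rV[R]_(N + N)) w La La' : hol F w -> La' < La ->
  (forall v, `|v *m jac F w| <= La' * `|v|) ->
  \forall w' \near w, forall v, `|v *m jac F w'| <= La * `|v|.
Proof.
move=> hF LL H; pose d : R := (La - La') / ((n + n)%:R + 1).
have m0 : 0 < (n + n)%:R + 1 :> R by rewrite ltr_wpDl.
have d0 : 0 < d by rewrite divr_gt0 ?subr_gt0.
have E : \forall w' \near w, forall ij : 'I_(n + n) * 'I_(N + N), `|jac F w' ij.1 ij.2 - jac F w ij.1 ij.2| <= d.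
  apply: (@filter_forall _ _ (fun (ij : 'I_(n + n) * 'I_(N + N)) w' => `|jac F w' ij.1 ij.2 - jac F w ij.1 ij.2| <= d) _ (nbhs_filter w)) => ij.
  have c : jac F w' ij.1 ij.2 @[w' --> w] --> jac F w ij.1 ij.2 by apply: mcvg_jac.
  have := (@cvgrPdist_le _ _ _ (nbhs w) (nbhs_filter w) _ _).1 c d d0.
  by apply: filterS => w' h; rewrite (distrC (jac F w' _ _)).
apply: filterS E => w' Hw' v.
have -> : v *m jac F w' = v *m jac F w + v *m (jac F w' - jac F w) by rewrite mulmxBr addrC subrK.
rewrite (le_trans (ler_normD _ _))//.
have h : `|v *m (jac F w' - jac F w)| <= (n + n)%:R * d * `|v|.
  by apply: mulmx_norm_le; [exact: ltW|move=> i j; have := Hw' (i, j); rewrite !mxE].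
apply: le_trans (lerD (H v) h) _; rewrite -mulrDl ler_wpM2r//.
have : (n + n)%:R * d <= La - La'.
  by rewrite /d mulrA ler_pdivrMr// mulrC ler_pM2l ?subr_gt0// lerDl.
by move: ((n + n)%:R * d) => q; rewrite lerBrDl.
Qed.

(** The slope bound makes the derivative of [prj] in the chart injective, so the inverse function
    theorem applies; the gap between [La'] and [La] keeps the slope bound on a neighbourhood. The
    last clause records that nearby points are reached by the section [t], which is what uniqueness
    rests on. *)
Lemma local_section La La' y c : atlas c -> dom c y -> dom ch (phi y) ->
  `|cmap ch (phi y) - a| < eta -> La' < La ->
  (forall v, `|v *m jac (lrep c) (cmap c y)| <= La' * `|v *m jac (lrep c) (cmap c y) *m P|) ->
  exists e t, [/\ 0 < e, t (prj y) = y, forall w, `|w - prj y| < e -> good La t w &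
    \forall z \near y, `|prj z - prj y| < e -> t (prj z) = z].
Proof.
move=> ac dy dy' sz LL sl; pose z0 := cmap c y; pose D := jac (lrep c) z0.
pose f z := (lrep c z - a) *m P.
have hl := lrep_hol ac dy dy'.
have [hP jP] := affine_hol (lrep c z0).
have hf : hol f z0 by exact: hol_comp hl hP.
have jf : jac f z0 = D *m P by have [_ ->] := cdiff_comp (hol_cdiff hl) (hol_cdiff hP); rewrite jP.
have uf : jac f z0 \in unitmx.
  apply: inj_unitmx => v; rewrite jf mulmxA => v0.
  apply: (@lrep_inj c y v ac dy dy'); apply/eqP; rewrite -normr_le0.
  by rewrite (le_trans (sl v))// v0 normr0 mulr0.
have lz0 : lrep c z0 = cmap ch (phi y) by rewrite /lrep /= /z0 cmapK.
have fz0 : f z0 = prj y by rewrite /f lz0.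
have N1 := isometry_near Hphi dy dy'.
have N2 : \forall z \near z0, `|lrep c z - a| < eta.
  have cl := hol_continuous hl; have NN : nbhs (lrep c z0) [set p : 'rV[R]_(N + N) | `|p - a| < eta].
    by apply: open_nbhs_nbhs; split; [exact: open_dist_lt|rewrite /= lz0].
  exact: cl _ NN.
have [d d0 Hd] := (near_ballP _ _).1 (filterI N1 N2).
have [r [e [b [g [/andP[r0 rd] e0 b0 finj Hg]]]]] := hol_inverse hf uf d0.
rewrite fz0 in Hg.
have gz0 : g (prj y) = z0.
  have [|h1 h2 _ _ _] := Hg (prj y); first by rewrite subrr normr0.
  have zz : `|z0 - z0| < r by rewrite subrr normr0.
  have := finj _ _ h1 zz; rewrite h2 fz0 subrr normr0 mulr0 normr_le0 subr_eq0 => /eqP.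
  by move=> ->.
have ht : hol (fun w => lrep c (g w)) (prj y).
  have [|_ _ _ hg _] := Hg (prj y); first by rewrite subrr normr0.
  by apply: hol_comp hg _; rewrite gz0.
have jt v : `|v *m jac (fun w => lrep c (g w)) (prj y)| <= La' * `|v|.
  have [|_ _ _ hg [_ jg]] := Hg (prj y); first by rewrite subrr normr0.
  have hl' : hol (lrep c) (g (prj y)) by rewrite gz0.
  rewrite (cdiff_comp (hol_cdiff hg) (hol_cdiff hl')).2 jg gz0 jf mulmxA.
  rewrite (le_trans (sl _))//.
  have -> : v *m invmx (D *m P) *m jac (lrep c) z0 *m P = v by rewrite -!mulmxA mulVmx ?mulmx1// -jf.
  by [].
have [e1 e10 He1] := (near_ballP _ _).1 (slope_near ht LL jt).
pose e' := Num.min e e1; exists e', (cinv c \o g); split.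
- by rewrite lt_min e0.
- by rewrite /= gz0 /z0 cmapK.
- move=> w; rewrite lt_min => /andP[we we1].
  have [h1 h2 _ hg _] := Hg w we; have [[im dg] sg] := Hd (g w) (lt_le_trans h1 rd).
  have [dcg ecg] := image_cinv im.
  have cg := hol_continuous hg.
  split; [|exact: dg|exact: h2|exact: sg| |].
  + exact: (cvg_comp _ _ cg (cinv_continuous im)).
  + move=> c' ac' dc'; have := transition_hol ac ac' dcg dc'; rewrite ecg => h.
    exact: (hol_comp hg h).
  + by move=> v; exact: He1.
- have N3 : \forall z \near y, dom c z by apply: open_nbhs_nbhs; split; [exact: dom_open|].
  have N4 : \forall z \near y, `|cmap c z - z0| < r.
    have NN : nbhs (cmap c y) [set q : 'rV[R]_(n + n) | `|q - z0| < r].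
      by apply: open_nbhs_nbhs; split; [exact: open_dist_lt|rewrite /= subrr normr0].
    exact: (cmap_continuous dy) _ NN.
  apply: filterS2 N3 N4 => z dz zr; rewrite lt_min => /andP[ze _].
  have fz : f (cmap c z) = prj z by rewrite /f /lrep /= cmapK.
  have [h1 h2 _ _ _] := Hg _ ze.
  have := finj _ _ h1 zr; rewrite h2 fz subrr normr0 mulr0 normr_le0 subr_eq0 => /eqP E.
  by rewrite /= -E cmapK.
Qed.

(** A section from [local_section] at [s w] agrees with [s] near [w], and it is known to recover all
    points near [s w]. *)
Lemma good_inv La s w : (\forall w' \near w, good La s w') -> \forall z \near s w, dom ch (phi z) /\ s (prj z) = z.
Proof.
move=> G; have gs := nbhs_singleton G; have pw := g_prj gs.
have ac := chart_at_atlas (s w); have dc := chart_at_dom (s w).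
have LL : La < La + 1 by rewrite ltrDl.
have [e [t [e0 tw _ Et]]] := local_section ac dc (g_dom gs) (g_size gs) LL (good_chart_slope G ac dc (g_slope gs)).
rewrite pw in tw Et.
have N1 : \forall w' \near w, s w' = t w'.
  have cs : {for w, continuous s} := g_cont gs.
  have N2 : \forall w' \near w, _ := cs _ Et; have N3 := near_dist w e0.
  by apply: filterS2 (filterI G N2) N3 => w' [gw' h] we; rewrite -[LHS](h _) (g_prj gw').
have N4 : \forall z \near s w, `|prj z - w| < e /\ s (prj z) = t (prj z).
  have c : {for s w, continuous prj} := prj_continuous (g_dom gs).
  have NN : nbhs (prj (s w)) [set q : 'rV[R]_(n + n) | `|q - w| < e /\ s q = t q].
    by rewrite pw; exact: filterI (near_dist w e0) N1.
  exact: c _ NN.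
have N5 := phi_near (g_dom gs).
by apply: filterS2 (filterI N4 N5) Et => z [[ze st] dz] h; split => //; rewrite st h.
Qed.

Lemma good_agree La s t w : (\forall w' \near w, good La s w') -> (\forall w' \near w, good La t w') ->
  s w = t w -> \forall w' \near w, s w' = t w'.
Proof.
move=> Gs Gt e; have := good_inv Gs; rewrite e => N1.
have ct : {for w, continuous t} := g_cont (nbhs_singleton Gt).
have N2 : \forall w' \near w, _ := ct _ N1.
by apply: filterS2 Gt N2 => w' gw' [_ h]; rewrite -[RHS]h (g_prj gw').
Qed.

Lemma good_differ La s t w : good La s w -> good La t w -> s w <> t w -> \forall w' \near w, s w' <> t w'.
Proof.
move=> gs gt ne; have hM : hausdorff_space M := @carrier_hausdorff _ _ M.
move: hM; rewrite open_hausdorff => hM; have st : s w != t w by apply/eqP.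
have [[A B] /= [/set_mem As /set_mem Bt] [oA oB AB]] := hM _ _ st.
have N1 : \forall w' \near w, A (s w') by apply: (g_cont gs); apply: open_nbhs_nbhs.
have N2 : \forall w' \near w, B (t w') by apply: (g_cont gt); apply: open_nbhs_nbhs.
apply: filterS2 N1 N2 => w' a1 b1 e; have : (A `&` B) (s w') by split => //; rewrite e.
by move/eqP: AB => ->.
Qed.

Lemma seg_near {m} (w0 w1 : 'rV[R]_m) (t : R) (A : set 'rV[R]_m) :
  (\forall z \near (w0 + t *: (w1 - w0)), A z) ->
  exists2 d, 0 < d & forall u : R, `|u - t| < d -> A (w0 + u *: (w1 - w0)).
Proof.
move=> /near_ballP[r r0 Hr]; exists (r / (`|w1 - w0| + 1)).
  by rewrite divr_gt0// ltr_wpDl.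
move=> u; rewrite ltr_pdivlMr ?ltr_wpDl// => h; apply: Hr.
have -> : w0 + u *: (w1 - w0) - (w0 + t *: (w1 - w0)) = (u - t) *: (w1 - w0).
  by rewrite opprD addrACA subrr add0r -scalerBl.
rewrite normrZ (le_lt_trans _ h)// ler_wpM2l// lerDl//.
Qed.

(** Along a segment the parameters where two sections agree form an open set by [good_agree], and a
    closed one by [good_differ] because the manifold is Hausdorff. *)
Lemma good_unique La s t w0 w1 :
  (forall u : R, 0 <= u <= 1 -> (\forall w \near w0 + u *: (w1 - w0), good La s w) /\
     (\forall w \near w0 + u *: (w1 - w0), good La t w)) -> s w0 = t w0 -> s w1 = t w1.
Proof.
move=> G e; pose p (u : R) := w0 + u *: (w1 - w0).
suff H (u : R) : 0 <= u <= 1 -> s (p u) = t (p u).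
  by have := H 1; rewrite /p scale1r addrC subrK => -> //; rewrite ler01 lexx.
apply: (@seg_ind _ (fun u => s (p u) = t (p u))) => [|v /andP[v0 v1] Hv|v /andP[v0 v1] Hv].
- by rewrite /p scale0r addr0.
- have [|Gs Gt] := G v; first by rewrite v0 ltW.
  have [|d d0 Hd] := seg_near (good_agree Gs Gt _); first by apply: Hv; rewrite v0 lexx.
  exists d => // x /andP[vx xd] _; apply: Hd; rewrite ger0_norm ?subr_ge0//.
  by rewrite ltrBlDl.
- have [|Gs Gt] := G v; first by rewrite v1 ltW.
  apply: contrapT => ne.
  have [d d0 Hd] := seg_near (good_differ (nbhs_singleton Gs) (nbhs_singleton Gt) ne).
  pose x := Num.max 0 (v - d / 2).
  have xv : x < v by rewrite gt_max v0 ltrBlDr ltrDl divr_gt0.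
  apply: (Hd x); last by apply: Hv; rewrite le_max lexx.
  rewrite distrC gtr0_norm ?subr_gt0// ltrBlDr -ltrBlDl lt_max; apply/orP; right.
  by rewrite ltrD2l ltrN2 ltr_pdivrMr// ltr_pMr// ltr1n.
Qed.

Lemma good_pullb La s w c : good La s w -> atlas c -> dom c (s w) ->
  pullb (cmap c \o s) (fun z => metric c (cinv c z)) w = pullb (srep s) Kh w.
Proof.
move=> gs ac dc; have [_ /(_ c ac dc) e] := good_srep gs; rewrite /pullb e.
have -> : (cmap c \o s) w = cmap c (s w) by [].
rewrite cmapK// (isometry_pullb Hphi ac ach dc (g_dom gs)) -/(lrep c) /pullb.
have -> : lrep c (cmap c (s w)) = srep s w by rewrite /lrep /srep /= cmapK.
move: (jac (cmap c \o s) w) (jac (lrep c) _) (metric ch _) => A D K.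
by rewrite trmx_mul !mulmxA.
Qed.

(** In a chart of the atlas, [cmap c \o s] is a change of coordinates; [scalar_chart_change] moves
    the curvature to the parametrisation, where the metric is the pull-back of the ambient one. *)
Lemma good_scal La s w : (\forall w' \near w, good La s w') ->
  scalar_curvature (s w) = local_scalar_curvature (pullb (srep s) Kh) w.
Proof.
move=> G; pose c := chart_at (s w); have ac : atlas c := chart_at_atlas (s w).
have dc : dom c (s w) := chart_at_dom (s w).
pose U := [set z | (\forall w' \near z, good La s w') /\ dom c (s z)].
have GU z : U z -> good La s z by move=> [/nbhs_singleton].
have oU : open U.
  rewrite openE => z Uz; have [Gz dz] := Uz.
  have N1 : \forall z' \near z, dom c (s z').
    by apply: (g_cont (GU z Uz)); apply: open_nbhs_nbhs; split; [exact: dom_open|].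
  have N2 := near_join Gz.
  by apply: filterS2 N1 N2 => z' d1 g1; split.
have Uw : U w by split.
pose f := cmap c \o s; have hf z : U z -> hol f z /\ (cmap c @` dom c) (f z).
  by move=> Uz; split; [exact: g_hol (GU z Uz) c ac Uz.2|exact: image_cmap Uz.2].
have uf z : U z -> jac f z \in unitmx.
  move=> Uz; apply: inj_unitmx => v v0.
  have e := good_section Uz.1; have [_ /(_ c ac Uz.2) ej] := good_srep (GU z Uz).
  by rewrite -[v]mulmx1 -e ej !mulmxA v0 !mul0mx.
have E := scalar_chart_change (metric_kahler ac) oU hf uf Uw.
rewrite /scalar_curvature -/c -[cmap c (s w)]/(f w) -E.
apply: (local_scalar_curvature_eq oU _ Uw) => z Uz; exact: good_pullb (GU z Uz) ac Uz.2.
Qed.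

Section Apriori.
Variables (Cb La R0 B : R).
Hypothesis Hb : forall p, `|p - a| < eta ->
  metric_bounds (cmap ch @` dom ch) Kh Cb p.
Hypothesis HP : forall w : 'rV[R]_(N + N), `|w *m P| <= La * `|w|.
Hypothesis HB : jet2_bd n N Cb La R0 B.
Hypothesis HR : forall y : M, R0 <= scalar_curvature y.
Hypothesis La0 : 0 < La.
Hypothesis B0 : 0 < B.

Lemma good_jet2 s w u v : (\forall w' \near w, good La s w') -> `|jet2 (srep s) u v w| <= B * `|u| * `|v|.
Proof.
move=> G; pose U : set 'rV[R]_(n + n) := [set z : 'rV[R]_(n + n) | \forall w' \near z, good La s w'].
have oU : open U by rewrite openE => z; exact: near_join.
have GU z : U z -> good La s z by exact: nbhs_singleton.
apply: (HB (metric_kahler ach) oU _ (P := P)) => //.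
- by move=> z Uz; split; [exact: (good_srep (GU z Uz)).1|apply: image_cmap; exact: g_dom (GU z Uz)].
- by move=> z; exact: good_section.
- exact: Hb (g_size (GU w G)).
- exact: g_slope (GU w G).
- by rewrite -(good_scal G).
Qed.

Lemma good_segment s w w' : (forall t : R, 0 <= t <= 1 -> \forall z \near w + t *: (w' - w), good La s z) ->
  `|srep s w' - srep s w| <= La * `|w' - w| /\
  forall v, `|v *m jac (srep s) w' - v *m jac (srep s) w| <= B * `|w' - w| * `|v|.
Proof.
move=> G; split => [|v].
  apply: mean_value_rV; first by rewrite mulr_ge0// ltW.
  move=> t t01; have gs := nbhs_singleton (G t t01).
  split; first exact: cdiff_differentiable (hol_cdiff (good_srep gs).1).
  by rewrite jacE; exact: g_slope gs _.
apply: (@mean_value_rV _ _ _ (fun z => v *m jac (srep s) z)); first by rewrite !mulr_ge0// ltW.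
move=> t t01; have gs := nbhs_singleton (G t t01).
split; first exact: cdiff_differentiable (hol_cdiff (hol_jac v (good_srep gs).1)).
rewrite jacE; exact: good_jet2 (G t t01).
Qed.

End Apriori.

(** * A parametrisation as a compatible chart *)

Section SectionChart.
Variables (La : R) (s : 'rV[R]_(n + n) -> M) (U : set 'rV[R]_(n + n)).
Hypothesis oU : open U.
Hypothesis GU : forall w, U w -> good La s w.

Let nU w : U w -> \forall w' \near w, good La s w'.
Proof. by move=> Uw; apply: filterS GU _; exact: open_nbhs_nbhs. Qed.

Lemma section_dom_open : open (s @` U).
Proof.
rewrite openE => _ [w Uw <-]; have gs := GU Uw.
have c : {for s w, continuous prj} := prj_continuous (g_dom gs).
have N1 : \forall z \near s w, U (prj z).
  by apply: c; apply: open_nbhs_nbhs; split; [exact: oU|rewrite (g_prj gs)].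
by apply: filterS2 (good_inv (nU Uw)) N1 => z [_ e] Uz; exists (prj z).
Qed.

Lemma section_codom : prj @` (s @` U) = U.
Proof.
apply/seteqP; split => [_ [_ [w Uw <-] <-]|w Uw]; first by rewrite (g_prj (GU Uw)).
by exists (s w); [exists w|rewrite (g_prj (GU Uw))].
Qed.

Lemma section_codom_open : open (prj @` (s @` U)).
Proof. by rewrite section_codom. Qed.

Lemma section_cmapK y : (s @` U) y -> s (prj y) = y.
Proof. by move=> [w Uw <-]; rewrite (g_prj (GU Uw)). Qed.

Lemma section_cmap_continuous y : (s @` U) y -> {for y, continuous prj}.
Proof. by move=> [w Uw <-]; apply: prj_continuous; exact: g_dom (GU Uw). Qed.

Lemma section_cinv_continuous z : (prj @` (s @` U)) z -> {for z, continuous s}.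
Proof. by rewrite section_codom => /GU/g_cont. Qed.

Definition section_chart : chart R M (n + n) :=
  Chart section_dom_open section_codom_open section_cmapK section_cmap_continuous section_cinv_continuous.

Lemma section_compat : compat section_chart.
Proof.
move=> c ac _ [w Uw <-] dc; have gs := GU Uw; split.
  by have := g_hol gs ac dc; rewrite /= (g_prj gs).
have h := lrep_hol ac dc (g_dom gs); have [hP _] := affine_hol (lrep c (cmap c (s w))).
exact: (hol_comp h hP).
Qed.

Lemma section_gram w : U w ->
  gram section_chart (s w) = pullb (srep s) Kh w.
Proof.
move=> Uw; rewrite -(good_pullb (GU Uw) (chart_at_atlas (s w)) (chart_at_dom (s w))) /gram /=.
by rewrite (g_prj (GU Uw)).
Qed.

End SectionChart.

End LocalSections.

Lemma norm_ball_compact {R : realType} {m} (z : 'rV[R]_m) r : compact [set y : 'rV[R]_m | `|y - z| <= r].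
Proof.
apply: bounded_closed_compact; first last.
  have : closed ((fun q : 'rV[R]_m => `|q - z|) @^-1` [set x | x <= r]).
    apply: closed_comp => [q _|]; last exact: closed_le.
    by apply: (@continuous_comp _ _ _ (fun q0 : 'rV[R]_m => q0 - z) Num.norm); [apply: continuousB; [exact: (fun A h => h)|exact: cst_continuous]|exact: norm_continuous].
  exact.
exists (`|z| + `|r|); split; first exact: num_real.
  move=> b hb y /= yr; rewrite -(subrK z y) (le_trans (ler_normD _ _))// (le_trans _ (ltW hb))//.
  by rewrite addrC lerD2l (le_trans yr)// ler_norm.
Qed.

Lemma le_sqr_succ {R : realType} (x : R) : 0 < x -> x <= (x + 1) ^+ 2.
Proof. by move=> x0; nra. Qed.

(** * Convex neighbourhoods of segments from the origin *)

Section Tubes.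
Context {R : realType} {m : nat}.
Implicit Types (w z : 'rV[R]_m) (e : R).

Definition tube w e := [set z | exists2 t : R, 0 <= t <= 1 & `|z - t *: w| < e].

Lemma tube_open w e : open (tube w e).
Proof.
rewrite openE => z [t t01 zt]; apply: filterS (open_nbhs_nbhs (conj (@open_dist_lt _ _ (t *: w) e) zt)) => z' h.
by exists t.
Qed.

Lemma tube_on w e (t : R) : 0 < e -> 0 <= t <= 1 -> tube w e (t *: w).
Proof. by move=> e0 t01; exists t => //; rewrite subrr normr0. Qed.

Lemma tube_ball w e z : `|z - w| < e -> tube w e z.
Proof. by move=> h; exists 1; rewrite ?scale1r// ler01 lexx. Qed.

Lemma tube_convex w e z z' (u : R) : 0 <= u <= 1 -> tube w e z -> tube w e z' -> tube w e (z + u *: (z' - z)).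
Proof.
move=> /andP[u0 u1] [t /andP[t0 t1] zt] [t' /andP[t'0 t'1] zt']; exists (t + u * (t' - t)).
  have v0 : 0 <= 1 - u by rewrite subr_ge0.
  have -> : t + u * (t' - t) = (1 - u) * t + u * t' by ring.
  rewrite addr_ge0 ?mulr_ge0//=.
  have h1 : (1 - u) * t <= (1 - u) * 1 by exact: ler_wpM2l.
  have h2 : u * t' <= u * 1 by exact: ler_wpM2l.
  by move: h1 h2; rewrite !mulr1 => h1 h2; rewrite (le_trans (lerD h1 h2))// subrK.
have -> : z + u *: (z' - z) - (t + u * (t' - t)) *: w = (z - t *: w) + u *: ((z' - t' *: w) - (z - t *: w)).
  by apply/rowP => i; rewrite !mxE; ring.
have := @segment_ball R m (z - t *: w) (z' - t' *: w) 0 e u; rewrite !subr0; apply => //.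
by rewrite u0.
Qed.

Lemma tube_sub w w' e d : `|w' - w| + d <= e -> tube w' d `<=` tube w e.
Proof.
move=> h z [t /andP[t0 t1] zt]; exists t; first by rewrite t0.
have -> : z - t *: w = (z - t *: w') + t *: (w' - w) by rewrite scalerBr addrA subrK.
rewrite (le_lt_trans (ler_normD _ _))// (lt_le_trans _ h)// addrC ler_ltD//.
by rewrite normrZ ger0_norm// ler_piMl.
Qed.

(** A point near the segment to [w] is near the shorter segment to [u *: w], or else close to the
    end point [w]. *)
Lemma tube_scale w (u e d : R) : 0 < u <= 1 -> d <= e ->
  tube w d `<=` [set z | tube (u *: w) e z \/ `|z - w| < d + (1 - u) * `|w|].
Proof.
move=> /andP[u0 u1] de z [t /andP[t0 t1] zt]; have [tu|ut] := leP t u.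
  left; exists (t / u); first by rewrite divr_ge0 ?(ltW u0)// ler_pdivrMr// mul1r.
  by rewrite scalerA divfK ?gt_eqF// (lt_le_trans zt).
right; have -> : z - w = (z - t *: w) - (1 - t) *: w by rewrite scalerBl scale1r opprB addrA subrK.
rewrite (le_lt_trans (ler_normB _ _))// ltr_leD// normrZ ger0_norm ?subr_ge0//.
by rewrite ler_wpM2r// lerD2l lerN2 ltW.
Qed.

End Tubes.

(** * Continuation of a section along segments *)

Section Continuation.
Context {R : realType} {n N : nat} (M : kahlerManifold R n) (M' : kahlerManifold R N).
Variable phi : M -> M'.
Hypothesis Hphi : holomorphic_isometry phi.
Hypothesis conn : connected [set: M].
Hypothesis cplt : complete_kahler M.
Variable ch : chart R M' (N + N).
Hypothesis ach : atlas ch.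
Variables (P : 'M[R]_(N + N, n + n)) (a : 'rV[R]_(N + N)) (eta : R).
Hypothesis JP : Jmx *m P = P *m Jmx.
Variables (Cb La1 La R0 B rho : R).
Hypothesis Hb : forall p, `|p - a| < eta ->
  metric_bounds (cmap ch @` dom ch) (fun q : 'rV[R]_(N + N) => metric ch (cinv ch q)) Cb p.
Hypothesis HP : forall w : 'rV[R]_(N + N), `|w *m P| <= La * `|w|.
Hypothesis HB : jet2_bd n N Cb La R0 B.
Hypothesis HR : forall y : M, R0 <= scalar_curvature y.
Hypothesis Cb0 : 0 < Cb.
Hypothesis La0 : 0 < La.
Hypothesis B0 : 0 < B.
Hypothesis eta0 : 0 < eta.
Hypothesis rho0 : 0 < rho.
(** Within radius [rho] the second derivative bound [B] raises the slope from [La1] at the centre by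
    at most 1/2, and by [La1La] the result is strictly below [La]; [Larho] keeps the graph within
    [eta] of its centre. So the conditions in [good] are satisfied with room to spare wherever a
    lift exists. *)
Hypothesis Brho : B * rho <= 2^-1.
Hypothesis Larho : La * rho <= eta.
Hypothesis La1La : La1 + 2^-1 < La.
Variables (x0 : M) (c0 : chart R M (n + n)).
Hypothesis ac0 : atlas c0.
Hypothesis dc0 : dom c0 x0.
Hypothesis dx0 : dom ch (phi x0).
Hypothesis ax0 : cmap ch (phi x0) = a.
Hypothesis slope0 : forall v : 'rV[R]_(n + n), `|v *m jac (lrep phi ch c0) (cmap c0 x0)| <= La1 * `|v *m jac (lrep phi ch c0) (cmap c0 x0) *m P|.

Implicit Types (x y : M) (w v z : 'rV[R]_(n + n)) (s t : 'rV[R]_(n + n) -> M).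
Local Notation good := (good phi ch P a eta La).
Local Notation prj := (prj phi ch P a).
Local Notation srep := (srep phi ch).
Local Notation Kh := (fun q : 'rV[R]_(N + N) => metric ch (cinv ch q)).

Lemma prj_x0 : prj x0 = 0.
Proof. by rewrite /prj ax0 subrr mul0mx. Qed.

(* Local inverses of [prj] are continued along segments from the origin, on convex
   neighbourhoods of the segment so that two of them agree where both exist. *)
Definition lift w e s := [/\ 0 < e, s 0 = x0 & forall z, tube w e z -> good s z].

Lemma lift_near w e s z : lift w e s -> tube w e z -> \forall z' \near z, good s z'.
Proof. by move=> [_ _ H] T; apply: filterS H _; apply: open_nbhs_nbhs; split; [exact: tube_open|]. Qed.

Lemma lift_seg w e s z (t : R) : lift w e s -> tube w e z -> 0 <= t <= 1 ->
  \forall z' \near (0 + t *: (z - 0)), good s z'.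
Proof.
move=> L T t01; apply: (lift_near L); apply: tube_convex => //.
by rewrite -(scale0r w); apply: tube_on; [case: L|rewrite lexx ler01].
Qed.

Lemma lift_eq w w' e e' s s' z : lift w e s -> lift w' e' s' -> tube w e z -> tube w' e' z -> s z = s' z.
Proof.
move=> L L' T T'; apply: (good_unique Hphi ach JP (w0 := 0) (w1 := z)).
  by move=> u u01; split; [exact: lift_seg L T u01|exact: lift_seg L' T' u01].
by case: L => _ -> _; case: L' => _ -> _.
Qed.

Lemma lift_slope0 w e s v : lift w e s -> `|v *m jac (srep s) 0| <= La1 * `|v|.
Proof.
move=> L; have T0 : tube w e 0 by rewrite -(scale0r w); apply: tube_on; [case: L|rewrite lexx ler01].
have G := lift_near L T0; have e1 := good_section Hphi ach JP G; have gs := nbhs_singleton G.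
have s0 : s 0 = x0 by case: L.
have dcs : dom c0 (s 0) by rewrite s0.
have [_ /(_ _ ac0 dcs) e2] := good_srep Hphi ach gs.
have e3 := mulmx_section v e1; rewrite s0 in e2.
by have := slope0 (v *m jac (cmap c0 \o s) 0); rewrite -mulmxA -e2 e3.
Qed.

Lemma lift_bounds w e s z : lift w e s -> tube w e z -> `|z| < rho ->
  `|srep s z - a| <= La * `|z| /\ forall v, `|v *m jac (srep s) z| <= (La1 + 2^-1) * `|v|.
Proof.
move=> L T zr.
have [|h1 h2] := good_segment Hphi ach JP Hb HP HB HR La0 B0 (s := s) (w := 0) (w' := z).
  by move=> t t01; exact: lift_seg L T t01.
have s0 : s 0 = x0 by case: L.
rewrite subr0 in h1 h2; split.
  by rewrite /srep /= s0 ax0 in h1.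
move=> v; have h3 := lift_slope0 v L; have h4 := h2 v.
have -> : v *m jac (srep s) z = v *m jac (srep s) 0 + (v *m jac (srep s) z - v *m jac (srep s) 0).
  by rewrite addrC subrK.
rewrite (le_trans (ler_normD _ _))// mulrDl lerD// (le_trans h4)// ler_wpM2r//.
by rewrite (le_trans _ Brho)// ler_pM2l// ltW.
Qed.

Lemma lift0 : exists e s, lift 0 e s.
Proof.
have LL : La1 < La by rewrite (le_lt_trans _ La1La)// lerDl.
have sz : `|cmap ch (phi x0) - a| < eta by rewrite ax0 subrr normr0.
have [e [t [e0 t0 G _]]] := local_section Hphi ach JP ac0 dc0 dx0 sz LL slope0.
rewrite prj_x0 in t0 G; exists e, t; split; [exact: e0|exact: t0|move=> z [u _ h]; apply: G].
by rewrite scaler0 in h.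
Qed.

Lemma lift_open w e s w' : lift w e s -> `|w' - w| < e / 2 -> lift w' (e / 2) s.
Proof.
move=> [e0 s0 G] h; split; [by rewrite divr_gt0|exact: s0|move=> z T].
 apply: G; apply: (tube_sub _ T); rewrite [leRHS](splitr e) lerD2r.
exact: ltW.
Qed.

Lemma lift_rdist w e s (u v : R) : lift w e s -> `|w| < rho -> 0 <= u <= v -> v <= 1 ->
  rdist (s (u *: w)) (s (v *: w)) <= (Cb + 1) * La * `|w| * (v - u).
Proof.
move=> L wr /andP[u0 uv] v1; have v0 := le_trans u0 uv; have [_ _ G] := L.
pose c := section_chart Hphi ach JP (@tube_open _ _ w e) G.
pose mu := (Cb + 1) * La * `|w| * (v - u).
have vu0 : 0 <= v - u by rewrite subr_ge0.
have mu0 : 0 <= mu by rewrite !mulr_ge0// ?addr_ge0// ltW.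
have e0 : 0 < e by case: L.
have seg (t : R) : 0 <= t <= 1 -> tube w e (u *: w + t *: (v *: w - u *: w)).
  move=> t01; apply: tube_convex => //; apply: tube_on => //; first by rewrite u0 (le_trans uv).
  by rewrite v0.
have hc : compat c by exact: section_compat.
have [||//|l /rdist_le h1 h2] := @segment_joined _ _ _ c (u *: w) (v *: w) mu hc.
- by move=> t t01; rewrite -[[set cmap c x | x in dom c]]/(prj @` (s @` tube w e)) (section_codom G); exact: seg.
- move=> t t01; have Tz := seg t t01; rewrite -[cinv c _]/(s _) (section_gram Hphi ach JP _ G Tz) pullb_bilin.
  move: Tz; set z := u *: w + _ => Tz; set h := v *: w - u *: w.
  have gz := G z Tz; have Hz := Hb (g_size gz).
  apply: le_trans (ler_norm _) _; apply: le_trans (mb_upper Hz _ _) _.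
  have h3 := g_slope gz h; have hn : `|h| = (v - u) * `|w| by rewrite /h -scalerBl normrZ ger0_norm.
  have -> : mu ^+ 2 = (Cb + 1) ^+ 2 * (La * `|h|) * (La * `|h|) by rewrite hn /mu; ring.
  have n0 : 0 <= La * `|h| by rewrite mulr_ge0// ltW.
  have CC := le_sqr_succ Cb0.
  apply: ler_pM => //; first by rewrite mulr_ge0// ltW.
  by apply: ler_pM => //; exact: ltW.
exact: le_trans h1 h2.
Qed.

(** Radial paths have length at most a constant times [|w|], so the end points of the lifts over
    shorter segments form a Cauchy sequence. At its limit the slope is still strictly below [La], a
    local section exists there, and it is glued to one of the earlier lifts. *)
Lemma lift_closed w : `|w| < rho -> (forall u : R, 0 <= u < 1 -> exists e s, lift (u *: w) e s) ->
  exists e s, lift w e s.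
Proof.
move=> wr H; pose u (k : nat) : R := 1 - k.+1%:R^-1.
have u01 k : 0 <= u k < 1.
  by rewrite subr_ge0 invf_le1// ler1n/= ltrBlDr ltrDl invr_gt0.
have H1 (k : nat) : exists es : R * ('rV[R]_(n + n) -> M), lift (u k *: w) es.1 es.2.
  by have [e [s L]] := H _ (u01 k); exists (e, s).
have [f Hf] := choice H1.
pose y k := (f k).2 (u k *: w).
have Tk k : tube (u k *: w) (f k).1 (u k *: w).
  by apply: tube_ball; rewrite subrr normr0; case: (Hf k).
have uwr k : `|u k *: w| < rho.
  have /andP[p q] := u01 k; rewrite normrZ ger0_norm// (le_lt_trans _ wr)// ler_piMl// ltW//.
pose C := (Cb + 1) * La * `|w|.
have C0 : 0 <= C by rewrite !mulr_ge0// ?addr_ge0// ltW.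
have dist k l : (k <= l)%N -> rdist (y k) (y l) <= C * k.+1%:R^-1.
  move=> kl; have inv_le : l.+1%:R^-1 <= k.+1%:R^-1 :> R by rewrite lef_pV2 ?posrE// ler_nat.
  have ukl : u k <= u l by rewrite lerD2l lerN2.
  have /andP[ul0 ul1] := u01 l; have /andP[uk0 uk1] := u01 k.
  have [ul|ul] := eqVneq (u l) 0.
    have uk : u k = 0 by apply/eqP; rewrite eq_le uk0 -ul ukl.
    have -> : y k = y l.
      have a1 : (f k).2 0 = x0 by case: (Hf k).
      have a2 : (f l).2 0 = x0 by case: (Hf l).
      by rewrite /y uk ul scale0r a1 a2.
    by rewrite rdist_xx mulr_ge0// invr_ge0.
  pose q := u k / u l; have ulp : 0 < u l by rewrite lt_neqAle eq_sym ul.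
  have qu : q *: (u l *: w) = u k *: w by rewrite scalerA divfK.
  have q0 : 0 <= q by rewrite divr_ge0.
  have q1 : q <= 1 by rewrite ler_pdivrMr// mul1r.
  have -> : y k = (f l).2 (q *: (u l *: w)).
    rewrite qu; apply: (lift_eq (Hf k) (Hf l)) => //; rewrite -qu; apply: tube_on; last by rewrite q0.
    by case: (Hf l).
  have -> : y l = (f l).2 (1 *: (u l *: w)) by rewrite scale1r.
  have q01 : 0 <= q <= 1 by rewrite q0.
  apply: le_trans (lift_rdist (Hf l) (uwr l) q01 (lexx 1)) _.
  rewrite normrZ ger0_norm//.
  have -> : (Cb + 1) * La * (u l * `|w|) * (1 - q) = C * (u l - q * u l) by rewrite /C; ring.
  rewrite divfK// ler_wpM2l// /u opprB addrC addrA subrK lerBlDr lerDl invr_ge0//.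
have small e : 0 < e -> exists k, forall l, (k <= l)%N -> C * l.+1%:R^-1 < e.
  move=> e0; have d0 : 0 < e / (C + 1) by rewrite divr_gt0// ltr_wpDl.
  have [k _ Hk] := near_infty_natSinv_lt (PosNum d0).
  exists k => l kl; have := Hk l kl; rewrite /= ltr_pdivlMr ?ltr_wpDl// => h.
  by rewrite (le_lt_trans _ h)// mulrC ler_wpM2l ?invr_ge0// lerDl.
have [x Hx] : exists x, rdist (y i) x @[i --> \oo] --> (0 : R).
  apply: cplt => e e0; have [k Hk] := small e e0; exists k => i j ki kj.
  have [ij|/ltnW ji] := leqP i j; first exact: le_lt_trans (dist _ _ ij) (Hk _ ki).
  by rewrite rdist_sym (le_lt_trans (dist _ _ ji))// Hk.
have near_x (A : set M) : nbhs x A -> exists K, forall k, (K <= k)%N -> A (y k).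
  move=> /(rdist_nbhs conn)[e e0 He].
  have := (@cvgrPdist_lt _ _ _ \oo _ _ _).1 Hx e e0 => -[K _ HK].
  exists K => k Kk; apply: He; have := HK k Kk.
  by rewrite /= sub0r normrN rdist_sym ger0_norm ?rdist_ge0.
have yx : y k @[k --> \oo] --> x.
  by move=> A /near_x[K HK]; exists K.
have prjy k : prj (y k) = u k *: w.
  by have [_ _ G] := Hf k; exact: g_prj (G _ (Tk k)).
have uw : u k *: w @[k --> \oo] --> w.
  apply/(@cvgrPdist_lt _ _ _ \oo) => e e0.
  have d0 : 0 < e / (`|w| + 1) by rewrite divr_gt0// ltr_wpDl.
  have := near_infty_natSinv_lt (PosNum d0); apply: filterS => k /=.
  have -> : w - u k *: w = k.+1%:R^-1 *: w by rewrite /u scalerBl scale1r opprB addrC subrK.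
  rewrite normrZ ger0_norm ?invr_ge0// ltr_pdivlMr ?ltr_wpDl// => h.
  by rewrite (le_lt_trans _ h)// ler_wpM2l ?invr_ge0// lerDl.
pose kap := La * `|w|.
have kape : kap < eta by rewrite (lt_le_trans _ Larho)// ltr_pM2l.
(* The images under [phi] stay in a compact part of the chart [ch], so the image of the limit point
   is still in the domain of [ch]. *)
pose K := [set q : 'rV[R]_(N + N) | `|q - a| <= kap].
have KW q : K q -> (cmap ch @` dom ch) q.
  by move=> Kq; exact: mb_in (Hb (le_lt_trans Kq kape)).
have cK : compact (cinv ch @` K).
  apply: continuous_compact; last exact: norm_ball_compact.
  by apply: continuous_in_subspaceT => q /set_mem Kq; exact: cinv_continuous (KW q Kq).
have clK : closed (cinv ch @` K) by apply: compact_closed cK; exact: carrier_hausdorff.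
have phix : (cinv ch @` K) (phi x).
  have pc : phi (y k) @[k --> \oo] --> phi x := cvg_comp _ _ yx (@Hphi.1.1 x).
  apply: (closed_cvg _ clK _ _ pc); apply: nearW => k; exists (cmap ch (phi (y k))).
    have [h _] := lift_bounds (Hf k) (Tk k) (uwr k).
    apply: le_trans h _; rewrite ler_pM2l// normrZ.
    by have /andP[p q] := u01 k; rewrite ger0_norm// ler_piMl// ltW.
  by apply: cmapK; have [_ _ G] := Hf k; exact: g_dom (G _ (Tk k)).
case: phix => q Kq qx; have [dx ex] := image_cinv (KW q Kq); rewrite qx in dx ex.
have sz : `|cmap ch (phi x) - a| < eta by rewrite ex (le_lt_trans Kq).
have prjx : prj x = w.
  have h1 : prj (y k) @[k --> \oo] --> prj x := cvg_comp _ _ yx (prj_continuous Hphi dx).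
  have h2 : prj (y k) @[k --> \oo] --> w.
    by apply: cvg_trans uw; apply: near_eq_cvg; apply: nearW => k; rewrite prjy.
  exact: (cvg_unique _ h1 h2).
pose c := chart_at x; have ac : atlas c := chart_at_atlas x; have dc : dom c x := chart_at_dom x.
have hl := lrep_hol Hphi ach ac dc dx.
have cy : cmap c (y k) @[k --> \oo] --> cmap c x := cvg_comp _ _ yx (cmap_continuous dc).
(* In the form of [good_chart_slope] the estimate involves only the chart [c] and the points [y k],
   and therefore survives the limit. *)
have slope v : `|v *m jac (lrep phi ch c) (cmap c x)| <= (La1 + 2^-1) * `|v *m jac (lrep phi ch c) (cmap c x) *m P|.
  have hv := hol_continuous (hol_jac v hl).
  have l1 : v *m jac (lrep phi ch c) (cmap c (y k)) @[k --> \oo] --> v *m jac (lrep phi ch c) (cmap c x) :=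
    cvg_comp _ _ cy hv.
  have l2 := cvg_comp _ _ l1 (@continuous_mulmxr _ _ _ P _).
  apply: (ler_cvg_to (cvg_norm l1) (cvgM (cvg_cst (La1 + 2^-1)) (cvg_norm l2))).
  have N1 : \forall k \near \oo, dom c (y k).
    by apply: yx; apply: open_nbhs_nbhs; split; [exact: dom_open|].
  apply: filterS N1 => k dk.
  have [_ h] := lift_bounds (Hf k) (Tk k) (uwr k).
  exact: (good_chart_slope Hphi ach JP (lift_near (Hf k) (Tk k)) ac dk h v).
have [e [t [e0 tx Gt Et]]] := local_section Hphi ach JP ac dc dx sz La1La slope.
rewrite prjx in tx Gt Et.
have e2 : 0 < e / 2 by rewrite divr_gt0.
have N1 : \forall k \near \oo, `|u k *: w - w| < e / 2.
  by have NN := near_dist w e2; exact: (uw _ NN).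
(* For large [k] the section [t] at the limit point passes through [y k]; one common point is enough
   to make it agree with the lift on the overlap. *)
have N2 : \forall k \near \oo, `|prj (y k) - w| < e -> t (prj (y k)) = y k := yx _ Et.
have [k [uk1 tk uk0]] : exists k, [/\ `|u k *: w - w| < e / 2, t (u k *: w) = y k & 0 < u k].
  have N3 : \forall k \near \oo, (0 < k)%N by exists 1%N.
  have [k [[h1 h2] h3]] := filter_ex (filterI (filterI N1 N2) N3).
  exists k; split => //.
    by rewrite -prjy h2// prjy (lt_trans h1)// ltr_pdivrMr// ltr_pMr// ltr1n.
  by rewrite subr_gt0 invf_lt1// ltr1n ltnS.
have L := Hf k; have Tkk := Tk k.
have Lk := L; have e'0 : 0 < (f k).1 by case: Lk.
rewrite /y in tk; move: (f k).1 (f k).2 L Tkk tk e'0 => e' s' L Tkk tk e'0.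
have Gt' z : `|z - w| < e -> \forall z' \near z, good t z'.
  by move=> h; apply: filterS (open_nbhs_nbhs (conj (@open_dist_lt _ _ w e) h)) => z'; exact: Gt.
have uke : `|u k *: w - w| < e by rewrite (lt_trans uk1)// ltr_pdivrMr// ltr_pMr// ltr1n.
have overlap z : tube (u k *: w) e' z -> `|z - w| < e -> t z = s' z.
  move=> Tz ze; apply: (good_unique Hphi ach JP (w0 := u k *: w) (w1 := z)) tk => v v01; split.
    by apply: Gt'; exact: segment_ball.
  by apply: (lift_near L); exact: tube_convex.
(* The new section is used near [w] and the earlier lift elsewhere; [overlap] makes the two fit
   together. The new width is chosen so that [tube_scale] covers the whole tube by these two
   regions. *)
pose s2 z := if `|z - w| < e then t z else s' z.
have T0 : tube (u k *: w) e' 0 by rewrite -(scale0r (u k *: w)); apply: tube_on; rewrite ?lexx ?ler01.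
exists (Num.min e' (e / 2)), s2; split; first by rewrite lt_min e'0.
  have s0 : s' 0 = x0 by case: L.
  by rewrite /s2; case: ifP => [h|_]; rewrite ?overlap.
move=> z Tz; have uk01 : 0 < u k <= 1 by rewrite uk0; have /andP[_ /ltW] := u01 k.
have mine : Num.min e' (e / 2) <= e' by rewrite ge_min lexx.
have : tube (u k *: w) e' z \/ `|z - w| < e.
  have [h|h] := tube_scale uk01 mine Tz; [by left|right].
  rewrite (lt_le_trans h)// [leRHS](splitr e) lerD ?ge_min ?lexx ?orbT//.
  rewrite (le_trans _ (ltW uk1))// -{3}(scale1r w) -scalerBl normrZ ler_wpM2r//.
  by rewrite distrC ler_norm.
move=> Hz; have [ze|ze] := boolP (`|z - w| < e).
  apply: (good_near Hphi ach _ (Gt z ze)).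
  have NN := open_nbhs_nbhs (conj (@open_dist_lt _ _ w e) ze).
  by apply: filterS NN => z' h; rewrite /s2 ifT.
have Tz' : tube (u k *: w) e' z by case: Hz => // h; case/negP: ze.
have [_ _ G'] := L; apply: (good_near Hphi ach _ (G' z Tz')).
have NN := open_nbhs_nbhs (conj (@tube_open _ _ (u k *: w) e') Tz').
by apply: filterS NN => z' h; rewrite /s2; case: ifP => // ze'; rewrite overlap.
Qed.

Lemma lift_all w : `|w| < rho -> exists e s, lift w e s.
Proof.
move=> wr; suff H (t : R) : 0 <= t <= 1 -> exists e s, lift (t *: w) e s.
  by have := H 1; rewrite scale1r; apply; rewrite ler01 lexx.
apply: (@seg_ind _ (fun t : R => exists e s, lift (t *: w) e s)) => [|v /andP[v0 v1] Hv|v /andP[v0 v1] Hv].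
- by rewrite scale0r; exact: lift0.
- have [|e [s L]] := Hv v; first by rewrite v0 lexx.
  have e0 : 0 < e / 2 by rewrite divr_gt0//; case: L.
  exists (e / 2 / (`|w| + 1)) => [|u /andP[vu uv] _]; first by rewrite divr_gt0// ltr_wpDl.
  exists (e / 2), s; apply: (lift_open L); rewrite -scalerBl normrZ ger0_norm ?subr_ge0//.
  have : u - v < e / 2 / (`|w| + 1) by rewrite ltrBlDl.
  rewrite ltr_pdivlMr ?ltr_wpDl// => h; rewrite (le_lt_trans _ h)// ler_wpM2l ?subr_ge0// lerDl//.
- apply: lift_closed => [|u /andP[u0 u1]].
    by rewrite normrZ gtr0_norm// (le_lt_trans _ wr)// ler_piMl.
  rewrite scalerA; apply: Hv; apply/andP; split; first by rewrite mulr_ge0// ltW.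
  by rewrite gtr_pMl.
Qed.

(** Every point takes the value of its own lift at its end point. Lifts over neighbouring segments
    agree by [lift_eq], so the resulting map is good everywhere in the ball. *)
Lemma continuation : exists2 s, s 0 = x0 & forall w, `|w| < rho -> good s w /\ `|srep s w - a| <= La * `|w|.
Proof.
have H w : exists es : R * ('rV[R]_(n + n) -> M), `|w| < rho -> lift w es.1 es.2.
  have [wr|] := boolP (`|w| < rho); last by exists (0, fun=> x0).
  by have [e [s L]] := lift_all wr; exists (e, s).
have [f Hf] := choice H; pose s w := (f w).2 w.
have Tw w : `|w| < rho -> tube w (f w).1 w.
  by move=> wr; apply: tube_ball; rewrite subrr normr0; case: (Hf w wr).
have agree w : `|w| < rho -> \forall w' \near w, (f w).2 w' = s w'.
  move=> wr; have L := Hf w wr; have e0 : 0 < (f w).1 by case: L.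
  have wr' : `|w - 0| < rho by rewrite subr0.
  have N1 := open_nbhs_nbhs (conj (@open_dist_lt _ _ 0 rho) wr').
  apply: filterS2 N1 (near_dist w e0) => w' /=; rewrite subr0 => w'r ww'.
  by apply: (lift_eq L (Hf w' w'r) _ (Tw w' w'r)); exact: tube_ball.
exists s => [|w wr].
  by rewrite /s; have [|_ -> _] := Hf 0; rewrite ?normr0.
have L := Hf w wr; have [h _] := lift_bounds L (Tw w wr) wr; have [_ _ G] := L.
by split; [exact: (good_near Hphi ach (agree w wr) (G w (Tw w wr)))|exact: h].
Qed.

End Continuation.

(** * Orthonormal coordinates and the constants of one ambient chart *)

Lemma metric_lip_near {R : realType} {N} (W : set 'rV[R]_(N + N)) (K : 'rV[R]_(N + N) -> 'M[R]_(N + N)) p0 :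
  kahler_metric W K -> W p0 -> exists r C, [/\ 0 < r, 0 <= C & forall p p' : 'rV[R]_(N + N), `|p - p0| < r -> `|p' - p0| < r ->
    forall i j, `|K p' i j - K p i j| <= C * `|p' - p|].
Proof.
move=> HK Wp; have oW := km_open HK; have sK := km_smooth HK.
have dK (t : 'I_(N + N) * 'I_(N + N) * 'I_(N + N)) :
    differentiable (fun q => dmx K (delta_mx 0 t.2) q t.1.1 t.1.2) p0.
  exact: (smooth_differentiable oW (@K_smooth_d _ _ K W sK t.1.1 t.1.2 _) Wp).
have [C C0 HC] := near_bounded_fin dK.
have [r r0 Hr] := (near_ballP _ _).1 (filterI HC (open_nbhs_nbhs (conj oW Wp))).
exists r, ((N + N)%:R * C); split => // [|p p' pr p'r i j]; first by rewrite mulr_ge0.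
have [t t01|t t01 ->] := @mean_value _ _ (fun q => K q i j) p p'.
  have [_ Wt] := Hr _ (segment_ball t01 pr p'r); exact: K_diff oW sK i j _ Wt.
have [H Wt] := Hr _ (segment_ball t01 pr p'r).
rewrite (isd_val (dmx_isd oW sK i j Wt)) (dmxE oW sK i j _ Wt).
rewrite (le_trans (ler_norm_sum _ _ _))// -!mulrA mulr_natl -[X in _ *+ X]card_ord -sumr_const.
by apply: ler_sum => l _; rewrite normrM mulrC ler_pM// ?coord_le_norm// (H (i, j, l)).
Qed.

Lemma metric_bounds_le {R : realType} {N} (W : set 'rV[R]_(N + N)) K C C' p : 0 < C -> C <= C' ->
  metric_bounds W K C p -> metric_bounds W K C' p.
Proof.
move=> C0 CC [h1 h2 h3 h4 h5]; split => //.
- by move=> a b; rewrite (le_trans (h2 a b))// !ler_wpM2r.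
- move=> a; have [->|a0] := eqVneq a 0; first by rewrite normr0 expr0n/= bilin0l mulr0.
  rewrite (le_trans (h3 a))// ler_wpM2r//.
  have : 0 < C * bilin (K p) a a by rewrite (lt_le_trans _ (h3 a))// exprn_gt0// normr_gt0.
  by rewrite pmulr_rgt0// => /ltW.
- by move=> a b; rewrite (le_trans (h4 a b))// !ler_wpM2r.
- by move=> a b c f; rewrite (le_trans (h5 a b c f))// !ler_wpM2r.
Qed.

Lemma le_sqr_mul {R : realType} (x C e k q : R) : 0 <= x -> 0 < C -> 0 <= k -> 0 <= q -> x ^+ 2 <= C * e ^+ 2 ->
  0 <= e -> e <= k * q -> x <= (C + 1) * k * q.
Proof.
move=> x0 C0 k0 q0 h e0 ek; rewrite -(@ler_pXn2r _ 2) ?nnegrE ?mulr_ge0// ?addr_ge0 ?(ltW C0)//.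
rewrite (le_trans h)// -(mulrA (C + 1)) [leRHS]exprMn.
apply: ler_pM; [exact: ltW|exact: sqr_ge0|exact: le_sqr_succ|].
by rewrite ler_pXn2r ?nnegrE ?mulr_ge0.
Qed.

Lemma mul_le_succ {R : realType} (C X : R) : 0 < X -> C * X <= (C + 1) * X + 1.
Proof. by move=> X0; nra. Qed.

Lemma half_lt_succ {R : realType} (C X : R) : 0 < C -> 0 < X -> X + 2^-1 < (C + 1) * X + 1.
Proof. by move=> C0 X0; nra. Qed.

Lemma ler_mul3 {R : realType} (C a a' b b' : R) : 0 <= C -> 0 <= a -> 0 <= b -> a <= a' -> b <= b' -> C * a * b <= C * a' * b'.
Proof. by move=> C0 a0 b0 aa bb; rewrite ler_pM ?mulr_ge0// ler_wpM2l. Qed.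

Lemma quarter_lt {R : realType} (x y r : R) : 0 < r -> x < r / 2 -> y < r / 4 -> x + y < r.
Proof. by move=> *; lra. Qed.

Lemma quarter_le {R : realType} (x y r : R) : x < r / 2 -> y < r / 4 -> x + y <= 3 / 4 * r.
Proof. by move=> *; lra. Qed.

Lemma le_sum4 {R : realType} (a b c d : R) : 0 <= a -> 0 <= b -> 0 <= c -> 0 <= d ->
  [/\ a <= a + b + c + d, b / 2 <= a + b + c + d & c + d <= a + b + c + d].
Proof. by move=> *; split; lra. Qed.

Lemma mx_subE {R : realType} {m k} (A B : 'M[R]_(m, k)) i j : (A - B) i j = A i j - B i j.
Proof. by rewrite !mxE. Qed.

Section UniformChart.
Context {R : realType} {n N : nat} (M : kahlerManifold R n) (M' : kahlerManifold R N).
Variable phi : M -> M'.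
Variable ch : chart R M' (N + N).
Implicit Types (x : M) (s : 'rV[R]_(n + n) -> M) (p : 'rV[R]_(N + N)).
Local Notation Kh := (fun q : 'rV[R]_(N + N) => metric ch (cinv ch q)).

(* [phi \o s] is a graph of size [rho] over the tangent space at [phi x], with
   orthonormal coordinates at [x] ([uc_one]). *)
Record uchart p0 r rho C x s (P : 'M[R]_(N + N, n + n)) : Prop := UChart {
  uc_JP : Jmx *m P = P *m Jmx;
  uc_P : forall p, `|p *m P| <= C * `|p|;
  uc_0 : s 0 = x;
  uc_good : forall w, `|w| < rho -> good phi ch P (cmap ch (phi x)) C C s w;
  uc_size : forall w, `|w| < rho -> `|srep phi ch s w - p0| <= 3 / 4 * r;
  uc_scal : forall w, `|w| < rho -> scalar_curvature (s w) = local_scalar_curvature (pullb (srep phi ch s) Kh) w;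
  uc_one : pullb (srep phi ch s) Kh 0 = 1%:M;
  uc_lip : forall w, `|w| < rho -> forall i j, `|pullb (srep phi ch s) Kh w i j - (1%:M : 'M[R]_(n + n)) i j| <= C * `|w|
}.

Lemma good_mono P a eta eta' La La' s w : eta <= eta' -> La <= La' ->
  good phi ch P a eta La s w -> good phi ch P a eta' La' s w.
Proof.
move=> ee LL [h1 h2 h3 h4 h5 h6]; split; [exact: h1|exact: h2|exact: h3|exact: lt_le_trans h4 ee|exact: h5|].
by move=> v; apply: le_trans (h6 v) _; exact: ler_wpM2r.
Qed.

Lemma uchart_mono p0 r rho rho' C C' x s P : rho' <= rho -> C <= C' ->
  uchart p0 r rho C x s P -> uchart p0 r rho' C' x s P.
Proof.
move=> rr CC [h1 h2 h3 h4 h5 h6 h7 h8]; split; [exact: h1| |exact: h3| | | |exact: h7|].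
- by move=> p; apply: le_trans (h2 p) _; exact: ler_wpM2r.
- by move=> w wr; exact: (good_mono CC CC (h4 w (lt_le_trans wr rr))).
- by move=> w wr; exact: h5 (lt_le_trans wr rr).
- by move=> w wr; exact: h6 (lt_le_trans wr rr).
- by move=> w wr i j; apply: le_trans (h8 w (lt_le_trans wr rr) i j) _; exact: ler_wpM2r.
Qed.

Hypothesis ach : atlas ch.
Hypothesis Hphi : holomorphic_isometry phi.

(** The rows of [T] are a unitary frame of the tangent space in the ambient chart, and [P] takes
    inner products with them: it is the orthogonal projection to the tangent space in unitary
    coordinates. Both norms are controlled by [Cb] alone, independently of the tangent space. *)
Lemma unitary_projection x Cb : 0 < Cb -> dom ch (phi x) ->
  metric_bounds (cmap ch @` dom ch) Kh Cb (cmap ch (phi x)) ->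
  exists (L : 'M[R]_(n + n)) (T : 'M[R]_(n + n, N + N)) (P : 'M[R]_(N + N, n + n)),
  [/\ Jmx *m P = P *m Jmx, T *m P = 1%:M, T = L *m jac (lrep phi ch (chart_at x)) (cmap (chart_at x) x) /\
      T *m Kh (cmap ch (phi x)) *m T^T = 1%:M,
    (forall u : 'rV[R]_(n + n), `|u *m T| <= (Cb + 1) * ((n + n)%:R + 1) * `|u|) &
    (forall p : 'rV[R]_(N + N), `|p *m P| <= Cb * ((Cb + 1) * ((n + n)%:R + 1)) * `|p|)].
Proof.
move=> Cb0 dx Hb; pose c := chart_at x; have ac : atlas c := chart_at_atlas x; have dc : dom c x := chart_at_dom x.
have HK := metric_kahler ach; have Wx := image_cmap dx; have Hc := metric_kahler ac; have Wc := image_cmap dc.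
have [L [HL JL]] := unitary_frame (km_sym Hc Wc) (fun u v => km_J Hc u v Wc) (fun u => km_pos Hc Wc).
have hl := lrep_hol Hphi ach ac dc dx; have JD := cdiff_J (hol_cdiff hl).
have E := isometry_pullb Hphi ac ach dc dx; rewrite -/(lrep phi ch c) /pullb in E.
have ex : lrep phi ch c (cmap c x) = cmap ch (phi x) by rewrite /lrep /= cmapK.
rewrite cmapK// E ex in HL.
have Ks := km_sym HK Wx; have KJ := fun u v => km_J HK u v Wx.
have Hu := mb_upper Hb; have Hl := mb_lower Hb.
move: (jac _ _) JD HL => D JD HL; move: (metric ch _) Ks KJ Hu Hl HL => K Ks KJ Hu Hl HL.
pose T := L *m D; exists L, T, (K *m T^T).
have JT : Jmx *m T = T *m Jmx by rewrite /T mulmxA JL -mulmxA JD mulmxA.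
have T1 : T *m K *m T^T = 1%:M by rewrite /T trmx_mul !mulmxA in HL *.
have JJ k : (Jmx : 'M[R]_(k + k))^T = - Jmx.
  by rewrite /Jmx tr_block_mx !trmx0 trmx1 linearN/= trmx1 -[RHS]/(- block_mx _ _ _ _) opp_block_mx !oppr0 opprK.
have JK : Jmx *m K = K *m Jmx.
  have H : Jmx *m K *m Jmx^T = K.
    by apply/matrixP => i j; have := KJ (delta_mx 0 i) (delta_mx 0 j); rewrite bilin_mulmx !bilin_delta.
  have J2 : (Jmx : 'M[R]_(N + N)) *m Jmx = - 1%:M.
    by apply: mulmxrI => v; rewrite mulmxA JmxK mulmxN mulmx1.
  by rewrite -[in RHS]H JJ mulmxN mulNmx -[X in - X]mulmxA J2 mulmxN mulmx1 opprK.
have TnB (u : 'rV[R]_(n + n)) : `|u *m T| <= (Cb + 1) * ((n + n)%:R + 1) * `|u|.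
  apply: (@le_sqr_mul _ _ Cb (enorm u)) => //.
  - rewrite (le_trans (Hl _))// ler_pM2l// enorm_sqr /dotp.
    have -> : bilin K (u *m T) (u *m T) = bilin (1%:M) u u by rewrite -T1 bilin_mulmx.
    rewrite /bilin mulmx1 mxE; apply: ler_sum => i _; rewrite mxE.
    exact: lexx.
  - exact: enorm_ge0.
  - exact: enorm_le.
split => //.
- have JTt : Jmx *m T^T = T^T *m Jmx by apply: oppr_inj; rewrite -mulNmx -mulmxN -!JJ -!trmx_mul JT.
  by rewrite mulmxA JK -!mulmxA JTt.
- by rewrite mulmxA.
move=> p; apply: norm_rV_le => [|j]; first by rewrite !mulr_ge0// ?addr_ge0// ltW.
have -> : (p *m (K *m T^T)) 0 j = bilin K p (row j T).
  by rewrite mulmxA /bilin tr_row colE mulmxA -colE [RHS]mxE.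
rewrite (le_trans (Hu _ _))// [leRHS]mulrAC; apply: ler_wpM2l; first by rewrite mulr_ge0// ltW.
by rewrite rowE (le_trans (TnB _))// norm_delta_mx mulr1.
Qed.

Hypothesis conn : connected [set: M].
Hypothesis cplt : complete_kahler M.

(** In the final constant, [La] bounds the slope and [P], and [r] covers the size of the graph. The
    other two summands are the Lipschitz constant of the pulled back metric at the centre, from the
    variation of the derivative ([B]) and of the ambient metric ([Cl]). Starting within [r / 4] of
    [p0] and moving less than [r / 2] leaves the graph within [3 / 4 * r]. *)
Lemma uchart_exists x R0 Cb Cl B p0 r rho : 0 < Cb -> 0 <= Cl -> 0 < B -> 0 < r ->
  (forall p, `|p - p0| < r -> metric_bounds (cmap ch @` dom ch) Kh Cb p /\
     forall p' : 'rV[R]_(N + N), `|p' - p0| < r -> forall i j, `|Kh p' i j - Kh p i j| <= Cl * `|p' - p|) ->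
  let La := (Cb + 1) * ((Cb + 1) * ((n + n)%:R + 1)) + 1 in
  jet2_bd n N Cb La R0 B -> (forall y : M, R0 <= scalar_curvature y) ->
  0 < rho -> B * rho <= 2^-1 -> La * rho <= r / 2 -> 
  dom ch (phi x) -> `|cmap ch (phi x) - p0| < r / 4 ->
  exists s P, uchart p0 r rho (La + r + 2 * (Cb * B * La) + (N + N)%:R * ((N + N)%:R * (Cl * La)) * La * La) x s P.
Proof.
move=> Cb0 Cl0 B0 r0 Hb La HB HR rho0 Brho Larho dx xr.
pose k : R := (n + n)%:R + 1; have k0 : 1 <= k by rewrite lerDr.
have kp : 0 < k := lt_le_trans ltr01 k0.
set a := cmap ch (phi x) in xr *.
have r4 : r / 4 < r by rewrite ltr_pdivrMr// ltr_pMr// ltr1n.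
have [Hba _] := Hb a (lt_trans xr r4).
have [L [T [P [JP TP [TD T1] Tn Pn]]]] := unitary_projection Cb0 dx Hba.
have La0 : 0 < La by rewrite ltr_wpDl// !mulr_ge0 ?addr_ge0// ltW.
have P2 p : `|p *m P| <= La * `|p|.
  by rewrite (le_trans (Pn p))// ler_wpM2r// mul_le_succ// mulr_gt0// ltr_wpDl// ltW.
have La1 : (Cb + 1) * k + 2^-1 < La.
  by rewrite half_lt_succ// mulr_gt0// ltr_wpDl// ltW.
have Hbe p : `|p - a| < r / 2 -> metric_bounds (cmap ch @` dom ch) Kh Cb p.
  move=> pa; apply: (Hb p _).1; have -> : p - p0 = (p - a) + (a - p0) by rewrite addrA subrK.
  by rewrite (le_lt_trans (ler_normD _ _))// quarter_lt.
pose c := chart_at x; have ac : atlas c := chart_at_atlas x; have dc : dom c x := chart_at_dom x.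
have slope (v : 'rV[R]_(n + n)) : `|v *m jac (lrep phi ch c) (cmap c x)| <= ((Cb + 1) * k) * `|v *m jac (lrep phi ch c) (cmap c x) *m P|.
  have LU : L \in unitmx.
    apply: inj_unitmx => u u0; rewrite -[u]mulmx1 -TP TD !mulmxA.
    by rewrite u0 !mul0mx.
  have -> : v *m jac (lrep phi ch c) (cmap c x) = v *m invmx L *m T by rewrite TD mulmxA mulmxKV.
  by rewrite (mulmx_section _ TP); exact: Tn.
have eta0 : 0 < r / 2 by rewrite divr_gt0.
have [s s0 Gs] := continuation Hphi conn cplt ach JP Hbe P2 HB HR Cb0 La0 B0 eta0 rho0 Brho Larho La1 ac dc dx erefl slope.
have gw w : `|w| < rho -> good phi ch P a (r / 2) La s w by move=> /Gs[].
have gn w : `|w| < rho -> \forall w' \near w, good phi ch P a (r / 2) La s w'.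
  move=> wr; have wr' : `|w - 0| < rho by rewrite subr0.
  have NN := open_nbhs_nbhs (conj (@open_dist_lt _ _ 0 rho) wr').
  by apply: filterS NN => w' /=; rewrite subr0; exact: gw.
have o0 : `|0 : 'rV[R]_(n + n)| < rho by rewrite normr0.
(* Both matrices have the tangent space at [x] as row space and [P] as right inverse, which forces
   them to be equal. *)
have j0 : jac (srep phi ch s) 0 = T.
  have e1 := good_section Hphi ach JP (gn 0 o0).
  have dcs : dom c (s 0) by rewrite s0.
  have [_ /(_ c ac dcs) e2] := good_srep Hphi ach (gw 0 o0).
  rewrite s0 in e2; rewrite e2; move: e1; rewrite e2 TD; rewrite TD in TP.
  move: (jac _ _) (jac _ _) TP => A D h1 h2; congr (_ *m _).
  have := mulmx1C (etrans (mulmxA L D P) h1) => h3.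
  by rewrite -[A]mulmx1 -h3 !mulmxA h2 mul1mx.
have F0 : srep phi ch s 0 = a by rewrite /srep /= s0.
pose C := La + r + 2 * (Cb * B * La) + (N + N)%:R * ((N + N)%:R * (Cl * La)) * La * La.
have x1 : 0 <= 2 * (Cb * B * La) by rewrite !mulr_ge0// ltW.
have x2 : 0 <= (N + N)%:R * ((N + N)%:R * (Cl * La)) * La * La by rewrite !mulr_ge0// ltW.
have [LaC rC _] := le_sum4 (ltW La0) (ltW r0) x1 x2; rewrite -/C in LaC rC.
have sz w : `|w| < rho -> `|srep phi ch s w - a| < r / 2.
  by move=> wr; exact: g_size (gw w wr).
exists s, P; split; [exact: JP| |exact: s0| | | | |].
- by move=> p; apply: le_trans (P2 p) _; exact: ler_wpM2r.
- by move=> w wr; exact: (good_mono rC LaC (gw w wr)).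
- move=> w wr; have h := sz w wr.
  have -> : srep phi ch s w - p0 = (srep phi ch s w - a) + (a - p0) by rewrite addrA subrK.
  by rewrite (le_trans (ler_normD _ _))// quarter_le.
- by move=> w wr; have E := good_scal Hphi ach JP (gn w wr); rewrite E.
- by rewrite /pullb j0 F0.
move=> w wr i j.
have seg (t : R) : 0 <= t <= 1 -> \forall z \near 0 + t *: (w - 0), good phi ch P a (r / 2) La s z.
  move=> /andP[t0 t1]; apply: gn; rewrite add0r subr0 normrZ ger0_norm//.
  by rewrite (le_lt_trans _ wr)// ler_piMl.
have [hF hJ] := good_segment Hphi ach JP Hbe P2 HB HR La0 B0 seg.
rewrite subr0 F0 in hF hJ.
have G0 : pullb (srep phi ch s) Kh 0 = 1%:M by rewrite /pullb j0 F0.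
have E (y : 'rV[R]_(n + n)) : pullb (srep phi ch s) Kh y i j = bilin (Kh (srep phi ch s y))
    (delta_mx 0 i *m jac (srep phi ch s) y) (delta_mx 0 j *m jac (srep phi ch s) y).
  exact: (etrans (esym (bilin_delta _ i j)) (pullb_bilin _ _ _ _ _)).
have E1 := E w; have E0 := etrans (congr1 (fun A : 'M[R]_(n + n) => A i j) (esym G0)) (E 0).
rewrite F0 in E0; move: {E G0} E1 E0.
generalize (pullb (srep phi ch s) Kh w i j) ((1%:M : 'M[R]_(n + n)) i j) => x' y' -> ->.
have [_ HK] := Hb a (lt_trans xr r4).
have szw := sz w wr; have wb := Hbe _ szw.
have Kd : forall i j, `|(Kh (srep phi ch s w) - Kh a) i j| <= Cl * La * `|w|.
  move=> i' j'; rewrite mx_subE; apply: le_trans (HK _ _ i' j') _; last by rewrite -mulrA ler_wpM2l.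
  have -> : srep phi ch s w - p0 = (srep phi ch s w - a) + (a - p0) by rewrite addrA subrK.
  by rewrite (le_lt_trans (ler_normD _ _))// quarter_lt.
have s1 v : `|v *m jac (srep phi ch s) w| <= La * `|v| := g_slope (gw w wr) v.
have s2 v : `|v *m jac (srep phi ch s) 0| <= La * `|v| := g_slope (gw 0 o0) v.
have Hu := mb_upper wb.
move: (jac _ w) (jac _ 0) hJ s1 s2 => J Z hJ s1 s2.
move: {hF Kd}(Kh (srep phi ch s w)) (Kh a) (Kd) Hu => K K0 Kd Hu.
set u : 'rV[R]_(n + n) := delta_mx 0 i; set v : 'rV[R]_(n + n) := delta_mx 0 j.
have u1 : `|u| = 1 := norm_delta_mx i; have v1 : `|v| = 1 := norm_delta_mx j.
have e0 : bilin K (u *m J) (v *m J) - bilin K0 (u *m Z) (v *m Z) =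
    bilin K (u *m J - u *m Z) (v *m J) + bilin K (u *m Z) (v *m J - v *m Z) + bilin (K - K0) (u *m Z) (v *m Z).
  rewrite bilinBl bilinBr bilin_mxD -(scaleN1r K0) bilin_mxZ.
  by move: (bilin K _ _) (bilin K _ _) (bilin K _ _) (bilin K0 _ _) => *; ring.
have Cb' := ltW Cb0.
have b1 : `|bilin K (u *m J - u *m Z) (v *m J)| <= Cb * (B * `|w|) * La.
  apply: le_trans (Hu _ _) _; apply: ler_mul3 => //; first by have := hJ u; rewrite u1 mulr1.
  by have := s1 v; rewrite v1 mulr1.
have b2 : `|bilin K (u *m Z) (v *m J - v *m Z)| <= Cb * La * (B * `|w|).
  apply: le_trans (Hu _ _) _; apply: ler_mul3 => //; first by have := s2 u; rewrite u1 mulr1.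
  by have := hJ v; rewrite v1 mulr1.
have b3 : `|bilin (K - K0) (u *m Z) (v *m Z)| <= (N + N)%:R * ((N + N)%:R * (Cl * La * `|w|)) * La * La.
  apply: le_trans (bilin_bound _ Kd _ _) _; first by rewrite !mulr_ge0// ltW.
  apply: ler_mul3 => //; first by rewrite !mulr_ge0// ltW.
    by have := s2 u; rewrite u1 mulr1.
  by have := s2 v; rewrite v1 mulr1.
rewrite e0; apply: le_trans (ler_normD _ _) _; apply: le_trans (lerD (ler_normD _ _) (lexx _)) _.
apply: le_trans (lerD (lerD b1 b2) b3) _.
have -> : Cb * (B * `|w|) * La + Cb * La * (B * `|w|) + (N + N)%:R * ((N + N)%:R * (Cl * La * `|w|)) * La * La =
   (2 * (Cb * B * La) + (N + N)%:R * ((N + N)%:R * (Cl * La)) * La * La) * `|w| by ring.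
by rewrite ler_wpM2r//; have [_ _] := le_sum4 (ltW La0) (ltW r0) x1 x2.
Qed.

End UniformChart.

(** * Uniformity over the compact ambient manifold *)

Section UniformRadius.
Context {R : realType} (n : nat) (R0 : R) {N : nat} (M' : kahlerManifold R N).

(** One number controls everything: [rho] is the size of the graphs and its inverse bounds all
    constants. Near each point all sufficiently small [rho] work at once, which is the form in which
    compactness of [M'] yields a common value. *)
Definition uatlas (rho : R) (q : M') := exists (ch : chart R M' (N + N)) (p0 : 'rV[R]_(N + N)) (r : R),
  [/\ atlas ch, dom ch q /\ `|cmap ch q - p0| < r / 4, 0 < r,
    (forall p, `|p - p0| < r -> metric_bounds (cmap ch @` dom ch) (fun q : 'rV[R]_(N + N) => metric ch (cinv ch q)) rho^-1 p) &
    forall T : kahler_tuple n M', class_K R0 T -> forall x : tspace T,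
      dom ch (tmap x) -> `|cmap ch (tmap x) - p0| < r / 4 ->
      exists s P, uchart (@tmap _ _ _ _ T) ch p0 r rho rho^-1 x s P].

Lemma uatlas_near (q : M') : exists rho, 0 < rho /\ \forall q' \near q, forall rho', 0 < rho' -> rho' <= rho -> uatlas rho' q'.
Proof.
pose ch := chart_at q; have ach : atlas ch := chart_at_atlas q; have dq : dom ch q := chart_at_dom q.
pose p0 := cmap ch q; have Wp : (cmap ch @` dom ch) p0 := image_cmap dq.
have HK := metric_kahler ach.
have [r1 [Cb [r10 Cb0 H1]]] := metric_bounds_near HK Wp.
have [r2 [Cl [r20 Cl0 H2]]] := metric_lip_near HK Wp.
pose r := Num.min r1 r2; have r0 : 0 < r by rewrite lt_min r10.
pose La := (Cb + 1) * ((Cb + 1) * ((n + n)%:R + 1)) + 1.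
have La0 : 0 < La by rewrite ltr_wpDl// !mulr_ge0 ?addr_ge0// ltW.
have [B B0 HB] := jet2_bd_ex n N R0 Cb0 La0.
pose C := La + r + 2 * (Cb * B * La) + (N + N)%:R * ((N + N)%:R * (Cl * La)) * La * La.
have C0 : 0 < C.
  have x1 : 0 <= 2 * (Cb * B * La) by rewrite !mulr_ge0// ltW.
  have x2 : 0 <= (N + N)%:R * ((N + N)%:R * (Cl * La)) * La * La by rewrite !mulr_ge0// ltW.
  by have [h _ _] := le_sum4 (ltW La0) (ltW r0) x1 x2; exact: lt_le_trans h.
(* The first two bounds are the smallness conditions of [uchart_exists]; the last two make [rho^-1]
   dominate the constants [C] and [Cb]. *)
pose rho := Num.min (Num.min (2^-1 / B) (r / 2 / La)) (Num.min C^-1 Cb^-1).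
have rho0 : 0 < rho.
  by rewrite !lt_min; apply/andP; split; apply/andP; split; rewrite ?invr_gt0// divr_gt0// ?divr_gt0// invr_gt0.
exists rho; split => //.
have N1 : \forall q' \near q, dom ch q' by apply: open_nbhs_nbhs; split; [exact: dom_open|].
have N2 : \forall q' \near q, `|cmap ch q' - p0| < r / 4.
  have NN : nbhs (cmap ch q) [set p : 'rV[R]_(N + N) | `|p - p0| < r / 4].
    by apply: open_nbhs_nbhs; split; [exact: open_dist_lt|rewrite /= subrr normr0 divr_gt0].
  exact: (cmap_continuous dq) _ NN.
apply: filterS2 N1 N2 => q' dq' q'r rho' rho'0 rho'le.
have [] : [/\ B * rho' <= 2^-1, La * rho' <= r / 2, C <= rho'^-1 & Cb <= rho'^-1].
  move: rho'le; rewrite !le_min => /andP[/andP[a1 a2] /andP[a3 a4]].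
  split; rewrite 1?mulrC -?ler_pdivlMr//.
    by rewrite -[C]invrK lef_pV2 ?posrE ?invr_gt0.
  by rewrite -[Cb]invrK lef_pV2 ?posrE ?invr_gt0.
move=> b1 b2 b3 b4; exists ch, p0, r; split => //.
  move=> p pr; apply: metric_bounds_le Cb0 b4 _; apply: H1; rewrite (lt_le_trans pr)//.
  by rewrite ge_min lexx.
move=> T [conn cplt sc iso] x dx xr.
have Hb p : `|p - p0| < r -> metric_bounds (cmap ch @` dom ch) (fun q : 'rV[R]_(N + N) => metric ch (cinv ch q)) Cb p /\
     forall p' : 'rV[R]_(N + N), `|p' - p0| < r -> forall i j, `|metric ch (cinv ch p') i j - metric ch (cinv ch p) i j| <= Cl * `|p' - p|.
  rewrite !lt_min => /andP[pr1 pr2]; split; first exact: H1.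
  by move=> p'; rewrite !lt_min => /andP[_ p'r2] i j; exact: H2.
have [s [P H]] := uchart_exists ach iso conn cplt Cb0 Cl0 B0 r0 Hb HB sc rho'0 b1 b2 dx xr.
by exists s, P; exact: uchart_mono (lexx _) b3 H.
Qed.

Lemma uatlas_uniform : compact [set: M'] -> exists2 rho : R, 0 < rho & forall q : M', uatlas rho q.
Proof.
move=> /compact_near_coveringP cov.
have H : \forall rho \near (0 : R)^'+, [set: M'] `<=` uatlas rho.
  apply: cov => q _; have [rho [rho0 H]] := uatlas_near q.
  exists ([set q' | forall rho', 0 < rho' -> rho' <= rho -> uatlas rho' q'], [set r : R | 0 < r <= rho]).
    split => //=; rewrite /nbhs /=; near=> e; apply/andP; split; near: e.
      exact: nbhs_right_gt.
    exact: nbhs_right_le.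
  by move=> [q' rho'] /= [h1 /andP[h2 h3]]; exact: h1.
have H1 : \forall rho \near (0 : R)^'+, 0 < rho by exact: nbhs_right_gt.
have [rho [h1 h2]] := filter_ex (filterI H1 H).
by exists rho => // q; exact: h2.
Unshelve. all: by end_near. Qed.

End UniformRadius.

(** * Metric spaces as topological spaces *)

Record mspace (R : realType) := MSpace {
  mpt :> Type;
  sdist : mpt -> mpt -> R;
  sdist_xx : forall x, sdist x x = 0;
  sdist_eq : forall x y, sdist x y = 0 -> x = y;
  sdist_sym : forall x y, sdist x y = sdist y x;
  sdist_tri : forall x y z, sdist x z <= sdist x y + sdist y z
}.

Section MetricTopology.
Context {R : realType} (X : mspace R).
Local Notation d := (@sdist R X).

Lemma sdist_ge0 (x y : X) : 0 <= d x y.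
Proof. by have := sdist_tri x y x; rewrite sdist_xx (sdist_sym y x) -mulr2n pmulrn_lge0. Qed.

HB.instance Definition _ := gen_eqMixin (mpt X).
HB.instance Definition _ := gen_choiceMixin (mpt X).

Definition mnbhs (x : mpt X) : set_system (mpt X) := [set A | exists2 e, 0 < e & forall y, d x y < e -> A y].

HB.instance Definition _ := hasNbhs.Build (mpt X) mnbhs.

Lemma mnbhs_filter (x : mpt X) : ProperFilter (nbhs x).
Proof.
split => [[e e0 /(_ x)]|]; first by rewrite sdist_xx; apply.
split; first by exists 1.
  move=> A B [e e0 He] [e' e'0 He']; exists (Num.min e e'); first by rewrite lt_min e0.
  by move=> y; rewrite lt_min => /andP[h h']; split; [exact: He|exact: He'].
by move=> A B AB [e e0 He]; exists e => // y /He/AB.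
Qed.

Lemma mnbhs_singleton (x : mpt X) (A : set X) : nbhs x A -> A x.
Proof. by move=> [e e0]; apply; rewrite sdist_xx. Qed.

Lemma mnbhs_nbhs (x : mpt X) (A : set X) : nbhs x A -> nbhs x (nbhs^~ A).
Proof.
move=> [e e0 He]; exists e => // y xy; exists (e - d x y); first by rewrite subr_gt0.
by move=> z yz; apply: He; rewrite (le_lt_trans (sdist_tri x y z))// addrC -ltrBrDr.
Qed.

HB.instance Definition _ := @Nbhs_isNbhsTopological.Build (mpt X) mnbhs_filter mnbhs_singleton mnbhs_nbhs.

End MetricTopology.

Section MetricFacts.
Context {R : realType} (X : mspace R).
Implicit Types x y z : X.
Local Notation d := (@sdist R X).

Lemma mball_open x e : open [set y : X | d x y < e].
Proof.
rewrite openE => y /= xy; exists (e - d x y); first by rewrite subr_gt0.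
by move=> z yz; rewrite /= (le_lt_trans (sdist_tri x y z))// addrC -ltrBrDr.
Qed.

Lemma mcball_closed x e : closed [set y : X | d x y <= e].
Proof.
rewrite -[X in closed X]setCK; apply: open_closedC; rewrite openE => y /= /negP; rewrite -ltNge => xy.
exists (d x y - e) => [|z yz]; first by rewrite subr_gt0.
apply/negP; rewrite -ltNge; have := sdist_tri x z y; rewrite (sdist_sym z y).
by move=> h; lra.
Qed.

Lemma mspace_hausdorff : hausdorff_space X.
Proof.
move=> x y cl; apply: sdist_eq; apply/eqP; rewrite eq_le sdist_ge0 andbT; apply/ler_addgt0Pl => e e0.
have e2 : 0 < e / 2 by rewrite divr_gt0.
have N1 w : nbhs w [set z : X | d w z < e / 2] by exists (e / 2).
have [z [/= xz yz]] := cl _ _ (N1 x) (N1 y).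
rewrite addr0 (le_trans (sdist_tri x z y))// (splitr e) lerD// ?ltW//.
by rewrite (sdist_sym z y).
Qed.

Lemma mcvgP (T : Type) (F : set_system T) (u : T -> X) x : Filter F ->
  u i @[i --> F] --> x <-> forall e, 0 < e -> \forall i \near F, d x (u i) < e.
Proof.
move=> FF; split => [H e e0|H A [e e0 He]].
  by apply: (H [set y | d x y < e]); exists e.
by apply: filterS (H e e0) => i; exact: He.
Qed.

(** Balls of radius 1/(m+1) around the points of finite nets, taken for all integer radii and all
    [m], form a countable base. *)
Lemma mspace_second_countable (p : X) : (forall r e, 0 < e -> exists s : seq X, forall x, d p x <= r -> exists2 y, y \in s & d y x < e) ->
  @second_countable X.
Proof.
move=> H; have [f Hf] : {f : nat * nat -> seq X & forall km x, d p x <= km.1%:R -> exists2 y, y \in f km & d y x < km.2.+1%:R^-1}.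
  by apply: (@choice _ _ (fun (km : nat * nat) s => forall x, d p x <= km.1%:R -> exists2 y, y \in s & d y x < km.2.+1%:R^-1)) => km; apply: H; rewrite invr_gt0.
pose g (t : nat * nat * nat) := [set x : X | d (nth p (f t.1) t.2) x < t.1.2.+1%:R^-1].
exists (range g); first exact: sub_countable (card_image_le g setT) (countableP _).
split; first by move=> _ [t _ <-]; exact: mball_open.
move=> x A [e e0 He].
have [m _ Hm] := near_infty_natSinv_lt (PosNum (divr_gt0 e0 (ltr0n R 2))).
have Hmm := Hm m (leqnn m); rewrite /= in Hmm.
have xk : d p x <= (Num.bound (d p x))%:R by rewrite ltW// (le_lt_trans _ (archi_boundP _))// ?sdist_ge0//.
have [y ys yx] := Hf (Num.bound (d p x), m) x xk.
exists (g (Num.bound (d p x), m, index y (f (Num.bound (d p x), m)))).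
  split; first by exists (Num.bound (d p x), m, index y (f (Num.bound (d p x), m))).
  by rewrite /g /= nth_index.
move=> z; rewrite /g /= nth_index// => yz; apply: He.
rewrite (le_lt_trans (sdist_tri x y z))// (splitr e) (sdist_sym x y) ltrD//.
  exact: lt_trans yx Hmm.
exact: lt_trans yz Hmm.
Qed.

End MetricFacts.

(** * The metric space associated with a pseudometric *)

Section Quotient.
Context {R : realType} (S : Type) (delta : S -> S -> R).
Hypothesis dxx : forall s, delta s s = 0.
Hypothesis dsym : forall s t, delta s t = delta t s.
Hypothesis dtri : forall s t u, delta s u <= delta s t + delta t u.

Lemma delta_eq s t u : delta s t = 0 -> delta s u = delta t u.
Proof.
move=> st; apply/eqP; rewrite eq_le; apply/andP; split.
  by rewrite (le_trans (dtri s t u))// st add0r.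
by rewrite (le_trans (dtri t s u))// dsym st add0r.
Qed.

Lemma quotient_mspace : exists (X : mspace R) (pi : S -> X),
  (forall x, exists s, pi s = x) /\ forall s t, sdist (pi s) (pi t) = delta s t.
Proof.
pose cls s := [set t | delta s t = 0].
pose X := {A : set S | exists s, A = cls s}.
pose pi s : X := exist _ (cls s) (ex_intro _ s erefl).
pose rep (A : X) : S := projT1 (cid (proj2_sig A)).
have repP A : proj1_sig A = cls (rep A) by rewrite /rep; case: cid.
have clsE s t : cls s = cls t -> delta s t = 0.
  by move=> e; have : cls s t by rewrite e; exact: dxx.
have ext (A B : X) : sval A = sval B -> A = B.
  by case: A => A HA; case: B => B HB /= e; subst A; congr exist; exact: Prop_irrelevance.
have repK s : delta (rep (pi s)) s = 0 by rewrite dsym; apply: clsE; rewrite -repP.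
pose D (A B : X) := delta (rep A) (rep B).
have DE s t : D (pi s) (pi t) = delta s t.
  by rewrite /D (delta_eq _ (repK s)) dsym (delta_eq _ (repK t)) dsym.
have Deq (A B : X) : D A B = 0 -> A = B.
  move=> e; apply: ext; rewrite !repP; apply/seteqP; split => u; rewrite /cls /= => h.
    by rewrite -(delta_eq u e).
  by rewrite (delta_eq u e).
exists (@MSpace R X D (fun A => dxx _) Deq (fun A B => dsym _ _) (fun A B C => dtri _ _ _)), pi.
split => // A; exists (rep A); apply: ext; by rewrite /= -repP.
Qed.

End Quotient.

(** * The Kähler structure pulled back along an immersion *)

Lemma Ck_on_local {R : realType} {m} k (U : set 'rV[R]_m) (f : 'rV[R]_m -> R) :
  (forall z, U z -> exists V : set 'rV[R]_m, [/\ open V, V z & Ck_on k V f]) -> Ck_on k U f.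
Proof.
elim: k U f => [|k IH] U f H.
  by split => // z /H[V [_ Vz [c _]]]; exact: c.
split => [z /H[V [_ Vz [c _]]]|v]; first exact: c.
split => [z /H[V [_ Vz [_ /(_ v)[h _]]]]|]; first exact: h.
by apply: IH => z /H[V [oV Vz [_ /(_ v)[_ h]]]]; exists V.
Qed.

Lemma trmx_Jmx {R : realType} k : (Jmx : 'M[R]_(k + k))^T = - Jmx.
Proof. by rewrite /Jmx tr_block_mx !trmx0 trmx1 linearN/= trmx1 opp_block_mx !oppr0 opprK. Qed.

Lemma bilin_mulJ {R : realType} k (G : 'M[R]_(k + k)) u v : bilin (G *m Jmx) u v = - bilin G u (v *m Jmx).
Proof. by rewrite /bilin trmx_mul trmx_Jmx mulNmx mulmxN !mulmxA [in RHS]mxE opprK. Qed.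

Lemma kahler_metric_eq {R : realType} {N} (U : set 'rV[R]_(N + N)) K K' :
  kahler_metric U K -> (forall z, U z -> K z = K' z) -> kahler_metric U K'.
Proof.
case=> oU h2 h3 h4 h5 h6 E; split; first exact: oU.
- by move=> z Uz; rewrite -E//; exact: h2.
- by move=> z u Uz; rewrite -E//; exact: h3.
- by move=> z u v Uz; rewrite -E//; exact: h4.
- by move=> i j k; apply: (Ck_on_ext oU _ (h5 i j k)) => z Uz; rewrite E.
- move=> z u v w Uz om; have := h6 z u v w Uz; rewrite /=.
  have D a b t : 'D_t (fun y => bilin (K y) (a *m Jmx) b) z = 'D_t (om a b) z.
    apply: near_eq_derive; apply: filterS (open_nbhs_nbhs (conj oU Uz)) => q Uq.
    by rewrite /om E.
  by rewrite !D.
Qed.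

Section Pullback.
Context {R : realType} {n N : nat} (X : complexManifold R n) (M' : kahlerManifold R N).
Variable phi : X -> M'.
Implicit Types (x : X) (c : chart R X (n + n)) (u v : 'rV[R]_(n + n)).
Hypothesis Hc : continuous phi.
Definition crep c (c' : chart R M' (N + N)) : 'rV[R]_(n + n) -> 'rV[R]_(N + N) := cmap c' \o phi \o cinv c.
Hypothesis Hh : forall c (c' : chart R M' (N + N)) x, atlas c -> atlas c' -> dom c x -> dom c' (phi x) -> hol (crep c c') (cmap c x).
Hypothesis Him : forall c (c' : chart R M' (N + N)) x u, atlas c -> atlas c' -> dom c x -> dom c' (phi x) -> u != 0 ->
  u *m jac (crep c c') (cmap c x) != 0.
Local Notation Kh e := (fun q : 'rV[R]_(N + N) => metric e (cinv e q)).

Lemma crep_near c (c' : chart R M' (N + N)) x : dom c x -> dom c' (phi x) ->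
  \forall z \near cmap c x, (cmap c @` dom c) z /\ dom c' (phi (cinv c z)).
Proof.
move=> dx dx'; have N1 : nbhs (cmap c x) (cmap c @` dom c).
  by apply: open_nbhs_nbhs; split; [exact: codom_open|exists x].
have N2 : nbhs (cmap c x) (cinv c @^-1` (phi @^-1` dom c')).
  apply: (cinv_continuous (ex_intro2 _ _ x dx erefl)); rewrite cmapK//.
  by apply: Hc; apply: open_nbhs_nbhs; split; [exact: dom_open|].
by apply: filterS2 N1 N2.
Qed.

Definition pullmetric c x := pullb (crep c (chart_at (phi x))) (Kh (chart_at (phi x))) (cmap c x).

Lemma crepE c (c' : chart R M' (N + N)) x : dom c x -> crep c c' (cmap c x) = cmap c' (phi x).
Proof. by move=> dx; rewrite /crep /= cmapK. Qed.

Lemma pullb_at c (c' : chart R M' (N + N)) x u v : dom c x -> dom c' (phi x) ->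
  bilin (pullb (crep c c') (Kh c') (cmap c x)) u v =
  bilin (metric c' (phi x)) (u *m jac (crep c c') (cmap c x)) (v *m jac (crep c c') (cmap c x)).
Proof.
move=> dx dx'; apply: (etrans (pullb_bilin _ _ _ _ _)); rewrite /jet1.
have e : cinv c' (crep c c' (cmap c x)) = phi x by rewrite crepE// cmapK.
by rewrite e.
Qed.

(** [pullmetric] changes its ambient chart from point to point. Since any chart gives the same
    value, one chart can be kept fixed near a given point, and smoothness and closedness follow from
    [pullb_kahler]. *)
Lemma pullmetric_indep c (c' : chart R M' (N + N)) x : atlas c -> atlas c' -> dom c x -> dom c' (phi x) ->
  pullmetric c x = pullb (crep c c') (Kh c') (cmap c x).
Proof.
move=> ac ac' dx dx'; pose c1 := chart_at (phi x); have ac1 : atlas c1 := chart_at_atlas (phi x).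
have d1 : dom c1 (phi x) := chart_at_dom (phi x).
have h1 := Hh ac ac1 dx d1.
have hT : hol (cmap c' \o cinv c1) (crep c c1 (cmap c x)) by rewrite crepE//; exact: transition_hol.
have E : \forall z \near cmap c x, (cmap c' \o cinv c1) (crep c c1 z) = crep c c' z.
  by apply: filterS (crep_near dx d1) => z [_ dz]; rewrite /crep /= cmapK.
have [cd ej] := cdiff_comp (hol_cdiff h1) (hol_cdiff hT).
have ej' := etrans (jac_near E cd) ej.
apply: bilin_ext => u v; apply: (etrans (pullb_at u v dx d1)); apply: esym.
apply: (etrans (pullb_at u v dx dx')); rewrite ej' crepE// (mulmxA u) (mulmxA v).
exact: transition_isometry.
Qed.

Lemma pullmetric_transition c1 c2 x u v : atlas c1 -> atlas c2 -> dom c1 x -> dom c2 x ->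
  let D := 'd (cmap c2 \o cinv c1) (cmap c1 x) in
  bilin (pullmetric c2 x) (D u) (D v) = bilin (pullmetric c1 x) u v /\ D (u *m Jmx) = D u *m Jmx.
Proof.
move=> a1 a2 d1 d2 D.
have cT : cdiff (cmap c2 \o cinv c1) (cmap c1 x).
  by apply: holomorphic_on_cdiff (atlas_holomorphic a1 a2) _; exists x.
pose c' := chart_at (phi x); have ac' : atlas c' := chart_at_atlas (phi x).
have dx' : dom c' (phi x) := chart_at_dom (phi x).
have h2 : hol (crep c2 c') ((cmap c2 \o cinv c1) (cmap c1 x)) by rewrite /= cmapK//; exact: Hh.
have E : \forall z \near cmap c1 x, crep c2 c' ((cmap c2 \o cinv c1) z) = crep c1 c' z.
  have N2 : \forall z \near cmap c1 x, dom c2 (cinv c1 z).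
    apply: (cinv_continuous (ex_intro2 _ _ x d1 erefl)); rewrite cmapK//.
    by apply: open_nbhs_nbhs; split; [exact: dom_open|].
  by apply: filterS N2 => z dz; rewrite /crep /= cmapK.
have [cd ej] := cdiff_comp cT (hol_cdiff h2).
have ej' := etrans (jac_near E cd) ej.
have e12 : (cmap c2 \o cinv c1) (cmap c1 x) = cmap c2 x by rewrite /= cmapK.
rewrite e12 in ej'; split; last by rewrite /D !jacE -(mulmxA u) (cdiff_J cT) mulmxA.
apply: (etrans (pullb_at (D u) (D v) d2 dx')); apply: esym; apply: (etrans (pullb_at u v d1 dx')).
by rewrite ej' /D !jacE (mulmxA u) (mulmxA v).
Qed.

Lemma pullmetric_local c x : atlas c -> dom c x -> exists U : set 'rV[R]_(n + n),
  [/\ U (cmap c x), kahler_metric U (fun z => pullmetric c (cinv c z)) & forall z, U z -> (cmap c @` dom c) z].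
Proof.
move=> ac dx; pose c' := chart_at (phi x); have ac' : atlas c' := chart_at_atlas (phi x).
have dx' : dom c' (phi x) := chart_at_dom (phi x).
have [r r0 Hr] := (near_ballP _ _).1 (crep_near dx dx').
pose U := [set z : 'rV[R]_(n + n) | `|z - cmap c x| < r].
have oU : open U by exact: open_dist_lt.
have HU z : U z -> exists y, [/\ dom c y, dom c' (phi y) & cmap c y = z].
  by move=> /Hr[[y dy <-]]; rewrite cmapK// => dy'; exists y.
have hF z : U z -> hol (crep c c') z /\ (cmap c' @` dom c') (crep c c' z).
  by move=> /HU[y [dy dy' <-]]; split; [exact: Hh|rewrite crepE//; exists (phi y)].
have HG := pullb_kahler (metric_kahler ac') oU hF _.
have {}HG : kahler_metric U (pullb (crep c c') (Kh c')).
  by apply: HG => z u /HU[y [dy dy' <-]]; exact: Him.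
have E z : U z -> pullb (crep c c') (Kh c') z = pullmetric c (cinv c z).
  move=> /HU[y [dy dy' <-]].
  exact: (etrans (esym (pullmetric_indep ac ac' dy dy')) (congr1 (pullmetric c) (esym (cmapK dy)))).
exists U; split; [by rewrite /U /= subrr normr0| |by move=> z /HU[y [dy _ <-]]; exists y].
exact: kahler_metric_eq HG E.
Qed.

(** The form is omega(u, v) = g(Ju, v); with this sign, omega(u, Jv) is again the metric g. *)
Definition pullform c x := pullmetric c x *m Jmx.

Lemma pullform_bilin c x u v : bilin (pullform c x) u v = - bilin (pullmetric c x) u (v *m Jmx).
Proof. exact: bilin_mulJ. Qed.

Lemma pullmetric_at c x u v : atlas c -> dom c x ->
  [/\ bilin (pullmetric c x) u v = bilin (pullmetric c x) v u,
      bilin (pullmetric c x) (u *m Jmx) (v *m Jmx) = bilin (pullmetric c x) u v &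
      u != 0 -> 0 < bilin (pullmetric c x) u u].
Proof.
move=> ac dx; have [U [Ux HK _]] := pullmetric_local ac dx.
have h1 := km_sym HK Ux; have h2 := km_J HK u v Ux; have h3 := @km_pos _ _ _ _ HK _ u Ux.
rewrite !cmapK// in h1 h2 h3; split => //; exact: bilin_sym.
Qed.

Lemma pullform_J c x u v : atlas c -> dom c x -> bilin (pullform c x) u v = bilin (pullmetric c x) (u *m Jmx) v.
Proof.
move=> ac dx; rewrite pullform_bilin; have [_ <- _] := pullmetric_at u (v *m Jmx) ac dx.
by rewrite JmxK bilinNr opprK.
Qed.

Lemma pullform_transition c1 c2 x u v : atlas c1 -> atlas c2 -> dom c1 x -> dom c2 x ->
  let D := 'd (cmap c2 \o cinv c1) (cmap c1 x) in
  bilin (pullform c2 x) (D u) (D v) = bilin (pullform c1 x) u v.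
Proof.
move=> a1 a2 d1 d2 D; have [_ e] := pullmetric_transition v v a1 a2 d1 d2.
have [h _] := pullmetric_transition u (v *m Jmx) a1 a2 d1 d2.
apply: (etrans (pullform_bilin _ _ _ _)); apply: esym; apply: (etrans (pullform_bilin _ _ _ _)).
by congr (- _); exact: (etrans (esym h) (congr1 (bilin (pullmetric c2 x) _) e)).
Qed.

Lemma pullform_smooth c i j : atlas c -> smooth_on (cmap c @` dom c) (fun z => pullform c (cinv c z) i j).
Proof.
move=> ac k; apply: Ck_on_local => _ [x dx <-]; have [U [Ux HK _]] := pullmetric_local ac dx.
exists U; split => //; first exact: km_open HK.
have -> : (fun z => pullform c (cinv c z) i j) = (fun z => \sum_l (Jmx : 'M[R]_(n + n)) l j * pullmetric c (cinv c z) i l).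
  by apply/funext => z; rewrite mxE; apply: eq_bigr => l _; rewrite mulrC.
apply: Ck_on_sum; first exact: km_open HK.
by move=> l; apply: Ck_onM; [exact: km_open HK|exact: Ck_on_cst|exact: km_smooth HK i l k].
Qed.

Lemma pullform_alternating c x u v : atlas c -> dom c x -> bilin (pullform c x) v u = - bilin (pullform c x) u v.
Proof.
move=> ac dx; rewrite pullform_bilin (pullform_J u v ac dx).
by have [-> _ _] := pullmetric_at v (u *m Jmx) ac dx.
Qed.

Lemma pullform_11 c x u v : atlas c -> dom c x ->
  bilin (pullform c x) (u *m Jmx) (v *m Jmx) = bilin (pullform c x) u v.
Proof.
by move=> ac dx; rewrite !pullform_bilin; have [_ -> _] := pullmetric_at u (v *m Jmx) ac dx.
Qed.

Lemma pullform_positive c x u : atlas c -> dom c x -> u != 0 -> 0 < bilin (pullform c x) u (u *m Jmx).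
Proof.
move=> ac dx u0; rewrite pullform_bilin JmxK bilinNr opprK.
by have [_ _ /(_ u0)] := pullmetric_at u u ac dx.
Qed.

Lemma pullform_closed c z u v w : atlas c -> (cmap c @` dom c) z ->
  let omega v w y := bilin (pullform c (cinv c y)) v w in
  'D_u (omega v w) z + 'D_v (omega w u) z + 'D_w (omega u v) z = 0.
Proof.
move=> ac [x dx <-] om; have [U [Ux HK UW]] := pullmetric_local ac dx.
have := km_closed HK u v w Ux; rewrite /=.
have D a b t : 'D_t (fun y => bilin (pullmetric c (cinv c y)) (a *m Jmx) b) (cmap c x) = 'D_t (om a b) (cmap c x).
  apply: near_eq_derive; apply: filterS (open_nbhs_nbhs (conj (@km_open _ _ _ _ HK) Ux)) => q Uq.
  by have [y dy <-] := UW q Uq; rewrite /om cmapK// pullform_J.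
by rewrite !D.
Qed.

Definition pullback_kahler : kahlerManifold R n :=
  @KahlerManifold R n X pullform pullform_transition pullform_smooth pullform_alternating pullform_11
    pullform_positive pullform_closed.

Lemma pullback_isometry : @holomorphic_isometry R n N pullback_kahler M' phi.
Proof.
split; first split; first exact: Hc.
  move=> c c' ac ac'; apply: hol_holomorphic_on => _ [x [dx dx'] <-]; exact: Hh.
move=> c c' x u v ac ac' dx dx' D.
have cd := hol_cdiff (Hh ac ac' dx dx').
have E t : D t = t *m jac (crep c c') (cmap c x) by rewrite /D jacE.
apply: esym; apply: (etrans (pullform_bilin c x u v)).
rewrite (pullmetric_indep ac ac' dx dx') (pullb_at _ _ dx dx') bilin_metric !E.
move: (jac _ _) (cdiff_J cd) => J JJ.
by rewrite -(mulmxA v) JJ (mulmxA v) JmxK bilinNr opprK.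
Qed.

End Pullback.

(** * Comparison of length metrics *)

Lemma gap_arith {R : realType} (a b q h : R) : 0 < b -> a < q + h -> b <= (q + h - a) / 2 -> a - h + b < q.
Proof. by move=> *; lra. Qed.

(** A comparison valid at small scale becomes global when the smaller-scale metric [d1] has almost
    intermediate points: pieces of length [eta / 2] are split off one at a time, by induction on
    their number. *)
Lemma chain_le {R : realType} {X : Type} (d1 d2 : X -> X -> R) (eta K : R) : 0 < eta -> 0 <= K ->
  (forall x y z, d2 x z <= d2 x y + d2 y z) ->
  (forall x y l e, 0 <= l <= d1 x y -> 0 < e -> exists z, d1 x z <= l /\ d1 z y <= d1 x y - l + e) ->
  (forall x y, d1 x y < eta -> d2 x y <= K * d1 x y) -> forall x y, d2 x y <= K * d1 x y.
Proof.
move=> eta0 K0 tri split loc.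
have h2 : 0 < eta / 2 by rewrite divr_gt0.
have H (m : nat) : forall x y, d1 x y < m.+1%:R * (eta / 2) -> forall e, 0 < e -> d2 x y <= K * (d1 x y + e).
  elim: m => [|m IH] x y xy e e0.
    rewrite (le_trans (loc _ _ _))//; first by rewrite mul1r in xy; rewrite (lt_trans xy)// ltr_pdivrMr// ltr_pMr// ltr1n.
    by rewrite ler_wpM2l// lerDl ltW.
  have [small|big] := ltP (d1 x y) eta.
    by rewrite (le_trans (loc _ _ small))// ler_wpM2l// lerDl ltW.
  (* The first bound keeps the accumulated error below [e], the second keeps the remaining distance
     strictly below the next multiple of [eta / 2]. *)
  pose e' := Num.min (e / 2) ((m.+2%:R * (eta / 2) - d1 x y) / 2).
  have e'0 : 0 < e' by rewrite lt_min !divr_gt0// subr_gt0.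
  have l01 : 0 <= eta / 2 <= d1 x y.
    by rewrite ltW//= (le_trans _ big)// ler_pdivrMr// ler_peMr ?ler1n// ltW.
  have [z [xz zy]] := split x y _ _ l01 e'0.
  have gap : d1 z y < m.+1%:R * (eta / 2).
    rewrite (le_lt_trans zy)//; have : e' <= (m.+2%:R * (eta / 2) - d1 x y) / 2 by rewrite ge_min lexx orbT.
    rewrite -[m.+2%:R]natr1 mulrDl mul1r in xy *; exact: gap_arith e'0 xy.
  have e2 : 0 < e / 2 by rewrite divr_gt0.
  have a1 := IH z y gap _ e2.
  have a2 := loc x z (le_lt_trans xz (_ : eta / 2 < eta)).
  have {}a2 : d2 x z <= K * (eta / 2).
    by rewrite (le_trans (a2 _)) ?ler_wpM2l// ltr_pdivrMr// ltr_pMr// ltr1n.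
  rewrite (le_trans (tri x z y))// (le_trans (lerD a2 a1))// -mulrDr ler_wpM2l//.
  have : e' <= e / 2 by rewrite ge_min lexx.
  by move: zy; clear; lra.
move=> x y; apply/ler_addgt0Pr => e e0.
have k1 : 0 < K + 1 by rewrite ltr_wpDl.
have bd : d1 x y < (Num.bound `|d1 x y / (eta / 2)|).+1%:R * (eta / 2).
  rewrite -ltr_pdivrMr// (le_lt_trans (ler_norm _))// (lt_trans (archi_boundP _))// ltr_nat//.
rewrite (le_trans (H _ x y bd (e / (K + 1)) _)) ?divr_gt0// mulrDr lerD2l mulrCA -[leRHS]mulr1; apply: ler_wpM2l; first exact: ltW.
by rewrite ler_pdivrMr// mul1r lerDl.
Qed.

(** A relative error of [e / 2] fits inside the factor [(1 + e) ^+ 2] in both directions as long as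
    [e <= 1]. *)
Lemma near_one {R : realType} (g q del e : R) : 0 < e -> e <= 1 -> 0 <= q -> del <= e / 2 -> `|g - q| <= del * q ->
  q <= (1 + e) ^+ 2 * g /\ g <= (1 + e) ^+ 2 * q.
Proof.
move=> e0 e1 q0 de; rewrite ler_norml => /andP[h1 h2].
have dq : del * q <= e / 2 * q by rewrite ler_wpM2r.
have {}h1 : (1 - e / 2) * q <= g by rewrite mulrBl mul1r; lra.
have {}h2 : g <= (1 + e / 2) * q by rewrite mulrDl mul1r; lra.
have s0 : 0 <= (1 + e) ^+ 2 by rewrite sqr_ge0.
split.
  rewrite (le_trans _ (ler_wpM2l s0 h1))// mulrA ler_peMl//.
  by nra.
rewrite (le_trans h2)// ler_wpM2r//; nra.
Qed.

(** * Charts that are almost Euclidean near the centre *)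

Section EuclideanCharts.
Context {R : realType} {n : nat} (M : kahlerManifold R n).
Hypothesis conn : connected [set: M].
Implicit Types (x y : M) (c : chart R M (n + n)) (w : 'rV[R]_(n + n)).

Record echart c x (rho : R) : Prop := EChart {
  ec_compat : compat c;
  ec_dom : dom c x;
  ec_0 : cmap c x = 0;
  ec_codom : forall w, `|w| < rho -> (cmap c @` dom c) w;
  ec_gram : forall w, `|w| < rho -> forall i j, `|gram c (cinv c w) i j - (1%:M : 'M[R]_(n + n)) i j| <= rho^-1 * `|w|
}.

(* On the ball of radius [erad k rho e] around the centre of an [echart] the metric is
   so close to the Euclidean one that distances agree up to a factor [1 + e]. *)
Definition erad (k : nat) (rho e : R) : R := e * rho / (2 * k%:R ^+ 2 + 1).

Lemma erad_gt0 k rho e : 0 < rho -> 0 < e -> 0 < erad k rho e.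
Proof. by move=> r0 e0; rewrite !mulr_gt0// invr_gt0 ltr_wpDl// mulr_ge0// sqr_ge0. Qed.

Lemma erad_le k rho e : 0 < rho -> 0 < e -> e <= 1 -> erad k rho e <= rho.
Proof.
move=> r0 e0 e1; have k1 : 1 <= 2 * k%:R ^+ 2 + 1 :> R by rewrite lerDr mulr_ge0// sqr_ge0.
rewrite ler_pdivrMr ?(lt_le_trans ltr01 k1)//.
have : e * rho <= 1 * rho by rewrite ler_wpM2r// ltW.
by rewrite mul1r => h; rewrite (le_trans h)// ler_peMr// ltW.
Qed.

(** An entrywise error of at most [rho^-1 * |w|] changes the quadratic form by at most k^2 times
    that, with k = n + n. On the ball of radius [erad] this is at most [e / 2] of the Euclidean
    form, and [near_one] applies. *)
Lemma echart_HB c x rho e : 0 < rho -> 0 < e -> e <= 1 -> echart c x rho ->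
  forall w, enorm (w - cmap c x) < erad (n + n) rho e -> (cmap c @` dom c) w /\
    forall v, dotp v v <= (1 + e) ^+ 2 * bilin (gram c (cinv c w)) v v /\
              bilin (gram c (cinv c w)) v v <= (1 + e) ^+ 2 * dotp v v.
Proof.
move=> r0 e0 e1 ec w; rewrite (ec_0 ec) subr0 => we.
have w1 : `|w| < erad (n + n) rho e := le_lt_trans (norm_le_enorm _) we.
have wr := lt_le_trans w1 (erad_le (n + n) r0 e0 e1).
split; first exact: (@ec_codom _ _ _ ec _ wr).
move=> v; have H := ec_gram ec wr; move: (gram _ _) H => G H.
pose k : R := (n + n)%:R.
have d0 : 0 <= rho^-1 * `|w| by rewrite mulr_ge0// invr_ge0 ltW.
have H' i j : `|(G - 1%:M) i j| <= rho^-1 * `|w| by rewrite mx_subE.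
have B := bilin_bound d0 H' v v.
have E1 : bilin (1%:M : 'M[R]_(n + n)) v v = dotp v v.
  by rewrite /bilin mulmx1 mxE; apply: eq_bigr => i _; rewrite mxE.
have E : bilin (G - 1%:M) v v = bilin G v v - dotp v v by rewrite bilin_mxD -scaleN1r bilin_mxZ mulN1r E1.
rewrite E in B.
apply: (near_one e0 e1 (dotp_ge0 v) (del := k * (k * (rho^-1 * `|w|)))).
  have : `|w| * (2 * k ^+ 2 + 1) <= e * rho.
    by rewrite -ler_pdivlMr ?ltW// ltr_wpDl// mulr_ge0// sqr_ge0.
  have w0 := normr_ge0 w.
  move=> h; rewrite ler_pdivlMr// -(ler_pM2l r0).
  have -> : rho * (k * (k * (rho^-1 * `|w|)) * 2) = `|w| * (2 * k ^+ 2) by field; rewrite gt_eqF.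
  rewrite (mulrC rho) (le_trans _ h)// ler_wpM2l// lerDl//.
rewrite (le_trans B)// -mulrA; apply: ler_wpM2l; first by rewrite mulr_ge0// mulr_ge0.
by rewrite -expr2 -enorm_sqr ler_pXn2r ?nnegrE ?enorm_ge0// norm_le_enorm.
Qed.

Lemma echart_le c x rho e w w' : 0 < rho -> 0 < e -> e <= 1 -> echart c x rho ->
  enorm w < erad (n + n) rho e -> enorm w' < erad (n + n) rho e ->
  rdist (cinv c w) (cinv c w') <= (1 + e) * enorm (w' - w).
Proof.
move=> r0 e0 e1 ec wr w'r; have c0 : 0 < 1 + e by rewrite addr_gt0.
by apply: (chart_rdist_le (ec_compat ec) c0 (echart_HB r0 e0 e1 ec)); rewrite (ec_0 ec) subr0.
Qed.

Lemma echart_ge c x rho e y y' : 0 < rho -> 0 < e -> e <= 1 -> echart c x rho -> dom c y ->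
  enorm (cmap c y) + (1 + e) * rdist y y' < erad (n + n) rho e ->
  dom c y' /\ enorm (cmap c y' - cmap c y) <= (1 + e) * rdist y y'.
Proof.
move=> r0 e0 e1 ec dy h; have c0 : 0 < 1 + e by rewrite addr_gt0.
by apply: (chart_rdist_ge (ec_compat ec) c0 (echart_HB r0 e0 e1 ec) dy (all_joined conn y y')); rewrite (ec_0 ec) subr0.
Qed.

End EuclideanCharts.

Section UChartDistance.
Context {R : realType} (n : nat) (R0 : R) {N : nat} (M' : kahlerManifold R N) (T : kahler_tuple n M').
Hypothesis HT : class_K R0 T.
Variables (ch : chart R M' (N + N)) (p0 : 'rV[R]_(N + N)) (r rho : R).
Hypothesis ach : atlas ch.
Hypothesis rho0 : 0 < rho.
Variables (x : tspace T) (s : 'rV[R]_(n + n) -> tspace T) (P : 'M[R]_(N + N, n + n)).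
Hypothesis uc : uchart (@tmap _ _ _ _ T) ch p0 r rho rho^-1 x s P.

Lemma uchart_echart : exists2 c : chart R (tspace T) (n + n), echart c x rho &
  [/\ cinv c = s, cmap c = prj (@tmap _ _ _ _ T) ch P (cmap ch (tmap x)) & dom c = s @` [set w : 'rV[R]_(n + n) | `|w| < rho]].
Proof.
have [_ _ _ iso] := HT.
have oU : open [set w : 'rV[R]_(n + n) | `|w| < rho].
  rewrite (_ : [set w | _] = [set w : 'rV[R]_(n + n) | `|w - 0| < rho]); first exact: open_dist_lt.
  by apply/funext => w; rewrite /= subr0.
have GU := uc_good uc; have JP := uc_JP uc.
pose c := section_chart iso ach JP oU GU; exists c => //.
have o0 : `|0 : 'rV[R]_(n + n)| < rho by rewrite normr0.
split.
- exact: section_compat.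
- by exists 0 => //; exact: uc_0 uc.
- by have := g_prj (GU 0 o0); rewrite (uc_0 uc).
- by move=> w wr; rewrite -[cmap c @` dom c]/(prj _ ch P _ @` (s @` [set w : 'rV[R]_(n + n) | `|w| < rho])) (section_codom GU).
- move=> w wr i j; rewrite -[cinv c w]/(s w) (section_gram iso ach JP oU GU wr); exact: uc_lip uc w wr i j.
Qed.

Lemma uchart_le e w w' : 0 < e -> e <= 1 -> enorm w < erad (n + n) rho e -> enorm w' < erad (n + n) rho e ->
  rdist (s w) (s w') <= (1 + e) * enorm (w' - w).
Proof. by move=> e0 e1 wr w'r; have [c ec [cs _ _]] := uchart_echart; have := echart_le rho0 e0 e1 ec wr w'r; rewrite cs. Qed.

Lemma uchart_ge e w y : 0 < e -> e <= 1 -> `|w| < rho -> enorm w + (1 + e) * rdist (s w) y < erad (n + n) rho e ->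
  exists w', [/\ enorm w' < erad (n + n) rho e, y = s w' & enorm (w' - w) <= (1 + e) * rdist (s w) y].
Proof.
move=> e0 e1 wr h; have [c ec [cs cm dm]] := uchart_echart; have [conn _ _ _] := HT.
have dc : dom c (s w) by rewrite dm; exists w.
have cw : cmap c (s w) = w by rewrite cm; exact: g_prj (uc_good uc wr).
rewrite -{1}cw in h; have [dy hy] := echart_ge conn rho0 e0 e1 ec dc h.
rewrite cw in h hy; exists (cmap c y); split => //; last by rewrite -cs cmapK.
rewrite (le_lt_trans _ h)//; have := enormD (cmap c y - w) w; rewrite subrK => /le_trans; apply.
by rewrite addrC lerD2l.
Qed.

End UChartDistance.

Lemma compact_net {R : realType} (X : mspace R) (A : set X) e : compact A -> 0 < e ->
  exists s : seq X, forall x, A x -> exists2 y, y \in s & sdist y x < e.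
Proof.
move=> /compact_near_coveringP cA e0.
(* Finite sequences directed by inclusion: the compactness statement along this filter produces one
   finite net for all of [A]. *)
pose F : set_system (seq X) := [set Q | exists s0 : seq X, forall s : seq X, {subset s0 <= s} -> Q s].
have FF : Filter F.
  split; first by exists [::].
    move=> Q Q' [s Hs] [s' Hs']; exists (s ++ s') => t st; split.
      by apply: Hs => x xs; apply: st; rewrite mem_cat xs.
    by apply: Hs' => x xs; apply: st; rewrite mem_cat xs orbT.
  by move=> Q Q' QQ [s Hs]; exists s => t /Hs/QQ.
have [] := cA (seq X) F (fun s x => exists2 y, y \in s & sdist y x < e) FF.
  move=> x Ax; exists ([set x' : X | sdist x x' < e], [set s : seq X | x \in s]).
    split => /=; first by exists e.
    by exists [:: x] => s; apply; rewrite inE.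
  by move=> [x' s] /= [xx' xs]; exists x.
by move=> s Hs; exists s => x; exact: Hs s (fun _ h => h) x.
Qed.

(** * The limit space as a Kähler manifold *)

Section LimitManifold.
Context {R : realType} {n N : nat} (M' : kahlerManifold R N) (X : mspace R).
Variables (phi : X -> M') (rho R0 : R).
Hypothesis rho0 : 0 < rho.
Hypothesis Hphi : continuous phi.
Implicit Types (x y : X) (w u v : 'rV[R]_(n + n)) (ch : chart R M' (N + N)) (e : R).
Local Notation d := (@sdist R X).
Local Notation rad := (erad (n + n) rho).
Local Notation Kh e := (fun q : 'rV[R]_(N + N) => metric e (cinv e q)).

(* A chart of the limit space, obtained as an ultralimit of [uchart]s. *)
Record lchart x ch (P : 'M[R]_(N + N, n + n)) (a : 'rV[R]_(N + N)) (S : 'rV[R]_(n + n) -> X)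
    (F : 'rV[R]_(n + n) -> 'rV[R]_(N + N)) : Prop := LChart {
  lc_atlas : atlas ch;
  lc_0 : S 0 = x;
  lc_JP : Jmx *m P = P *m Jmx;
  lc_dom : forall w, enorm w < rad 1 -> dom ch (phi (S w)) /\ cmap ch (phi (S w)) = F w;
  lc_prj : forall w, enorm w < rad 1 -> (F w - a) *m P = w;
  lc_hol : forall w, enorm w < rad 1 -> hol F w;
  lc_gram : forall w, enorm w < rad 1 -> forall i j, `|pullb F (Kh ch) w i j - (1%:M : 'M[R]_(n + n)) i j| <= rho^-1 * `|w|;
  lc_scal : forall w, enorm w < rad 1 -> R0 <= local_scalar_curvature (pullb F (Kh ch)) w;
  lc_le : forall e w w', 0 < e -> e <= 1 -> enorm w < rad e -> enorm w' < rad e -> d (S w) (S w') <= (1 + e) * enorm (w' - w);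
  lc_ge : forall e w y, 0 < e -> e <= 1 -> enorm w < rad 1 -> enorm w + (1 + e) * d (S w) y < rad e ->
    exists w', [/\ enorm w' < rad e, y = S w' & enorm (w' - w) <= (1 + e) * d (S w) y]
}.

Definition eball : set 'rV[R]_(n + n) := [set w | enorm w < rad 1].

Lemma rad1_gt0 : 0 < rad 1. Proof. exact: erad_gt0. Qed.

Lemma eball_open : open eball.
Proof.
rewrite (_ : eball = [set w : 'rV[R]_(n + n) | enorm (w - 0) < rad 1]); first exact: enorm_ball_open.
by apply/funext => w; rewrite /eball /= subr0.
Qed.

Lemma eball_near w : eball w -> \forall w' \near w, eball w'.
Proof. by move=> h; apply: open_nbhs_nbhs; split; [exact: eball_open|]. Qed.

Lemma eball0 : eball 0. Proof. by rewrite /eball /= enorm0 rad1_gt0. Qed.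

Section Chart.
Variables (x0 : X) (ch : chart R M' (N + N)) (P : 'M[R]_(N + N, n + n)) (a : 'rV[R]_(N + N)).
Variables (S : 'rV[R]_(n + n) -> X) (F : 'rV[R]_(n + n) -> 'rV[R]_(N + N)).
Hypothesis H : lchart x0 ch P a S F.

Definition lmap y : 'rV[R]_(n + n) := (cmap ch (phi y) - a) *m P.

Lemma lmapK w : eball w -> lmap (S w) = w.
Proof. by move=> Bw; rewrite /lmap (lc_dom H Bw).2 (lc_prj H Bw). Qed.

Lemma lchart_dom_open : open (S @` eball).
Proof.
rewrite openE => _ [w Bw <-]; exists ((rad 1 - enorm w) / 2).
  by rewrite divr_gt0// subr_gt0.
move=> y; rewrite ltr_pdivlMr// ltrBrDl mulrC => h.
by have [w' [Bw' -> _]] := lc_ge H ltr01 (lexx 1) Bw h; exists w'.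
Qed.

Lemma lchart_codom : lmap @` (S @` eball) = eball.
Proof.
apply/seteqP; split => [_ [_ [w Bw <-] <-]|w Bw]; first by rewrite lmapK.
by exists (S w); [exists w|rewrite lmapK].
Qed.

Lemma lchart_codom_open : open (lmap @` (S @` eball)).
Proof. by rewrite lchart_codom; exact: eball_open. Qed.

Lemma lchart_cmapK y : (S @` eball) y -> S (lmap y) = y.
Proof. by move=> [w Bw <-]; rewrite lmapK. Qed.

Lemma lchart_cmap_continuous y : (S @` eball) y -> {for y, continuous lmap}.
Proof.
move=> [w Bw <-]; have [dy _] := lc_dom H Bw.
have c1 : cmap ch (phi z) @[z --> S w] --> cmap ch (phi (S w)).
  exact: (cvg_comp _ _ (@Hphi (S w)) (cmap_continuous dy)).
have c2 : cmap ch (phi z) - a @[z --> S w] --> cmap ch (phi (S w)) - a by apply: cvgB c1 (cvg_cst _).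
exact: (cvg_comp _ _ c2 (@continuous_mulmxr _ _ _ P _)).
Qed.

Lemma lchart_S_continuous w : eball w -> {for w, continuous S}.
Proof.
move=> Bw; apply/(@mcvgP _ _ _ (nbhs w) _ _ (nbhs_filter w)) => e e0.
have e4 : 0 < e / 4 by rewrite divr_gt0.
have N1 : \forall w' \near w, enorm (w' - w) < e / 4.
  by apply: open_nbhs_nbhs; split; [exact: enorm_ball_open|rewrite /= subrr enorm0].
apply: filterS2 (eball_near Bw) N1 => w' Bw' h.
rewrite (le_lt_trans (lc_le H ltr01 (lexx 1) Bw Bw'))//.
by move: (enorm _) h => q h; lra.
Qed.

Lemma lchart_cinv_continuous z : (lmap @` (S @` eball)) z -> {for z, continuous S}.
Proof. by rewrite lchart_codom; exact: lchart_S_continuous. Qed.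

Definition lchart_chart : chart R X (n + n) :=
  Chart lchart_dom_open lchart_codom_open lchart_cmapK lchart_cmap_continuous lchart_cinv_continuous.

Lemma lchart_transition ch' w : atlas ch' -> eball w -> dom ch' (phi (S w)) ->
  [/\ hol (fun w' => cmap ch' (phi (S w'))) w,
      True &
      forall u, u != 0 -> u *m jac (fun w' => cmap ch' (phi (S w'))) w != 0].
Proof.
move=> ach' Bw dw'; have [dw Fw] := lc_dom H Bw; have ach := lc_atlas H; have hF := lc_hol H Bw.
have hT : hol (cmap ch' \o cinv ch) (F w) by rewrite -Fw; exact: transition_hol.
have E : \forall w' \near w, (cmap ch' \o cinv ch) (F w') = cmap ch' (phi (S w')).
  by apply: filterS (eball_near Bw) => w' Bw'; have [dw1 <-] := lc_dom H Bw'; rewrite /= cmapK.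
have hc : hol (fun w' => (cmap ch' \o cinv ch) (F w')) w := hol_comp hF hT.
have [r r0 Hr] := (near_ballP _ _).1 E.
have hS : hol (fun w' => cmap ch' (phi (S w'))) w := hol_near_eq r0 Hr hc.
split => // u u0; apply/eqP => uz; move/eqP: u0; apply.
have hT' : hol (cmap ch \o cinv ch') (cmap ch' (phi (S w))) by exact: transition_hol.
have E' : \forall w' \near w, (cmap ch \o cinv ch') (cmap ch' (phi (S w'))) = F w'.
  have N1 : \forall w' \near w, dom ch' (phi (S w')).
    have c : phi (S z) @[z --> w] --> phi (S w) := cvg_comp _ _ (lchart_S_continuous Bw) (@Hphi (S w)).
    by apply: c; apply: open_nbhs_nbhs; split; [exact: dom_open|].
  by apply: filterS2 N1 (eball_near Bw) => w' d1 Bw'; rewrite /= cmapK//; exact: (lc_dom H Bw').2.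
have [cd ej] := cdiff_comp (hol_cdiff hS) (hol_cdiff hT').
have ej' := etrans (jac_near E' cd) ej.
have [hP jP] := hol_affine (- (a *m P)) (F w) (lc_JP H).
have [_ eP] := cdiff_comp (hol_cdiff hF) (hol_cdiff hP); rewrite jP in eP.
have I : jac (fun w' => F w' *m P - a *m P) w = 1%:M.
  apply: jac_isD; have I : isD (fun y : 'rV[R]_(n + n) => y) w 1%:M.
    by apply: isd_ext (isd_id w) => v; rewrite mulmx1.
  by apply: isd_near I; apply: filterS (eball_near Bw) => w' Bw'; rewrite -mulmxBl (lc_prj H Bw').
by rewrite -[u]mulmx1 -I eP ej' !mulmxA uz !mul0mx.
Qed.

End Chart.

Hypothesis Hlc : forall x, exists ch P a S F, lchart x ch P a S F.
Hypothesis Hsplit : forall x y l, 0 <= l <= d x y -> exists z, d x z <= l /\ d z y <= d x y - l.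
Variable p : X.

Definition latlas : set (chart R X (n + n)) :=
  [set c | exists x ch P a S F (H : lchart x ch P a S F), c = lchart_chart H].

Lemma latlas_cover x : exists2 c, latlas c & dom c x.
Proof.
have [ch [P [a [S [F H]]]]] := Hlc x; exists (lchart_chart H); first by exists x, ch, P, a, S, F, H.
by exists 0; [exact: eball0|exact: lc_0 H].
Qed.

Lemma latlas_hol c ch x : latlas c -> atlas ch -> dom c x -> dom ch (phi x) ->
  hol (cmap ch \o phi \o cinv c) (cmap c x) /\
  forall u, u != 0 -> u *m jac (cmap ch \o phi \o cinv c) (cmap c x) != 0.
Proof.
move=> [x0 [ch0 [P [a [S [F [H ->]]]]]]] ach [w Bw <-] dx.
have -> : cmap (lchart_chart H) (S w) = w := lmapK H Bw.
by have [h1 _ h2] := lchart_transition H ach Bw dx.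
Qed.

(** A transition map is the representation of [phi] in one chart followed by the affine projection
    that defines the other. It is holomorphic for this reason, and no limit of transition maps is
    taken. *)
Lemma latlas_holomorphic c c' : latlas c -> latlas c' ->
  holomorphic_on (cmap c @` (dom c `&` dom c')) (cmap c' \o cinv c).
Proof.
move=> ac [x0 [ch0 [P [a [S [F [H ->]]]]]]]; apply: hol_holomorphic_on => _ [x [dx [w Bw wx]] <-].
have dx' : dom ch0 (phi x) by rewrite -wx; exact: (lc_dom H Bw).1.
have [h _] := latlas_hol ac (lc_atlas H) dx dx'.
have [hP _] := hol_affine (- (a *m P)) ((cmap ch0 \o phi \o cinv c) (cmap c x)) (lc_JP H).
have := hol_comp h hP.
rewrite (_ : (fun _ => _) = cmap (lchart_chart H) \o cinv c)//.
by apply/funext => z; rewrite /= /lmap mulmxBl.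
Qed.

Lemma small_ball_compact x : compact [set y : X | d x y <= rad 1 / 8].
Proof.
have [ch [P [a [S [F H]]]]] := Hlc x; have r1 := rad1_gt0.
apply: (@subclosed_compact _ _ (S @` [set w : 'rV[R]_(n + n) | enorm (w - 0) <= rad 1 / 2])).
- exact: mcball_closed.
- apply: continuous_compact; last exact: enorm_ball_compact.
  apply: continuous_in_subspaceT => w /set_mem /= wr; apply: (lchart_S_continuous H).
  by rewrite /eball /=; move: wr; rewrite subr0 => /le_lt_trans; apply; lra.
move=> y /= xy; have S0 := lc_0 H.
have [|w [wr yw we]] := lc_ge H ltr01 (lexx 1) eball0 (y := y).
  by rewrite enorm0 S0; lra.
by exists w => //=; rewrite subr0 S0 in we *; lra.
Qed.

(** All balls of radius [del] are compact with the same [del]. A point one step of [del / 2] farther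
    from [p] is within [del] of a point of the previous net, hence within reach of a finer net of
    that compact ball. *)
Lemma ball_net r e : 0 < e -> exists s : seq X, forall y, d p y <= r -> exists2 z, z \in s & d z y < e.
Proof.
pose del := rad 1 / 8; have del0 : 0 < del by rewrite divr_gt0// rad1_gt0.
have Hk (k : nat) e1 : 0 < e1 -> exists s : seq X, forall y, d p y <= k%:R * (del / 2) -> exists2 z, z \in s & d z y < e1.
  elim: k e1 => [|k IH] e' e'0.
    exists [:: p] => y; rewrite mul0r => py; exists p; rewrite ?inE ?eqxx// (le_lt_trans py)//.
  have d2 : 0 < del / 2 by rewrite divr_gt0.
  have [s Hs] := IH _ d2.
  have Hn z : exists s : seq X, forall x, d z x <= rad 1 / 8 -> exists2 y, y \in s & d y x < e'.
    exact: (compact_net (@small_ball_compact z) e'0).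
  have [f Hf] := choice Hn.
  exists (flatten [seq f z | z <- s]) => y py.
  have [z [pz zy]] : exists z, d p z <= k%:R * (del / 2) /\ d z y <= del / 2.
    have [small|big] := leP (d p y) (k%:R * (del / 2)).
      by exists y; rewrite sdist_xx (ltW d2).
    have [|z [h1 h2]] := Hsplit (x := p) (y := y) (l := k%:R * (del / 2)).
      by rewrite mulr_ge0 ?(ltW d2)// ltW.
    exists z; split => //; rewrite (le_trans h2)// lerBlDr (le_trans py)//.
    by rewrite -natr1 mulrDl mul1r addrC.
  have [z' z's z'z] := Hs z pz.
  have [|y' y'f y'y] := Hf z' y.
    rewrite /= -/del (splitr del) (le_trans (sdist_tri _ z _))// lerD//; exact: ltW.
  by exists y' => //; apply/flattenP; exists (f z') => //; apply/mapP; exists z'.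
move=> e0; have d2 : 0 < del / 2 by rewrite divr_gt0.
have [s Hs] := Hk (Num.bound `|r / (del / 2)|) e e0; exists s => y py; apply: Hs.
rewrite (le_trans py)// -ler_pdivrMr// (le_trans (ler_norm _))// ltW// archi_boundP//.
Qed.

Definition limit_manifold : complexManifold R n :=
  @ComplexManifold R n X (@mspace_hausdorff R X) (@mspace_second_countable R X p (fun r e => @ball_net r e))
    latlas latlas_cover latlas_holomorphic.

Lemma latlas_crep (c : chart R limit_manifold (n + n)) ch (x : limit_manifold) : atlas c -> atlas ch -> dom c x ->
  dom ch (phi x) -> hol (crep (X := limit_manifold) phi c ch) (cmap c x).
Proof. by move=> ac ach dx dx'; have [] := latlas_hol ac ach dx dx'. Qed.

Lemma latlas_immersed (c : chart R limit_manifold (n + n)) ch (x : limit_manifold) u : atlas c -> atlas ch -> dom c x ->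
  dom ch (phi x) -> u != 0 -> u *m jac (crep (X := limit_manifold) phi c ch) (cmap c x) != 0.
Proof. by move=> ac ach dx dx' u0; have [_ h] := latlas_hol ac ach dx dx'; exact: h. Qed.

Definition limit_kahler : kahlerManifold R n :=
  @pullback_kahler R n N limit_manifold M' phi Hphi
    latlas_crep latlas_immersed.

Lemma limit_isometry : @holomorphic_isometry R n N limit_kahler M' phi.
Proof. exact: pullback_isometry. Qed.

(** A set that is open and closed contains, with each of its points, the ball of radius [rad 1 / 8],
    because that ball is covered by images of segments. Intermediate points then reach every point
    in finitely many steps. *)
Lemma limit_connected : connected [set: X].
Proof.
move=> B [x0 Bx0] [C oC BC] [C' cC' BC']; rewrite !setTI in BC BC'.
have r1 := rad1_gt0.
have oB : open B by rewrite BC.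
have oBC : open (~` B) by apply: closed_openC; rewrite BC'.
have ball x y : B x -> d x y <= rad 1 / 8 -> B y.
  move=> Bx xy; have [ch [P [a [S [F H]]]]] := Hlc x.
  have [|w [wr -> we]] := lc_ge H ltr01 (lexx 1) eball0 (y := y).
    by rewrite enorm0 (lc_0 H); lra.
  have tb (t : R) : 0 <= t <= 1 -> eball (0 + t *: (w - 0)).
    move=> /andP[t0 t1]; rewrite /eball /= add0r subr0 enormZ ger0_norm// (le_lt_trans _ wr)//.
    by rewrite ler_piMl// enorm_ge0.
  have nearB (A : set X) t : open A -> 0 <= t <= 1 -> A (S (0 + t *: (w - 0))) ->
      exists2 d, 0 < d & forall u : R, `|u - t| < d -> A (S (0 + u *: (w - 0))).
    move=> oA t01 At; apply: (@seg_near _ _ 0 w t (fun z => A (S z))); apply: (lchart_S_continuous H (tb t t01)).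
    exact: open_nbhs_nbhs.
  suff Hs (t : R) : 0 <= t <= 1 -> B (S (0 + t *: (w - 0))).
    by have := Hs 1; rewrite scale1r add0r subr0; apply; rewrite ler01 lexx.
  apply: (@seg_ind _ (fun t => B (S (0 + t *: (w - 0))))) => [|v /andP[v0 v1] Hv|v /andP[v0 v1] Hv].
  - by rewrite scale0r addr0 (lc_0 H).
  - have [||d0 d00 Hd] := nearB B v oB; first by rewrite v0 ltW.
      by apply: Hv; rewrite v0 lexx.
    exists d0 => // u /andP[vu ud] _; apply: Hd; rewrite ger0_norm ?subr_ge0//.
    by rewrite ltrBlDl.
  - apply: contrapT => ne; have [||d0 d00 Hd] := nearB (~` B) v oBC; first by rewrite v1 ltW.
      exact: ne.
    pose u := Num.max 0 (v - d0 / 2).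
    have uv : u < v by rewrite gt_max v0 ltrBlDr ltrDl divr_gt0.
    apply: (Hd u); last by apply: Hv; rewrite le_max lexx.
    rewrite distrC gtr0_norm ?subr_gt0// ltrBlDr -ltrBlDl lt_max; apply/orP; right.
    by rewrite ltrD2l ltrN2 ltr_pdivrMr// ltr_pMr// ltr1n.
apply/seteqP; split => // y _.
pose del := rad 1 / 8; have del0 : 0 < del by rewrite divr_gt0.
have Hk (k : nat) : forall y, d x0 y <= k%:R * del -> B y.
  elim: k => [|k IH] z xz; first by apply: (ball x0) => //; rewrite mul0r in xz; rewrite (le_trans xz)// ltW.
  have [small|big] := leP (d x0 z) (k%:R * del); first exact: IH.
  have [|z' [h1 h2]] := Hsplit (x := x0) (y := z) (l := k%:R * del).
    by rewrite mulr_ge0 ?(ltW del0)// ltW.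
  apply: (ball z'); first exact: IH.
  by rewrite (le_trans h2)// lerBlDr (le_trans xz)// -natr1 mulrDl mul1r addrC.
apply: (Hk (Num.bound `|d x0 y / del|)).
by rewrite -ler_pdivrMr// (le_trans (ler_norm _))// ltW// archi_boundP.
Qed.

Local Notation V := limit_kahler.

Lemma lchart_cmapS x0 ch P a S F (H : lchart x0 ch P a S F) w : eball w -> cmap (lchart_chart H) (S w) = w.
Proof. exact: lmapK H _. Qed.

Lemma metric_lchart x0 ch P a S F (H : lchart x0 ch P a S F) w : eball w ->
  @metric R n V (lchart_chart H) (S w) = pullb F (Kh ch) w.
Proof.
move=> Bw; pose c : chart R V (n + n) := lchart_chart H.
have ac : atlas c by exists x0, ch, P, a, S, F, H.
have dc : dom c (S w) by exists w.
have [dx ex] := lc_dom H Bw; have ach := lc_atlas H.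
have cw : cmap c (S w) = w := lchart_cmapS H Bw.
apply: (etrans (isometry_pullb limit_isometry ac ach dc dx)); rewrite cw.
have E : \forall z \near w, F z = (cmap ch \o phi \o cinv c) z.
  by apply: filterS (eball_near Bw) => z Bz; rewrite -(lc_dom H Bz).2.
have hF := hol_cdiff (lc_hol H Bw).
by rewrite /pullb (jac_near E hF) -(nbhs_singleton E).
Qed.

Lemma limit_scalar (x : V) : R0 <= scalar_curvature x.
Proof.
have [x0 [ch [P [a [S [F [H cE]]]]]]] : latlas (chart_at x) := chart_at_atlas x.
have dx := chart_at_dom x; rewrite /scalar_curvature; move: dx; rewrite cE => -[w Bw wx].
have cw : cmap (lchart_chart H) x = w by rewrite -wx; exact: lchart_cmapS.
have HE z : eball z -> @metric R n V (lchart_chart H) (cinv (lchart_chart H) z) = pullb F (Kh ch) z by exact: metric_lchart.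
by have E := local_scalar_curvature_eq eball_open HE Bw; rewrite cw E; exact: (lc_scal H Bw).
Qed.

(** The charts of the limit cover a Euclidean ball, whereas [echart] asks for a ball in the sup
    norm; this is a sup norm radius that fits. *)
Definition rho2 : R := rad 1 / ((n + n)%:R + 1).

Lemma rho2_gt0 : 0 < rho2. Proof. by rewrite divr_gt0 ?rad1_gt0// ltr_wpDl. Qed.

Lemma rho2_le : rho2 <= rho.
Proof.
rewrite (le_trans (_ : rho2 <= rad 1))//; last exact: erad_le.
by rewrite ler_pdivrMr ?ltr_wpDl// ler_peMr ?lerDr// ltW// rad1_gt0.
Qed.

Lemma eball_rho2 w : `|w| < rho2 -> eball w.
Proof.
rewrite /rho2 ltr_pdivlMr ?ltr_wpDl// mulrC => h; exact: le_lt_trans (enorm_le w) h.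
Qed.

Lemma limit_echart x0 ch P a S F (H : lchart x0 ch P a S F) : @echart R n V (lchart_chart H) x0 rho2.
Proof.
pose c : chart R V (n + n) := lchart_chart H.
have ac : atlas c by exists x0, ch, P, a, S, F, H.
split.
- exact: atlas_compat ac.
- by exists 0; [exact: eball0|exact: lc_0 H].
- exact: (etrans (congr1 (cmap (lchart_chart H)) (esym (lc_0 H))) (lchart_cmapS H eball0)).
- by move=> w /eball_rho2 Bw; exists (S w); [exists w|exact: lchart_cmapS].
move=> w wr i j; have Bw := eball_rho2 wr.
have dc : dom c (S w) by exists w.
have E : gram c (S w) = pullb F (Kh ch) w := etrans (gram_atlas ac dc) (metric_lchart H Bw).
rewrite -[cinv _ w]/(S w) E (le_trans (lc_gram H Bw i j))// ler_wpM2r// lef_pV2 ?posrE ?rho2_gt0//.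
exact: rho2_le.
Qed.

Lemma erad_mono k (r r' e : R) : 0 <= e -> r <= r' -> erad k r e <= erad k r' e.
Proof. by move=> e0 rr; rewrite ler_wpM2r ?invr_ge0 ?addr_ge0 ?mulr_ge0 ?sqr_ge0// ler_wpM2l. Qed.

Let r2 := erad (n + n) rho2.

Lemma limit_rdist_close e x y : 0 < e -> e <= 1 -> (1 + e) * d x y < r2 e ->
  rdist (x : V) y <= (1 + e) ^+ 2 * d x y.
Proof.
move=> e0 e1 xy; have [ch [P [a [S [F H]]]]] := Hlc x.
have c0 : 0 < 1 + e by rewrite addr_gt0.
have rr : r2 e <= rad e by apply: erad_mono (ltW e0) rho2_le.
have [|w [wr yw we]] := lc_ge H e0 e1 eball0 (y := y).
  by rewrite enorm0 add0r (lc_0 H) (lt_le_trans xy).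
rewrite subr0 (lc_0 H) in we.
have w2 : enorm w < r2 e := le_lt_trans we xy.
have o2 : enorm (0 : 'rV[R]_(n + n)) < r2 e by rewrite enorm0 erad_gt0// rho2_gt0.
have := echart_le rho2_gt0 e0 e1 (limit_echart H) o2 w2.
rewrite -[cinv _ 0]/(S 0) -[cinv _ w]/(S w) (lc_0 H) -yw subr0 => /le_trans; apply.
by rewrite expr2 -mulrA ler_pM2l.
Qed.

Lemma limit_dist_close e x y : 0 < e -> e <= 1 -> (1 + e) * rdist (x : V) y < r2 e ->
  d x y <= (1 + e) ^+ 2 * rdist (x : V) y.
Proof.
move=> e0 e1 xy; have [ch [P [a [S [F H]]]]] := Hlc x.
have c0 : 0 < 1 + e by rewrite addr_gt0.
have rr : r2 e <= rad e by apply: erad_mono (ltW e0) rho2_le.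
pose c : chart R V (n + n) := lchart_chart H; have ec := limit_echart H.
have [|dy hy] := echart_ge (limit_connected : connected [set: V]) rho2_gt0 e0 e1 ec (ec_dom ec) (y' := y).
  by rewrite (ec_0 ec) enorm0 add0r.
rewrite (ec_0 ec) subr0 in hy; have [w Bw wy] := dy.
have cw : cmap c y = w by rewrite -wy; exact: lchart_cmapS.
rewrite -/c cw in hy; have w2 : enorm w < rad e := lt_le_trans (le_lt_trans hy xy) rr.
have o2 : enorm (0 : 'rV[R]_(n + n)) < rad e by rewrite enorm0 erad_gt0.
have := lc_le H e0 e1 o2 w2; rewrite (lc_0 H) wy subr0 => /le_trans; apply.
by rewrite expr2 -mulrA ler_pM2l.
Qed.

(** For [e <= 1] the square [(1 + e) ^+ 2] is at most 1 + 3e, which explains the denominator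
    [3 * b + 1]. *)
Lemma sqr_limit (t b : R) : 0 <= b -> (forall e, 0 < e -> e <= 1 -> t <= (1 + e) ^+ 2 * b) -> t <= b.
Proof.
move=> b0 Ht; apply/ler_addgt0Pr => e e0; pose e1 := Num.min 1 (e / (3 * b + 1)).
have b1 : 0 < 3 * b + 1 by rewrite ltr_wpDl// mulr_ge0.
have e10 : 0 < e1 by rewrite lt_min ltr01 divr_gt0.
have e11 : e1 <= 1 by rewrite ge_min lexx.
have : e1 * (3 * b + 1) <= e by rewrite -ler_pdivlMr// ge_min lexx orbT.
have := Ht e1 e10 e11; move: e1 e10 e11 => e1 *; nra.
Qed.

Lemma limit_rdist x y : rdist (x : V) y = d x y.
Proof.
have conn : connected [set: V] := limit_connected.
have key e : 0 < e -> e <= 1 -> 0 < r2 e / (1 + e) by move=> e0 _; rewrite divr_gt0 ?addr_gt0// erad_gt0// rho2_gt0.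
have s0 (e : R) : 0 <= (1 + e) ^+ 2 by exact: sqr_ge0.
have cl (e t : R) : 0 < e -> t < r2 e / (1 + e) -> (1 + e) * t < r2 e.
  by move=> e0; rewrite ltr_pdivlMr ?addr_gt0// mulrC.
apply/eqP; rewrite eq_le; apply/andP; split.
  apply: (sqr_limit (sdist_ge0 x y)) => e e0 e1.
  apply: (@chain_le R X d (fun x y => rdist (x : V) y) _ _ (key e e0 e1) (s0 e)).
  - by move=> *; exact: rdist_triangle.
  - by move=> a b l e' /Hsplit[z [h1 h2]] e'0; exists z; split => //; rewrite (le_trans h2)// lerDl ltW.
  - by move=> a b ab; apply: limit_rdist_close => //; exact: cl.
apply: (sqr_limit (rdist_ge0 (x : V) y)) => e e0 e1.
apply: (@chain_le R X (fun x y => rdist (x : V) y) d _ _ (key e e0 e1) (s0 e)).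
- by move=> *; exact: sdist_tri.
- by move=> a b l e' h e'0; exact: (@rdist_split _ _ V conn a b l e' h e'0).
- by move=> a b ab; apply: limit_dist_close => //; exact: cl.
Qed.

(** The tail of a Cauchy sequence lies in one ball of radius [del], which is compact since [del]
    works at every point; a cluster point is the limit. *)
Lemma limit_complete : complete_kahler V.
Proof.
move=> u cu; pose del := rad 1 / 8; have del0 : 0 < del by rewrite divr_gt0// rad1_gt0.
have [k Hk] := cu del del0.
have uF : (u i @[i --> \oo]) [set y : X | d (u k) y <= del].
  by exists k => // i /= ki; rewrite ltW// -limit_rdist Hk.
have [x [_ cx]] := @small_ball_compact (u k) _ _ uF.
exists x; apply/(@cvgrPdist_lt _ _ _ \oo) => e e0; have e2 : 0 < e / 2 by rewrite divr_gt0.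
have [k' Hk'] := cu (e / 2) e2.
have [z [Hi xz]] : (u @` [set i | (k' <= i)%N] `&` [set y : X | d x y < e / 2]) !=set0.
  apply: cx; last by exists (e / 2).
  by exists k' => // i /= ki; exists i.
exists k' => // i /= ki; rewrite sub0r normrN ger0_norm ?rdist_ge0//.
case: Hi xz => i0 /= k'i0 <- xz; rewrite (splitr e) (le_lt_trans (rdist_triangle (limit_connected : connected [set: V]) _ (u i0) _))//.
by rewrite ltrD ?Hk'// limit_rdist (@sdist_sym R X).
Qed.

End LimitManifold.

(** The first derivatives are again holomorphic with bounds uniform in [i], so [hol_limit] applies
    to them a second time and gives the second jets. *)
Lemma hol_limit_jets {R : realType} {T : Type} (U : set_system T) {UU : UltraFilter U} {m n}
    (F : T -> 'rV[R]_(m + m) -> 'rV[R]_(n + n)) f z rho L : 0 < rho ->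
  (\forall i \near U, hol_ball (F i) z rho L) ->
  (forall y, `|y - z| < rho -> F i y @[i --> U] --> f y) ->
  [/\ hol f z, forall u, jet1 (F i) u z @[i --> U] --> jet1 f u z &
      forall u v, jet2 (F i) u v z @[i --> U] --> jet2 f u v z].
Proof.
move=> rho0 HF Ff; have h2 : 0 < rho / 2 by rewrite divr_gt0.
have at_y (y : 'rV[R]_(m + m)) : `|y - z| < rho / 2 ->
    cdiff f y /\ (forall v : 'rV[R]_(m + m), `|v *m jac f y| <= L * `|v|) /\
    forall v : 'rV[R]_(m + m), v *m jac (F i) y @[i --> U] --> v *m jac f y.
  move=> yz; have half (q : 'rV[R]_(m + m)) : `|q - y| < rho / 2 -> `|q - z| < rho.
    by move=> qy; rewrite [ltRHS](splitr rho) (le_lt_trans (ler_distD y _ _))// ltrD.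
  apply: (hol_limit (rho := rho / 2)) => //; last by move=> q /half; exact: Ff.
  by apply: filterS HF => i Hi q /half; exact: Hi.
have zz : `|z - z| < rho / 2 by rewrite subrr normr0.
split.
- by exists (rho / 2), L; split => // y /at_y[h1 [h3 _]].
- by move=> u; have [_ [_]] := at_y z zz; exact.
move=> u v; have h4 : 0 < rho / 4 by rewrite divr_gt0.
have HG : \forall i \near U, hol_ball (fun y => v *m jac (F i) y) z (rho / 4) (32 * L / rho * `|v|).
  by apply: filterS HF => i Hi; have [] := hol_ball_jac rho0 Hi v.
have q42 : rho / 4 <= rho / 2 by apply: ler_wpM2l; [exact: ltW|rewrite lef_pV2 ?posrE// ler_nat].
have Hy (y : 'rV[R]_(m + m)) : `|y - z| < rho / 4 -> v *m jac (F i) y @[i --> U] --> v *m jac f y.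
  by move=> yz; have [_ [_ h]] := at_y y (lt_le_trans yz q42); exact: (h v).
have [_ [_ h]] := hol_limit h4 HG (f := fun y => v *m jac f y) Hy.
exact: (h u).
Qed.

Lemma section_jac {R : realType} {n N} (F : 'rV[R]_(n + n) -> 'rV[R]_(N + N)) P a w : Jmx *m P = P *m Jmx ->
  cdiff F w -> (\forall w' \near w, (F w' - a) *m P = w') -> jac F w *m P = 1%:M.
Proof.
move=> JP cF E; have [hP jP] := hol_affine (- (a *m P)) (F w) JP.
have [_ eP] := cdiff_comp cF (hol_cdiff hP); rewrite jP in eP; rewrite -eP.
apply: jac_isD; have I : isD (fun y : 'rV[R]_(n + n) => y) w 1%:M.
  by apply: isd_ext (isd_id w) => v; rewrite mulmx1.
by apply: isd_near I; apply: filterS E => w' {1}<-; rewrite mulmxBl.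
Qed.

Lemma mcvg_unique {R : realType} {T : Type} (U : set_system T) {FF : ProperFilter U} {m k}
  (A A' : T -> 'M[R]_(m, k)) B B' : mcvg U A B -> mcvg U A' B' -> (\forall i \near U, A i = A' i) -> B = B'.
Proof.
move=> h h' E; apply/matrixP => a b.
have h1 : A i a b @[i --> U] --> B' a b.
  by apply: cvg_near_ext (h' a b); apply: filterS E => i ->.
exact: (cvg_unique _ (h a b) h1).
Qed.

Lemma slack_le {R : realType} (a b D e l : R) : b < e / 2 -> a <= D + e / 2 - l + b -> a <= D - l + e.
Proof. by move=> *; lra. Qed.

Lemma section_inj {R : realType} {m k} (A : 'M[R]_(m, k)) P (u : 'rV[R]_m) : A *m P = 1%:M -> u != 0 -> u *m A != 0.
Proof. by move=> AP; apply: contra_neq => uA; rewrite -[u]mulmx1 -AP mulmxA uA mul0mx. Qed.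

Lemma mcvg_rows {R : realType} {T : Type} (U : set_system T) {FF : ProperFilter U} {m k}
    (A : T -> 'M[R]_(m, k)) L :
  (forall u : 'rV[R]_m, u *m A i @[i --> U] --> u *m L) -> mcvg U A L.
Proof.
move=> h a b; have c := @mcvg_rV R T U k (fun i => (delta_mx 0 a : 'rV[R]_m) *m A i) _ (h (delta_mx 0 a)) 0 b.
rewrite mx_coord_row (_ : (fun i => A i a b) = fun i => ((delta_mx 0 a : 'rV[R]_m) *m A i) 0 b); first exact: c.
by apply/funext => i; rewrite -mx_coord_row.
Qed.

(** * The ultralimit of the spaces and of their parametrisations *)

Section Ultralimit.
Context {R : realType} (n : nat) (R0 : R) {N : nat} (M' : kahlerManifold R N).
Hypothesis connM' : connected [set: M'].
Variable Ts : nat -> kahler_tuple n M'.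
Hypothesis hTs : forall i, class_K R0 (Ts i).
Variable rho : R.
Hypothesis rho0 : 0 < rho.
Hypothesis Hat : forall q : M', uatlas n R0 rho q.
Variable U : set_system nat.
Context {UU : UltraFilter U}.
Hypothesis Unp : forall k, U [set i | (k <= i)%N].

Local Notation Mi i := (tspace (Ts i)).
Local Notation phi i := (@tmap _ _ _ _ (Ts i)).
Local Notation rad := (erad (n + n) rho).

Let conn i : connected [set: Mi i]. Proof. by case: (hTs i). Qed.
Let iso i : holomorphic_isometry (phi i). Proof. by case: (hTs i). Qed.

Definition ubounded (u : forall i, Mi i) := exists C, \forall i \near U, rdist (tpoint (Ts i)) (u i) <= C.
Record useq := USeq { us :> forall i, Mi i; us_bd : ubounded us }.

Lemma ubounded_near u v C : ubounded u -> (\forall i \near U, rdist (u i) (v i) <= C) -> ubounded v.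
Proof.
move=> [C' H] H'; exists (C' + C); apply: filterS2 H H' => i h h'.
by rewrite (le_trans (rdist_triangle (@conn i) _ (u i) _))// lerD.
Qed.

Definition udist (u v : useq) : R := lim (rdist (u i) (v i) @[i --> U]).

Lemma udist_cvg (u v : useq) : rdist (u i) (v i) @[i --> U] --> udist u v.
Proof.
have [C HC] := us_bd u; have [C' HC'] := us_bd v.
apply: (@ultra_cvgR _ _ _ _ _ (C + C')); apply: filterS2 HC HC' => i h h'.
rewrite ger0_norm ?rdist_ge0// (le_trans (rdist_triangle (@conn i) _ (tpoint (Ts i)) _))// lerD//.
by rewrite rdist_sym.
Qed.

Lemma udist_xx u : udist u u = 0.
Proof.
apply: (cvg_unique _ (@udist_cvg u u)) => //; rewrite (_ : (fun i => _) = fun=> 0); first exact: cvg_cst.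
by apply/funext => i; rewrite rdist_xx.
Qed.

Lemma udist_sym u v : udist u v = udist v u.
Proof.
apply: (cvg_unique _ (@udist_cvg u v)) => //; rewrite (_ : (fun i => _) = fun i => rdist (v i) (u i)); first exact: udist_cvg.
by apply/funext => i; rewrite rdist_sym.
Qed.

Lemma udist_tri u v w : udist u w <= udist u v + udist v w.
Proof.
apply: (ler_cvg_to (@udist_cvg u w) (cvgD (@udist_cvg u v) (@udist_cvg v w))).
by apply: nearW => i; exact: rdist_triangle.
Qed.

(** The ultralimit is known only through the projection [pi], a choice of representatives [rep] and
    the distance formula [piE]; likewise [phiX] is characterised by the convergence of the images of
    the chosen representatives. *)
Variables (X : mspace R) (pi : useq -> X) (rep : X -> useq).
Hypothesis repK : forall x, pi (rep x) = x.
Hypothesis piE : forall u v, sdist (pi u) (pi v) = udist u v.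
Local Notation d := (@sdist R X).
Implicit Types x y : X.

Lemma dist_cvg (u v : useq) : rdist (u i) (v i) @[i --> U] --> d (pi u) (pi v).
Proof. by rewrite piE; exact: udist_cvg. Qed.

Lemma dist_le (u v : useq) C : (\forall i \near U, rdist (u i) (v i) <= C) -> d (pi u) (pi v) <= C.
Proof. by move=> H; apply: (ler_cvg_to (@dist_cvg u v) (@cvg_cst _ C _ U _)). Qed.

Lemma dist_near (u v : useq) C : d (pi u) (pi v) < C -> \forall i \near U, rdist (u i) (v i) < C.
Proof.
move=> h; have e0 : 0 < C - d (pi u) (pi v) by rewrite subr_gt0.
have NN : \forall i \near U, `|d (pi u) (pi v) - rdist (u i) (v i)| < C - d (pi u) (pi v).
  exact: ((@cvgrPdist_lt _ _ _ U _ _ _).1 (@dist_cvg u v) _ e0).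
by apply: filterS NN => i; rewrite distrC => /(le_lt_trans (ler_norm _)); rewrite ltrD2r.
Qed.

Variable phiX : X -> M'.
Hypothesis phiXrep : forall x, phi i (rep x i) @[i --> U] --> phiX x.

(** The maps do not increase distances, so the limit of the images is the same for every
    representative of a point. *)
Lemma phiX_cvg (u : useq) : phi i (u i) @[i --> U] --> phiX (pi u).
Proof.
move=> A /(rdist_nbhs connM')[e e0 He]; have e2 : 0 < e / 2 by rewrite divr_gt0.
have N1 : \forall i \near U, rdist (phiX (pi u)) (phi i (rep (pi u) i)) < e / 2 := phiXrep (rdist_near _ e2).
have N2 : \forall i \near U, rdist (rep (pi u) i) (u i) < e / 2.
  by apply: dist_near; rewrite repK sdist_xx.
apply: filterS2 N1 N2 => i h1 h2; apply: He; rewrite [ltRHS](splitr e).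
rewrite (le_lt_trans (rdist_triangle connM' _ (phi i (rep (pi u) i)) _))// ltrD//.
exact: le_lt_trans (isometry_lipschitz (iso i) _ _ (@conn i)) h2.
Qed.

Lemma phiX_lipschitz x y : rdist (phiX x) (phiX y) <= d x y.
Proof.
apply/ler_addgt0Pr => e e0; have e3 : 0 < e / 3 by rewrite divr_gt0.
have N1 : \forall i \near U, rdist (phiX x) (phi i (rep x i)) < e / 3 := phiXrep (rdist_near _ e3).
have N2 : \forall i \near U, rdist (phiX y) (phi i (rep y i)) < e / 3 := phiXrep (rdist_near _ e3).
have N3 : \forall i \near U, rdist (rep x i) (rep y i) < d x y + e / 3.
  by apply: dist_near; rewrite !repK ltrDl.
have [i [[h1 h2] h3]] := filter_ex (filterI (filterI N1 N2) N3).
have t1 := rdist_triangle connM' (phiX x) (phi i (rep x i)) (phiX y).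
have t2 := rdist_triangle connM' (phi i (rep x i)) (phi i (rep y i)) (phiX y).
rewrite (rdist_sym (phi i (rep y i)) (phiX y)) in t2.
have t3 := isometry_lipschitz (iso i) (rep x i) (rep y i) (@conn i).
by move: h1 h2 h3 t1 t2 t3; move: (rdist _ _) (rdist _ _) (rdist _ _) (rdist _ _) (rdist _ _) (rdist _ _) => *; lra.
Qed.

Lemma phiX_continuous : continuous phiX.
Proof.
move=> x A /(rdist_nbhs connM')[e e0 He]; exists e => // y xy; apply: He.
exact: le_lt_trans (phiX_lipschitz _ _) xy.
Qed.

Lemma ultra_split x y l : 0 <= l <= d x y -> exists z, d x z <= l /\ d z y <= d x y - l.
Proof.
move=> /andP[l0 lxy].
(* [D] will be slightly more than the limit distance from [x] to [y], which may differ from the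
   distance in the space of index [i]. The slack 1/(i+1) vanishes along [U], so the intermediate
   point in the limit is exact. *)
have H i : exists z : Mi i, rdist (rep x i) z <= l /\
    forall D, rdist (rep x i) (rep y i) <= D -> l <= D -> rdist z (rep y i) <= D - l + i.+1%:R^-1.
  have i0 : 0 < i.+1%:R^-1 :> R by rewrite invr_gt0.
  have [lr|rl] := leP l (rdist (rep x i) (rep y i)).
    have [|z [h1 h2]] := @rdist_split _ _ _ (@conn i) (rep x i) (rep y i) l _ _ i0; first by rewrite l0.
    by exists z; split => // D rD lD; rewrite (le_trans h2)// lerD2r lerB.
  exists (rep y i); split => [|D rD lD]; first exact: ltW.
  by rewrite rdist_xx addr_ge0 ?subr_ge0 ?(ltW i0).
pose z i : Mi i := projT1 (cid (H i)); have Hz i := projT2 (cid (H i)); rewrite -/(z _) in Hz.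
have zb : ubounded z by apply: (ubounded_near (us_bd (rep x)) (C := l)); apply: nearW => i; exact: (Hz i).1.
pose zs := USeq zb; exists (pi zs); split.
  by rewrite -{1}(repK x); apply: dist_le; apply: nearW => i; exact: (Hz i).1.
apply/ler_addgt0Pr => e e0; have e2 : 0 < e / 2 by rewrite divr_gt0.
rewrite -{1}(repK y); apply: dist_le.
have N1 : \forall i \near U, rdist (rep x i) (rep y i) < d x y + e / 2.
  by apply: dist_near; rewrite !repK ltrDl.
have N2 : \forall i \near U, i.+1%:R^-1 < e / 2.
  have [k _ Hk] := near_infty_natSinv_lt (PosNum e2).
  by apply: filterS (Unp k) => i /= ki; exact: Hk.
apply: filterS2 N1 N2 => i h1 h2; have := (Hz i).2 (d x y + e / 2) (ltW h1) _.
rewrite (le_trans lxy) ?lerDl ?(ltW e2)// => /(_ isT); rewrite [us zs i]/(z i).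
exact: slack_le h2.
Qed.

(* [b] is only a default value for unbounded families. *)
Definition useq_of (b : useq) (u : forall i, Mi i) : useq :=
  if pselect (ubounded u) is left ub then USeq ub else b.

Lemma useq_ofE b u i : ubounded u -> useq_of b u i = u i.
Proof. by rewrite /useq_of; case: pselect. Qed.

Lemma rad1_rho w : enorm (w : 'rV[R]_(n + n)) < rad 1 -> `|w| < rho.
Proof. by move=> h; rewrite (le_lt_trans (norm_le_enorm w))// (lt_le_trans h)// erad_le. Qed.

Lemma ultra_lchart x : exists ch P a S F, @lchart R n N M' X phiX rho R0 x ch P a S F.
Proof.
have [ch [p0 [r [ach [dq qr] r0 Hb Hch]]]] := Hat (phiX x).
pose a i := cmap ch (phi i (rep x i)).
have N1 : \forall i \near U, dom ch (phi i (rep x i)) := phiXrep (open_nbhs_nbhs (conj (@dom_open _ _ _ ch) dq)).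
have ca : a i @[i --> U] --> cmap ch (phiX x) := cvg_comp _ _ (@phiXrep x) (cmap_continuous dq).
have N2 : \forall i \near U, `|a i - p0| < r / 4.
  have := ca _ (open_nbhs_nbhs (conj (@open_dist_lt _ _ p0 (r / 4)) qr)); exact.
(* For indices where the chart data do not apply, constant maps serve as default; by [N1] and [N2]
   the set of the other indices belongs to [U]. *)
have H i : exists sP : ('rV[R]_(n + n) -> Mi i) * 'M[R]_(N + N, n + n),
    dom ch (phi i (rep x i)) -> `|a i - p0| < r / 4 -> uchart (phi i) ch p0 r rho rho^-1 (rep x i) sP.1 sP.2.
  have [h1|] := pselect (dom ch (phi i (rep x i))); last by exists (fun=> rep x i, 0).
  have [h2|h2] := boolP (`|a i - p0| < r / 4); last by exists (fun=> rep x i, 0).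
  by have [s [P uc]] := Hch (Ts i) (hTs i) (rep x i) h1 h2; exists (s, P).
pose s i := (projT1 (cid (H i))).1; pose P i := (projT1 (cid (H i))).2.
have UC : \forall i \near U, uchart (phi i) ch p0 r rho rho^-1 (rep x i) (s i) (P i).
  by apply: filterS2 N1 N2 => i h1 h2; exact: (projT2 (cid (H i))).
pose F i := srep (phi i) ch (s i); pose f w := lim (F i w @[i --> U]).
pose Kh := fun q : 'rV[R]_(N + N) => metric ch (cinv ch q).
have HK := metric_kahler ach.
have Ff w : `|w| < rho -> F i w @[i --> U] --> f w.
  move=> wr; apply: (@ultra_cvg _ _ _ _ _ _ (3 / 4 * r + `|p0|)); apply: filterS UC => i uc.
  by rewrite -(subrK p0 (F i w)) (le_trans (ler_normD _ _))// lerD2r; exact: (uc_size uc wr).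
(* The graphs stay within [3 / 4 * r] of [p0], so the limit stays strictly inside the ball of radius
   [r], where the ambient bounds hold. *)
have fW w : `|w| < rho -> (cmap ch @` dom ch) (f w) /\ `|f w - p0| < r.
  move=> wr; have h : `|f w - p0| < r.
    apply: (@le_lt_trans _ _ (3 / 4 * r)); last by rewrite gtr_pMl// ltr_pdivrMr// mul1r ltr_nat.
    apply: (@cvg_norm_le _ _ _ U _ (fun i => F i w - p0)); first by apply: cvgB (Ff w wr) (cvg_cst _).
    by apply: filterS UC => i uc; exact: (uc_size uc wr).
  by split => //; exact: mb_in (Hb _ h).
have HB z : `|z| < rho -> 0 < rho - `|z| /\ \forall i \near U, hol_ball (F i) z (rho - `|z|) rho^-1.
  move=> zr; split; first by rewrite subr_gt0.
  apply: filterS UC => i uc y yz.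
  have yr : `|y| < rho.
    by rewrite -[y](subrK z) (le_lt_trans (ler_normD _ _))// -ltrBrDr.
  have g := uc_good uc yr; split; first exact: hol_cdiff (good_srep (iso i) ach g).1.
  exact: g_slope g.
have J z : `|z| < rho -> [/\ hol f z, forall u, jet1 (F i) u z @[i --> U] --> jet1 f u z &
      forall u v, jet2 (F i) u v z @[i --> U] --> jet2 f u v z].
  move=> zr; have [h1 h2] := HB z zr; apply: (hol_limit_jets h1 h2) => y yz; apply: Ff.
  by rewrite -[y](subrK z) (le_lt_trans (ler_normD _ _))// -ltrBrDr.
have Pn : \forall i \near U, forall j k, `|P i j k| <= rho^-1.
  apply: filterS UC => i uc j k; rewrite mx_coord_row (le_trans (coord_le_norm _ _ _))//.
  by rewrite (le_trans (uc_P uc _))// norm_delta_mx mulr1.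
have [Pl HPl] := ultra_mx Pn.
have cP : mcvg U P Pl.
  by move=> j k; apply/(@cvgrPdist_le _ _ _ U) => e e0; apply: filterS (HPl e e0) => i h; rewrite distrC.
have sbd w : enorm w < rad 1 -> ubounded (fun i => s i w).
  move=> wr; apply: (ubounded_near (us_bd (rep x)) (C := (1 + 1) * enorm (w - 0))); apply: filterS UC => i uc.
  rewrite -{1}(uc_0 uc); apply: (uchart_le (hTs i) ach rho0 uc ltr01 (lexx 1)) => //.
  by rewrite enorm0 erad_gt0.
pose S w := pi (useq_of (rep x) (fun i => s i w)).
have SE w i : enorm w < rad 1 -> useq_of (rep x) (fun i => s i w) i = s i w.
  by move=> wr; rewrite useq_ofE//; exact: sbd.
have rad_le e : 0 < e -> e <= 1 -> rad e <= rad 1.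
  by move=> e0 e1; rewrite ler_wpM2r ?invr_ge0 ?addr_ge0 ?mulr_ge0 ?sqr_ge0// ler_wpM2r// ltW.
have Sx : S 0 = x.
  apply: sdist_eq; apply/eqP; rewrite eq_le sdist_ge0 andbT.
  suff : d (S 0) (pi (rep x)) <= 0 by rewrite repK.
  apply: dist_le; apply: filterS UC => i uc; rewrite SE ?enorm0 ?erad_gt0//.
  by rewrite (uc_0 uc) rdist_xx.
have prj w : enorm w < rad 1 -> (f w - cmap ch (phiX x)) *m Pl = w.
  move=> wr; apply: (@mcvg_unique _ _ U _ _ _ (fun i => (F i w - a i) *m P i) (fun=> w)).
  - apply: mcvg_mulmx cP; apply: mcvg_rV; apply: cvgB ca; exact: Ff (rad1_rho wr).
  - by move=> j k; exact: cvg_cst.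
  - by apply: filterS UC => i uc; exact: g_prj (uc_good uc (rad1_rho wr)).
have JPl : Jmx *m Pl = Pl *m Jmx.
  apply: (@mcvg_unique _ _ U _ _ _ (fun i => Jmx *m P i) (fun i => P i *m Jmx)).
  - by apply: mcvg_mulmx cP => j k; exact: cvg_cst.
  - by apply: mcvg_mulmx cP _ => j k; exact: cvg_cst.
  - by apply: filterS UC => i uc; exact: uc_JP uc.
have jmcvg w : `|w| < rho -> mcvg U (fun i => jac (F i) w) (jac f w).
  by move=> wr; have [_ h _] := J w wr; exact: mcvg_rows h.
have gmcvg w : `|w| < rho -> mcvg U (fun i => pullb (F i) Kh w) (pullb f Kh w).
  move=> wr; apply: mcvg_mulmx; last by apply: mcvg_tr; exact: jmcvg.
  apply: mcvg_mulmx; first exact: jmcvg.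
  apply: (@mcvg_comp _ _ _ _ U _ _ (fun i => F i w) (f w)); first exact: Ff.
  move=> j k; have := K_diff (km_open HK) (km_smooth HK) j k (fW w wr).1; exact: differentiable_continuous.
exists ch, Pl, (cmap ch (phiX x)), S, f; split => //.
- move=> w wr; have wrho := rad1_rho wr.
  have [dw ew] := image_cinv (fW w wrho).1.
  suff -> : phiX (S w) = cinv ch (f w) by [].
  have hM : hausdorff_space M' by exact: carrier_hausdorff.
  have C1 : phi i (s i w) @[i --> U] --> phiX (S w).
    rewrite (_ : (fun i => phi i (s i w)) = fun i => phi i (useq_of (rep x) (fun i => s i w) i)).
      exact: phiX_cvg.
    by apply/funext => i; rewrite SE.
  have C2 : phi i (s i w) @[i --> U] --> cinv ch (f w).
    apply: (@cvg_near_ext _ U _ M' (fun i => cinv ch (F i w)) _ _ _ (cvg_comp _ _ (Ff w wrho) (cinv_continuous (fW w wrho).1))).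
    by apply: filterS UC => i uc; rewrite /F /srep /= cmapK//; exact: g_dom (uc_good uc wrho).
  exact: (cvg_unique hM C1 C2).
- by move=> w wr; have [] := J w (rad1_rho wr).
- move=> w wr i j; have wrho := rad1_rho wr.
  have c : pullb (F k) Kh w i j - (1%:M : 'M[R]_(n + n)) i j @[k --> U] --> pullb f Kh w i j - (1%:M : 'M[R]_(n + n)) i j.
    by apply: cvgB (gmcvg w wrho i j) (cvg_cst _).
  apply: (cvg_norm_le c); apply: filterS UC => k uc; exact: uc_lip uc w wrho i j.
- move=> w wr; have wrho := rad1_rho wr; have [hf j1 j2] := J w wrho.
  have I1 : \forall i \near U, immersed (cmap ch @` dom ch) (F i) w.
    apply: filterS UC => i uc; exists [set y : 'rV[R]_(n + n) | `|y - 0| < rho]; split.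
    - exact: open_dist_lt.
    - by rewrite /= subr0.
    - move=> y; rewrite /= subr0 => yr; have g := uc_good uc yr; split.
        exact: (good_srep (iso i) ach g).1.
      exact: image_cmap (g_dom g).
    - move=> y u yr; apply: (@section_inj _ _ _ _ (P i)).
      have NN : \forall w' \near y, `|w' - 0| < rho := open_nbhs_nbhs (conj (@open_dist_lt _ _ 0 rho) yr).
      have G : \forall w' \near y, good (phi i) ch (P i) (cmap ch (phi i (rep x i))) rho^-1 rho^-1 (s i) w'.
        by apply: filterS NN => w'; rewrite subr0 => w'r; exact: (uc_good uc w'r).
      exact: (good_section (iso i) ach (uc_JP uc) G).
  have I2 : immersed (cmap ch @` dom ch) f w.
    exists (eball rho); split.
    - exact: eball_open.
    - exact: wr.
    - move=> y yr; have yrho := rad1_rho yr; split; first by have [] := J y yrho.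
      exact: (fW y yrho).1.
    - move=> y u yr; apply: (@section_inj _ _ _ _ Pl).
      apply: (section_jac (a := cmap ch (phiX x)) JPl).
        by have [h _ _] := J y (rad1_rho yr); exact: hol_cdiff h.
      have NN : \forall w' \near y, (eball rho) w' := eball_near yr.
      by apply: filterS NN => w' w'r; exact: prj w'r.
  have C := cvg_scalar_curvature HK I1 I2 (Ff w wrho) j1 j2.
  apply: (ler_cvg_to (@cvg_cst _ R0 _ U _) (C _)); apply: filterS UC => i uc.
  by have [_ _ h _] := hTs i; rewrite -(uc_scal uc wrho).
- move=> e w w' e0 e1 wr w'r; apply: dist_le; apply: filterS UC => i uc.
  have h1 := lt_le_trans wr (rad_le e e0 e1); have h2 := lt_le_trans w'r (rad_le e e0 e1).
  by rewrite !SE//; exact: (uchart_le (hTs i) ach rho0 uc).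
- move=> e w y e0 e1 wr h; have e10 : 0 < 1 + e by rewrite ltr_wpDl.
  have NN : \forall i \near U, enorm w + (1 + e) * rdist (s i w) (rep y i) < rad e.
    have h' : d (S w) (pi (rep y)) < (rad e - enorm w) / (1 + e).
      by rewrite repK ltr_pdivlMr// ltrBrDl mulrC.
    apply: filterS (dist_near h') => i; rewrite SE//.
    by rewrite ltr_pdivlMr// ltrBrDl mulrC.
  (* [ws i] will be the coordinates of the representative of [y] in the chart of index [i]. They are
     bounded along [U], and their limit [w'] is the coordinate vector of [y]. *)
  have Q i : exists w' : 'rV[R]_(n + n), uchart (phi i) ch p0 r rho rho^-1 (rep x i) (s i) (P i) ->
      enorm w + (1 + e) * rdist (s i w) (rep y i) < rad e ->
      [/\ enorm w' < rad e, rep y i = s i w' & enorm (w' - w) <= (1 + e) * rdist (s i w) (rep y i)].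
    have [uc|] := pselect (uchart (phi i) ch p0 r rho rho^-1 (rep x i) (s i) (P i)); last by exists 0.
    have [hi|hi] := boolP (enorm w + (1 + e) * rdist (s i w) (rep y i) < rad e); last by exists 0.
    have [w' Hw'] := uchart_ge (hTs i) ach rho0 uc e0 e1 (rad1_rho wr) hi.
    by exists w' => _ _.
  have [ws Hws] := choice Q.
  have WS : \forall i \near U, [/\ enorm (ws i) < rad e, rep y i = s i (ws i) &
      enorm (ws i - w) <= (1 + e) * rdist (s i w) (rep y i)].
    by apply: filterS2 UC NN => i uc hi; exact: (Hws i uc hi).
  have cw : cvg (ws i @[i --> U]).
    apply: (@ultra_cvg _ _ _ _ _ _ (rad e)); apply: filterS WS => i [h1 _ _].
    exact: ltW (le_lt_trans (norm_le_enorm _) h1).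
  pose w' := lim (ws i @[i --> U]).
  have cd : rdist (s i w) (rep y i) @[i --> U] --> d (S w) y.
    rewrite -{2}(repK y); apply: cvg_near_ext (@dist_cvg _ (rep y)).
    by apply: nearW => i; rewrite SE.
  have ce v : enorm (ws i - v) @[i --> U] --> enorm (w' - v).
    exact: (cvg_comp _ _ cw (@enorm_continuous _ _ v w')).
  have hw : enorm (w' - w) <= (1 + e) * d (S w) y.
    have c1 : (1 + e) * rdist (s i w) (rep y i) @[i --> U] --> (1 + e) * d (S w) y by apply: cvgM cd; exact: cvg_cst.
    apply: (ler_cvg_to (ce w) c1).
    by apply: filterS WS => i [].
  have w'r : enorm w' < rad e.
    rewrite (le_lt_trans _ h)//; have := enormD (w' - w) w; rewrite subrK => /le_trans; apply.
    by rewrite addrC lerD2l.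
  have w'1 := lt_le_trans w'r (rad_le e e0 e1).
  exists w'; split; [exact: w'r| |exact: hw].
  (* The distance from [S w'] to [y] is the limit of distances bounded by twice or less the
     Euclidean distance from [w'] to [ws i], which tends to 0. *)
  apply: sdist_eq; apply/eqP; rewrite eq_le sdist_ge0 andbT.
  have c0 : (1 + e) * enorm (ws i - w') @[i --> U] --> (1 + e) * enorm (w' - w') by apply: cvgM (ce w'); exact: cvg_cst.
  suff : d (S w') y <= (1 + e) * enorm (w' - w') by rewrite subrr enorm0 mulr0 sdist_sym.
  have cd' : rdist (s i w') (rep y i) @[i --> U] --> d (S w') y.
    rewrite -{2}(repK y); apply: cvg_near_ext (@dist_cvg _ (rep y)).
    by apply: nearW => i; rewrite SE.
  apply: (ler_cvg_to cd' c0); apply: filterS2 UC WS => i uc [h1 h2 _].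
  by rewrite h2; exact: (uchart_le (hTs i) ach rho0 uc e0 e1 w'r h1).
Qed.

End Ultralimit.

(** * Extraction of the subsequence *)

Lemma increasing_selection (Q : nat -> nat -> Prop) : (forall k m : nat, exists2 i : nat, (m < i)%N & Q k i) ->
  exists s : nat -> nat, (forall i j : nat, (i < j)%N -> (s i < s j)%N) /\ forall k, Q k (s k).
Proof.
move=> H; have H' (km : nat * nat) : exists i, (km.2 < i)%N /\ Q km.1 i by have [i] := H km.1 km.2; exists i.
have [g Hg] := choice H'; pose s := fix s k := if k is k'.+1 then g (k, s k') else g (0%N, 0%N).
exists s; split; last by case=> [|k]; [exact: (Hg (0%N, 0%N)).2|exact: (Hg (k.+1, s k)).2].
move=> i j; elim: j => // j IH; rewrite ltnS leq_eqVlt => /orP[/eqP->|/IH ij]; first exact: (Hg (j.+1, s j)).1.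
exact: ltn_trans ij (Hg (j.+1, s j)).1.
Qed.

Section Approximation.
Context {R : realType} {X Xi Y : Type} (d : X -> X -> R) (p : X) (di : Xi -> Xi -> R) (pi : Xi) (dY : Y -> Y -> R).

(** One integer fixes both the radius and the precision. Only points within [k] of the base point
    have to be approximated, while [Phi] is controlled on the ball of radius [k + 1], which has room
    for the approximating points. *)
Definition approximates (fi : Xi -> Y) (f : X -> Y) (k : nat) (Phi : X -> Xi) : Prop :=
  [/\ Phi p = pi,
      forall y, di pi y <= k%:R -> exists2 x, d p x <= k.+1%:R & di (Phi x) y < k.+1%:R^-1,
      forall x1 x2, d p x1 <= k.+1%:R -> d p x2 <= k.+1%:R -> `|di (Phi x1) (Phi x2) - d x1 x2| < k.+1%:R^-1 &
      forall x, d p x <= k.+1%:R -> dY (fi (Phi x)) (f x) < k.+1%:R^-1].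

End Approximation.

Lemma approx_radius {R : realType} (e r k1 D a b c : R) :
  k1 <= e / 2 -> D <= r - e -> `|a - b| < k1 -> a <= D + c -> c < k1 -> b <= r.
Proof. by rewrite ltr_norml => ? ? /andP[? ?] ? ?; lra. Qed.

(** For a point within [r - e] of the base point, the approximating point has to lie within [r]. The
    margin [e] absorbs the covering error and the distortion, each of which is below [e / 2] at
    large scales. *)
Lemma approximates_pgh {R : realType} (Xs : nat -> Type) (ds : forall i, Xs i -> Xs i -> R) (ps : forall i, Xs i)
    (X : Type) (d : X -> X -> R) (p : X) (Y : Type) (dY : Y -> Y -> R) (fs : forall i, Xs i -> Y) (f : X -> Y)
    (Phi : forall i, X -> Xs i) :
  (forall i x y z, ds i x z <= ds i x y + ds i y z) -> (forall i x y, ds i x y = ds i y x) -> d p p = 0 ->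
  (forall k, approximates d p (@ds k) (ps k) dY (@fs k) f k (Phi k)) ->
  pgh_approximation ds ps d p Phi /\
  forall r e : R, 0 < r -> 0 < e -> \forall i \near \oo, forall x, cball d p r x -> dY (fs i (Phi i x)) (f x) < e.
Proof.
move=> tri sym pp H.
have big (r e : R) : 0 < e -> \forall k \near \oo, r <= k%:R /\ k.+1%:R^-1 <= e / 2.
  move=> e0; have e2 : 0 < e / 2 by rewrite divr_gt0.
  have N1 : \forall k \near \oo, k.+1%:R^-1 < e / 2 := near_infty_natSinv_lt (PosNum e2).
  have N2 : \forall k \near \oo, r <= k%:R := nbhs_infty_ger r.
  by apply: filterS2 N1 N2 => k /ltW.
split; last first.
  move=> r e r0 e0; apply: filterS (big r e e0) => k [rk ke] x px; have [_ _ _ h] := H k.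
  have xk : d p x <= k.+1%:R by rewrite (le_trans px)// (le_trans rk)// ler_nat.
  by rewrite (lt_le_trans (h x xk))// (le_trans ke)// ler_pdivrMr// ler_peMr ?(ltW e0)// ler1n.
split=> [i|r e r0 e0]; first by have [] := H i.
apply: filterS (big r e e0) => k [rk ke]; have [h1 h2 h3 _] := H k.
have e2e : e / 2 <= e by rewrite ler_pdivrMr// ler_peMr ?(ltW e0)// ler1n.
have rk1 : r <= k.+1%:R by rewrite (le_trans rk)// ler_nat.
split=> [y yr|x1 x2 px1 px2]; last first.
  by rewrite (lt_le_trans (h3 x1 x2 (le_trans px1 rk1) (le_trans px2 rk1)))// (le_trans ke).
have [|x xk xy] := h2 y; first by rewrite (le_trans yr)// (le_trans _ rk)// lerBlDr lerDl ltW.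
have pk : d p p <= k.+1%:R by rewrite pp.
exists (Phi k x); last by rewrite (lt_le_trans xy)// (le_trans ke).
exists x => //; have h := h3 p x pk xk; have t := tri k (ps k) y (Phi k x); rewrite (sym k y) in t.
by rewrite h1 in h; exact: approx_radius ke yr h t xy.
Qed.

Lemma near_all_seq {T : Type} (U : set_system T) {FF : Filter U} {A : eqType} (s : seq A) (P : A -> T -> Prop) :
  (forall a, \forall i \near U, P a i) -> \forall i \near U, forall a, a \in s -> P a i.
Proof.
move=> H; elim: s => [|b s IH]; first exact: nearW.
by apply: filterS2 (H b) IH => i hb hs a; rewrite inE => /orP[/eqP->|/hs].
Qed.

Lemma net_dist_lt {R : realType} (e a b c x y : R) : `|a - b| < e / 8 -> x < e / 8 -> y < e / 8 ->
  b <= x + c + y -> c <= x + b + y -> `|a - c| < e.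
Proof. by rewrite !ltr_norml => /andP[? ?] ? ? ? ?; apply/andP; split; lra. Qed.

Lemma net_sum_lt {R : realType} (e a b c : R) : `|a - b| < e / 8 -> b < e / 8 -> c < e / 8 -> a + c < 2^-1 * e.
Proof. by rewrite ltr_norml => /andP[? ?] ? ?; lra. Qed.

Lemma net_sum2_lt {R : realType} (e a b c : R) : `|a - b| < e / 8 -> b < e / 8 -> c < 2^-1 * e -> a + c < e.
Proof. by rewrite ltr_norml => /andP[? ?] ? ?; lra. Qed.

Lemma net_map_lt {R : realType} (e a b c : R) : 0 < e -> a < e / 8 -> b <= c -> c < e / 8 -> a + b < e.
Proof. by move=> ? ? ? ?; lra. Qed.

Lemma net_cover_lt {R : realType} (e a x y z k D : R) : e <= 1 -> 0 < e ->
  `|a - x| < e / 8 -> a <= k + z -> z < e / 8 -> D <= x + y -> y < e / 8 -> D <= k + 1.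
Proof. by rewrite !ltr_norml => ? ? /andP[? ?] ? ? ? ?; lra. Qed.

Section UltraApproximation.
Context {R : realType} (Xs : nat -> Type) (ds : forall i, Xs i -> Xs i -> R) (ps : forall i, Xs i).
Context (X : mspace R) (p : X) (Y : Type) (dY : Y -> Y -> R) (fs : forall i, Xs i -> Y) (f : X -> Y).
Context (U : set_system nat) {UU : UltraFilter U} (rep : X -> forall i, Xs i).
Hypothesis tri : forall i (x y z : Xs i), ds x z <= ds x y + ds y z.
Hypothesis sym : forall i (x y : Xs i), ds x y = ds y x.
Hypothesis dd : forall i (x : Xs i), ds x x = 0.
Hypothesis triY : forall x y z, dY x z <= dY x y + dY y z.
Hypothesis rep_p : forall i, rep p i = ps i.
Hypothesis rep_dist : forall x y e, 0 < e -> \forall i \near U, `|ds (rep x i) (rep y i) - sdist x y| < e.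
Hypothesis rep_lim : forall (u : forall i, Xs i) C, (forall i, ds (ps i) (u i) <= C) ->
  exists x, forall e, 0 < e -> \forall i \near U, ds (rep x i) (u i) < e.
Hypothesis rep_f : forall x e, 0 < e -> \forall i \near U, dY (fs (rep x i)) (f x) < e.
Hypothesis f_lip : forall x y, dY (f x) (f y) <= sdist x y.
Hypothesis net : forall r e, 0 < e -> exists s : seq X, forall y, sdist p y <= r -> exists2 z, z \in s & sdist z y < e.

(** Otherwise the failing indices belong to [U], and a family of badly covered points can be chosen.
    This family has a limit in [X], a point of the net is close to that limit, and its
    representatives cover the chosen points for an index in [U]. *)
Lemma ultra_cover (s : seq X) (k : nat) e : 0 < e -> e <= 1 ->
  (forall y, sdist p y <= k%:R + 1 -> exists2 z, z \in s & sdist z y < e / 8) ->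
  \forall i \near U, forall y, ds (ps i) y <= k%:R ->
    exists2 a, a \in s & sdist p a <= k%:R + 1 /\ ds (rep a i) y < 2^-1 * e.
Proof.
move=> e0 e1 Hs; pose G i y := exists2 a, a \in s & sdist p a <= k%:R + 1 /\ ds (rep a i) y < 2^-1 * e.
pose good := [set i | forall y, ds (ps i) y <= k%:R -> G i y].
have [//|Ub] := in_ultra_setVsetC good UU.
have H i : exists y, ds (ps i) y <= k%:R /\ (~ good i -> ~ G i y).
  have [gi|] := pselect (good i); first by exists (ps i); split => [|//]; rewrite dd.
  by move=> /existsNP[y /not_implyP[h1 h2]]; exists y.
pose u i : Xs i := projT1 (cid (H i)); have Hu i : ds (ps i) (u i) <= k%:R /\ (~ good i -> ~ G i (u i)) := projT2 (cid (H i)).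
have [x Hx] := @rep_lim u k%:R (fun i => (Hu i).1); have e4 : 0 < e / 8 by rewrite divr_gt0.
have px : sdist p x <= k%:R + 1.
  have [i [h1 h2]] := filter_ex (filterI (@rep_dist p x _ e4) (Hx _ e4)).
  rewrite rep_p in h1; have t := tri (ps i) (u i) (rep x i); rewrite (sym (u i)) in t.
  apply: (@net_cover_lt _ e _ _ 0 _ k%:R _ e1 e0 h1 _ h2); [|by rewrite addr0|exact: e4].
  by rewrite (le_trans t)// lerD2r (Hu i).1.
have [a sa ax] := Hs x px.
have Na : \forall i \near U, ds (rep a i) (u i) < 2^-1 * e.
  apply: filterS2 (@rep_dist a x _ e4) (Hx _ e4) => i h1 h2; rewrite (le_lt_trans (tri _ (rep x i) _))//.
  exact: net_sum_lt h1 ax h2.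
have [i [[bi h1] [h2 h3]]] := filter_ex (filterI (filterI Ub Na) (filterI (@rep_dist p x _ e4) (Hx _ e4))).
case: ((Hu i).2 bi); exists a => //; split => //.
rewrite rep_p in h2; have t := tri (ps i) (u i) (rep x i); rewrite (sym (u i)) in t.
have t' := @sdist_tri _ X p x a; rewrite (@sdist_sym _ X x a) in t'.
apply: (@net_cover_lt _ e _ _ _ _ k%:R _ e1 e0 h2 _ h3 t' ax).
by rewrite (le_trans t)// lerD2r (Hu i).1.
Qed.

Lemma ultra_approximates (k : nat) : \forall i \near U, exists Phi, approximates (@sdist _ X) p (@ds i) (ps i) dY (@fs i) f k Phi.
Proof.
pose e : R := k.+1%:R^-1; have e0 : 0 < e by rewrite invr_gt0.
have e1 : e <= 1 by rewrite invf_le1// ler1n.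
have e4 : 0 < e / 8 by rewrite divr_gt0.
have [s Hs] := @net (k%:R + 1) _ e4.
(* The base point must be sent exactly to the base points, so [p] is added to the net and serves as
   its own approximation. *)
have Hz x : exists z, sdist p x <= k.+1%:R -> [/\ z \in p :: s, sdist z x < e / 8 & x = p -> z = p].
  have [px|px] := boolP (sdist p x <= k.+1%:R); last by exists p.
  have [xp|xp] := pselect (x = p); first by exists p => _; rewrite inE eqxx xp sdist_xx.
  by have [|z zs zx] := Hs x; [rewrite natr1|exists z => _; rewrite inE zs orbT; split].
have [z Hz'] := choice Hz.
have pp : sdist p p <= k.+1%:R by rewrite sdist_xx.
have zp : z p = p by have [_ _] := Hz' p pp; exact.
have N1 : \forall i \near U, forall a, a \in p :: s -> forall b, b \in p :: s -> `|ds (rep a i) (rep b i) - sdist a b| < e / 8.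
  by apply: near_all_seq => a; apply: near_all_seq => b; exact: rep_dist.
have N2 : \forall i \near U, forall a, a \in p :: s -> dY (fs (rep a i)) (f a) < e / 8.
  by apply: near_all_seq => a; exact: rep_f.
apply: filterS3 N1 N2 (ultra_cover e0 e1 Hs) => i h1 h2 h3; exists (fun x => rep (z x) i); split.
- by rewrite zp rep_p.
- move=> y /h3[a sa [pa ay]]; have ak : sdist p a <= k.+1%:R by rewrite -natr1.
  exists a => //; have [zs za _] := Hz' a ak.
  have as' : a \in p :: s by rewrite inE sa orbT.
  rewrite (le_lt_trans (tri _ (rep a i) _))//; exact: net_sum2_lt (h1 _ zs _ as') za ay.
- move=> x1 x2 /Hz'[z1s z1 _] /Hz'[z2s z2 _].
  have t1 := le_trans (@sdist_tri _ X (z x1) x1 (z x2)) (lerD (lexx _) (@sdist_tri _ X x1 x2 (z x2))).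
  have t2 := le_trans (@sdist_tri _ X x1 (z x1) x2) (lerD (lexx _) (@sdist_tri _ X (z x1) (z x2) x2)).
  rewrite (@sdist_sym _ X x2) addrA in t1; rewrite (@sdist_sym _ X x1 (z x1)) addrA in t2.
  exact: net_dist_lt (h1 _ z1s _ z2s) z1 z2 t1 t2.
- move=> x /Hz'[zs zx _]; rewrite (le_lt_trans (triY _ (f (z x)) _))//.
  have h := h2 _ zs; have l := f_lip (z x) x; exact: net_map_lt e0 h l zx.
Qed.

End UltraApproximation.

Theorem theorem1p2 (R : realType) (n N : nat) (R0 : R)
    (Mhat : kahlerManifold R N) (hn : (0 < n)%N) (hN : (n < N)%N)
    (hcompact : compact [set: Mhat]) (hconnected : connected [set: Mhat])
    (Ts : nat -> kahler_tuple n Mhat)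
    (hTs : forall i : nat, class_K R0 (Ts i)) :
  exists s : nat -> nat,
    (forall i j : nat, (i < j)%N -> (s i < s j)%N) /\
    exists T : kahler_tuple n Mhat,
      class_K R0 T /\ tuples_converge (fun i : nat => Ts (s i)) T.
Proof.
have [rho rho0 Hat] := uatlas_uniform n R0 hcompact.
(* Refining the filter of tails makes the ultrafilter nonprincipal, so sets in [U] have arbitrarily
   large elements. *)
have [U [UU HU]] := ultraFilterLemma eventually_filter.
have Unp k : U [set i | (k <= i)%N] by apply: HU; exact: nbhs_infty_ge.
have conn i : connected [set: tspace (Ts i)] by case: (hTs i).
have iso i : holomorphic_isometry (@tmap _ _ _ _ (Ts i)) by case: (hTs i).
have [X [pi [pis piE]]] := quotient_mspace (@udist_xx R n R0 N Mhat Ts hTs U UU) (@udist_sym R n R0 N Mhat Ts hTs U UU)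
  (@udist_tri R n R0 N Mhat Ts hTs U UU).
have bb : ubounded U (fun i => tpoint (Ts i)) by exists 0; apply: nearW => i; rewrite rdist_xx.
pose b : useq Ts U := USeq bb; pose p := pi b.
have [rep0 rep0K] := choice pis.
(* The representative of the base point is forced to be the family of base points itself, because
   the approximations must fix base points exactly and not only in the limit. *)
pose rep x : useq Ts U := if x == p then b else rep0 x.
have repK x : pi (rep x) = x by rewrite /rep; case: (eqVneq x p) => [->|_]; [|exact: rep0K].
have rep_p : rep p = b by rewrite /rep eqxx.
(* Compactness of [Mhat] provides the limit of the images along [U]. *)
have Hphi x : exists y : Mhat, @tmap _ _ _ _ (Ts i) (rep x i) @[i --> U] --> y.
  have K := hcompact; rewrite compact_ultra in K.
  have UF : UltraFilter (@tmap _ _ _ _ (Ts i) (rep x i) @[i --> U]) by exact: ultra_fmap.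
  by have [y [_ hy]] := K _ UF filterT; exists y.
have [phiX phiXrep] := choice Hphi.
have Hc : continuous phiX := @phiX_continuous R n R0 N Mhat hconnected Ts hTs U UU X pi rep repK piE phiX phiXrep.
have Hlc x := @ultra_lchart R n R0 N Mhat hconnected Ts hTs rho rho0 Hat U UU X pi rep repK piE phiX phiXrep x.
have Hs (x y : X) (l : R) : 0 <= l <= sdist x y -> exists z, sdist x z <= l /\ sdist z y <= sdist x y - l.
  exact: (ultra_split hTs Unp repK piE).
pose Minf := limit_kahler rho0 Hc Hlc Hs p.
pose T := @KahlerTuple R n N Mhat Minf p phiX.
have clT : class_K R0 T.
  split; [exact: (limit_connected rho0 Hlc Hs)|exact: limit_complete|exact: limit_scalar|exact: limit_isometry].
have AP (k : nat) : \forall i \near U, exists Phi, approximates (@sdist R X) p (@rdist R n (tspace (Ts i))) (tpoint (Ts i))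
    (@rdist R N Mhat) (@tmap _ _ _ _ (Ts i)) phiX k Phi.
  apply: (@ultra_approximates R (fun i => tspace (Ts i)) (fun i => @rdist R n (tspace (Ts i))) (fun i => tpoint (Ts i))
    X p Mhat (@rdist R N Mhat) (fun i => @tmap _ _ _ _ (Ts i)) phiX U UU (fun x i => rep x i)).
  - by move=> i; exact: rdist_triangle.
  - by move=> i; exact: rdist_sym.
  - by move=> i; exact: rdist_xx.
  - exact: rdist_triangle.
  - by move=> i; rewrite rep_p.
  - move=> x y e e0; have c := @dist_cvg R n R0 N Mhat Ts hTs U UU X pi piE (rep x) (rep y).
    rewrite !repK in c; have NN : \forall i \near U, `|sdist x y - rdist (rep x i) (rep y i)| < e.
      exact: ((@cvgrPdist_lt _ _ _ U _ _ _).1 c _ e0).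
    by apply: filterS NN => i; rewrite distrC.
  - move=> u C Hu; have ub : ubounded U u by exists C; apply: nearW.
    exists (pi (USeq ub)) => e e0; apply: (@dist_near R n R0 N Mhat Ts hTs U UU X pi piE _ (USeq ub)).
    by rewrite repK sdist_xx.
  - move=> x e e0; have NN : \forall i \near U, rdist (phiX x) (@tmap _ _ _ _ (Ts i) (rep x i)) < e.
      exact: (phiXrep x _ (rdist_near _ e0)).
    by apply: filterS NN => i; rewrite rdist_sym.
  - exact: (@phiX_lipschitz R n R0 N Mhat hconnected Ts hTs U UU X pi rep repK piE phiX phiXrep).
  - by move=> r e e0; exact: (ball_net rho0 Hlc Hs).
(* For each scale [k] the good indices form a set in [U], and so do the indices beyond any [m]; a
   common element keeps the selection strictly increasing. *)
have [k m|s [sI sQ]] := @increasing_selection (fun k i => exists Phi, approximates (@sdist R X) p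
    (@rdist R n (tspace (Ts i))) (tpoint (Ts i)) (@rdist R N Mhat) (@tmap _ _ _ _ (Ts i)) phiX k Phi).
  by have [i [h1 h2]] := filter_ex (filterI (AP k) (Unp m.+1)); exists i.
exists s; split; [exact: sI|exists T; split; [exact: clT|]].
(* The approximations are made for the ultralimit distance; this identity lets them serve for the
   Riemannian distance that the convergence statement uses. *)
have E : @rdist R n Minf = @sdist R X by apply/funext => x; apply/funext => y; exact: limit_rdist.
pose Phi k := projT1 (cid (sQ k)).
have [H1 H2] := @approximates_pgh R (fun i => tspace (Ts (s i))) (fun i => @rdist R n (tspace (Ts (s i))))
  (fun i => tpoint (Ts (s i))) X (@sdist R X) p Mhat (@rdist R N Mhat) (fun i => @tmap _ _ _ _ (Ts (s i))) phiX Phi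
  (fun i => rdist_triangle (@conn (s i))) (fun i => @rdist_sym _ _ _) (sdist_xx p) (fun k => projT2 (cid (sQ k))).
by rewrite /tuples_converge /= E; split; exists Phi.
Qed.
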